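(* Let $\Omega\subset\mathbb{R}^3$ be a bounded open set with smooth boundary $\Gamma=\partial\Omega$, and let $\mathcal{E}_h$ be a polyhedral bulk-surface mesh of $\Omega$ satisfying the assumptions (F1)-(F4), (V1)-(V2) listed in the context. Then there exists a homeomorphism $G:\Omega_h\to\Omega$ (onto the closed bulk) such that $G\in W^{1,\infty}(\Omega_h)$ and $$G|_{\Gamma_h}=\boldsymbol a|_{\Gamma_h},\qquad G|_{\Omega_h\setminus\Omega_B}=\mathrm{Id},$$ $$\|JG-\mathrm{Id}\|_{L^\infty(\Omega_B)}\le Ch,\qquad \|\det(JG)-1\|_{L^\infty(\Omega_B)}\le Ch,\qquad \|G-\mathrm{Id}\|_{L^\infty(\Omega_B)}\le Ch^2,$$ where $JG$ is the Jacobian of $G$ and $C$ is a constant that depends on $\Gamma$, $\gamma_1$ and $\gamma_2$. Even if restricted to a single element $E\in\mathcal{E}_h$, $G$ might not be a diffeomorphism unless $E$ is a tetrahedron.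
   Context: $d$ is the oriented distance to $\Gamma$ (negative inside $\Omega$) and $\boldsymbol\nu$ the outward unit normal. The Fermi stripe $U$ of $\Gamma$ is the maximal open neighbourhood of $\Gamma$ on which every $x$ has a unique decomposition $x=\boldsymbol a(x)+d(x)\boldsymbol\nu(\boldsymbol a(x))$ with $\boldsymbol a(x)\in\Gamma$; $\boldsymbol a$ is the normal projection onto $\Gamma$. For meshsize $h>0$, $\Omega_h=\bigcup_{E\in\mathcal{E}_h}E$ is a polyhedral approximation of the bulk $\Omega$, where $\mathcal{E}_h$ is a set of non-degenerate compact polyhedra. It induces the polygonal surface $\Gamma_h=\partial\Omega_h=\bigcup_{F\in\mathcal{F}_h}F$, where $\mathcal{F}_h$ is the set of the faces of $\Omega_h$ that constitute $\Gamma_h$. Assumptions: (F1) the diameter of each $E\in\mathcal{E}_h$ does not exceed $h$; (F2) the intersection of any two distinct elements or faces is empty, a common vertex, a common edge, or a common face; (F3) all nodes of $\Gamma_h$ lie on $\Gamma$; (F4) every face $F\in\mathcal{F}_h$ is contained in $U$; (V1) there exists $\gamma_1>0$ such that every $E\in\mathcal{E}_h$ and every face $F$ of $E$ is star-shaped with respect to a ball of radius $\gamma_1h_E$ and $\gamma_1h_F$ respectively, where $h_E,h_F$ are the diameters of $E,F$; (V2) there exists $\gamma_2>0$ such that for every $E\in\mathcal{E}_h$ and every face $F$ of $E$, the distance between any two nodes of $E$ (resp. $F$) is at least $\gamma_2h_E$ (resp. $\gamma_2h_F$). An element $E\in\mathcal{E}_h$ is exterior if it has at least a face or an edge contained in $\Gamma_h$.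 $\Omega_B$ is the union of the exterior elements.
   Formalization: The existence claim is for meshsizes h ≤ h0, with h0 > 0 depending only on Ω, γ1, γ2 (it fails for coarse meshes, e.g. one tetrahedron inscribed in a ball); ''polyhedral approximation of Ω'' is taken to mean that Ω_h and Ω coincide outside the Fermi stripe U, and meshes are finite. *)

(* Defs.v *)
From HB Require Import structures.
From mathcomp Require Export all_boot all_order all_algebra.
From mathcomp Require Export all_classical all_reals all_analysis.
Export Order.TTheory GRing.Theory Num.Theory.
Export numFieldNormedType.Exports.

Set Implicit Arguments.
Unset Strict Implicit.
Unset Printing Implicit Defensive.

Local Open Scope classical_set_scope.
Local Open Scope ring_scope.

Notation pt R := 'rV[R]_3.

Section Euclidean.
Context {R : realType}.
Implicit Types (A H : set (pt R)) (x y p q c n : pt R).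

(* The norm of the library on ['rV_3] is the maximum norm (same topology);
   distances, diameters and normals below are Euclidean. *)
Definition dot x y : R := \sum_i x 0 i * y 0 i.
Definition enorm x : R := Num.sqrt (dot x x).

Definition diam A : R := sup [set enorm (p.1 - p.2) | p in A `*` A].

Definition frontier A : set (pt R) := closure A `\` interior A.

Definition segment p q : set (pt R) :=
  [set (1 - t) *: p + t *: q | t in `[0%R, 1%R]].

Definition convex_hull A : set (pt R) :=
  [set x | exists k (w : 'I_k -> R) (p : 'I_k -> pt R),
     [/\ forall i, 0 <= w i, \sum_i w i = 1, forall i, A (p i)
       & x = \sum_i w i *: p i]].

Definition is_plane H : Prop :=
  exists c n, n != 0 /\ H = [set x | dot n (x - c) = 0].

(* Interior of [A] in the relative topology of [H]. *)
Definition relint H A : set (pt R) :=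
  [set x | A x /\ \forall y \near x, H y -> A y].

(* Star-shaped with respect to the ball of [H] of some centre and radius [r];
   [H] is the whole space for elements and the supporting plane for faces. *)
Definition star_shaped_ball H A (r : R) : Prop :=
  exists c, H c /\ forall y, H y -> enorm (y - c) <= r ->
    A y /\ forall x, A x -> segment x y `<=` A.

End Euclidean.

Section Smoothness.
Context {R : realType} {W : normedModType R}.

(* Functions of class C^k on the whole space. *)
Fixpoint Ck (k : nat) (f : pt R -> W) : Prop :=
  if k is k'.+1 then
    (forall x, differentiable f x) /\ forall v, Ck k' (fun x => 'D_v f x)
  else continuous f.

Definition smooth (f : pt R -> W) : Prop := forall k, Ck k f.

End Smoothness.

Section Domain.
Context {R : realType}.
Implicit Types (Omega A B : set (pt R)) (x p n : pt R).

Definition defining_function Omega p (phi : pt R -> R) : Prop :=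
  [/\ smooth phi, exists v, 'D_v phi p != 0
    & \forall x \near p, Omega x <-> phi x < 0].

Definition smooth_boundary Omega : Prop :=
  forall p, frontier Omega p -> exists phi, defining_function Omega p phi.

(* The gradient of a defining function is a positive multiple of [n]. *)
Definition is_outward_unit_normal Omega p n : Prop :=
  enorm n = 1 /\
  exists phi (c : R), [/\ defining_function Omega p phi, 0 < c
    & forall v, 'D_v phi p = c * dot n v].

Definition normal Omega p : pt R := xget 0 (is_outward_unit_normal Omega p).

Definition oriented_distance Omega x : R :=
  let r := inf [set enorm (x - y) | y in frontier Omega] in
  if x \in Omega then - r else r.

Definition normal_foot Omega x : set (pt R) :=
  [set a | frontier Omega a /\
           x = a + oriented_distance Omega x *: normal Omega a].

(* Open neighbourhoods of the boundary on which the foot is unique are stable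
   under unions: the maximal one is the union of all of them. *)
Definition fermi_stripe Omega : set (pt R) :=
  \bigcup_(N in [set N | [/\ open N, frontier Omega `<=` N
                           & forall x, N x -> exists! a, normal_foot Omega x a]])
    N.

Definition normal_projection Omega x : pt R := xget 0 (normal_foot Omega x).

Definition homeomorphism_on A B (f : pt R -> pt R) : Prop :=
  exists g : pt R -> pt R,
    [/\ {within A, continuous f}, {within B, continuous g},
        forall x, A x -> B (f x) /\ g (f x) = x
      & forall y, B y -> A (g y) /\ f (g y) = y].

(* C^1-diffeomorphism of [A] onto [f @` A], where maps on a (not necessarily
   open) set are C^1 when they extend to C^1 maps; [A] is compact below, so
   that global and local extendability agree. *)
Definition diffeomorphism_on A (f : pt R -> pt R) : Prop :=
  exists P Q : pt R -> pt R,
    [/\ Ck 1 P, Ck 1 Q & forall x, A x -> P x = f x /\ Q (f x) = x].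

End Domain.

Section Sobolev.
Context {R : realType}.
Implicit Types (D O : set (pt R)) (G : pt R -> pt R) (J : pt R -> 'M[R]_3).

(* Lebesgue measure lives on [R * R * R]; [vec3] transports it to ['rV_3]. *)
Definition vec3 (u : R * R * R) : pt R :=
  \row_(i < 3) nth 0 [:: u.1.1; u.1.2; u.2] i.

Definition leb3 :=
  ((@lebesgue_measure R \x @lebesgue_measure R) \x @lebesgue_measure R)%E.

Definition Linfty D (f : pt R -> R) : \bar R :=
  Lnorm leb3 +oo%E (fun u => (\1_D (vec3 u) * f (vec3 u))%:E).

Definition in_Linfty D (f : pt R -> R) : Prop :=
  measurable_fun (vec3 @^-1` D) (f \o vec3) /\ (Linfty D f < +oo)%E.

Definition test_function O (phi : pt R -> R) : Prop :=
  smooth phi /\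
  exists K : set (pt R), [/\ compact K, K `<=` O & forall x, ~ K x -> phi x = 0].

Definition weak_jacobian O G J : Prop :=
  forall (i j : 'I_3) phi, test_function O phi ->
    (\int[leb3]_(u in vec3 @^-1` O)
       (G (vec3 u) 0%R i * 'D_(delta_mx 0%R j) phi (vec3 u))%R%:E
     = - \int[leb3]_(u in vec3 @^-1` O) (J (vec3 u) i j * phi (vec3 u))%R%:E)%E.

(* [G] belongs to W^{1,oo}(D), with Jacobian [J]; derivatives are taken in the
   interior of [D] ([D] is a finite union of polyhedra below). *)
Definition W1infty D G J : Prop :=
  [/\ forall i, in_Linfty D (fun x => G x 0 i),
      forall i j, in_Linfty D (fun x => J x i j)
    & weak_jacobian (interior D) G J].

End Sobolev.

(* Faces and edges are part of the data, as adjacent faces may be coplanar and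
   adjacent edges collinear.  Edges are nondegenerate segments, which determine
   their endpoints. *)
Record polygon (R : realType) := Polygon {
  pg_set : set (pt R);
  pg_edges : set (set (pt R)) }.

Record polyhedron (R : realType) := Polyhedron {
  ph_set : set (pt R);
  ph_faces : set (polygon R) }.

Section Polyhedra.
Context {R : realType}.
Implicit Types (F : polygon R) (E : polyhedron R).

Definition is_edge (e : set (pt R)) : Prop :=
  exists p q, p != q /\ e = segment p q.

Definition endpoint (e : set (pt R)) (p : pt R) : Prop :=
  exists q, p != q /\ e = segment p q.

Definition pg_nodes F : set (pt R) :=
  [set p | exists2 e, pg_edges F e & endpoint e p].

(* A compact planar region bounded by finitely many segments which meet only
   at common endpoints. *)
Definition is_polygon F : Prop :=
  finite_set (pg_edges F) /\
  (forall e, pg_edges F e -> is_edge e) /\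
  (forall e e', pg_edges F e -> pg_edges F e' -> e <> e' ->
     e `&` e' = set0 \/
     exists p, [/\ endpoint e p, endpoint e' p & e `&` e' = [set p]]) /\
  compact (pg_set F) /\ pg_set F !=set0 /\
  exists H, [/\ is_plane H, pg_set F `<=` H,
    closure (relint H (pg_set F)) = pg_set F
  & pg_set F `\` relint H (pg_set F) = \bigcup_(e in pg_edges F) e].

Definition ph_edges E : set (set (pt R)) :=
  \bigcup_(F in ph_faces E) pg_edges F.

Definition ph_nodes E : set (pt R) := \bigcup_(F in ph_faces E) pg_nodes F.

Definition faces_meet_properly F F' : Prop :=
  [\/ pg_set F `&` pg_set F' = set0,
      exists p, [/\ pg_nodes F p, pg_nodes F' p
                  & pg_set F `&` pg_set F' = [set p]]
    | exists e, [/\ pg_edges F e, pg_edges F' e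
                  & pg_set F `&` pg_set F' = e]].

(* Nondegenerate compact polyhedra: nonempty and regular closed. *)
Definition is_polyhedron E : Prop :=
  [/\ finite_set (ph_faces E),
      forall F, ph_faces E F -> is_polygon F,
      forall F F', ph_faces E F -> ph_faces E F' -> F <> F' ->
        faces_meet_properly F F',
      compact (ph_set E) /\ ph_set E !=set0
    & closure (interior (ph_set E)) = ph_set E /\
      frontier (ph_set E) = \bigcup_(F in ph_faces E) pg_set F].

Definition elements_meet_properly E E' : Prop :=
  [\/ ph_set E `&` ph_set E' = set0,
      exists p, [/\ ph_nodes E p, ph_nodes E' p
                  & ph_set E `&` ph_set E' = [set p]],
      exists e, [/\ ph_edges E e, ph_edges E' e
                  & ph_set E `&` ph_set E' = e]
    | exists F, [/\ ph_faces E F, ph_faces E' F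
                  & ph_set E `&` ph_set E' = pg_set F]].

(* Elements with additional (hanging) nodes are not tetrahedra. *)
Definition is_tetrahedron E : Prop :=
  exists p : 'I_4 -> pt R,
    ph_nodes E = range p /\ ph_set E = convex_hull (range p).

End Polyhedra.

Section Mesh.
Context {R : realType}.
Implicit Types (Omega : set (pt R)) (M : set (polyhedron R)).

Definition mesh_faces M : set (polygon R) := \bigcup_(E in M) ph_faces E.

Definition bulk M : set (pt R) := \bigcup_(E in M) ph_set E.

Definition surface M : set (pt R) := frontier (bulk M).

Definition surface_faces M : set (polygon R) :=
  [set F | mesh_faces M F /\ pg_set F `<=` surface M].

Definition exterior M (E : polyhedron R) : Prop :=
  (exists2 F, ph_faces E F & pg_set F `<=` surface M) \/
  (exists2 e, ph_edges E e & e `<=` surface M).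

Definition exterior_bulk M : set (pt R) :=
  \bigcup_(E in [set E | M E /\ exterior M E]) ph_set E.

(* [mesh_bulk_approx]: the polyhedral domain may deviate from the exact one
   only inside the Fermi stripe.  Without it the empty mesh, or a mesh of the
   cavity of a shell, would be a mesh of the shell. *)
Record bulk_surface_mesh Omega (h gamma1 gamma2 : R) M : Prop := {
  mesh_finite : finite_set M;
  mesh_polyhedra : forall E, M E -> is_polyhedron E;
  mesh_bulk_approx :
    bulk M `\` fermi_stripe Omega = Omega `\` fermi_stripe Omega;
  mesh_surface : surface M = \bigcup_(F in surface_faces M) pg_set F;
  mesh_F1 : forall E, M E -> diam (ph_set E) <= h;
  mesh_F2 :
    (forall E E', M E -> M E' -> E <> E' -> elements_meet_properly E E') /\
    (forall F F', mesh_faces M F -> mesh_faces M F' -> F <> F' ->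
       faces_meet_properly F F');
  mesh_F3 : forall F, surface_faces M F -> pg_nodes F `<=` frontier Omega;
  mesh_F4 : forall F, surface_faces M F -> pg_set F `<=` fermi_stripe Omega;
  mesh_V1 :
    (forall E, M E ->
       star_shaped_ball setT (ph_set E) (gamma1 * diam (ph_set E))) /\
    (forall F, mesh_faces M F ->
       exists H, [/\ is_plane H, pg_set F `<=` H
         & star_shaped_ball H (pg_set F) (gamma1 * diam (pg_set F))]);
  mesh_V2 :
    (forall E, M E -> forall p q, ph_nodes E p -> ph_nodes E q -> p <> q ->
       gamma2 * diam (ph_set E) <= enorm (p - q)) /\
    (forall F, mesh_faces M F -> forall p q, pg_nodes F p -> pg_nodes F q ->
       p <> q -> gamma2 * diam (pg_set F) <= enorm (p - q)) }.

(* [C * h] estimates of the parametrization of the exact bulk; [J] is the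
   (weak) Jacobian of [G], and [`|_|] on matrices is the maximum norm. *)
Record bulk_parametrization Omega (h C : R) M (G : pt R -> pt R) : Prop := {
  param_homeo : homeomorphism_on (bulk M) (closure Omega) G;
  param_surface : forall x, surface M x -> G x = normal_projection Omega x;
  param_interior : forall x, (bulk M `\` exterior_bulk M) x -> G x = x;
  param_estimates : exists J : pt R -> 'M[R]_3,
    [/\ W1infty (bulk M) G J,
        (Linfty (exterior_bulk M) (fun x => `|J x - 1%:M|%R) <= (C * h)%:E)%E,
        (Linfty (exterior_bulk M) (fun x => (\det (J x) - 1)%R) <= (C * h)%:E)%E
      & (Linfty (exterior_bulk M) (fun x => enorm (G x - x)%R)
           <= (C * h ^+ 2)%:E)%E] }.

End Mesh.

(* Main.v *)
Require Import Defs.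
From HB Require Import structures.
From mathcomp Require Import ring lra perm measurable_realfun.
From mathcomp Require ess_sup_inf.

(** The tubular neighbourhood of the boundary [Gamma] gives quantitative control
    of the oriented distance and of the projection [a].  Since the nodes of
    [Gamma_h] lie on [Gamma] and faces have diameter at most [h], the
    displacement [a - Id] is [O(h^2)] and [O(h)]-Lipschitz on [Gamma_h].  It is
    extended by [0] to the other edges, then from edges to faces and from faces
    to elements: by McShane's theorem in general, by an explicit [C^1] formula
    in barycentric coordinates on tetrahedra.  Shape regularity keeps all
    Lipschitz constants of order [h], so [G = Id + w] with [w] globally
    [Ch]-Lipschitz is a bi-Lipschitz bijection of the space; following the normal
    fibres of [Gamma] shows that it maps the polyhedral bulk onto the exact one.
    The weak Jacobian of a Lipschitz map comes from the Radon-Nikodym theorem on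
    lines and from Fubini.

    For the negative part take a cube inscribed in a ball: on two adjacent faces
    [G] is the radial projection, which forces the differential of any [C^1]
    extension of [G] at the midpoint of their common edge to vanish in the radial
    direction, so that no [C^1] left inverse exists. *)

Set Implicit Arguments.
Unset Strict Implicit.
Unset Printing Implicit Defensive.

Local Open Scope classical_set_scope.
Local Open Scope ring_scope.

(** * Euclidean norm and Lipschitz functions *)

(** Piecewise estimates control the displacement only along segments that stay in the polyhedral
    bulk. A short chord that leaves it joins surface points of possibly unrelated faces, so the
    polyhedral surface must be shown to be, at scale [h], a graph of small slope over [Gamma]. The
    obstacle is that the mesh axioms do not tell on which side of a surface face its element lies.
    The way out: an element protrudes from [Omega] by at most a small fraction of its own diameter.
    Indeed the normal fibre through a protruding point leaves the bulk in a face whose nodes are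
    very far compared with the height, since they lie on [Gamma] and the face is nearly tangent;
    shape regularity then forces the element to contain that face or one of its edges ([star_in],
    [high_point]). An element above its surface face would contradict this ([below]). Where neither
    the tetrahedral formula nor the projection prescribes values, data are extended by degree-one
    homogeneity from a star centre, which preserves finite covers by Lipschitz pieces; McShane's
    theorem serves to pass from the bulk to the whole space. *)

Section Dot.
Context {R : realType}.
Implicit Types (x y z u v : pt R) (a b t : R).

Lemma dotC x y : dot x y = dot y x.
Proof. by apply: eq_bigr => i _; rewrite mulrC. Qed.
Lemma dotDl x y z : dot (x + y) z = dot x z + dot y z.
Proof. by rewrite /dot -big_split; apply: eq_bigr => i _; rewrite mxE mulrDl. Qed.
Lemma dotDr x y z : dot z (x + y) = dot z x + dot z y.
Proof. by rewrite dotC dotDl !(dotC z). Qed.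
Lemma dotZl a x y : dot (a *: x) y = a * dot x y.
Proof. by rewrite /dot big_distrr; apply: eq_bigr => i _; rewrite mxE /= mulrA. Qed.
Lemma dotZr a x y : dot x (a *: y) = a * dot x y.
Proof. by rewrite dotC dotZl dotC. Qed.
Lemma dotNl x y : dot (- x) y = - dot x y.
Proof. by rewrite -scaleN1r dotZl mulN1r. Qed.
Lemma dotNr x y : dot x (- y) = - dot x y.
Proof. by rewrite dotC dotNl dotC. Qed.
Lemma dot0l y : dot 0 y = 0.
Proof. by rewrite -(scale0r (0 : pt R)) dotZl mul0r. Qed.
Lemma dot0r y : dot y 0 = 0.
Proof. by rewrite dotC dot0l. Qed.

Definition dotE := (dotDl, dotDr, dotZl, dotZr, dotNl, dotNr, dot0l, dot0r).

Lemma dot_ge0 x : 0 <= dot x x.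
Proof. by apply: sumr_ge0 => i _; rewrite -expr2 sqr_ge0. Qed.

Lemma dot_eq0 x : (dot x x == 0) = (x == 0).
Proof.
apply/eqP/eqP => [h|->]; last exact: dot0l.
apply/rowP => i; rewrite !mxE; apply/eqP; rewrite -sqrf_eq0 expr2; apply/eqP.
by apply: (psumr_eq0P _ h) => // j _; rewrite -expr2 sqr_ge0.
Qed.

Lemma enorm_ge0 x : 0 <= enorm x.
Proof. exact: sqrtr_ge0. Qed.
Lemma enorm2 x : enorm x ^+ 2 = dot x x.
Proof. by rewrite sqr_sqrtr // dot_ge0. Qed.
Lemma enorm_eq0 x : (enorm x == 0) = (x == 0).
Proof. by rewrite -sqrf_eq0 enorm2 dot_eq0. Qed.
Lemma enorm0 : enorm (0 : pt R) = 0.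
Proof. by apply/eqP; rewrite enorm_eq0. Qed.
Lemma enorm_gt0 x : (0 < enorm x) = (x != 0).
Proof. by rewrite lt_neqAle enorm_ge0 andbT eq_sym enorm_eq0. Qed.
Lemma enormZ a x : enorm (a *: x) = `|a| * enorm x.
Proof. by rewrite /enorm dotZl dotZr mulrA -expr2 sqrtrM ?sqr_ge0 // sqrtr_sqr. Qed.
Lemma enormN x : enorm (- x) = enorm x.
Proof. by rewrite /enorm dotNl dotNr opprK. Qed.
Lemma enormB x y : enorm (x - y) = enorm (y - x).
Proof. by rewrite -enormN opprB. Qed.

Lemma dot_le x y : dot x y <= enorm x * enorm y.
Proof.
have [->|x0] := eqVneq x 0; first by rewrite dot0l enorm0 mul0r.
have [->|y0] := eqVneq y 0; first by rewrite dot0r enorm0 mulr0.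
have := dot_ge0 (enorm y *: x - enorm x *: y); rewrite !dotE -!enorm2 (dotC y x).
move: x0 y0; rewrite -!enorm_gt0 => x0 y0 h.
have xy0 : 0 < enorm x * enorm y by rewrite mulr_gt0.
rewrite -(ler_pM2l xy0); nra.
Qed.

Lemma dot_abs x y : `|dot x y| <= enorm x * enorm y.
Proof. by rewrite ler_norml dot_le andbT lerNl -dotNl (le_trans (dot_le _ _)) ?enormN. Qed.

Lemma ler_enormD x y : enorm (x + y) <= enorm x + enorm y.
Proof.
rewrite -(@ler_pXn2r _ 2) ?nnegrE ?addr_ge0 ?enorm_ge0 // enorm2 !dotE sqrrD !enorm2 (dotC y x).
have := dot_le x y; lra.
Qed.

Lemma ler_enormB x y : enorm (x - y) <= enorm x + enorm y.
Proof. by rewrite (le_trans (ler_enormD _ _)) // enormN. Qed.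

Lemma enorm_triangle z x y : enorm (x - y) <= enorm (x - z) + enorm (z - y).
Proof. by have := ler_enormD (x - z) (z - y); rewrite addrA subrK. Qed.

Lemma enorm_sum I (r : seq I) (P : pred I) (F : I -> pt R) :
  enorm (\sum_(i <- r | P i) F i) <= \sum_(i <- r | P i) enorm (F i).
Proof.
elim/big_rec2: _ => [|i y1 y2 _ h]; first by rewrite enorm0.
by rewrite (le_trans (ler_enormD _ _)) // lerD2l.
Qed.

Lemma coord_le_enorm x i : `|x 0 i| <= enorm x.
Proof.
rewrite -(@ler_pXn2r _ 2) ?nnegrE ?enorm_ge0 // enorm2 real_normK ?num_real //.
rewrite /dot (bigD1 i) //= -expr2 lerDl.
by apply: sumr_ge0 => j _; rewrite -expr2 sqr_ge0.
Qed.

Lemma mx_coord_le_norm m n (M : 'M[R]_(m, n)) i j : `|M i j| <= `|M|.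
Proof. by rewrite -[`|M|]/(mx_norm M) mx_normrE (le_bigmax_cond _ (fun ij => `|M ij.1 ij.2|) (j := (i, j))). Qed.

Lemma mx_norm_le m n (M : 'M[R]_(m, n)) c : 0 <= c -> (forall i j, `|M i j| <= c) -> `|M| <= c.
Proof.
by move=> c0 h; rewrite -[`|M|]/(mx_norm M) mx_normrE; apply/bigmax_leP; split => // -[i j] _; exact: h.
Qed.

Lemma norm_le_enorm x : `|x| <= enorm x.
Proof. by apply: mx_norm_le (enorm_ge0 x) _ => i j; rewrite (ord1 i); exact: coord_le_enorm. Qed.

Lemma enorm_le_norm x : enorm x <= 2 * `|x|.
Proof.
rewrite -(@ler_pXn2r _ 2) ?nnegrE ?mulr_ge0 ?enorm_ge0 // enorm2 exprMn.
apply: (@le_trans _ _ (\sum_(i < 3) `|x| ^+ 2)).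
  apply: ler_sum => i _; rewrite -expr2 -[X in X <= _]ger0_norm ?sqr_ge0 // normrX.
  by rewrite ler_pXn2r ?nnegrE // mx_coord_le_norm.
rewrite sumr_const card_ord -[_ *+ 3]mulr_natl ler_wpM2r ?sqr_ge0 //; lra.
Qed.

Lemma enorm_lip x y : `|enorm x - enorm y| <= enorm (x - y).
Proof.
rewrite ler_norml; have := ler_enormD (x - y) y; have := ler_enormD (y - x) x.
rewrite !subrK (enormB y x) => h1 h2; apply/andP; split; lra.
Qed.

(** Bridge between the topology, given by the maximum norm, and Euclidean epsilon-delta
    arguments. *)
Lemma enorm_ballP (P : pt R -> Prop) x :
  (\forall y \near x, P y) <-> exists2 e, 0 < e & forall y, enorm (y - x) < e -> P y.
Proof.
split=> [/nbhs_ballP[e /= e0 h]|[e e0 h]].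
  exists e => // y hy; apply: h; rewrite -ball_normE /=.
  by rewrite (le_lt_trans (norm_le_enorm _)) // enormB.
apply/nbhs_ballP; exists (e / 2); rewrite /= ?divr_gt0 // => y.
rewrite -ball_normE /= => hy; apply: h; rewrite enormB.
by rewrite (le_lt_trans (enorm_le_norm _)) // mulrC -ltr_pdivlMr.
Qed.

Lemma elip_continuous (W : normedModType R) (f : pt R -> W) (K : R) :
  (forall x y, `|f x - f y| <= K * enorm (x - y)) -> continuous f.
Proof.
move=> fK x; have F := nbhs_filter x; apply/cvgrPdist_lt => e e0; apply/enorm_ballP.
have K0 : 0 < `|K| + 1 by rewrite ltr_wpDl.
exists (e / (`|K| + 1)); rewrite ?divr_gt0 // => y.
rewrite ltr_pdivlMr // mulrC enormB; apply: le_lt_trans; apply: (le_trans (fK _ _)).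
by rewrite ler_wpM2r ?enorm_ge0 // (le_trans (ler_norm _)) // lerDl.
Qed.

Lemma dot_continuous u : continuous (dot u).
Proof. by apply: (@elip_continuous _ _ (enorm u)) => x y; rewrite -dotNr -dotDr dot_abs. Qed.

End Dot.

(** * Connectedness arguments along paths *)

Section Paths.
Context {R : realType}.

(** Connectedness of the interval: the supremum of the parameters with [s t] in [A] works for both
    sets. Later [A] and [B] are unions of mesh cells with and without a given property. *)
Lemma path_meet (T : topologicalType) (s : R -> T) (a b : R) (A B : set T) : a <= b ->
  (forall t, a <= t <= b -> {for t, continuous s}) -> closed A -> closed B ->
  (forall t, a <= t <= b -> A (s t) \/ B (s t)) -> A (s a) -> B (s b) ->
  exists t, a <= t <= b /\ A (s t) /\ B (s t).
Proof.
move=> ab cs cA cB hAB Aa Bb.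
have nin (C : set T) t : closed C -> a <= t <= b -> ~ C (s t) ->
    exists2 e, 0 < e & forall t', `|t' - t| < e -> ~ C (s t').
  move=> cC tab nC; have /(cs t tab) : nbhs (s t) (~` C).
    by apply: open_nbhs_nbhs; split => //; exact: closed_openC.
  move=> /nbhs_ballP[e /= e0 h]; exists e => // t' ht'; apply: h.
  by rewrite -ball_normE /= distrC.
pose S := [set t | a <= t <= b /\ A (s t)].
have Sa : S a by split => //; rewrite lexx ab.
have hS : has_sup S by split; [exists a | exists b => t [/andP[]]].
have ubS t : S t -> t <= sup S by move=> St; apply: ub_le_sup hS.2 _ St.
have leb : sup S <= b by apply: ge_sup; [exists a | move=> t [/andP[]]].
have inS : a <= sup S <= b by rewrite leb ubS.
exists (sup S); split=> //; split.
  apply: contrapT => /(nin _ _ cA inS)[e e0 h].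
  have [t St ht] := sup_adherent e0 hS.
  by apply: (h t) St.2; rewrite distrC ger0_norm ?subr_ge0 ?ubS //; lra.
apply: contrapT => nB; have [e e0 h] := nin _ _ cB inS nB.
move: leb; rewrite le_eqVlt => /orP[/eqP eb|ltb]; first by rewrite eb in nB.
pose t := Num.min b (sup S + e / 2).
have tS : sup S < t by rewrite lt_min ltb ltrDl divr_gt0.
have tab : a <= t <= b by rewrite (le_trans _ (ltW tS)) ?(andP inS).1 //= ge_min lexx.
case: (hAB t tab) => [At|]; first by have := ubS t (conj tab At); lra.
apply: h; rewrite ger0_norm ?subr_ge0 ?ltW //.
have : t <= sup S + e / 2 by rewrite ge_min lexx orbT.
lra.
Qed.

(* Induction on the cover: leave the piece containing the left end point for
   the last time and continue with the remaining pieces. *)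
Lemma pw_lip1 (W : normedModType R) (n : nat) (A : 'I_n -> set R) (f : R -> W) L a b :
  a <= b -> (forall i, closed (A i)) ->
  (forall t, a <= t <= b -> exists i, A i t) ->
  (forall i s t, a <= s <= b -> a <= t <= b -> A i s -> A i t -> `|f s - f t| <= L * `|s - t|) ->
  `|f b - f a| <= L * (b - a).
Proof.
pose P (s : seq 'I_n) := forall a, a <= b -> (forall i, closed (A i)) ->
  (forall t, a <= t <= b -> exists2 i, i \in s & A i t) ->
  (forall i s t, a <= s <= b -> a <= t <= b -> A i s -> A i t -> `|f s - f t| <= L * `|s - t|) ->
  `|f b - f a| <= L * (b - a).
suff H : forall m (s : seq 'I_n), (size s <= m)%N -> P s.
  move=> ab cA cov lip; apply: (H _ (enum 'I_n) (leqnn _)) => // t /cov[i Ai].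
  by exists i => //; rewrite mem_enum.
elim=> [|m IH] s sm {a} a ab cA cov lip.
  have [|i] := cov a; first by rewrite lexx.
  by move: sm; rewrite leqn0 size_eq0 => /eqP->.
have [|i is_ Aia] := cov a; first by rewrite lexx.
pose S := [set t | a <= t <= b /\ A i t].
have Sa : S a by split => //; rewrite lexx.
have hS : has_sup S by split; [exists a | exists b => t [/andP[]]].
have ubS t : S t -> t <= sup S by move=> St; apply: ub_le_sup hS.2 _ St.
have leb : sup S <= b by apply: ge_sup; [exists a | move=> t [/andP[]]].
have inS : a <= sup S <= b by rewrite leb ubS.
have ASi : A i (sup S).
  apply: (cA i) => B /nbhs_ballP[e /= e0 h].
  have [t St ht] := sup_adherent e0 hS.
  exists t; split; first exact: St.2.
  by apply: h; rewrite -ball_normE /= ger0_norm ?subr_ge0 ?ubS //; lra.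
have lip1 : `|f (sup S) - f a| <= L * (sup S - a).
  have := lip i (sup S) a inS; rewrite lexx ab [`|sup S - a|]ger0_norm ?subr_ge0 ?ubS //.
  by apply.
move: leb; rewrite le_eqVlt => /orP[/eqP eb|ltb]; first by move: lip1; rewrite eb.
have lip2 : `|f b - f (sup S)| <= L * (b - sup S).
  apply: (IH (rem i s)) => //.
  - by rewrite size_rem // -ltnS prednK //; case: (s) is_.
  - exact: ltW.
  (* The delicate point is [sup S] itself: if no other piece contained it, closedness would keep all
     of them away from it, and points just to the right, where piece [i] is absent, would be
     uncovered. *)
  - move=> t /andP[t1 t2]; move: t1; rewrite le_eqVlt => /orP[/eqP <-|t1].
      apply: contrapT => hn.
      have : exists2 e, 0 < e & forall j t', j \in rem i s -> `|t' - sup S| < e -> ~ A j t'.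
        have : forall j, j \in rem i s -> ~ A j (sup S) by move=> j js Aj; apply: hn; exists j.
        elim: (rem i s) => [|j l IHl] hl; first by exists 1.
        have [|e1 e10 h1] := IHl; first by move=> k kl; apply: hl; rewrite inE kl orbT.
        have /nbhs_ballP[e2 /= e20 h2] : nbhs (sup S) (~` A j).
          by apply: open_nbhs_nbhs; split; [exact: closed_openC | apply: hl; rewrite inE eqxx].
        exists (Num.min e1 e2); first by rewrite lt_min e10 e20.
        move=> k t'; rewrite inE lt_min => /orP[/eqP->|kl] /andP[d1 d2]; last exact: h1.
        by apply: h2; rewrite -ball_normE /= distrC.
      move=> [e e0 h]; pose u := Num.min b (sup S + e / 2).
      have uS : sup S < u by rewrite lt_min ltb ltrDl divr_gt0.
      have ub : u <= b by rewrite ge_min lexx.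
      have us : u <= sup S + e / 2 by rewrite ge_min lexx orbT.
      have uab : a <= u <= b by rewrite (le_trans _ (ltW uS)) ?(andP inS).1.
      have [j js Aj] := cov u uab.
      have [eji|nji] := eqVneq j i; first by move: Aj; rewrite eji => Aj; have := ubS u (conj uab Aj); lra.
      apply: (h j u) Aj; first by move: js; rewrite (perm_mem (perm_to_rem is_)) inE (negbTE nji).
      by rewrite ger0_norm; lra.
    have tab : a <= t <= b by rewrite t2 andbT (le_trans (andP inS).1) // ltW.
    have [j js Aj] := cov t tab; exists j => //.
    have nji : j != i by apply/eqP => eji; move: Aj; rewrite eji => Aj; have := ubS t (conj tab Aj); lra.
    by move: js; rewrite (perm_mem (perm_to_rem is_)) inE (negbTE nji).
  - by move=> j u v /andP[u1 u2] /andP[v1 v2]; apply: lip; rewrite ?u2 ?v2 andbT (le_trans (andP inS).1).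
have -> : f b - f a = (f b - f (sup S)) + (f (sup S) - f a) by rewrite addrA subrK.
apply: (le_trans (ler_normD _ _)); have := lerD lip2 lip1.
by rewrite -mulrDr addrA subrK.
Qed.

End Paths.

(** * Lipschitz extension, generic perturbation, inversion of small perturbations of the identity *)

Section Extension.
Context {R : realType}.
Implicit Types (S H : set (pt R)) (L M : R).

(** The lower envelope of the cones [f y + L * enorm (x - y)], truncated to [[-M, M]]; truncation
    does not increase Lipschitz constants. *)
Lemma mcshane S (f : pt R -> R) L M : 0 <= L -> 0 <= M ->
  (forall x y, S x -> S y -> `|f x - f y| <= L * enorm (x - y)) ->
  (forall x, S x -> `|f x| <= M) ->
  exists g : pt R -> R, [/\ forall x, S x -> g x = f x,
    forall x y, `|g x - g y| <= L * enorm (x - y) & forall x, `|g x| <= M].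
Proof.
move=> L0 M0 fL fM.
have [[s0 Ss0]|S0] := pselect (S !=set0); last first.
  exists (fun=> 0); split => [x Sx|x y|x]; first by case: S0; exists x.
    by rewrite subrr normr0 mulr_ge0 ?enorm_ge0.
  by rewrite normr0.
pose V x := [set f y + L * enorm (x - y) | y in S].
have lbV x : lbound (V x) (- M).
  move=> _ [y Sy <-]; have := fM y Sy; rewrite ler_norml => /andP[h _].
  by rewrite (le_trans h) // lerDl mulr_ge0 ?enorm_ge0.
have hV x : has_inf (V x) by split; [exists (f s0 + L * enorm (x - s0)); exists s0 | exists (- M)].
pose F x := inf (V x).
have FleV x y : S y -> F x <= f y + L * enorm (x - y).
  by move=> Sy; apply: (ge_inf (hV x).2); exists y.
have FL x y : F x - F y <= L * enorm (x - y).
  rewrite lerBlDr -lerBlDl; apply: lb_le_inf (hV y).1 _ => _ [z Sz <-].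
  rewrite lerBlDl (le_trans (FleV x z Sz)) // addrCA lerD2l -mulrDr ler_wpM2l //.
  exact: enorm_triangle.
pose cl a := Num.max (- M) (Num.min M a).
have clL a b : `|cl a - cl b| <= `|a - b|.
  have mx (c u v : R) : `|Num.max c u - Num.max c v| <= `|u - v|.
    case: (leP c u) => hu; case: (leP c v) => hv; rewrite ?subrr ?normr0 // ler_norml; have := ler_norm (u - v); have := ler_norm (v - u); rewrite distrC => ? ?; apply/andP; split; lra.
  have mn (c u v : R) : `|Num.min c u - Num.min c v| <= `|u - v|.
    case: (leP c u) => hu; case: (leP c v) => hv; rewrite ?subrr ?normr0 // ler_norml; have := ler_norm (u - v); have := ler_norm (v - u); rewrite distrC => ? ?; apply/andP; split; lra.
  exact: le_trans (mx _ _ _) (mn _ _ _).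
exists (cl \o F); split => [x Sx|x y|x] /=.
- have -> : F x = f x.
    apply/eqP; rewrite eq_le; apply/andP; split.
      by have := FleV x x Sx; rewrite subrr enorm0 mulr0 addr0.
    apply: lb_le_inf (hV x).1 _ => _ [z Sz <-].
    have := fL x z Sx Sz; rewrite ler_norml; lra.
  have := fM x Sx; rewrite ler_norml => /andP[h1 h2].
  by rewrite /cl min_r // max_r.
- apply: (le_trans (clL _ _)); rewrite ler_norml FL andbT lerNl opprB enormB; exact: FL.
- rewrite /cl ler_norml le_max lexx /= ge_max ge_min lexx /= andbT; lra.
Qed.

(** Componentwise extension; the factor 2 is the price for comparing the Euclidean with the maximum
    norm. *)
Lemma mcshane_vec S (f : pt R -> pt R) L M : 0 <= L -> 0 <= M ->
  (forall x y, S x -> S y -> enorm (f x - f y) <= L * enorm (x - y)) ->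
  (forall x, S x -> enorm (f x) <= M) ->
  exists g : pt R -> pt R, [/\ forall x, S x -> g x = f x,
    forall x y, enorm (g x - g y) <= 2 * L * enorm (x - y) & forall x, enorm (g x) <= 2 * M].
Proof.
move=> L0 M0 fL fM.
have /choice[g gP] : forall i : 'I_3, exists g : pt R -> R, [/\ forall x, S x -> g x = f x 0 i,
    forall x y, `|g x - g y| <= L * enorm (x - y) & forall x, `|g x| <= M].
  move=> i; apply: mcshane => // [x y Sx Sy|x Sx].
    by rewrite (le_trans _ (fL x y Sx Sy)) //; have := coord_le_enorm (f x - f y) i; rewrite !mxE.
  by rewrite (le_trans _ (fM x Sx)) // coord_le_enorm.
exists (fun x => \row_i g i x); split => [x Sx|x y|x].
- by apply/rowP => i; rewrite mxE; case: (gP i) => ->.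
- rewrite -mulrA (le_trans (enorm_le_norm _)) // ler_wpM2l // mx_norm_le ?mulr_ge0 ?enorm_ge0 // => i j.
  by rewrite (ord1 i) !mxE; case: (gP j).
- rewrite (le_trans (enorm_le_norm _)) // ler_wpM2l // mx_norm_le // => i j.
  by rewrite (ord1 i) !mxE; case: (gP j).
Qed.

Definition affine H := forall x y z t, H x -> H y -> H z -> H (x + t *: (y - z)).

(** General position: the hyperplanes are left one after the other, each move being so small that
    those already avoided stay avoided. *)
Lemma avoid H (l : seq (pt R * R)) x e : affine H -> H x -> 0 < e ->
  (forall k, k \in l -> exists2 y, H y & dot k.1 y != k.2) ->
  exists x', [/\ H x', enorm (x' - x) < e & forall k, k \in l -> dot k.1 x' != k.2].
Proof.
move=> aH Hx; elim: l e => [|[n c] l IH] e e0 hl; first by exists x; rewrite subrr enorm0.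
have [|x' [Hx' x'e x'l]] := IH (e / 2) (divr_gt0 e0 (ltr0n _ 2)).
  by move=> k kl; apply: hl; rewrite inE kl orbT.
have [y Hy yn] : exists2 y, H y & dot n y != c by apply: (hl (n, c)); rewrite inE eqxx.
have [nx'|/negPn/eqP nx'] := boolP (dot n x' != c).
  exists x'; split => //; first lra.
  by move=> k; rewrite inE => /orP[/eqP->|/x'l].
have [e1 e10 h1] : exists2 e1, 0 < e1 & forall z, enorm (z - x') < e1 ->
    forall k, k \in l -> dot k.1 z != k.2.
  move: x'l; elim: (l) => [|k s IHs] hs; first by exists 1.
  have [j js|e2 e20 h2] := IHs; first by apply: hs; rewrite inE js orbT.
  have v0 : 0 < `|dot k.1 x' - k.2| by rewrite normr_gt0 subr_eq0 hs // inE eqxx.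
  have k0 : 0 < enorm k.1 + 1 by rewrite ltr_wpDl ?enorm_ge0.
  exists (Num.min e2 (`|dot k.1 x' - k.2| / (enorm k.1 + 1))).
    by rewrite lt_min e20 divr_gt0.
  move=> z; rewrite lt_min => /andP[z2 zv] j; rewrite inE => /orP[/eqP->|js]; last exact: h2.
  apply/eqP => kz; move: zv; rewrite -kz -dotNr -dotDr ltr_pdivlMr // enormB => hlt.
  have := dot_abs k.1 (x' - z); have := enorm_ge0 (x' - z); nra.
have yx0 : 0 < enorm (y - x') + 1 by rewrite ltr_wpDl ?enorm_ge0.
pose d := Num.min (e / 2) e1; have d0 : 0 < d by rewrite lt_min e10 divr_gt0.
pose s := d / (enorm (y - x') + 1); have s0 : 0 < s by rewrite divr_gt0.
have sd : enorm (s *: (y - x')) < d.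
  rewrite enormZ gtr0_norm // /s -mulrA gtr_pMr // mulrC ltr_pdivrMr // mul1r; lra.
have [de1 de2] : d <= e / 2 /\ d <= e1 by rewrite !ge_min !lexx orbT.
exists (x' + s *: (y - x')); split; first exact: aH.
  have := enorm_triangle x' (x' + s *: (y - x')) x; rewrite [x' + _]addrC addrK; lra.
move=> k; rewrite inE => /orP[/eqP->|kl] /=; last by apply: h1 => //; rewrite [x' + _]addrC addrK; lra.
rewrite !dotE nx'; apply: contraNneq yn => h; have : s * (dot n y - c) = 0 by lra.
by move/eqP; rewrite mulf_eq0 subr_eq0 gt_eqF.
Qed.

Lemma affineT : affine setT.
Proof. by []. Qed.

Lemma affine_plane H : is_plane H -> affine H.
Proof.
move=> [c [n [_ ->]]] x y z t /=; rewrite !dotE => hx hy hz.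
have -> : dot n y = dot n z by lra.
by rewrite subrr mulr0 addr0.
Qed.

(** Banach's fixed point theorem for [x |-> y - w x]. It is applied in the maximum norm, where the
    Euclidean factor 1/4 becomes the contraction factor 1/2. *)
Lemma id_plus_lip_bij (w : pt R -> pt R) :
  (forall x y, enorm (w x - w y) <= 1 / 4 * enorm (x - y)) ->
  exists g : pt R -> pt R, [/\ forall x, g (x + w x) = x, forall y, g y + w (g y) = y &
   forall x y, enorm (g x - g y) <= 2 * enorm (x - y)].
Proof.
move=> wL.
have inj x x' : enorm (x - x') <= 2 * enorm ((x + w x) - (x' + w x')).
  have := wL x x'; have := ler_enormD ((x + w x) - (x' + w x')) (w x' - w x).
  have -> : x + w x - (x' + w x') + (w x' - w x) = x - x'.
    by apply/rowP => i; rewrite !mxE; ring.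
  rewrite (enormB (w x')) => h1 h2; have : enorm (x - x') <= 4 / 3 * enorm (x + w x - (x' + w x')) by lra. have := enorm_ge0 (x + w x - (x' + w x')); lra.
have ex y : exists x, x + w x = y.
  pose f : {fun [set: pt R] >-> [set: pt R]} := mkfun_fun (fun x (_ : setT x) => I : setT (y - w x)).
  have cf : is_contraction f.
    exists (1 / 2)%:nng; split; rewrite /= ?ltr_pdivrMr ?mul1r ?ltr1n //.
    move=> [a b] _ /=; rewrite opprB addrC subrKA (le_trans (norm_le_enorm _)) //.
    rewrite (le_trans (wL _ _)) // enormB; have := enorm_le_norm (a - b); lra.
  pose X : completeNormedModType R := HB.pack_for (completeNormedModType R) 'rV[R]_3.
  have [|p _ pf] := @banach_fixed_point R X setT f cf closedT; first by exists 0.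
  by exists p; rewrite {1}pf; exact: subrK.
have [g gP] := choice ex; exists g; split => // [x|x y].
  apply/eqP; rewrite -subr_eq0 -enorm_eq0 eq_le enorm_ge0 andbT.
  by have := inj (g (x + w x)) x; rewrite gP subrr enorm0 mulr0.
by have := inj (g x) (g y); rewrite !gP.
Qed.

End Extension.

(** * Strict differentiability *)

(* Strict (Peano) differentiability; on an open set it is equivalent to being C^1,
   and it turns all calculus below into inequalities. *)
Definition sdiff (R : realType) (V W : normedModType R) (f : V -> W) (x : V) (L : V -> W) : Prop :=
  [/\ linear L, exists C, forall v, `|L v| <= C * `|v|
    & forall e, 0 < e -> exists2 d, 0 < d & forall y z, `|y - x| < d -> `|z - x| < d ->
        `|f y - f z - L (y - z)| <= e * `|y - z|].

Section StrictDiff.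
Context {R : realType}.
Implicit Types (U V W : normedModType R).

Lemma lin0 V W (L : V -> W) : linear L -> L 0 = 0.
Proof. by move=> lL; have := lL (-1) 0 0; rewrite !scaleN1r !addNr. Qed.
Lemma linZ V W (L : V -> W) a v : linear L -> L (a *: v) = a *: L v.
Proof. by move=> lL; have := lL a v 0; rewrite !addr0 lin0 // addr0. Qed.
Lemma linD V W (L : V -> W) u v : linear L -> L (u + v) = L u + L v.
Proof. by move=> lL; have := lL 1 u v; rewrite !scale1r. Qed.
Lemma linN V W (L : V -> W) v : linear L -> L (- v) = - L v.
Proof. by move=> lL; rewrite -scaleN1r linZ // scaleN1r. Qed.
Lemma linB V W (L : V -> W) u v : linear L -> L (u - v) = L u - L v.
Proof. by move=> lL; rewrite linD // linN. Qed.

Lemma pos_bound V W (L : V -> W) : (exists C, forall v, `|L v| <= C * `|v|) ->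
  exists2 C, 0 < C & forall v, `|L v| <= C * `|v|.
Proof.
move=> [C hC]; exists (`|C| + 1); first by rewrite ltr_wpDl.
by move=> v; rewrite (le_trans (hC v)) // ler_wpM2r // (le_trans (ler_norm _)) // lerDl.
Qed.

Lemma sdiff_lip V W (f : V -> W) x L : sdiff f x L ->
  exists C d, [/\ 0 < C, 0 < d & forall y z, `|y - x| < d -> `|z - x| < d -> `|f y - f z| <= C * `|y - z|].
Proof.
move=> [lL /pos_bound[C C0 hC] /(_ 1 ltr01)[d d0 h]].
exists (C + 1), d; split=> //; first lra.
move=> y z hy hz; have h1 := h y z hy hz; have h2 := hC (y - z).
have -> : f y - f z = (f y - f z - L (y - z)) + L (y - z) by rewrite subrK.
by apply: (le_trans (ler_normD _ _)); rewrite mulrDl addrC lerD.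
Qed.

Lemma sdiff_cont V W (f : V -> W) x L : sdiff f x L ->
  forall e, 0 < e -> exists2 d, 0 < d & forall y, `|y - x| < d -> `|f y - f x| < e.
Proof.
move=> /sdiff_lip[C [d [C0 d0 h]]] e e0.
exists (Num.min d (e / C)); first by rewrite lt_min d0 divr_gt0.
move=> y; rewrite lt_min ltr_pdivlMr // mulrC => /andP[h1 h2].
by apply: le_lt_trans h2; apply: h => //; rewrite subrr normr0.
Qed.

Lemma sdiff_near V W (f g : V -> W) x L d : 0 < d -> (forall y, `|y - x| < d -> f y = g y) ->
  sdiff f x L -> sdiff g x L.
Proof.
move=> d0 fg [lL bL h]; split=> // e e0; have [d1 d10 h1] := h e e0.
exists (Num.min d d1); first by rewrite lt_min d0.
by move=> y z; rewrite !lt_min => /andP[y1 y2] /andP[z1 z2]; rewrite -!fg //; exact: h1.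
Qed.

Lemma sdiff_cst V W (c : W) x : sdiff (fun _ : V => c) x (fun=> 0).
Proof.
split=> [a u v||e e0]; first by rewrite scaler0 addr0.
  by exists 0 => v; rewrite normr0 mul0r.
by exists 1 => // y z _ _; rewrite !subrr normr0 mulr_ge0 // ltW.
Qed.

Lemma sdiff_lin V W (L : V -> W) x : linear L -> (exists C, forall v, `|L v| <= C * `|v|) ->
  sdiff L x L.
Proof.
by move=> lL bL; split=> // e e0; exists 1 => // y z _ _; rewrite linB // subrr normr0 mulr_ge0 // ltW.
Qed.

Lemma sdiff_id V (x : V) : sdiff id x id.
Proof. by apply: sdiff_lin => //; exists 1 => v; rewrite mul1r. Qed.

Lemma sdiffD V W (f g : V -> W) x L M : sdiff f x L -> sdiff g x M ->
  sdiff (fun y => f y + g y) x (fun v => L v + M v).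
Proof.
move=> [lL [C hC] hf] [lM [D hD] hg]; split.
- by move=> a u v; rewrite lL lM scalerDr addrACA.
- by exists (C + D) => v; rewrite (le_trans (ler_normD _ _)) // mulrDl lerD.
- move=> e e0; have [d1 d10 h1] := hf (e / 2) (divr_gt0 e0 (ltr0n _ 2)).
  have [d2 d20 h2] := hg (e / 2) (divr_gt0 e0 (ltr0n _ 2)).
  exists (Num.min d1 d2); first by rewrite lt_min d10.
  move=> y z; rewrite !lt_min => /andP[y1 y2] /andP[z1 z2].
  have := h1 y z y1 z1; have := h2 y z y2 z2.
  have -> : f y + g y - (f z + g z) - (L (y - z) + M (y - z)) =
    (f y - f z - L (y - z)) + (g y - g z - M (y - z)).
    rewrite [- (f z + g z)]opprD [f y + g y + _]addrACA [- (L _ + _)]opprD.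
    by rewrite [LHS]addrACA.
  move=> a b; apply: (le_trans (ler_normD _ _)); lra.
Qed.

Lemma sdiffM V (a f : V -> R) x A L : sdiff a x A -> sdiff f x L ->
  sdiff (fun y => a y * f y) x (fun v => A v * f x + a x * L v).
Proof.
move=> sa sf; have [C [d1 [C0 d10 lipf]]] := sdiff_lip sf.
case: (sa) (sf) => [lA /pos_bound[CA CA0 hCA] ha] [lL /pos_bound[CL CL0 hCL] hf]; split.
- by move=> c u v; rewrite lA lL /GRing.scale /=; ring.
- exists (CA * `|f x| + `|a x| * CL) => v; rewrite (le_trans (ler_normD _ _)) // !normrM.
  have := hCA v; have := hCL v; have := normr_ge0 (f x); have := normr_ge0 (a x); nra.
- move=> e e0.
  pose K := `|f x| + `|a x| + 1.
  have [fx0 ax0] : 0 <= `|f x| /\ 0 <= `|a x| by [].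
  have K0 : 0 < K by rewrite /K; lra.
  have eK : 0 < e / (4 * K) by rewrite divr_gt0 ?mulr_gt0.
  have [d3 d30 h3] := ha _ eK; have [d4 d40 h4] := hf _ eK.
  have [d5 d50 h5] := sdiff_cont sf (divr_gt0 e0 (mulr_gt0 (ltr0n _ 4) CA0) : 0 < e / (4 * CA)).
  have [d6 d60 h6] := sdiff_cont sa (divr_gt0 e0 (mulr_gt0 (ltr0n _ 4) C0) : 0 < e / (4 * C)).
  have [d7 d70 h7] := sdiff_cont sf (ltr01).
  exists (Num.min d1 (Num.min d3 (Num.min d4 (Num.min d5 (Num.min d6 d7))))).
    by rewrite !lt_min d10 d30 d40 d50 d60 d70.
  move=> y z; rewrite !lt_min => /and5P[y1 y3 y4 y5 /andP[y6 y7]] /and5P[z1 z3 z4 z5 /andP[z6 z7]].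
  have -> : a y * f y - a z * f z - (A (y - z) * f x + a x * L (y - z)) =
    (a y - a z - A (y - z)) * f y + A (y - z) * (f y - f x)
    + (a z - a x) * (f y - f z) + a x * (f y - f z - L (y - z)) by ring.
  have t : 0 <= `|y - z| by [].
  have fyK : `|f y| <= K.
    by have := ler_normD (f y - f x) (f x); rewrite subrK; have := h7 _ y7; rewrite /K; lra.
  have b1 : `|(a y - a z - A (y - z)) * f y| <= e / 4 * `|y - z|.
    rewrite normrM; apply: (@le_trans _ _ (e / (4 * K) * `|y - z| * K)).
      by apply: ler_pM => //; exact: h3.
    by rewrite le_eqVlt; apply/orP; left; apply/eqP; field; rewrite gt_eqF.
  have b2 : `|A (y - z) * (f y - f x)| <= e / 4 * `|y - z|.
    rewrite normrM; apply: (@le_trans _ _ (CA * `|y - z| * (e / (4 * CA)))).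
      by apply: ler_pM => //; exact/ltW/h5.
    by rewrite le_eqVlt; apply/orP; left; apply/eqP; field; rewrite gt_eqF.
  have b3 : `|(a z - a x) * (f y - f z)| <= e / 4 * `|y - z|.
    rewrite normrM; apply: (@le_trans _ _ (e / (4 * C) * (C * `|y - z|))).
      by apply: ler_pM => //; [exact/ltW/h6 | exact: lipf].
    by rewrite le_eqVlt; apply/orP; left; apply/eqP; field; rewrite gt_eqF.
  have b4 : `|a x * (f y - f z - L (y - z))| <= e / 4 * `|y - z|.
    rewrite normrM; apply: (@le_trans _ _ (K * (e / (4 * K) * `|y - z|))).
      by apply: ler_pM => //; [rewrite /K; lra | exact: h4].
    by rewrite le_eqVlt; apply/orP; left; apply/eqP; field; rewrite gt_eqF.
  apply: (le_trans (ler_normD _ _)); apply: (le_trans (lerD (ler_normD _ _) (lexx _))).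
  apply: (le_trans (lerD (lerD (ler_normD _ _) (lexx _)) (lexx _))).
  lra.
Qed.

Lemma sdiff_comp U V W (f : U -> V) (g : V -> W) x L M : sdiff f x L -> sdiff g (f x) M ->
  sdiff (g \o f) x (M \o L).
Proof.
move=> sf; have [C [d1 [C0 d10 lipf]]] := sdiff_lip sf.
case: (sf) => [lL /pos_bound[CL CL0 hCL] hf] [lM /pos_bound[CM CM0 hCM] hg]; split.
- by move=> c u v; rewrite /= lL lM.
- exists (CM * CL) => v; rewrite -mulrA (le_trans (hCM _)) // ler_pM2l //.
- move=> e e0.
  have [d2 d20 h2] := hg (e / (2 * C)) (divr_gt0 e0 (mulr_gt0 (ltr0n _ 2) C0)).
  have [d3 d30 h3] := hf (e / (2 * CM)) (divr_gt0 e0 (mulr_gt0 (ltr0n _ 2) CM0)).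
  have [d4 d40 h4] := sdiff_cont sf d20.
  exists (Num.min d1 (Num.min d3 d4)); first by rewrite !lt_min d10 d30.
  move=> y z; rewrite !lt_min => /and3P[y1 y3 y4] /and3P[z1 z3 z4] /=.
  have -> : g (f y) - g (f z) - M (L (y - z)) =
    (g (f y) - g (f z) - M (f y - f z)) + M (f y - f z - L (y - z)).
    by rewrite (linB (f y - f z) _ lM) addrA subrK.
  have b1 : `|g (f y) - g (f z) - M (f y - f z)| <= e / 2 * `|y - z|.
    apply: (le_trans (h2 _ _ (h4 _ y4) (h4 _ z4))).
    apply: (@le_trans _ _ (e / (2 * C) * (C * `|y - z|))).
      by rewrite ler_pM2l ?lipf // divr_gt0 ?mulr_gt0.
    by rewrite le_eqVlt; apply/orP; left; apply/eqP; field; rewrite gt_eqF.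
  have b2 : `|M (f y - f z - L (y - z))| <= e / 2 * `|y - z|.
    apply: (le_trans (hCM _)); apply: (@le_trans _ _ (CM * (e / (2 * CM) * `|y - z|))).
      by rewrite ler_pM2l ?h3.
    by rewrite le_eqVlt; apply/orP; left; apply/eqP; field; rewrite gt_eqF.
  apply: (le_trans (ler_normD _ _)); lra.
Qed.

Lemma sdiff_row V n (f L : V -> 'rV[R]_n) x :
  (forall i, sdiff (fun y => f y 0 i) x (fun v => L v 0 i)) -> sdiff f x L.
Proof.
move=> h; split.
- by move=> a u v; apply/rowP => i; rewrite !mxE; case: (h i) => ->.
- have /choice[C hC] : forall i, exists C, 0 <= C /\ forall v, `|L v 0 i| <= C * `|v|.
    by move=> i; case: (h i) => _ /pos_bound[C C0 hC] _; exists C; split => //; exact: ltW.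
  exists (\sum_i C i) => v; apply: mx_norm_le.
    by apply: mulr_ge0 => //; apply: sumr_ge0 => i _; case: (hC i).
  move=> i j; rewrite (ord1 i) (le_trans ((hC j).2 v)) // ler_wpM2r // (bigD1 j) //= lerDl.
  by apply: sumr_ge0 => k _; case: (hC k).
- move=> e e0; have /choice[d hd] : forall i, exists d, 0 < d /\ forall y z, `|y - x| < d -> `|z - x| < d ->
      `|f y 0 i - f z 0 i - L (y - z) 0 i| <= e * `|y - z|.
    by move=> i; case: (h i) => _ _ /(_ e e0)[d d0 hd]; exists d.
  have [d1 d10 hd1] : exists2 d1, 0 < d1 & forall i, d1 <= d i.
    exists (\big[Num.min/1]_i d i); last by move=> i; apply: bigmin_le_cond.
    by apply: lt_bigmin => // i _; case: (hd i).
  exists d1 => // y z hy hz; apply: mx_norm_le; first by rewrite mulr_ge0 // ltW.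
  move=> i j; rewrite (ord1 i) !mxE; apply: (hd j).2; exact: lt_le_trans (hd1 j).
Qed.

Lemma sdiff_coord V n (f L : V -> 'rV[R]_n) x i : sdiff f x L ->
  sdiff (fun y => f y 0 i) x (fun v => L v 0 i).
Proof.
move=> [lL [C hC] h]; split=> [a u v||e e0]; first by rewrite lL !mxE.
  by exists C => v; rewrite (le_trans _ (hC v)) // mx_coord_le_norm.
have [d d0 hd] := h e e0; exists d => // y z hy hz.
by rewrite (le_trans _ (hd y z hy hz)) //; have := mx_coord_le_norm (f y - f z - L (y - z)) 0 i; rewrite !mxE.
Qed.

Lemma sdiffZ V n (a : V -> R) (f : V -> 'rV[R]_n) x A L : sdiff a x A -> sdiff f x L ->
  sdiff (fun y => a y *: f y) x (fun v => A v *: f x + a x *: L v).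
Proof.
move=> sa sf; apply: sdiff_row => i.
have -> : (fun y => (a y *: f y) 0 i) = fun y => a y * f y 0 i by apply/funext => y; rewrite mxE.
have -> : (fun v => (A v *: f x + a x *: L v) 0 i) = fun v => A v * f x 0 i + a x * L v 0 i.
  by apply/funext => y; rewrite !mxE.
by apply: sdiffM => //; exact: sdiff_coord.
Qed.

Lemma sdiff_sqrt (x : R) : 0 < x -> sdiff Num.sqrt x (fun v => v / (2 * Num.sqrt x)).
Proof.
move=> x0; have s0 : 0 < Num.sqrt x by rewrite sqrtr_gt0.
split=> [a u v||e e0]; first by rewrite /GRing.scale /=; field; rewrite gt_eqF.
  by exists (2 * Num.sqrt x)^-1 => v; rewrite normrM mulrC ler_wpM2r // ger0_norm // invr_ge0 mulr_ge0 // ltW.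
have [d1 d10 h1] : exists2 d, 0 < d & forall y, `|y - x| < d -> 0 < y /\ `|Num.sqrt y - Num.sqrt x| < Num.min (Num.sqrt x / 2) (e * x / 2).
  have m0 : 0 < Num.min (Num.sqrt x / 2) (e * x / 2) by rewrite lt_min !divr_gt0 // mulr_gt0.
  have := @sqrt_continuous R x; move/cvgrPdist_lt => /(_ _ m0) /nbhs_ballP[d /= d0 hd].
  exists (Num.min d x); first by rewrite lt_min d0.
  move=> y; rewrite lt_min => /andP[yd yx]; split.
    by move: yx; rewrite ltr_norml => /andP[h _]; lra.
  by rewrite distrC; apply: hd; rewrite -ball_normE /= distrC.
exists d1 => // y z /h1[y0 hy] /h1[z0 hz].
move: hy hz; set sx := Num.sqrt x; set sy := Num.sqrt y; set sz := Num.sqrt z.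
have [ey ez ex] : [/\ y = sy ^+ 2, z = sz ^+ 2 & x = sx ^+ 2] by rewrite !sqr_sqrtr ?ltW.
rewrite !lt_min => /andP[hy1 hy2] /andP[hz1 hz2].
have [sy0 sz0] : sx / 2 < sy /\ sx / 2 < sz by move: hy1 hz1; rewrite !ltr_norml; lra.
have sx0 : 0 < sx by [].
have -> : sy - sz - (y - z) / (2 * sx) = (sy - sz) * ((sx - sy) + (sx - sz)) / (2 * sx).
  by rewrite ey ez; field; rewrite gt_eqF.
have -> : y - z = (sy - sz) * (sy + sz) by rewrite ey ez; ring.
rewrite !normrM -mulrA [e * _]mulrCA ler_wpM2l //.
rewrite [X in _ <= _ * X]gtr0_norm; last lra.
rewrite [X in _ * X <= _]gtr0_norm ?invr_gt0 ?mulr_gt0 // ler_pdivrMr ?mulr_gt0 //.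
apply: (le_trans (ler_normD _ _)); rewrite !(distrC sx).
have : e * x <= e * (sy + sz) * (2 * sx) by rewrite ex -mulrA ler_pM2l //; nra.
lra.
Qed.

Lemma sdiff_inv (x : R) : 0 < x -> sdiff (fun y : R => y^-1 : R) x (fun v : R => - v / x ^+ 2 : R).
Proof.
move=> x0; split=> [a u v||e e0]; first by rewrite /GRing.scale /=; field; rewrite gt_eqF.
  by exists (`|x ^+ 2|^-1) => v; rewrite normrM normrN normfV mulrC.
exists (Num.min (x / 2) (e * x ^+ 3 / 12)); first by rewrite lt_min !divr_gt0 ?mulr_gt0 ?exprn_gt0.
move=> y z; rewrite !lt_min => /andP[y1 y2] /andP[z1 z2].
have [yx zx] : x / 2 < y < 2 * x /\ x / 2 < z < 2 * x by move: y1 z1; rewrite !ltr_norml; lra.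
have [y0 z0] : 0 < y /\ 0 < z by lra.
have -> : y^-1 - z^-1 - - (y - z) / x ^+ 2 = (y - z) * ((y * z - x ^+ 2) / (x ^+ 2 * (y * z))).
  by field; rewrite !gt_eqF.
rewrite normrM mulrC ler_wpM2r // normrM [X in _ * X]gtr0_norm; last by rewrite invr_gt0 !mulr_gt0 ?exprn_gt0.
rewrite ler_pdivrMr ?mulr_gt0 ?exprn_gt0 //.
have -> : y * z - x ^+ 2 = (y - x) * z + x * (z - x) by ring.
apply: (le_trans (ler_normD _ _)); rewrite !normrM (gtr0_norm x0) (gtr0_norm z0).
have b1 : `|y - x| * z <= e * x ^+ 3 / 12 * (2 * x) by apply: ler_pM => //; lra.
have b2 : x * `|z - x| <= x * (e * x ^+ 3 / 12) by rewrite ler_pM2l // ltW.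
have b3 : e * (x ^+ 2 * (x / 2 * (x / 2))) <= e * (x ^+ 2 * (y * z)).
  by rewrite ler_pM2l // ler_pM2l ?exprn_gt0 //; apply: ler_pM; lra.
rewrite (_ : e * (x ^+ 2 * (x / 2 * (x / 2))) = e * x ^+ 2 * (x * x) / 4) in b3; last by field.
rewrite (_ : e * x ^+ 3 / 12 * (2 * x) = e * x ^+ 2 * (x * x) / 6) in b1; last by field.
rewrite (_ : x * (e * x ^+ 3 / 12) = e * x ^+ 2 * (x * x) / 12) in b2; last by field.
have : 0 <= e * x ^+ 2 * (x * x) by rewrite !mulr_ge0 ?sqr_ge0 // ltW.
lra.
Qed.

Lemma sdiff_derive V W (f : V -> W) x L v : sdiff f x L -> 'D_v f x = L v.
Proof.
move=> [lL [C hC] h]; apply: cvg_lim => //; apply/cvgrPdist_le => e e0.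
have [d d0 hd] := h (e / (`|v| + 1)) (divr_gt0 e0 (ltr_wpDl (normr_ge0 v) ltr01)).
near=> t; have t0 : t != 0 by near: t; exact: nbhs_dnbhs_neq.
have htv : `|t *: v + x - x| < d.
  rewrite addrK normrZ; apply: (@le_lt_trans _ _ (`|t| * (`|v| + 1))).
    by rewrite ler_wpM2l // lerDl.
  rewrite -ltr_pdivlMr ?ltr_wpDl //; near: t.
  apply/nbhs_dnbhs/nbhs_ballP; exists (d / (`|v| + 1)) => /=; first by rewrite divr_gt0 // ltr_wpDl.
  by move=> u; rewrite -ball_normE /= sub0r normrN.
have := hd _ x htv; rewrite subrr normr0 => /(_ d0); rewrite addrK linZ //= => hh.
have -> : L v - t^-1 *: (f (t *: v + x) - f x) = - (t^-1 *: (f (t *: v + x) - f x - t *: L v)).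
  by rewrite [in RHS]scalerBr scalerA mulVf // scale1r opprB.
rewrite normrN normrZ normfV ler_pdivrMl ?normr_gt0 //; apply: (le_trans hh).
rewrite normrZ mulrCA ler_wpM2l // mulrAC ler_pdivrMr ?ltr_wpDl // ler_pM2l // lerDl //.
Unshelve. all: by end_near. Qed.

Lemma sdiff_differentiable V W (f : V -> W) x L : sdiff f x L -> differentiable f x.
Proof.
move=> [lL [C hC] h]; pose l : {linear V -> W} := HB.pack L (GRing.isLinear.Build _ _ _ _ L lL).
have cl : continuous l.
  apply/bounded_linear_continuous/ex_bound; exists `|C|.
  apply/nbhs_ballP; exists 1 => //= v; rewrite -ball_normE /= sub0r normrN => v1.
  rewrite (le_trans (hC v)) // -[leRHS]mulr1 (le_trans (ler_norm _)) // normrM normr_id.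
  by rewrite ler_wpM2l // ltW.
have hl : f \o shift x = cst (f x) + l +o_ 0 id.
  apply/eqaddoP => e e0; have [d d0 hd] := h e e0.
  apply/nbhs_ballP; exists d => //= u; rewrite -ball_normE /= sub0r normrN => hu.
  have := hd (u + x) x; rewrite addrK subrr normr0 => /(_ hu d0).
  by rewrite !fctE /= opprD addrA.
by apply/diff_locallyP; rewrite (diff_unique cl hl).
Qed.

End StrictDiff.

Section C1.
Context {R : realType}.
Implicit Types (V W : normedModType R).

Lemma conv_lt (t a b d : R) : 0 <= t -> t <= 1 -> a < d -> b < d -> (1 - t) * a + t * b < d.
Proof.
move=> t0 t1 ad bd; have [ab|ab] := lerP a b.
  have : 0 <= (1 - t) * (b - a) by rewrite mulr_ge0 ?subr_ge0.
  lra.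
have : 0 <= t * (a - b) by rewrite mulr_ge0 // subr_ge0 ltW.
lra.
Qed.

(** Continuity of the derivative is built into strictness: the expansions at [x] and at a nearby [y]
    are compared on one common small increment. *)
Lemma sdiff_close V W (f : V -> W) x L : sdiff f x L -> forall e, 0 < e ->
  exists2 d, 0 < d & forall y M, `|y - x| < d -> sdiff f y M -> forall v, `|M v - L v| <= e * `|v|.
Proof.
move=> [lL bL h] e e0; have [d d0 hd] := h (e / 2) (divr_gt0 e0 (ltr0n _ 2)).
exists d => // y M yd [lM bM hM] v.
have [->|v0] := eqVneq v 0; first by rewrite (lin0 lM) (lin0 lL) addrN !normr0 mulr0.
have nv0 : 0 < `|v| by rewrite normr_gt0.
have [d1 d10 hd1] := hM (e / 2) (divr_gt0 e0 (ltr0n _ 2)).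
pose t := Num.min d1 (d - `|y - x|) / (2 * `|v|).
have m0 : 0 < Num.min d1 (d - `|y - x|) by rewrite lt_min d10 subr_gt0.
have t0 : 0 < t by rewrite divr_gt0 // mulr_gt0.
have tv : `|t *: v| < Num.min d1 (d - `|y - x|).
  rewrite normrZ gtr0_norm // (_ : t * _ = Num.min d1 (d - `|y - x|) / 2); first by move: m0; lra.
  by rewrite /t; field; rewrite gt_eqF.
have [tv1 tv2] : `|t *: v| < d1 /\ `|t *: v| < d - `|y - x|.
  by move: tv; rewrite lt_min => /andP[].
have y1 : `|y + t *: v - x| < d by rewrite addrAC (le_lt_trans (ler_normD _ _)) //; lra.
have e1 := hd (y + t *: v) y y1 yd.
have := hd1 (y + t *: v) y; rewrite subrr normr0 [y + _]addrC addrK => /(_ tv1 d10) e2.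
move: e1; rewrite [y + _]addrC addrK (linZ _ _ lL) => e1; rewrite (linZ _ _ lM) in e2.
have nt : `|t *: v| = t * `|v| by rewrite normrZ gtr0_norm.
rewrite nt in e1 e2.
rewrite -(ler_pM2l t0) -[t in leLHS]gtr0_norm // -normrZ scalerBr.
have -> : t *: M v - t *: L v = (f (t *: v + y) - f y - t *: L v) - (f (t *: v + y) - f y - t *: M v).
  by rewrite opprB [RHS]addrC addrA subrK.
apply: (le_trans (ler_normB _ _)); lra.
Qed.

Lemma sdiff_bound V W (f : V -> W) x L K d : 0 < d ->
  (forall y z, `|y - x| < d -> `|z - x| < d -> `|f y - f z| <= K * `|y - z|) ->
  sdiff f x L -> forall v, `|L v| <= K * `|v|.
Proof.
move=> d0 fK [lL bL h] v; apply/ler_addgt0Pr => e e0.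
have [->|v0] := eqVneq v 0; first by rewrite (lin0 lL) !normr0 mulr0 add0r ltW.
have nv0 : 0 < `|v| by rewrite normr_gt0.
have [d1 d10 hd] := h (e / `|v|) (divr_gt0 e0 nv0).
pose t := Num.min d1 d / (2 * `|v|).
have m0 : 0 < Num.min d1 d by rewrite lt_min d10.
have t0 : 0 < t by rewrite divr_gt0 // mulr_gt0.
have : `|t *: v| < Num.min d1 d.
  rewrite normrZ gtr0_norm // (_ : t * _ = Num.min d1 d / 2); first by move: m0; lra.
  by rewrite /t; field; rewrite gt_eqF.
rewrite lt_min => /andP[tv1 tv2].
have := hd (x + t *: v) x; have := fK (x + t *: v) x; rewrite subrr normr0 [x + _]addrC addrK.
move=> /(_ tv2 d0) h1 /(_ tv1 d10); rewrite (linZ _ _ lL) => h2.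
rewrite -(ler_pM2l t0) -[t in leLHS]gtr0_norm // -normrZ.
have -> : t *: L v = (f (t *: v + x) - f x) - (f (t *: v + x) - f x - t *: L v) by rewrite opprB addrC subrK.
apply: (le_trans (ler_normB _ _)); move: h1 h2; rewrite normrZ gtr0_norm // => h1 h2.
have e3 : e / `|v| * (t * `|v|) = t * e by field; rewrite gt_eqF.
rewrite e3 in h2; rewrite mulrDr; move: h1; rewrite mulrCA; lra.
Qed.

Lemma sdiff_Ck1 W (f : pt R -> W) : (forall x, exists L, sdiff f x L) -> Ck 1 f.
Proof.
move=> h; split=> [x|v] /=; first by have [L /sdiff_differentiable] := h x.
move=> x; have [L sL] := h x; have F := nbhs_filter x; apply/cvgrPdist_lt => e e0.
have [d d0 hd] := sdiff_close sL (divr_gt0 e0 (ltr_wpDl (normr_ge0 v) ltr01)).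
apply/enorm_ballP; exists d => // y /(le_lt_trans (norm_le_enorm _)) yd.
have [M sM] := h y; rewrite (sdiff_derive v sL) (sdiff_derive v sM) distrC.
apply: (le_lt_trans (hd y M yd sM v)).
by rewrite mulrAC ltr_pdivrMr ?ltr_wpDl // ltr_pM2l // ltrDl.
Qed.

Definition grad (f : pt R -> R) (x : pt R) : pt R := \row_i 'D_(delta_mx 0 i) f x.

Lemma derive_grad (f : pt R -> R) x v : differentiable f x -> 'D_v f x = dot (grad f x) v.
Proof.
move=> df; rewrite deriveE // {1}[v]row_sum_delta linear_sum; apply: eq_bigr => i _.
by rewrite linearZ /= mxE deriveE // mulrC.
Qed.

Lemma segment_MVT (f : pt R -> R) y z : (forall x, differentiable f x) ->
  exists t, 0 <= t <= 1 /\ f y - f z = dot (grad f (z + t *: (y - z))) (y - z).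
Proof.
move=> df; pose g (t : R) := f (z + t *: (y - z)).
have dg t : is_derive t (1 : R) g (dot (grad f (z + t *: (y - z))) (y - z)).
  have e (h : R) : h^-1 *: ((g \o shift t) (h *: (1 : R)) - g t) =
      h^-1 *: ((f \o shift (z + t *: (y - z))) (h *: (y - z)) - f (z + t *: (y - z))).
    by rewrite /g /= scalerDl addrCA [_ *: 1]mulr1.
  apply: DeriveDef.
    by rewrite /derivable (funext e); exact: diff_derivable.
  by rewrite /derive (funext e) -derive_grad.
have [|t] := @MVT_segment R g _ 0 1 ler01 (fun t _ => dg t).
  apply: continuous_subspaceT => t; apply: differentiable_continuous.
  by apply/derivable1_diffP; case: (dg t).
rewrite in_itv /= => t01; rewrite /g subr0 mulr1 scale0r scale1r addr0 [z + (y - z)]addrC subrK => e.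
by exists t.
Qed.

Lemma grad_cont (f : pt R -> R) x e : Ck 1 f -> 0 < e ->
  exists2 d, 0 < d & forall y, enorm (y - x) < d -> enorm (grad f y - grad f x) <= e.
Proof.
move=> [df cf] e0.
have /choice[d hd] : forall i : 'I_3, exists d, 0 < d /\ forall y, enorm (y - x) < d ->
    `|(grad f y - grad f x) 0 i| <= e / 2.
  move=> i; have := cf (delta_mx 0 i) x; have F := nbhs_filter x.
  move/cvgrPdist_le => /(_ _ (divr_gt0 e0 (ltr0n _ 2))) /enorm_ballP[d d0 h]; exists d; split=> // y yd.
  by rewrite !mxE distrC h.
exists (\big[Num.min/1]_i d i); first by apply: lt_bigmin => // i _; case: (hd i).
move=> y yd; apply: (le_trans (enorm_le_norm _)); rewrite mulrC -ler_pdivlMr //.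
apply: mx_norm_le => [|i j]; first by rewrite divr_ge0 // ltW.
by rewrite (ord1 i); apply: (hd j).2; apply: lt_le_trans yd _; apply: bigmin_le_cond.
Qed.

Lemma C1_sdiff (f : pt R -> R) x : Ck 1 f -> sdiff f x (dot (grad f x)).
Proof.
move=> cf; split=> [a u v||e e0]; first by rewrite !dotE.
  exists (2 * enorm (grad f x)) => v; apply: (le_trans (dot_abs _ _)).
  by rewrite -mulrA mulrCA ler_wpM2l ?enorm_ge0 // enorm_le_norm.
have [d d0 hd] := grad_cont x cf (divr_gt0 e0 (ltr0n _ 2)).
exists (d / 2); first exact: divr_gt0.
move=> y z hy hz; have [t [/andP[t0 t1] ->]] := segment_MVT y z cf.1.
rewrite -dotNl -dotDl; apply: (le_trans (dot_abs _ _)).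
apply: (@le_trans _ _ (e / 2 * (2 * `|y - z|))); last lra.
apply: ler_pM; rewrite ?enorm_ge0 ?enorm_le_norm //; apply: hd.
have -> : z + t *: (y - z) - x = (1 - t) *: (z - x) + t *: (y - x).
  by apply/rowP => i; rewrite !mxE; ring.
apply: (le_lt_trans (ler_enormD _ _)); rewrite !enormZ !ger0_norm ?subr_ge0 //.
have := enorm_le_norm (z - x); have := enorm_le_norm (y - x) => h1 h2.
by apply: conv_lt => //; lra.
Qed.

Lemma grad_lip (f : pt R -> R) x : Ck 2 f -> exists K d, [/\ 0 < K, 0 < d &
  forall y z, enorm (y - x) < d -> enorm (z - x) < d -> enorm (grad f y - grad f z) <= K * enorm (y - z)].
Proof.
move=> [df cf].
have /choice[C hC] : forall i : 'I_3, exists C : R * R, [/\ 0 < C.1, 0 < C.2 & forall y z,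
    `|y - x| < C.2 -> `|z - x| < C.2 -> `|grad f y 0 i - grad f z 0 i| <= C.1 * `|y - z|].
  move=> i; have [C [d [C0 d0 h]]] := sdiff_lip (C1_sdiff x (cf (delta_mx 0 i))).
  by exists (C, d); split => // y z hy hz; rewrite !mxE; exact: h.
exists (2 * \sum_i (C i).1), (\big[Num.min/1]_i (C i).2); split.
- by rewrite mulr_gt0 // big_ord_recl ltr_wpDr // ?sumr_ge0 // => [i _|]; [case: (hC (lift ord0 i)) => /ltW | case: (hC ord0)].
- by apply: lt_bigmin => // i _; case: (hC i).
- move=> y z hy hz; apply: (le_trans (enorm_le_norm _)); rewrite -mulrA ler_wpM2l //.
  have S0 : 0 <= \sum_i (C i).1 by apply: sumr_ge0 => i _; case: (hC i) => /ltW.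
  apply: mx_norm_le => [|i j]; first by rewrite mulr_ge0 // enorm_ge0.
  rewrite (ord1 i) !mxE; case: (hC j) => C0 _ h; have := h y z; rewrite !mxE => h'.
  apply: (le_trans (h' _ _)).
  + by apply: le_lt_trans (norm_le_enorm _) _; apply: lt_le_trans hy _; apply: bigmin_le_cond.
  + by apply: le_lt_trans (norm_le_enorm _) _; apply: lt_le_trans hz _; apply: bigmin_le_cond.
  apply: ler_pM => //; [exact: ltW| |exact: norm_le_enorm].
  by rewrite (bigD1 j) //= lerDl sumr_ge0 // => k _; case: (hC k) => /ltW.
Qed.

Lemma taylor2 (f : pt R -> R) x : Ck 2 f -> exists K d, [/\ 0 < K, 0 < d &
  forall y z, enorm (y - x) < d -> enorm (z - x) < d ->
    `|f y - f z - dot (grad f z) (y - z)| <= K * enorm (y - z) ^+ 2].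
Proof.
move=> cf; have [K [d [K0 d0 h]]] := grad_lip x cf.
exists K, d; split => // y z hy hz; have [t [/andP[t0 t1] ->]] := segment_MVT y z cf.1.
rewrite -dotNl -dotDl; apply: (le_trans (dot_abs _ _)).
rewrite expr2 mulrA ler_wpM2r ?enorm_ge0 //; apply: (le_trans (h _ _ _ hz)).
  have -> : z + t *: (y - z) - x = (1 - t) *: (z - x) + t *: (y - x).
    by apply/rowP => i; rewrite !mxE; ring.
  apply: (le_lt_trans (ler_enormD _ _)); rewrite !enormZ !ger0_norm ?subr_ge0 //; exact: conv_lt.
rewrite [z + _]addrC addrK enormZ ger0_norm // ler_pM2l //.
by rewrite ler_piMl ?enorm_ge0.
Qed.

End C1.

(** * Calculus of strictly differentiable maps and implicit differentiation *)

Section Implicit.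
Context {R : realType}.
Implicit Types (U V W : normedModType R).

Definition sd V W (f : V -> W) x : Prop := exists L, sdiff f x L.

Lemma sd_cst V W (c : W) (x : V) : sd (fun=> c) x.
Proof. by eexists; exact: sdiff_cst. Qed.
Lemma sd_id V (x : V) : sd id x.
Proof. by eexists; exact: sdiff_id. Qed.
Lemma sdD V W (f g : V -> W) x : sd f x -> sd g x -> sd (fun y => f y + g y) x.
Proof. by move=> [L fL] [M gM]; eexists; exact: sdiffD fL gM. Qed.
Lemma sdM V (f g : V -> R) x : sd f x -> sd g x -> sd (fun y => f y * g y) x.
Proof. by move=> [L fL] [M gM]; eexists; exact: sdiffM fL gM. Qed.
Lemma sdZ V n (a : V -> R) (f : V -> 'rV[R]_n) x : sd a x -> sd f x -> sd (fun y => a y *: f y) x.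
Proof. by move=> [L fL] [M gM]; eexists; exact: sdiffZ fL gM. Qed.
Lemma sd_comp U V W (f : U -> V) (g : V -> W) x : sd f x -> sd g (f x) -> sd (fun y => g (f y)) x.
Proof. by move=> [L fL] [M gM]; eexists; exact: sdiff_comp fL gM. Qed.
Lemma sd_coord V n (f : V -> 'rV[R]_n) x i : sd f x -> sd (fun y => f y 0 i) x.
Proof. by move=> [L fL]; eexists; apply: sdiff_coord fL. Qed.
Lemma sd_row V n (f : V -> 'rV[R]_n) x : (forall i, sd (fun y => f y 0 i) x) -> sd f x.
Proof.
move=> /choice[L hL]; exists (fun v => \row_i L i v); apply: sdiff_row => i.
by have -> : (fun v => (\row_i L i v) 0 i) = L i by apply/funext => v; rewrite mxE.
Qed.
Lemma sd_near V W (f g : V -> W) x d : 0 < d -> (forall y, `|y - x| < d -> f y = g y) -> sd f x -> sd g x.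
Proof. by move=> d0 fg [L fL]; exists L; exact: (sdiff_near d0 fg fL). Qed.
Lemma sd_inv V (f : V -> R) x : sd f x -> 0 < f x -> sd (fun y => (f y)^-1) x.
Proof.
move=> sf f0; apply: (@sd_comp _ _ _ f (fun y : R => y^-1 : R) x sf).
by exists (fun v : R => - v / f x ^+ 2 : R); exact: sdiff_inv.
Qed.
Lemma sd_sqrt V (f : V -> R) x : sd f x -> 0 < f x -> sd (fun y => Num.sqrt (f y)) x.
Proof.
move=> sf f0; apply: (@sd_comp _ _ _ f (@Num.sqrt R : R -> R) x sf).
by exists (fun v : R => v / (2 * Num.sqrt (f x)) : R); exact: sdiff_sqrt.
Qed.
Lemma sd_dot V (f g : V -> pt R) x : sd f x -> sd g x -> sd (fun y => dot (f y) (g y)) x.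
Proof.
move=> sf sg; rewrite /dot; under eq_fun do rewrite !big_ord_recl big_ord0.
by do !apply: sdD; try apply: sdM; try exact: sd_coord; exact: sd_cst.
Qed.
Lemma sd_enorm V (f : V -> pt R) x : sd f x -> f x != 0 -> sd (fun y => enorm (f y)) x.
Proof.
by move=> sf f0; apply: sd_sqrt; [exact: sd_dot | rewrite lt_neqAle dot_ge0 eq_sym dot_eq0 f0].
Qed.

Lemma sdiff_enorm (f L : pt R -> pt R) x : linear L -> (exists C, forall v, enorm (L v) <= C * enorm v) ->
  (forall e, 0 < e -> exists2 d, 0 < d & forall y z, enorm (y - x) < d -> enorm (z - x) < d ->
      enorm (f y - f z - L (y - z)) <= e * enorm (y - z)) -> sdiff f x L.
Proof.
move=> lL [C hC] h; split=> //.
  exists (`|C| * 2) => v; apply: (le_trans (norm_le_enorm _)); apply: (le_trans (hC _)).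
  apply: (le_trans (ler_wpM2r (enorm_ge0 _) (ler_norm C))).
  by rewrite -mulrA ler_wpM2l // enorm_le_norm.
move=> e e0; have [d d0 hd] := h (e / 2) (divr_gt0 e0 (ltr0n _ 2)).
exists (d / 2); first exact: divr_gt0.
have H y : `|y - x| < d / 2 -> enorm (y - x) < d.
  by move=> hy; apply: (le_lt_trans (enorm_le_norm _)); lra.
move=> y z /H hy /H hz; apply: (le_trans (norm_le_enorm _)); apply: (le_trans (hd _ _ hy hz)).
have := enorm_le_norm (y - z); nra.
Qed.

Lemma enorm_sdiff (f L : pt R -> pt R) x : sdiff f x L ->
  forall e, 0 < e -> exists2 d, 0 < d & forall y z, enorm (y - x) < d -> enorm (z - x) < d ->
      enorm (f y - f z - L (y - z)) <= e * enorm (y - z).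
Proof.
move=> [_ _ h] e e0; have [d d0 hd] := h (e / 2) (divr_gt0 e0 (ltr0n _ 2)).
exists d => // y z hy hz; apply: (le_trans (enorm_le_norm _)).
have := hd y z (le_lt_trans (norm_le_enorm _) hy) (le_lt_trans (norm_le_enorm _) hz).
have := norm_le_enorm (y - z); nra.
Qed.

(** Implicit function theorem for a solution [z] that is already known: its increments satisfy
    [(Id + T) dz = B dx] up to a strict error, and [Id + T] is inverted by the contraction
    principle. It serves for the projection and for inverse maps. *)
Lemma sd_implicit (z T B : pt R -> pt R) x0 : linear T -> (forall v, enorm (T v) <= 1 / 4 * enorm v) ->
  linear B -> (exists C, forall v, enorm (B v) <= C * enorm v) ->
  (forall e, 0 < e -> exists2 d, 0 < d & forall x y, enorm (x - x0) < d -> enorm (y - x0) < d ->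
     enorm ((z x - z y) + T (z x - z y) - B (x - y)) <= e * enorm (x - y)) ->
  sd z x0.
Proof.
move=> lT T4 lB [C hC] h.
have [|g [gK Kg gL]] := @id_plus_lip_bij _ T; first by move=> x y; rewrite -linB.
have inj u v : u + T u = v + T v -> u = v by move=> e; rewrite -(gK u) e gK.
have lg : linear g.
  by move=> a u v; apply: inj; rewrite Kg lT addrACA Kg -scalerDr Kg.
exists (g \o B); apply: sdiff_enorm.
- by move=> a u v /=; rewrite lB lg.
- exists (2 * C) => v /=; have := gL (B v) 0; rewrite (lin0 lg) !subr0 => h1.
  by rewrite (le_trans h1) // -mulrA ler_pM2l.
- move=> e e0; have [d d0 hd] := h (e / 2) (divr_gt0 e0 (ltr0n _ 2)).
  exists d => // x y hx hy /=; rewrite -(gK (z x - z y)).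
  apply: (le_trans (gL _ _)); have := hd x y hx hy; lra.
Qed.

End Implicit.

(** * Oriented distance and tubular neighbourhood *)

Section Segments.
Context {R : realType}.
Implicit Types (x y z : pt R) (t : R).

Definition segpt x y t : pt R := (1 - t) *: x + t *: y.

Lemma segptE x y t : segpt x y t = x + t *: (y - x).
Proof. by apply/rowP => i; rewrite !mxE; ring. Qed.
Lemma segpt0 x y : segpt x y 0 = x.
Proof. by rewrite segptE scale0r addr0. Qed.
Lemma segpt1 x y : segpt x y 1 = y.
Proof. by rewrite segptE scale1r addrC subrK. Qed.
Lemma segpt_dist x y s t : enorm (segpt x y s - segpt x y t) = `|s - t| * enorm (x - y).
Proof.
by rewrite -[enorm (x - y)]enormB -enormZ; congr enorm; apply/rowP => i; rewrite !mxE; ring.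
Qed.
Lemma segpt_distl x y t : 0 <= t -> enorm (segpt x y t - x) = t * enorm (x - y).
Proof. by move=> t0; rewrite -[X in _ - X](segpt0 x y) segpt_dist subr0 ger0_norm. Qed.
Lemma segpt_distr x y t : t <= 1 -> enorm (segpt x y t - y) = (1 - t) * enorm (x - y).
Proof. by move=> t0; rewrite -[X in _ - X](segpt1 x y) segpt_dist distrC ger0_norm ?subr_ge0. Qed.
Lemma segpt_cont x y : continuous (segpt x y).
Proof.
move=> t; apply/cvgrPdist_lt => e e0.
have n0 : 0 < enorm (x - y) + 1 by rewrite ltr_wpDl ?enorm_ge0.
apply/nbhs_ballP; exists (e / (enorm (x - y) + 1)); rewrite /= ?divr_gt0 // => s.
rewrite /ball /= ltr_pdivlMr // => hs; apply: le_lt_trans hs.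
by apply: (le_trans (norm_le_enorm _)); rewrite segpt_dist ler_wpM2l // lerDl.
Qed.
Lemma segptP x y z : segment x y z <-> exists t, 0 <= t <= 1 /\ z = segpt x y t.
Proof.
split=> [[t] /=|[t [t01 ->]]]; first by rewrite in_itv /= => t01 <-; exists t.
by exists t => //=; rewrite in_itv.
Qed.
End Segments.

Lemma closure_closed_sub (T : topologicalType) (A B : set T) : closed B -> A `<=` B -> closure A `<=` B.
Proof. by move=> cB AB; rewrite (closure_id B).1 //; exact: closure_subset. Qed.

Lemma closureE (R : realType) (A : set (pt R)) x :
  closure A x <-> forall e, 0 < e -> exists2 y, A y & enorm (y - x) < e.
Proof.
split=> [cx e e0|h B /enorm_ballP[e e0 hB]].
  have /cx[y [Ay yx]] : nbhs x [set y | enorm (y - x) < e] by apply/enorm_ballP; exists e.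
  by exists y.
by have [y Ay yx] := h e e0; exists y; split => //; exact: hB.
Qed.

Lemma interiorE (R : realType) (A : set (pt R)) x :
  interior A x <-> exists2 e, 0 < e & forall y, enorm (y - x) < e -> A y.
Proof. exact: enorm_ballP. Qed.

Lemma bounded_enormP (R : realType) (A : set (pt R)) :
  bounded_set A <-> exists C, forall x, A x -> enorm x <= C.
Proof.
split=> [[C [_ hC]]|[C hC]].
  exists (2 * (C + 1)) => x Ax; apply: (le_trans (enorm_le_norm _)); rewrite ler_pM2l //.
  by apply: (hC (C + 1)) => //; rewrite ltrDl.
exists C; split; first exact: num_real.
by move=> D CD x Ax; apply: (le_trans (norm_le_enorm _)); apply: (le_trans (hC x Ax)); exact: ltW.
Qed.

Lemma compactE (R : realType) (A : set (pt R)) :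
  compact A <-> closed A /\ exists C, forall x, A x -> enorm x <= C.
Proof.
split=> [cA|[cA /bounded_enormP bA]]; last exact: bounded_closed_compact.
split; first by apply: compact_closed => //; exact: norm_hausdorff.
by apply/bounded_enormP; exact: compact_bounded.
Qed.

Lemma lip_closed (R : realType) (f : pt R -> R) K c : (forall x y, `|f x - f y| <= K * enorm (x - y)) ->
  closed [set x | f x <= c].
Proof.
by move=> fK; apply: (continuous_closedP f).1 (@closed_le R c); exact: elip_continuous fK.
Qed.

Section Boundary.
Context {R : realType} (Om : set (pt R)).
Hypotheses (oO : open Om) (bO : bounded_set Om).
Implicit Types (x y z p a u v : pt R).
Notation Gam := (frontier Om).
Notation od := (oriented_distance Om).

Lemma GamP p : Gam p <-> closure Om p /\ ~ Om p.
Proof. by rewrite /frontier /setD /= (interior_id Om).1. Qed.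

Lemma Gam_compact : compact Gam.
Proof.
apply/compactE; split.
  by apply: closedI; [exact: closed_closure | apply: open_closedC; exact: open_interior].
move/bounded_enormP: bO => [C hC]; exists C => x [cx _].
apply/ler_addgt0Pr => e e0; have [y Oy yx] := (closureE _ _).1 cx e e0.
by have := ler_enormD (x - y) y; rewrite subrK enormB; have := hC y Oy; lra.
Qed.

Lemma cross x y : ~ Om x -> Om y -> exists t, 0 <= t <= 1 /\ Gam (segpt x y t).
Proof.
move=> nx Oy.
have [|||||||t [t01 [h1 h2]]] := @path_meet R _ (segpt x y) 0 1 (~` Om) (closure Om).
- exact: ler01.
- by move=> t _; exact: segpt_cont.
- exact: open_closedC.
- exact: closed_closure.
- move=> t _; have [h|h] := pselect (Om (segpt x y t)); [right; exact: subset_closure|by left].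
- by rewrite segpt0.
- by rewrite segpt1; exact: subset_closure.
by exists t; split => //; apply/GamP.
Qed.

Definition nearest x a := Gam a /\ forall b, Gam b -> enorm (x - a) <= enorm (x - b).

Lemma nearest_ex x : Gam !=set0 -> exists a, nearest x a.
Proof.
move=> G0; have [|a Ga h] := EVT_min_rV G0 Gam_compact (f := fun y => enorm (x - y)).
  apply: continuous_subspaceT; apply: (@elip_continuous _ _ _ 1) => y z; rewrite mul1r.
  by apply: (le_trans (enorm_lip _ _)); rewrite opprB addrC subrKA enormB.
exists a; split; first exact: set_mem.
by move=> b Gb; apply: h; exact: mem_set.
Qed.

Definition rdist x := inf [set enorm (x - y) | y in Gam].

Lemma rdistE x a : nearest x a -> rdist x = enorm (x - a).
Proof.
move=> [Ga h]; apply/eqP; rewrite eq_le; apply/andP; split.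
  apply: ge_inf; last by exists a.
  by exists 0 => _ [y _ <-]; exact: enorm_ge0.
by apply: lb_le_inf; [exists (enorm (x - a)); exists a | move=> _ [b Gb <-]; exact: h].
Qed.

Lemma rdist_le x b : Gam b -> rdist x <= enorm (x - b).
Proof. by move=> Gb; apply: ge_inf; [exists 0 => _ [y _ <-]; exact: enorm_ge0 | exists b]. Qed.

Lemma odE x : od x = if x \in Om then - rdist x else rdist x.
Proof. by []. Qed.

Lemma od_in x : Om x -> od x = - rdist x.
Proof. by move=> /mem_set Ox; rewrite odE Ox. Qed.
Lemma od_out x : ~ Om x -> od x = rdist x.
Proof. by move=> Ox; rewrite odE (memNset Ox). Qed.

Lemma rdist_segl x y t : 0 <= t -> Gam (segpt x y t) -> rdist x <= t * enorm (x - y).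
Proof. by move=> t0 Gt; rewrite -(segpt_distl x y t0) enormB; exact: rdist_le. Qed.
Lemma rdist_segr x y t : t <= 1 -> Gam (segpt x y t) -> rdist y <= (1 - t) * enorm (x - y).
Proof. by move=> t0 Gt; rewrite -(segpt_distr x y t0) enormB; exact: rdist_le. Qed.

Hypothesis G0 : Gam !=set0.

Lemma rdist_ge0 x : 0 <= rdist x.
Proof. by have [a na] := nearest_ex x G0; rewrite (rdistE na) enorm_ge0. Qed.

Lemma rdist_ge x r : (forall b, Gam b -> r <= enorm (x - b)) -> r <= rdist x.
Proof. by move=> h; have [a na] := nearest_ex x G0; rewrite (rdistE na); apply: h na.1. Qed.

Lemma od_abs x : `|od x| = rdist x.
Proof. by rewrite odE; case: ifP => _; [apply: (etrans (normrN _))|]; exact: ger0_norm (rdist_ge0 x). Qed.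

Lemma Gam_od p : Gam p -> od p = 0.
Proof.
move=> Gp; apply/normr0_eq0; rewrite od_abs; apply/eqP; rewrite eq_le rdist_ge0 andbT.
by have := rdist_le p Gp; rewrite subrr enorm0.
Qed.

Lemma rdist_lip x y : rdist x <= rdist y + enorm (x - y).
Proof.
have [a na] := nearest_ex y G0; rewrite (rdistE na) addrC.
by apply: (le_trans (rdist_le x na.1)); exact: enorm_triangle.
Qed.

(** For points on different sides the segment meets the boundary, and the two distances are bounded
    by the two parts of the segment. *)
Lemma od_lip x y : `|od x - od y| <= enorm (x - y).
Proof.
have H a b : ~ Om a -> Om b -> od a - od b <= enorm (a - b).
  move=> na Ob; have [t [/andP[t0 t1] Gt]] := cross na Ob.
  have := rdist_segl t0 Gt; have := rdist_segr t1 Gt; rewrite od_out // od_in //; lra.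
have nn a : ~ Om a -> 0 <= od a by move=> h; rewrite od_out // rdist_ge0.
have pp a : Om a -> od a <= 0 by move=> h; rewrite od_in // oppr_le0 rdist_ge0.
have [Ox|Ox] := pselect (Om x); have [Oy|Oy] := pselect (Om y).
- have := rdist_lip x y; have := rdist_lip y x; rewrite !od_in // (enormB y) ler_norml => ? ?.
  by apply/andP; split; lra.
- rewrite distrC ger0_norm; first by rewrite enormB; exact: H.
  by have := nn _ Oy; have := pp _ Ox; lra.
- rewrite ger0_norm; first exact: H.
  by have := nn _ Ox; have := pp _ Oy; lra.
- have := rdist_lip x y; have := rdist_lip y x; rewrite !od_out // (enormB y) ler_norml => ? ?.
  by apply/andP; split; lra.
Qed.

(** Comparison with the oriented distance to the sphere of an inscribed ball; [od_outer] is the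
    exterior counterpart. Balls touching from both sides will pinch [od] between two explicit
    functions. *)
Lemma od_inner x c r : (forall z, enorm (z - c) < r -> Om z) -> 0 < r -> od x <= enorm (x - c) - r.
Proof.
move=> hc r0; have Oc : Om c by apply: hc; rewrite subrr enorm0.
have hb b : Gam b -> r <= enorm (b - c).
  by move=> /GamP[_ nb]; rewrite leNgt; apply/negP => /hc.
have [Ox|Ox] := pselect (Om x).
  rewrite od_in // lerNl opprB; apply: rdist_ge => b /hb; have := enorm_triangle x b c; rewrite (enormB b x); lra.
have [t [/andP[t0 t1] Gt]] := cross Ox Oc.
have := hb _ Gt; have := rdist_segl t0 Gt; rewrite od_out // segpt_distr //; lra.
Qed.

Lemma od_outer x c r : (forall z, enorm (z - c) < r -> ~ Om z) -> 0 < r -> r - enorm (x - c) <= od x.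
Proof.
move=> hc r0; have Oc : ~ Om c by apply: hc; rewrite subrr enorm0.
have hb b : Gam b -> r <= enorm (b - c).
  move=> /GamP[/closureE cb _]; rewrite leNgt; apply/negP => hlt.
  have [|z Oz hz] := cb (r - enorm (b - c)); first by rewrite subr_gt0.
  by apply: (hc z) Oz; have := enorm_triangle b z c; lra.
have [Ox|Ox] := pselect (Om x); last first.
  rewrite od_out // ; apply: rdist_ge => b /hb; have := enorm_triangle x b c; rewrite (enormB b x); lra.
have [t [/andP[t0 t1] Gt]] := cross Oc Ox.
have := hb _ Gt; have := rdist_segr t1 Gt; rewrite od_in // segpt_distl // (enormB c); lra.
Qed.

End Boundary.

(** * Outward normals and two-sided tangent balls *)

Section Normals.
Context {R : realType} (Om : set (pt R)).
Hypotheses (oO : open Om) (bO : bounded_set Om) (sO : smooth_boundary Om).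
Implicit Types (x y z p a u v : pt R).
Notation Gam := (frontier Om).

Lemma outward_in p n v : is_outward_unit_normal Om p n -> Gam p -> dot n v < 0 ->
  exists2 e, 0 < e & forall t, 0 < t < e -> Om (p + t *: v).
Proof.
move=> [n1 [phi [c [[sphi _ hphi] c0 hc]]]] /(GamP oO)[cp np] nv.
have /enorm_ballP[e1 e10 he1] := hphi.
have df := (sphi 1%N).1 p.
have [d d0 hd] : exists2 d, 0 < d & forall t, 0 < t < d -> phi (p + t *: v) - phi p < 0.
  have [_ _ h] := C1_sdiff p (sphi 1%N).
  have cv : 0 < - (c * dot n v) by rewrite oppr_gt0 pmulr_rlt0.
  have v0 : 0 < `|v| by rewrite normr_gt0; apply: contraTneq nv => ->; rewrite dot0r ltxx.
  have [d d0 hd] := h (- (c * dot n v) / (2 * `|v|)) (divr_gt0 cv (mulr_gt0 (ltr0n _ 2) v0)).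
  exists (d / `|v|); first exact: divr_gt0.
  move=> t /andP[t0]; rewrite ltr_pdivlMr // => tv.
  have := hd (p + t *: v) p; rewrite subrr normr0 [p + _]addrC addrK normrZ gtr0_norm // => /(_ tv d0).
  rewrite dotZr -derive_grad // hc ler_norml => /andP[_].
  have -> : - (c * dot n v) / (2 * `|v|) * (t * `|v|) = t * - (c * dot n v) / 2 by field; rewrite gt_eqF.
  have : 0 < t * - (c * dot n v) by rewrite mulr_gt0.
  lra.
have pp : phi p <= 0.
  rewrite leNgt; apply/negP => phip.
  have [_ _ h] := C1_sdiff p (sphi 1%N).
  have [d1 d10 hd1] := sdiff_cont (C1_sdiff p (sphi 1%N)) phip.
  have m0 : 0 < Num.min e1 d1 by rewrite lt_min e10.
  have [y Oy yp] := (closureE _ _).1 cp _ m0.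
  move: yp; rewrite lt_min => /andP[y1 y2].
  have := hd1 y (le_lt_trans (norm_le_enorm _) y2); rewrite ltr_norml.
  by have := (he1 y y1).1 Oy; lra.
have w0 : 0 < enorm v + 1 by rewrite ltr_wpDl ?enorm_ge0.
exists (Num.min d (e1 / (enorm v + 1))); first by rewrite lt_min d0 divr_gt0.
move=> t /andP[t0]; rewrite lt_min ltr_pdivlMr // => /andP[td te].
apply/(he1 (p + t *: v)); last by have := hd t; rewrite t0 td => /(_ isT); lra.
rewrite [p + _]addrC addrK enormZ gtr0_norm //; apply: le_lt_trans te.
by rewrite ler_pM2l // lerDl.
Qed.

Lemma outward_out p n v : is_outward_unit_normal Om p n -> Gam p -> 0 < dot n v ->
  exists2 e, 0 < e & forall t, 0 < t < e -> ~ Om (p + t *: v).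
Proof.
move=> [n1 [phi [c [[sphi _ hphi] c0 hc]]]] /(GamP oO)[cp np] nv.
have /enorm_ballP[e1 e10 he1] := hphi.
have df := (sphi 1%N).1 p.
have [d d0 hd] : exists2 d, 0 < d & forall t, 0 < t < d -> 0 < phi (p + t *: v) - phi p.
  have [_ _ h] := C1_sdiff p (sphi 1%N).
  have cv : 0 < c * dot n v by rewrite mulr_gt0.
  have v0 : 0 < `|v| by rewrite normr_gt0; apply: contraTneq nv => ->; rewrite dot0r ltxx.
  have [d d0 hd] := h ((c * dot n v) / (2 * `|v|)) (divr_gt0 cv (mulr_gt0 (ltr0n _ 2) v0)).
  exists (d / `|v|); first exact: divr_gt0.
  move=> t /andP[t0]; rewrite ltr_pdivlMr // => tv.
  have := hd (p + t *: v) p; rewrite subrr normr0 [p + _]addrC addrK normrZ gtr0_norm // => /(_ tv d0).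
  rewrite dotZr -derive_grad // hc ler_norml => /andP[+ _].
  have -> : (c * dot n v) / (2 * `|v|) * (t * `|v|) = t * (c * dot n v) / 2 by field; rewrite gt_eqF.
  have : 0 < t * (c * dot n v) by rewrite mulr_gt0.
  lra.
have pp : 0 <= phi p.
  rewrite leNgt; apply/negP => phip; apply: np; apply/(he1 p) => //; by rewrite subrr enorm0.
have w0 : 0 < enorm v + 1 by rewrite ltr_wpDl ?enorm_ge0.
exists (Num.min d (e1 / (enorm v + 1))); first by rewrite lt_min d0 divr_gt0.
move=> t /andP[t0]; rewrite lt_min ltr_pdivlMr // => /andP[td te] Ot.
have : phi (p + t *: v) < 0.
  apply/(he1 (p + t *: v)) => //; rewrite [p + _]addrC addrK enormZ gtr0_norm //; apply: le_lt_trans te.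
  by rewrite ler_pM2l // lerDl.
by have := hd t; rewrite t0 td => /(_ isT); lra.
Qed.

(* Both half-space conditions along [n' - n] are incompatible. *)
Lemma outward_unique p n n' : Gam p -> is_outward_unit_normal Om p n ->
  is_outward_unit_normal Om p n' -> n = n'.
Proof.
move=> Gp hn hn'; have n1 := hn.1; have n1' := hn'.1.
apply/eqP; rewrite -subr_eq0 -enorm_eq0 -sqrf_eq0 enorm2; apply/eqP.
have e1 : dot n n = 1 by rewrite -enorm2 n1 expr1n.
have e2 : dot n' n' = 1 by rewrite -enorm2 n1' expr1n.
rewrite !dotE e1 e2 (dotC n' n).
have := dot_le n n'; rewrite n1 n1' mulr1 le_eqVlt => /orP[/eqP->|lt1]; first by lra.
have [|e e0 h] := @outward_in p n (n' - n) hn Gp; first by rewrite !dotE e1; lra.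
have [|d d0 h'] := @outward_out p n' (n' - n) hn' Gp; first by rewrite !dotE e2 (dotC n'); lra.
pose t := Num.min e d / 2; have m0 : 0 < Num.min e d by rewrite lt_min e0.
have [m1 m2] : Num.min e d <= e /\ Num.min e d <= d by rewrite !ge_min !lexx orbT.
have t0 : 0 < t by rewrite divr_gt0.
by exfalso; apply: (h' t); last apply: (h t); rewrite t0 /t /=; lra.
Qed.

(** Quantitative smoothness at [p]: tangent balls of radius [r] on both sides (positive reach) and,
    near [p], a normal field whose differential obeys the curvature bound [1 / r]. *)
Definition good_at (r : R) p := exists N : pt R -> pt R, [/\ is_outward_unit_normal Om p (N p),
  forall z, enorm (z - (p - r *: N p)) < r -> Om z, forall z, enorm (z - (p + r *: N p)) < r -> ~ Om z &
  exists2 d, 0 < d & forall y, enorm (y - p) < d -> (Gam y -> is_outward_unit_normal Om y (N y)) /\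
    exists2 L, sdiff N y L & forall v, enorm (L v) <= r^-1 * enorm v].

(** [N] is the normalised gradient of a defining function. In a small ball tangent at [p] the linear
    term of that function dominates its quadratic Taylor remainder, so its sign is known throughout
    the ball. *)
Lemma loc_good p0 : Gam p0 -> exists r0 d, [/\ 0 < r0, 0 < d & forall p, Gam p -> enorm (p - p0) < d ->
  forall r, 0 < r -> r <= r0 -> good_at r p].
Proof.
move=> Gp0; have [phi [sphi [v0 hv0] /enorm_ballP[d1 d10 h1]]] := sO Gp0.
have df y : differentiable phi y := (sphi 1%N).1 y.
pose G := grad phi; pose g0 := enorm (G p0) / 2.
have Gp00 : G p0 != 0 by apply: contra_neq hv0 => e; rewrite derive_grad // -/G e dot0l.
have g00 : 0 < g0 by rewrite divr_gt0 // enorm_gt0.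
have [K [d2 [K0 d20 h2]]] := taylor2 p0 (sphi 2%N).
have [d3 d30 h3] := grad_cont p0 (sphi 1%N) g00.
have hG y : enorm (y - p0) < d3 -> g0 <= enorm (G y).
  move=> /h3; have := ler_enormD (G p0 - G y) (G y); rewrite subrK (enormB (G p0)) -/G /g0; lra.
pose N y := (enorm (G y))^-1 *: G y.
have sG y : sd G y.
  apply: sd_row => i; exists (dot (grad ('D_(delta_mx 0 i) phi) y)).
  under eq_fun do rewrite mxE; apply: C1_sdiff; exact: (sphi 2%N).2.
have sN y : enorm (y - p0) < d3 -> sd N y.
  move=> /hG hy; have Gy : 0 < enorm (G y) by exact: lt_le_trans hy.
  apply: sdZ => //; apply: sd_inv => //; apply: sd_enorm => //; by rewrite -enorm_gt0.
have [L0 sL0] : sd N p0 by apply: sN; rewrite subrr enorm0.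
have [C [d4 [C0 d40 h4]]] := sdiff_lip sL0.
have N1 y : enorm (y - p0) < d3 -> enorm (N y) = 1.
  move=> /hG hy; have Gy : 0 < enorm (G y) by exact: lt_le_trans hy.
  by rewrite enormZ ger0_norm ?invr_ge0 ?enorm_ge0 // mulVf // gt_eqF.
have dGN y u : enorm (y - p0) < d3 -> dot (G y) u = enorm (G y) * dot (N y) u.
  move=> /hG hy; have Gy : 0 < enorm (G y) by exact: lt_le_trans hy.
  by rewrite /N dotZl mulrA mulfV ?mul1r // gt_eqF.
clearbody N.
pose d := Num.min (Num.min d1 d2) (Num.min d3 d4).
have d0 : 0 < d by rewrite !lt_min d10 d20 d30.
have dd y : enorm (y - p0) < d -> [/\ enorm (y - p0) < d1, enorm (y - p0) < d2, enorm (y - p0) < d3 & enorm (y - p0) < d4].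
  by rewrite !lt_min => /andP[/andP[-> ->] /andP[-> ->]].
have outw y : enorm (y - p0) < d -> Gam y -> is_outward_unit_normal Om y (N y).
  move=> yd Gy; have [y1 y2 y3 y4] := dd y yd; split; first exact: N1.
  have Gy0 : 0 < enorm (G y) by apply: lt_le_trans (hG y y3).
  exists phi, (enorm (G y)); split => //.
    split => //.
      exists (G y); rewrite derive_grad // -/G dot_eq0 -enorm_eq0 gt_eqF //.
    apply/enorm_ballP; exists (d1 - enorm (y - p0)); first by rewrite subr_gt0.
    by move=> z hz; apply: h1; have := enorm_triangle y z p0; lra.
  by move=> v; rewrite derive_grad // dGN.
have phi0 p : enorm (p - p0) < d -> Gam p -> phi p = 0.
  move=> pd Gp; have [y1 _ _ _] := dd p pd; have [cp np] := (GamP oO _).1 Gp.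
  apply/eqP; rewrite eq_le; apply/andP; split; last first.
    by rewrite leNgt; apply/negP => h; apply: np; apply/h1.
  rewrite leNgt; apply/negP => phip.
  have [e1 e10 he1] := sdiff_cont (C1_sdiff p (sphi 1%N)) phip.
  have m0 : 0 < Num.min e1 (d1 - enorm (p - p0)) by rewrite lt_min e10 subr_gt0.
  have [y Oy] := (closureE _ _).1 cp _ m0; rewrite lt_min => /andP[ye1 yd1].
  have := he1 y (le_lt_trans (norm_le_enorm _) ye1); rewrite ltr_norml => /andP[h _].
  have : phi y < 0 by apply/h1 => //; have := enorm_triangle p y p0; lra.
  lra.
(* [d / 8] keeps the tangent balls where the expansions hold, [g0 / (2 * K)] lets the linear term
   beat the remainder, and the last bound controls the differential of [N], whose factor 2 comes
   from the change of norm. *)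
pose r0 := Num.min (d / 8) (Num.min (g0 / (2 * K)) (2 * C)^-1).
have r00 : 0 < r0 by rewrite !lt_min; apply/and3P; split; [exact: divr_gt0 | exact: divr_gt0 g00 (mulr_gt0 _ _) | rewrite invr_gt0 mulr_gt0].
exists r0, (d / 4); split => //; first exact: divr_gt0.
move=> p Gp pd r rp; rewrite !le_min => /and3P[r1 r2 r3].
have pd' : enorm (p - p0) < d by lra.
have [p1 p2 p3 p4] := dd p pd'.
have Np := N1 p p3; have Gg := hG p p3; have Gp0' : 0 < enorm (G p) by apply: lt_le_trans Gg.
have dNN : dot (N p) (N p) = 1 by rewrite -enorm2 Np expr1n.
(* [s = r] is the inner ball and [s = - r] the outer one; the last conclusion is the expanded ball
   inequality. *)
have ball_aux z s : enorm (s *: N p + (z - p)) < r -> s ^+ 2 = r ^+ 2 -> `|s| = r ->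
   [/\ enorm (z - p0) < d, `|phi z - dot (G p) (z - p)| <= K * enorm (z - p) ^+ 2 &
     2 * s * dot (N p) (z - p) < - enorm (z - p) ^+ 2].
  move=> hz s2 sr; set u := z - p in hz *; have eu : u = z - p by []; clearbody u.
  have ur : enorm u < 2 * r.
    have := ler_enormD (s *: N p + u) (- (s *: N p)); rewrite [s *: N p + u]addrC addrK addrC enormN enormZ Np sr.
    by lra.
  have zd : enorm (z - p0) < d by have := enorm_triangle p z p0; rewrite -eu; lra.
  have [z1 z2 z3 z4] := dd z zd.
  split => //; first by have := h2 z p z2 p2; rewrite (phi0 p) // subr0 -eu.
  have : enorm (s *: N p + u) ^+ 2 < r ^+ 2 by rewrite ltr_pXn2r ?nnegrE ?enorm_ge0 // ltW.
  rewrite !enorm2 !dotE dNN mulr1 -s2 (dotC u); lra.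
have Kr : K * (2 * r) <= enorm (G p).
  by apply: le_trans Gg; move: r2; rewrite ler_pdivlMr ?mulr_gt0 //; lra.
have dG u := dGN p u p3.
exists N; split; first exact: outw.
- move=> z hz; have [|||zd tz nz] := ball_aux z r => //; last first.
  + apply/h1; first by case: (dd z zd).
    have [u0|u0] := eqVneq (enorm (z - p)) 0.
      move: nz; have /eqP : enorm (z - p) == 0 by rewrite u0.
      move=> /eqP; rewrite enorm_eq0 => /eqP->; rewrite dot0r enorm0 expr0n /= mulr0 oppr0 ltxx //.
    have u2 : 0 < enorm (z - p) ^+ 2 by rewrite exprn_gt0 // lt_neqAle eq_sym u0 enorm_ge0.
    move: tz; rewrite ler_norml dG => /andP[_ tz].
    have : r * (enorm (G p) * dot (N p) (z - p) + K * enorm (z - p) ^+ 2) < 0.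
      nra.
    by rewrite pmulr_rlt0 //; lra.
  + by rewrite gtr0_norm.
  + by move: hz; rewrite opprB addrCA.
- move=> z hz Oz; have [|||zd tz nz] := ball_aux z (- r); last first.
  + have := (h1 z (let: And4 h _ _ _ := dd z zd in h)).1 Oz => phz.
    have u2 : 0 <= enorm (z - p) ^+ 2 by rewrite sqr_ge0.
    move: tz; rewrite ler_norml dG => /andP[tz _].
    have : 0 <= r * (enorm (G p) * dot (N p) (z - p) - K * enorm (z - p) ^+ 2).
      nra.
    by rewrite pmulr_rge0 //; lra.
  + by rewrite normrN gtr0_norm.
  + by rewrite sqrrN.
  + by rewrite (_ : - r *: N p + (z - p) = z - (p + r *: N p)) //; apply/rowP => i; rewrite !mxE; ring.
- exists (d / 4); first exact: divr_gt0.
  move=> y yp; have yd : enorm (y - p0) < d by have := enorm_triangle p y p0; lra.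
  have [y1 y2 y3 y4] := dd y yd; split; first exact: outw.
  have [L sL] := sN y y3; exists L => // v.
  have lL : forall v, `|L v| <= C * `|v|.
    apply: (@sdiff_bound _ _ _ N y L C (d4 - enorm (y - p0))) sL; first by rewrite subr_gt0.
    have toN z : `|z - y| < (d4 - enorm (y - p0)) -> `|z - p0| < d4.
      move=> hz; have := ler_normD (z - y) (y - p0); rewrite subrKA.
      by have := norm_le_enorm (y - p0); lra.
    by move=> a b /toN ha /toN hb; exact: h4.
  apply: (le_trans (enorm_le_norm _)); apply: (@le_trans _ _ (2 * (C * enorm v))).
    by rewrite ler_pM2l // (le_trans (lL v)) // ler_pM2l // norm_le_enorm.
  rewrite mulrA ler_wpM2r ?enorm_ge0 // -[2 * C]invrK lef_pV2 // posrE ?invr_gt0 ?mulr_gt0 //.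
Qed.

End Normals.

(** Concavity of the square root: [sqrt (A^2 + u) <= A + u / (2 A)] with
    [u = 2 A dot n w + |w|^2]. *)
Lemma enorm_shift (R : realType) (n w : pt R) A : enorm n = 1 -> 0 < A ->
  enorm (w + A *: n) <= A + dot n w + enorm w ^+ 2 / (2 * A).
Proof.
move=> n1 A0; have := dot_abs n w; rewrite n1 mul1r ler_norml => /andP[b1 b2].
set q := enorm w ^+ 2 / (2 * A).
have qE : 2 * A * q = enorm w ^+ 2 by rewrite /q; field; rewrite gt_eqF.
have q0 : 0 <= q by rewrite divr_ge0 ?sqr_ge0 // mulr_ge0 // ltW.
have s0 : 0 <= A + dot n w + q.
  have : 0 <= 2 * A * (A + dot n w + q).
    rewrite (_ : 2 * A * _ = 2 * A * (A + dot n w) + enorm w ^+ 2); last by rewrite -qE; ring.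
    have := sqr_ge0 (enorm w - A); have := sqr_ge0 A.
    have : 0 <= A * (dot n w + enorm w) by rewrite mulr_ge0 //; lra.
    lra.
  by rewrite pmulr_rge0 // mulr_gt0.
rewrite -(@ler_pXn2r _ 2) ?nnegrE ?enorm_ge0 // enorm2 !dotE -!enorm2 n1 expr1n -qE (dotC w n).
have := sqr_ge0 (dot n w + q); lra.
Qed.

Section Tube.
Context {R : realType} (Om : set (pt R)).
Hypotheses (oO : open Om) (bO : bounded_set Om) (sO : smooth_boundary Om).
Implicit Types (x y z p a b u v : pt R).
Notation Gam := (frontier Om).
Notation od := (oriented_distance Om).
Notation nu := (normal Om).
Notation A := (normal_projection Om).

(** Compactness of the boundary in near-covering form, for the filter of radii tending to [0] from
    the right. *)
Lemma tube_ex : exists2 r, 0 < r & forall p, Gam p -> good_at Om r p.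
Proof.
have cG := (compact_near_coveringP Gam).1 (Gam_compact bO).
have := cG R ((0:R)^'+) (fun r p => Gam p -> good_at Om r p) _.
case=> [p Gp|e /= e0 he].
  have [r0 [d [r00 d0 h]]] := loc_good oO sO Gp.
  near=> x r; have r1 : 0 < r by near: r; exact: nbhs_right_gt.
  have r2 : r <= r0 by near: r; exact: nbhs_right_le.
  have xd : enorm (x - p) < d by near: x; apply/enorm_ballP; exists d.
  by move=> Gx; exact: h.
have h2 : 0 < e / 2 by rewrite divr_gt0.
exists (e / 2) => // p Gp; apply: he => //=; rewrite sub0r normrN gtr0_norm //; lra.
Unshelve. all: by end_near. Qed.

Variable R0 : R.
Hypotheses (R00 : 0 < R0) (hgood : forall p, Gam p -> good_at Om R0 p) (G0 : Gam !=set0).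

Lemma nu_spec p : Gam p -> is_outward_unit_normal Om p (nu p).
Proof. by move=> Gp; apply: xgetPex; have [N [hN _ _ _]] := hgood Gp; exists (N p). Qed.

Lemma nu_unique p n : Gam p -> is_outward_unit_normal Om p n -> nu p = n.
Proof. by move=> Gp; apply: outward_unique => //; exact: nu_spec. Qed.

Lemma nu1 p : Gam p -> enorm (nu p) = 1.
Proof. by case/nu_spec. Qed.

Lemma inner_ball p z : Gam p -> enorm (z - (p - R0 *: nu p)) < R0 -> Om z.
Proof. by move=> Gp; have [N [hN h _ _]] := hgood Gp; rewrite (nu_unique Gp hN); exact: h. Qed.

Lemma outer_ball p z : Gam p -> enorm (z - (p + R0 *: nu p)) < R0 -> ~ Om z.
Proof. by move=> Gp; have [N [hN _ h _]] := hgood Gp; rewrite (nu_unique Gp hN); exact: h. Qed.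

(** Equality case of the Cauchy-Schwarz inequality. *)
Lemma opp_unit u n : enorm n = 1 -> dot u n <= - enorm u -> u = - enorm u *: n.
Proof.
move=> n1 h; apply/eqP; rewrite -subr_eq0 -enorm_eq0 -sqrf_eq0 eq_le sqr_ge0 andbT.
rewrite scaleNr opprK enorm2 !dotE -!enorm2 n1 expr1n (dotC n u).
have := enorm_ge0 u; nra.
Qed.

(** Two disjoint balls whose spheres share [a] have [a] on the segment between their centres.
    Otherwise the centres are closer than [s + r], and the point dividing that segment in the ratio
    [s : r] lies in both. *)
Lemma disjoint_balls x a n s r : 0 < s -> 0 < r -> enorm n = 1 -> enorm (x - a) = s ->
  (forall z, enorm (z - x) < s -> enorm (z - (a + r *: n)) < r -> False) -> x - a = - s *: n.
Proof.
move=> s0 r0 n1 xa h; rewrite -xa; apply: opp_unit => //; rewrite xa.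
rewrite leNgt; apply/negP => hd.
pose c := a + r *: n; pose z := segpt x c (s / (s + r)).
have sr : 0 < s + r by rewrite addr_gt0.
have xc : enorm (x - c) < s + r.
  have -> : x - c = (x - a) - r *: n by rewrite /c opprD addrA.
  move: xa hd; move: (x - a) => w xa hd.
  rewrite -(@ltr_pXn2r _ 2) ?nnegrE ?enorm_ge0 // ?ltW // enorm2 !dotE -!enorm2 n1 expr1n xa.
  rewrite (dotC n); nra.
have t0 : 0 <= s / (s + r) by rewrite divr_ge0 // ltW.
have t1 : s / (s + r) <= 1 by rewrite ler_pdivrMr // mul1r lerDl ltW.
apply: (h z); rewrite /z ?segpt_distl // ?segpt_distr //.
  by rewrite mulrAC ltr_pdivrMr // ltr_pM2l.
rewrite (_ : 1 - _ = r / (s + r)); last by field; rewrite gt_eqF.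
by rewrite mulrAC ltr_pdivrMr // ltr_pM2l.
Qed.

(** The ball about [x] through its nearest point [a] contains no boundary point, so it is disjoint
    from the tangent ball at [a] on the other side; [disjoint_balls] puts [x] on the normal. *)
Lemma nearest_foot x a : nearest Om x a -> normal_foot Om x a.
Proof.
move=> na; have Ga := na.1; split=> //; have rE := rdistE na.
have [s0|/negPf s0] := eqVneq (enorm (x - a)) 0.
  have -> : od x = 0 by apply/normr0_eq0; rewrite od_abs // rE.
  by rewrite scale0r addr0; apply/eqP; rewrite -subr_eq0 -enorm_eq0 s0.
have {}s0 : 0 < enorm (x - a) by rewrite lt_neqAle eq_sym s0 enorm_ge0.
have hb z t : 0 <= t <= 1 -> enorm (z - x) < enorm (x - a) -> Gam (segpt z x t) -> False.
  move=> /andP[t0 t1] zx Gt; have := rdist_segr t1 Gt; rewrite rE => h.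
  have : (1 - t) * enorm (z - x) <= enorm (z - x) by rewrite ler_piMl ?enorm_ge0 //; lra.
  lra.
have hb' z t : 0 <= t <= 1 -> enorm (z - x) < enorm (x - a) -> Gam (segpt x z t) -> False.
  move=> /andP[t0 t1] zx Gt; have := rdist_segl t0 Gt; rewrite rE (enormB x z) => h.
  have : t * enorm (z - x) <= enorm (z - x) by rewrite ler_piMl ?enorm_ge0.
  lra.
have [Ox|Ox] := pselect (Om x).
  rewrite od_in // rE -(@disjoint_balls x a (nu a) (enorm (x - a)) R0) ?nu1 //; first by rewrite addrC subrK.
  move=> z zx zc; have nz := outer_ball Ga zc.
  by have [t [t01 Gt]] := cross oO nz Ox; exact: (hb z t).
rewrite od_out // rE -[enorm _ in RHS]opprK scaleNr -scalerN.
rewrite -(@disjoint_balls x a (- nu a) (enorm (x - a)) R0) ?enormN ?nu1 //; first by rewrite addrC subrK.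
move=> z zx; rewrite scalerN => zc; have Oz := inner_ball Ga zc.
by have [t [t01 Gt]] := cross oO Ox Oz; exact: (hb' z t).
Qed.

Lemma foot_nearest x a : normal_foot Om x a -> nearest Om x a.
Proof.
move=> [Ga xE]; split=> // b Gb; apply: le_trans (rdist_le x Gb).
by rewrite -od_abs // {1}xE addrC addKr enormZ nu1 // mulr1.
Qed.

Lemma A_foot x : normal_foot Om x (A x).
Proof. by apply: xgetPex; have [a na] := nearest_ex bO x G0; exists a; exact: nearest_foot. Qed.

Lemma A_Gam x : Gam (A x).
Proof. by case: (A_foot x). Qed.
Lemma A_eq x : x = A x + od x *: nu (A x).
Proof. by case: (A_foot x). Qed.
(** [od] is squeezed between the oriented distances to the two tangent balls at [a]. Their centres
    are at distance [R0 + od x] and [R0 - od x] from [x], both at least [R0 / 2], so [enorm_shift]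
    leaves the error [|y - x|^2 / R0]. Thus [nu a] acts as the gradient of [od] at [x]. *)
Lemma odQ x a y : normal_foot Om x a -> `|od x| <= R0 / 2 ->
  `|od y - od x - dot (nu a) (y - x)| <= enorm (y - x) ^+ 2 / R0.
Proof.
move=> [Ga xE]; set t := od x in xE *; rewrite ler_norml => /andP[t1 t2].
have n1 := nu1 Ga; set w := y - x.
have aux (s : R) : R0 / 2 <= s -> enorm w ^+ 2 / (2 * s) <= enorm w ^+ 2 / R0.
  by move=> hs; have r0 := R00; rewrite ler_wpM2l ?sqr_ge0 // lef_pV2 // ?posrE; lra.
have h1 : od y <= enorm (y - (a - R0 *: nu a)) - R0.
  by apply: od_inner => // z; exact: inner_ball.
have h2 : R0 - enorm (y - (a + R0 *: nu a)) <= od y.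
  by apply: od_outer => // z; exact: outer_ball.
have e1 : y - (a - R0 *: nu a) = w + (R0 + t) *: nu a.
  by rewrite /w xE; apply/rowP => i; rewrite !mxE; ring.
have e2 : y - (a + R0 *: nu a) = w + (R0 - t) *: (- nu a).
  by rewrite /w xE; apply/rowP => i; rewrite !mxE; ring.
have r0 := R00; have [A1 A2] : 0 < R0 + t /\ 0 < R0 - t by lra.
have := enorm_shift w n1 A1; have := @enorm_shift _ (- nu a) w (R0 - t) (etrans (enormN _) n1) A2.
have := aux (R0 + t); have := aux (R0 - t); rewrite -e1 -e2 dotNl.
move=> /(_ ltac:(lra)) k1 /(_ ltac:(lra)) k2 k3 k4.
by rewrite ler_norml; apply/andP; split; lra.
Qed.

Notation g x := (nu (A x)).

Lemma odA x y : `|od x| <= R0 / 2 -> `|od y - od x - dot (g x) (y - x)| <= enorm (y - x) ^+ 2 / R0.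
Proof. by apply: odQ; exact: A_foot. Qed.

(** The normals at both feet are gradients of [od] at [x] in the sense of [odQ]. Testing with
    [v = (R0 / 4) e], where [e] is their difference, gives [R0 / 4 |e|^2 <= R0 / 8 |e|^2]. *)
Lemma foot_uniq x a b : normal_foot Om x a -> normal_foot Om x b -> `|od x| <= R0 / 2 -> a = b.
Proof.
move=> fa fb hx; have e0 : nu a = nu b.
  apply/eqP; rewrite -subr_eq0 -enorm_eq0 -sqrf_eq0 eq_le sqr_ge0 andbT.
  have [e ee] : exists e, e = nu a - nu b by exists (nu a - nu b).
  have [v ev] : exists v, v = (R0 / 4) *: e by exists ((R0 / 4) *: e).
  rewrite -ee.
  have := odQ (x + v) fa hx; have := odQ (x + v) fb hx.
  have -> : x + v - x = v by rewrite addrC addKr.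
  rewrite !ler_norml => /andP[_ h2] /andP[h3 _].
  have : dot e v <= 2 * enorm v ^+ 2 / R0.
    move: h2 h3; rewrite ee dotDl dotNl; clear; move: (dot _ _) (dot _ _) (od _) (od _) (enorm v ^+ 2) => p q r s z; lra.
  have -> : dot e v = R0 / 4 * enorm e ^+ 2 by rewrite ev dotZr enorm2.
  have -> : 2 * enorm v ^+ 2 / R0 = R0 / 8 * enorm e ^+ 2.
    rewrite ev enormZ exprMn real_normK ?num_real //; field; by rewrite gt_eqF.
  have := R00; have := sqr_ge0 (enorm e); move: (enorm e ^+ 2) => z; nra.
case: fa fb => _ ea [_ eb]; apply: (addIr (od x *: nu b)).
exact: etrans (esym (etrans ea (congr1 (fun n => a + od x *: n) e0))) eb.
Qed.

(** A function with quadratic upper and lower bounds has a Lipschitz gradient: [od (x + v)] is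
    expanded from [x] and from [y], with [v] along [e] of length [|x - y|]. The three errors are 1,
    4 and 1 times [|x - y|^2 / R0]. *)
Lemma foot_lip x y a b : normal_foot Om x a -> normal_foot Om y b -> `|od x| <= R0 / 2 -> `|od y| <= R0 / 2 ->
  enorm (nu a - nu b) <= 6 / R0 * enorm (x - y).
Proof.
move=> fa fb hx hy; set e := nu a - nu b.
have [->|e0] := eqVneq e 0; first by rewrite enorm0 mulr_ge0 ?enorm_ge0 // divr_ge0 // ltW.
have ne : 0 < enorm e by rewrite enorm_gt0.
pose v := (enorm (x - y) / enorm e) *: e.
have nv : enorm v = enorm (x - y).
  by rewrite /v enormZ ger0_norm ?divr_ge0 ?enorm_ge0 // -mulrA mulVf ?mulr1 // gt_eqF.
have dv : dot e v = enorm (x - y) * enorm e.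
  by rewrite /v dotZr -enorm2; field; rewrite gt_eqF.
have := odQ (x + v) fa hx; have := odQ (x + v) fb hy; have := odQ x fb hy.
rewrite [x + v]addrC addrK nv; have e1 : v + x - y = v + (x - y) by rewrite addrA.
rewrite e1 !dotDr => h1 h2 h3.
have b4 : enorm (v + (x - y)) ^+ 2 <= 4 * enorm (x - y) ^+ 2.
  have := ler_enormD v (x - y); rewrite nv; have := enorm_ge0 (v + (x - y)); have := enorm_ge0 (x - y); nra.
have {}h2 : `|od (v + x) - od y - (dot (nu b) v + (dot (nu b) x + dot (nu b) (- y)))| <= 4 * enorm (x - y) ^+ 2 / R0.
  by apply: le_trans h2 _; rewrite ler_wpM2r // invr_ge0 ltW.
have key : dot e v <= 6 * enorm (x - y) ^+ 2 / R0.
  rewrite /e dotDl dotNl; move: h1 h2 h3; rewrite !ler_norml => /andP[h1 h1'] /andP[h2 h2'] /andP[h3 h3'].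
  have -> : 6 * enorm (x - y) ^+ 2 / R0 = enorm (x - y) ^+ 2 / R0 + 4 * enorm (x - y) ^+ 2 / R0 + enorm (x - y) ^+ 2 / R0 by ring.
  move: h1 h1' h2 h2' h3 h3'; move: (_ / R0) (_ / R0) => s1 s2; repeat (move: (dot _ _) => ?); repeat (move: (od _) => ?); lra.
have [xy|xy] := eqVneq (enorm (x - y)) 0.
  exfalso; move: e0 => /eqP; apply.
  have /eqP : enorm (x - y) == 0 by rewrite xy.
  move/eqP; rewrite enorm_eq0 subr_eq0 => /eqP exy; subst y.
  by rewrite /e (foot_uniq fa fb hx) subrr.
have xy0 : 0 < enorm (x - y) by rewrite lt_neqAle eq_sym xy enorm_ge0.
rewrite -(ler_pM2l xy0) -dv; apply: le_trans key _.
by rewrite le_eqVlt; apply/orP; left; apply/eqP; ring.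
Qed.

End Tube.

Record tube (R : realType) (Om : set (pt R)) (R0 : R) : Prop := Tube {
  tb_open : open Om;
  tb_bounded : bounded_set Om;
  tb_nonempty : frontier Om !=set0;
  tb_pos : 0 < R0;
  tb_good : forall p, frontier Om p -> good_at Om R0 p }.

Lemma sum5 (R : realType) (a b c d f N : R) : a <= 5 / 40 * N -> b <= 1 / 2 * N -> c <= 2 / 40 * N ->
  d <= 6 / 40 * N -> f <= 6 / 40 * N -> 0 <= N -> a + b + c + d + f <= N.
Proof. lra. Qed.

(** Exact remainder of the linearised equation [x = a + s n]: here [l] stands for the differential
    of the normal field applied to [a - b], and [n0], [s0] are the values at the base point. Each of
    the five terms is small near that point. *)
Lemma sd_alg (R : realType) (a b n m n0 l x y : pt R) (s t s0 : R) : x = a + s *: n -> y = b + t *: m ->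
  a - b + s0 *: l - (x - y - dot n0 (x - y) *: n0) =
  (s0 - t) *: l - t *: (n - m - l) - (s - t - dot m (x - y)) *: n
  + dot n0 (x - y) *: (n0 - n) + dot (n0 - m) (x - y) *: n.
Proof.
move=> ex ey; rewrite dotDl dotNl; move: (dot n0 _) (dot m _) => p q.
by rewrite ex ey; apply/rowP => i; rewrite !mxE; ring.
Qed.

Section TubeFacts.
Context {R : realType} (Om : set (pt R)) (R0 : R) (T : tube Om R0).
Implicit Types (x y z p a b u v : pt R).
Notation Gam := (frontier Om).
Notation od := (oriented_distance Om).
Notation nu := (normal Om).
Notation A := (normal_projection Om).
Let oO := tb_open T.
Let bO := tb_bounded T.
Let G0 := tb_nonempty T.
Let R00 := tb_pos T.
Let hg := tb_good T.

Lemma tGam x : Gam (A x).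
Proof. exact: (A_Gam oO bO R00 hg G0). Qed.
Lemma tA x : x = A x + od x *: nu (A x).
Proof. exact: (A_eq oO bO R00 hg G0). Qed.
Lemma tnu1 x : enorm (nu (A x)) = 1.
Proof. by apply: (nu1 hg); exact: tGam. Qed.
Lemma tod_lip x y : `|od x - od y| <= enorm (x - y).
Proof. exact: (od_lip oO bO G0). Qed.
Lemma tod0 p : Gam p -> od p = 0.
Proof. exact: (Gam_od bO G0). Qed.
Lemma trdist x : rdist Om x = `|od x|.
Proof. by rewrite (od_abs bO G0). Qed.
Lemma todQ x y : `|od x| <= R0 / 2 ->
  `|od y - od x - dot (nu (A x)) (y - x)| <= enorm (y - x) ^+ 2 / R0.
Proof. exact: (odA oO bO R00 hg G0). Qed.
Lemma tA_eq x a : normal_foot Om x a -> `|od x| <= R0 / 2 -> A x = a.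
Proof. by move=> fa hx; apply: (foot_uniq oO bO R00 hg G0 _ fa hx); exact: (A_foot oO bO R00 hg G0). Qed.

Lemma tA_Gam p : Gam p -> A p = p.
Proof.
move=> Gp; apply: tA_eq; last by rewrite tod0 // normr0 divr_ge0 // ltW.
by split=> //; rewrite tod0 // scale0r addr0.
Qed.

Lemma tg_lip x y : `|od x| <= R0 / 2 -> `|od y| <= R0 / 2 ->
  enorm (nu (A x) - nu (A y)) <= 6 / R0 * enorm (x - y).
Proof. by apply: (foot_lip oO bO R00 hg G0); exact: (A_foot oO bO R00 hg G0). Qed.

Lemma tA_lip x y : `|od x| <= R0 / 2 -> `|od y| <= R0 / 2 -> enorm (A x - A y) <= 5 * enorm (x - y).
Proof.
move=> hx hy; have -> : A x - A y = (x - y) - ((od x - od y) *: nu (A x) + od y *: (nu (A x) - nu (A y))).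
  have := tA x; have := tA y; move: (A x) (A y) (od x) (od y) => a b s t ey ex.
  move: (nu a) (nu b) ex ey => n m -> ->.
  by apply/rowP => i; rewrite !mxE; ring.
apply: (le_trans (ler_enormB _ _)); apply: (le_trans (lerD (lexx _) (ler_enormD _ _))).
rewrite !enormZ tnu1 mulr1; have h1 := tod_lip x y.
have h2 : `|od y| * enorm (nu (A x) - nu (A y)) <= R0 / 2 * (6 / R0 * enorm (x - y)).
  by apply: ler_pM => //; [exact: enorm_ge0 | exact: tg_lip].
have e : R0 / 2 * (6 / R0 * enorm (x - y)) = 3 * enorm (x - y) by field; rewrite gt_eqF.
rewrite e in h2; lra.
Qed.

(** The two tangent balls at [p] give the two inequalities for [od]; the projection then follows
    from uniqueness of the foot. *)
Lemma tfiber p t : Gam p -> `|t| <= R0 / 2 -> od (p + t *: nu p) = t /\ A (p + t *: nu p) = p.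
Proof.
move=> Gp ht; have r0 := R00; move: (ht); rewrite ler_norml => /andP[t1 t2].
have n1 : enorm (nu p) = 1 by exact: (nu1 hg).
have odt : od (p + t *: nu p) = t.
  have h1 := od_inner oO bO G0 (p + t *: nu p) (fun z => inner_ball oO hg (z:=z) Gp) R00.
  have h2 := od_outer oO bO G0 (p + t *: nu p) (fun z => outer_ball oO hg (z:=z) Gp) R00.
  have e1 : p + t *: nu p - (p - R0 *: nu p) = (R0 + t) *: nu p by apply/rowP => i; rewrite !mxE; ring.
  have e2 : p + t *: nu p - (p + R0 *: nu p) = (t - R0) *: nu p by apply/rowP => i; rewrite !mxE; ring.
  move: h1 h2; rewrite e1 e2 !enormZ n1 !mulr1 ger0_norm; last lra.
  by rewrite ler0_norm; last lra; move=> h1 h2; apply/eqP; rewrite eq_le; apply/andP; split; lra.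
by split => //; apply: tA_eq; rewrite ?odt //; split; rewrite ?odt.
Qed.

Lemma stripe_unique x a b : fermi_stripe Om x -> nearest Om x a -> nearest Om x b -> a = b.
Proof.
move=> [N [_ _ hN] Nx] na nb; have [c [_ hc]] := hN x Nx.
by rewrite -(hc a) ?(hc b) //; exact: (nearest_foot oO bO R00 hg G0).
Qed.

(* If the foot were unique, moving away from it would increase the distance. *)
Lemma local_max x e : 0 < e -> 0 < rdist Om x ->
  (forall y, enorm (y - x) < e -> rdist Om y <= rdist Om x) -> ~ fermi_stripe Om x.
Proof.
move=> e0 r0 hmax sx; have [a na] := nearest_ex bO x G0; have ra := rdistE na.
pose K := Gam `&` [set b | dot (x - a) (x - b) <= 0].
have cK : compact K.
  have /compactE[cG [C hC]] := Gam_compact bO; apply/compactE; split; last by exists C => z [/hC].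
  apply: closedI => //; apply: (@lip_closed _ _ (enorm (x - a))) => y z.
  rewrite -dotNr -dotDr (_ : x - y - (x - z) = z - y); last by rewrite opprB addrC subrKA.
  by rewrite (enormB y z); exact: dot_abs.
(* For [y] slightly farther from [a] than [x], a nearest point [b] of [y] satisfies
   [|y - b| <= |x - b|], which puts it in the half-space opposite to [a], and it is almost nearest
   to [x]. In the limit this yields a second nearest point of [x] inside [K]. *)
have step t : 0 < t -> t * rdist Om x < e -> exists2 b, K b & enorm (x - b) <= (1 + t) * rdist Om x.
  move=> t0 te; pose y := x + t *: (x - a).
  have yx : enorm (y - x) = t * rdist Om x by rewrite /y [x + _]addrC addrK enormZ gtr0_norm // ra.
  have [b nb] := nearest_ex bO y G0; have rb := rdistE nb.
  have yb : enorm (y - b) <= rdist Om x by rewrite -rb; apply: hmax; rewrite yx.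
  exists b; last by have := enorm_triangle y x b; rewrite (enormB x y) yx; lra.
  split; first exact: nb.1.
  have xb : rdist Om x <= enorm (x - b) by rewrite rdist_le //; exact: nb.1.
  have : enorm (y - b) ^+ 2 <= enorm (x - b) ^+ 2.
    by rewrite ler_pXn2r ?nnegrE ?enorm_ge0 // (le_trans yb).
  have -> : y - b = (x - b) + t *: (x - a) by rewrite /y addrAC.
  rewrite /=; move: (x - b) (x - a) => u v; rewrite !enorm2 !dotE (dotC u v).
  have := dot_ge0 v => v0 h; have : t * (2 * dot v u) <= 0 by have := mulr_ge0 (mulr_ge0 (ltW t0) (ltW t0)) v0; lra.
  by rewrite pmulr_rle0 //; lra.
pose t0 := e / (2 * rdist Om x).
have tt0 : 0 < t0 by rewrite divr_gt0 // mulr_gt0.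
have te t : 0 < t -> t <= t0 -> t * rdist Om x < e.
  move=> tp tle; apply: (@le_lt_trans _ _ (t0 * rdist Om x)); first by rewrite ler_pM2r.
  have -> : t0 * rdist Om x = e / 2 by rewrite /t0; field; rewrite gt_eqF.
  lra.
have K0 : K !=set0 by have [b Kb _] := step t0 tt0 (te _ tt0 (lexx _)); exists b.
have [|b /set_mem Kb hb] := EVT_min_rV K0 cK (f := fun y => enorm (x - y)).
  apply: continuous_subspaceT; apply: (@elip_continuous _ _ _ 1) => y z; rewrite mul1r.
  by apply: (le_trans (enorm_lip _ _)); rewrite opprB addrC subrKA enormB.
have nb : nearest Om x b.
  split; first exact: Kb.1.
  move=> c Gc; apply: le_trans (rdist_le x Gc); apply/ler_addgt0Pr => d d0.
  pose t := Num.min t0 (d / rdist Om x).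
  have tp : 0 < t by rewrite lt_min tt0 divr_gt0.
  have tt : t <= t0 by rewrite ge_min lexx.
  have [c' Kc' hc'] := step t tp (te t tp tt).
  have := hb c' (mem_set Kc'); have : t * rdist Om x <= d.
    by rewrite -ler_pdivlMr // ge_min lexx orbT.
  lra.
have eab := stripe_unique sx na nb; move: Kb.2; rewrite /= -eab -enorm2 -ra.
by rewrite leNgt exprn_gt0.
Qed.

Lemma locconst (S : set (pt R)) z : ~ frontier S z ->
  exists2 e, 0 < e & forall y, enorm (y - z) < e -> (S y <-> S z).
Proof.
move=> nf; have [Sz|Sz] := pselect (S z).
  have /interiorE[e e0 h] : interior S z.
    by apply: contrapT => h; apply: nf; split => //; exact: subset_closure.
  by exists e => // y /h.
have [e h] : exists e, 0 < e /\ forall y, S y -> enorm (y - z) < e -> False.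
  apply: contrapT => hn; apply: nf; split; last by move=> /interior_subset.
  apply/closureE => e e0; apply: contrapT => hn'; apply: hn; exists e; split=> // y Sy yz.
  by apply: hn'; exists y.
by exists e; [exact: h.1 | move=> y yz; split=> // Sy; case: (h.2 y)].
Qed.

(** Away from both boundaries the disagreement set is locally constant. A point of its closure with
    maximal distance to the boundary would be a local maximum of the distance, hence outside the
    Fermi stripe by [local_max]; but there the two sets agree. *)
Lemma agree_far (B : set (pt R)) h : 0 <= h -> compact B ->
  (forall x, frontier B x -> rdist Om x <= h) ->
  B `\` fermi_stripe Om = Om `\` fermi_stripe Om -> forall x, h < rdist Om x -> (B x <-> Om x).
Proof.
move=> h0 /compactE[_ [CB hCB]] hB eB x0 hx0; apply: contrapT => nx0.
pose V := [set x | h < rdist Om x /\ ~ (B x <-> Om x)].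
have loc z : h < rdist Om z -> exists2 e, 0 < e &
   forall y, enorm (y - z) < e -> h < rdist Om y /\ ((B y <-> Om y) <-> (B z <-> Om z)).
  move=> hz; have [|e1 e10 h1] := @locconst B z; first by move=> /hB; lra.
  have [|e2 e20 h2] := @locconst Om z.
    by move=> /tod0; move: hz; rewrite trdist => + e; rewrite e normr0; lra.
  exists (Num.min (rdist Om z - h) (Num.min e1 e2)); first by rewrite !lt_min subr_gt0 hz e10.
  move=> y; rewrite !lt_min => /and3P[y0 /h1 y1 /h2 y2]; split; last by rewrite y1 y2.
  by have := rdist_lip bO G0 z y; rewrite (enormB z); lra.
have [CO hCO] := (bounded_enormP _).1 bO.
have cV : compact (closure V).
  apply/compactE; split; first exact: closed_closure.
  exists (Num.max CB CO); apply: (closure_closed_sub (@lip_closed _ (@enorm R) 1 _ _)).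
    by move=> y z; rewrite mul1r enorm_lip.
  move=> z [_ hz] /=; have [Bz|Bz] := pselect (B z); first by rewrite le_max hCB.
  by have [Oz|Oz] := pselect (Om z); [rewrite le_max hCO // orbT | case: hz].
have [||z /set_mem cz hz] := EVT_max_rV _ cV (f := rdist Om); first by exists x0; exact: subset_closure.
  apply: continuous_subspaceT; apply: (@elip_continuous _ _ _ 1) => y z; rewrite mul1r ler_norml.
  have := rdist_lip bO G0 z y; have := rdist_lip bO G0 y z; rewrite (enormB z) => ? ?.
  by apply/andP; split; lra.
have Vx0 : closure V x0 by apply: subset_closure; split.
have zr : h < rdist Om z := lt_le_trans hx0 (hz x0 (mem_set Vx0)).
have [e e0 he] := loc z zr.
have [y Vy yz] := (closureE _ _).1 cz e e0.
have nz : ~ (B z <-> Om z) by move=> /(he y yz).2; exact: Vy.2.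
have ns : ~ fermi_stripe Om z.
  apply: (@local_max z e) => //; first lra.
  move=> w wz; apply: hz; apply/mem_set; apply: subset_closure.
  by have [w1 w2] := he w wz; split => // /w2.
apply: nz; split=> hh.
  by have [] : (Om `\` fermi_stripe Om) z by rewrite -eB; split.
by have [] : (B `\` fermi_stripe Om) z by rewrite eB; split.
Qed.

(* Implicit differentiation of [x = A x + od x * N (A x)]. *)
Lemma tA_sd x0 : `|od x0| < R0 / 4 -> sd A x0.
Proof.
move=> hx0; have r0 := R00; have Gp := tGam x0; have [N [hN _ _ [d d0 hd]]] := hg Gp.
have [|_ [L sL hL]] := hd (A x0); first by rewrite subrr enorm0.
have AL : exists2 d1, 0 < d1 & forall y, enorm (y - x0) < d1 -> `|od y| <= R0 / 2 /\ enorm (A y - A x0) <= 5 * enorm (y - x0).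
  exists (R0 / 4); first lra.
  move=> y hy; have : `|od y| <= R0 / 2.
    by have := ler_normD (od y - od x0) (od x0); rewrite subrK; have := tod_lip y x0; lra.
  by move=> h; split => //; apply: tA_lip => //; lra.
have [d1 d10 h1] := AL.
have gN y : enorm (y - x0) < Num.min d1 (d / 5) -> nu (A y) = N (A y).
  rewrite lt_min => /andP[/h1[_ hA] y2]; apply: (nu_unique oO hg (tGam y)).
  by apply: (hd (A y) _).1; [lra | exact: tGam].
set g0 := nu (A x0).
have [lL bL _] := sL.
(* The linearised equation is [(Id + od x0 L) dA = dx - dot g0 dx g0]. Since [|od x0| < R0 / 4] and
   [L] is bounded by [1 / R0], the perturbation has norm at most 1/4. *)
apply: (@sd_implicit _ A (fun v => od x0 *: L v) (fun v => v - dot g0 v *: g0)).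
- by move=> c u v; rewrite lL !scalerDr !scalerA mulrC.
- move=> v; rewrite enormZ; apply: (@le_trans _ _ (R0 / 4 * (R0^-1 * enorm v))).
    by apply: ler_pM; rewrite ?enorm_ge0 // ltW.
  by rewrite le_eqVlt; apply/orP; left; apply/eqP; field; rewrite gt_eqF.
- by move=> c u v; rewrite !dotE; apply/rowP => i; rewrite !mxE; ring.
- exists 2 => v; apply: (le_trans (ler_enormB _ _)); rewrite enormZ tnu1 mulr1.
  by have := dot_abs g0 v; rewrite tnu1; lra.
move=> e e0.
(* The tolerances are such that the five terms of [sd_alg] take 5, 20, 2, 6 and 6 fortieths of
   [e]. *)
have c5 : 0 < e / (4 * 5 * (R0 / 4)) by rewrite divr_gt0 ?mulr_gt0 // divr_gt0.
have [d2 d20 h2] := enorm_sdiff sL c5.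
pose D := e * R0 / 40.
have D0 : 0 < D by rewrite divr_gt0 // mulr_gt0.
exists (Num.min (Num.min d1 (d / 5)) (Num.min (d2 / 5) D)); first by rewrite !lt_min d10 D0 !divr_gt0.
move=> x y; rewrite lt_min => /andP[x1 x2]; rewrite lt_min => /andP[y1 y2].
have [[ox Ax] [oy Ay]] : (`|od x| <= R0 / 2 /\ enorm (A x - A x0) <= 5 * enorm (x - x0)) /\
   (`|od y| <= R0 / 2 /\ enorm (A y - A x0) <= 5 * enorm (y - x0)).
  by move: x1 y1; rewrite !lt_min => /andP[x1 _] /andP[y1 _]; split; exact: h1.
have := gN x x1; have := gN y y1 => gy gx.
move: x2 y2; rewrite !lt_min => /andP[x2 x3] /andP[y2 y3].
have AA := tA_lip ox oy.
have m5 z : enorm (z - x0) < d2 / 5 -> enorm (A z - A x0) <= 5 * enorm (z - x0) -> enorm (A z - A x0) < d2.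
  by rewrite ltr_pdivlMr // mulrC => p q; exact: le_lt_trans q p.
have k1 := h2 (A x) (A y) (m5 _ x2 Ax) (m5 _ y2 Ay).
have k2 := todQ x oy.
have xy : enorm (x - y) <= 2 * D by apply: (le_trans (enorm_triangle x0 x y)); rewrite (enormB x0) mulr_natl mulr2n lerD // ltW.
have q0 : `|od x0| <= R0 / 2.
  by apply: (le_trans (ltW hx0)); rewrite ler_pM2l // lef_pV2 ?posrE // ler_nat.
have kx := tg_lip ox q0; have ky := tg_lip oy q0.
have kt := tod_lip y x0; have kL := hL (A x - A y).
have n1 := tnu1 x; have n0 : enorm g0 = 1 := tnu1 x0.
move: k1; rewrite -gx -gy => k1.
have ex := tA x; have ey := tA y.
set r1 := nu (A x) - nu (A y) - L (A x - A y) in k1.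
set r2 := od x - od y - dot (nu (A y)) (x - y) in k2.
rewrite (sd_alg _ _ _ ex ey) -/r1 -/r2.
have b1 : enorm ((od x0 - od y) *: L (A x - A y)) <= D * (R0^-1 * (5 * enorm (x - y))).
  rewrite enormZ; apply: ler_pM; rewrite ?enorm_ge0 //; first by rewrite distrC (le_trans kt) // ltW.
  by apply: (le_trans kL); rewrite ler_pM2l ?invr_gt0.
have b2 : enorm (od y *: r1) <= R0 / 2 * (e / (4 * 5 * (R0 / 4)) * (5 * enorm (x - y))).
  rewrite enormZ; apply: ler_pM; rewrite ?enorm_ge0 //; apply: (le_trans k1).
  by rewrite ler_pM2l.
have b3 : enorm (r2 *: nu (A x)) <= 2 * D * enorm (x - y) / R0.
  rewrite enormZ n1 mulr1; apply: (le_trans k2); rewrite ler_wpM2r ?invr_ge0 ?(ltW r0) //.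
  by rewrite expr2 ler_wpM2r ?enorm_ge0.
have b4 : enorm (dot g0 (x - y) *: (g0 - nu (A x))) <= enorm (x - y) * (6 / R0 * D).
  rewrite enormZ; apply: ler_pM; rewrite ?enorm_ge0 //.
    by have := dot_abs g0 (x - y); rewrite n0 mul1r.
  by rewrite enormB (le_trans kx) // ler_wpM2l ?divr_ge0 ?(ltW r0) // ltW.
have b5 : enorm (dot (g0 - nu (A y)) (x - y) *: nu (A x)) <= 6 / R0 * D * enorm (x - y).
  rewrite enormZ n1 mulr1; apply: (le_trans (dot_abs _ _)); rewrite ler_wpM2r ?enorm_ge0 //.
  by rewrite enormB (le_trans ky) // ler_wpM2l ?divr_ge0 ?(ltW r0) // ltW.
apply: (le_trans (ler_enormD _ _)); apply: (le_trans (lerD (ler_enormD _ _) (lexx _))).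
apply: (le_trans (lerD (lerD (ler_enormB _ _) (lexx _)) (lexx _))).
apply: (le_trans (lerD (lerD (lerD (ler_enormB _ _) (lexx _)) (lexx _)) (lexx _))).
have t1 : D * (R0^-1 * (5 * enorm (x - y))) = 5 / 40 * (e * enorm (x - y)) by rewrite /D; field; rewrite gt_eqF.
have t2 : R0 / 2 * (e / (4 * 5 * (R0 / 4)) * (5 * enorm (x - y))) = 1 / 2 * (e * enorm (x - y)) by field; rewrite gt_eqF.
have t3 : 2 * D * enorm (x - y) / R0 = 2 / 40 * (e * enorm (x - y)) by rewrite /D; field; rewrite gt_eqF.
have t4 : enorm (x - y) * (6 / R0 * D) = 6 / 40 * (e * enorm (x - y)) by rewrite /D; field; rewrite gt_eqF.
have t5 : 6 / R0 * D * enorm (x - y) = 6 / 40 * (e * enorm (x - y)) by rewrite /D; field; rewrite gt_eqF.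
rewrite t1 in b1; rewrite t2 in b2; rewrite t3 in b3; rewrite t4 in b4; rewrite t5 in b5.
have N0 : 0 <= e * enorm (x - y) by rewrite mulr_ge0 ?enorm_ge0 // ltW.
exact: (sum5 b1 b2 b3 b4 b5 N0).
Qed.

End TubeFacts.

(** * Star-shaped polyhedra *)

(** Common setting for faces, with [H] their plane, and for elements, with [H] the whole space. *)
Record star (R : realType) (H K : set (pt R)) (c : pt R) (r D : R) : Prop := Star {
  st_aff : affine H;
  st_c : H c;
  st_sub : K `<=` H;
  st_compact : compact K;
  st_r : 0 < r;
  st_D : 0 <= D;
  st_diam : forall x, K x -> enorm (x - c) <= D;
  st_ball : forall y, H y -> enorm (y - c) <= r -> K y;
  st_star : forall y x t, H y -> enorm (y - c) <= r -> K x -> 0 <= t <= 1 -> K (segpt x y t) }.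

Lemma ccK (R : realType) (c x : pt R) : c + (x - c) = x.
Proof. by rewrite addrC subrK. Qed.

Lemma lip1_continuous (R : realType) (W : normedModType R) (f : R -> W) (K : R) :
  (forall x y, `|f x - f y| <= K * `|x - y|) -> continuous f.
Proof.
move=> fK x; apply/cvgrPdist_lt => e e0; apply/nbhs_ballP.
have K0 : 0 < `|K| + 1 by rewrite ltr_wpDl.
exists (e / (`|K| + 1)); rewrite /= ?divr_gt0 // => y; rewrite /ball /=.
rewrite ltr_pdivlMr // mulrC; apply: le_lt_trans; apply: (le_trans (fK _ _)).
by rewrite ler_wpM2r // (le_trans (ler_norm _)) // lerDl.
Qed.

Section Star.
Context {R : realType} (H K : set (pt R)) (c : pt R) (r D : R) (S : star H K c r D).
Implicit Types (x y z : pt R) (t : R).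
Let aH := st_aff S.
Let r0 := st_r S.

Definition gset x := [set t : R | 0 < t /\ K (c + t^-1 *: (x - c))].
(** Minkowski functional of [K] about [c]. *)
Definition gauge x : R := inf (gset x).
Definition radial x : pt R := c + (gauge x)^-1 *: (x - c).
Definition bd := K `\` relint H K.
(** Extension of boundary data that is positively homogeneous of degree one about [c]; unlike the
    degree-zero extension it is Lipschitz at [c]. *)
Definition cext (f : pt R -> pt R) x := gauge x *: f (radial x).
Definition cone (A : set (pt R)) := [set z | exists t a, [/\ 0 <= t <= 1, A a & z = segpt c a t]].

Lemma Hray x t : H x -> H (c + t *: (x - c)).
Proof. by move=> Hx; apply: aH => //; exact: st_c S. Qed.

Lemma gset_ball x t : H x -> 0 < t -> enorm (x - c) <= r * t -> gset x t.
Proof.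
move=> Hx t0 hx; split=> //; apply: (st_ball S); first exact: Hray.
by rewrite addrC addKr enormZ ger0_norm ?invr_ge0 ?(ltW t0) // mulrC ler_pdivrMr.
Qed.

(** The scaled point of [y] is a convex combination of a point of [K] and a point of the ball. This
    is what star-shapedness with respect to a ball adds to that with respect to a point: the gauge
    becomes [1 / r]-Lipschitz. *)
Lemma gset_add x y t d : H x -> H y -> 0 < d -> enorm (y - x) <= r * d -> gset x t -> gset y (t + d).
Proof.
move=> Hx Hy d0 hd [t0 Kt]; split; first by rewrite addr_gt0.
have Hc := st_c S; pose b := c + d^-1 *: (y - x).
have Hb : H b by exact: aH.
have -> : c + (t + d)^-1 *: (y - c) = segpt (c + t^-1 *: (x - c)) b (d / (t + d)).
  by rewrite segptE /b; apply/rowP => i; rewrite !mxE; field; rewrite !gt_eqF // addr_gt0.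
apply: (st_star S) => //.
  by rewrite /b addrC addKr enormZ ger0_norm ?invr_ge0 ?(ltW d0) // mulrC ler_pdivrMr.
by rewrite divr_ge0 ?ltW ?addr_gt0 //= ltr_pdivrMr ?addr_gt0 // mul1r ltrDr.
Qed.

Lemma gset_nonempty x : H x -> gset x !=set0.
Proof.
move=> Hx; exists (enorm (x - c) / r + 1); apply: gset_ball => //.
  by rewrite ltr_wpDl // divr_ge0 ?enorm_ge0 // ltW.
by rewrite mulrDr mulr1 mulrC divfK ?gt_eqF // lerDl ltW.
Qed.

Lemma gset_lb x : has_lbound (gset x).
Proof. by exists 0 => t [/ltW]. Qed.

Lemma gauge_ge0 x : H x -> 0 <= gauge x.
Proof. by move=> Hx; apply: lb_le_inf; [exact: gset_nonempty | move=> t [/ltW]]. Qed.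

Lemma gauge_le x t : gset x t -> gauge x <= t.
Proof. by move=> h; apply: (ge_inf (gset_lb x)). Qed.

Lemma gauge_lt x e : H x -> gauge x < e -> exists2 t, t < e & gset x t.
Proof.
move=> Hx he; have e0 : 0 < e - gauge x by rewrite subr_gt0.
have [t gt ht] := inf_adherent e0 (conj (gset_nonempty Hx) (gset_lb x)).
by exists t => //; move: ht; rewrite addrC subrK.
Qed.

Lemma gauge_lipl x y : H x -> H y -> gauge y <= gauge x + enorm (y - x) / r.
Proof.
move=> Hx Hy; apply/ler_addgt0Pr => e e0; have e2 : 0 < e / 2 by rewrite divr_gt0.
have [|t tx gt] := @gauge_lt x (gauge x + e / 2) Hx; first by rewrite ltrDl.
have d0 : 0 < enorm (y - x) / r + e / 2 by rewrite ltr_wpDl // divr_ge0 ?enorm_ge0 // ltW.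
have h := @gset_add x y t _ Hx Hy d0 _ gt.
have {h}/gauge_le : gset y (t + (enorm (y - x) / r + e / 2)).
  by apply: h; rewrite mulrDr mulrC divfK ?gt_eqF // lerDl mulr_ge0 ?(ltW e2) // ltW.
lra.
Qed.

Lemma gauge_lip x y : H x -> H y -> `|gauge x - gauge y| <= enorm (x - y) / r.
Proof.
move=> Hx Hy; have := gauge_lipl Hx Hy; have := gauge_lipl Hy Hx.
by rewrite (enormB y x) ler_norml => h1 h2; apply/andP; split; lra.
Qed.

Lemma gauge_diam x : H x -> enorm (x - c) <= D * gauge x.
Proof.
move=> Hx; apply/ler_addgt0Pr => e e0.
have [|t tx [t0 Kt]] := @gauge_lt x (gauge x + e / (D + 1)) Hx.
  by rewrite ltrDl divr_gt0 // ltr_wpDl // (st_D S).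
have := st_diam S Kt; rewrite addrC addKr enormZ ger0_norm ?invr_ge0 ?(ltW t0) // mulrC ler_pdivrMr // => h.
apply: (le_trans h); apply: (@le_trans _ _ (D * (gauge x + e / (D + 1)))).
  by rewrite ler_wpM2l ?(st_D S) // ltW.
rewrite mulrDr lerD2l mulrCA -[leRHS]mulr1 ler_pM2l // ler_pdivrMr ?mul1r ?lerDl //.
by rewrite ltr_wpDl // (st_D S).
Qed.

Lemma gauge_c : gauge c = 0.
Proof.
apply/eqP; rewrite eq_le; apply/andP; split; last exact: gauge_ge0 (st_c S).
apply/ler_addgt0Pr => e e0; rewrite add0r.
by apply: gauge_le; apply: gset_ball => //; [exact: st_c S | rewrite subrr enorm0 mulr_ge0 // ltW].
Qed.

Lemma gauge_scal x t : H x -> 0 <= t -> gauge (c + t *: (x - c)) = t * gauge x.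
Proof.
have le1 y u : H y -> 0 < u -> gauge (c + u *: (y - c)) <= u * gauge y.
  move=> Hy u0; rewrite mulrC -ler_pdivrMr //; apply: lb_le_inf; first exact: gset_nonempty.
  move=> v [v0 Kv]; rewrite ler_pdivrMr // mulrC; apply: gauge_le; split; first exact: mulr_gt0.
  rewrite [c + u *: _]addrC addrK scalerA (_ : (u * v)^-1 * u = v^-1) //.
  by field; rewrite !gt_eqF.
move=> Hx; rewrite le_eqVlt => /orP[/eqP <-|t0]; first by rewrite scale0r addr0 mul0r gauge_c.
apply/eqP; rewrite eq_le le1 //=; have := le1 _ t^-1 (Hray t Hx).
rewrite invr_gt0 => /(_ t0); rewrite [c + t *: _]addrC addrK scalerA mulVf ?gt_eqF // scale1r ccK.
by rewrite mulrC ler_pdivlMr // mulrC.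
Qed.

Lemma gaugeP x : H x -> (K x <-> gauge x <= 1).
Proof.
move=> Hx; split=> [Kx|g1].
  by apply: gauge_le; split => //; rewrite invr1 scale1r addrC subrK.
have /compactE[cK _] := st_compact S.
apply: cK; apply/closureE => e e0.
have n0 : 0 < enorm (x - c) + 1 by rewrite ltr_wpDl ?enorm_ge0.
pose d := e / (enorm (x - c) + 1); have d0 : 0 < d by exact: divr_gt0.
have [|t td [t0 Kt]] := @gauge_lt x (1 + d) Hx; first by rewrite (le_lt_trans g1) // ltrDl.
have h := @gset_add x x t (1 + d - t) Hx Hx; rewrite subrr enorm0 subr_gt0 in h.
have [|_ Kd] := h td _ (conj t0 Kt); first by rewrite mulr_ge0 ?subr_ge0 // ltW.
rewrite (addrC t) subrK in Kd; have d1 : 0 < 1 + d by rewrite addr_gt0.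
exists (c + (1 + d)^-1 *: (x - c)) => //.
have -> : c + (1 + d)^-1 *: (x - c) - x = (- (d / (1 + d))) *: (x - c).
  by apply/rowP => i; rewrite !mxE; field; rewrite gt_eqF.
have q0 : 0 <= d / (1 + d) by apply: divr_ge0; exact: ltW.
rewrite enormZ normrN ger0_norm //.
rewrite mulrAC ltr_pdivrMr //; have de : d * (enorm (x - c) + 1) = e by rewrite divfK // gt_eqF.
by have : 0 < e * d by [exact: mulr_gt0]; lra.
Qed.

Lemma relintP x : H x -> (relint H K x <-> gauge x < 1).
Proof.
move=> Hx; split=> [[Kx /enorm_ballP[e e0 h]]|g1].
  have [xc|xc] := eqVneq x c; first by rewrite xc gauge_c.
  have n0 : 0 < enorm (x - c) by rewrite enorm_gt0 subr_eq0.
  pose d := e / (2 * enorm (x - c)); have d0 : 0 < d by rewrite divr_gt0 // mulr_gt0.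
  have /gaugeP : K (c + (1 + d) *: (x - c)).
    apply: h; last exact: Hray.
    have -> : c + (1 + d) *: (x - c) - x = d *: (x - c) by apply/rowP => i; rewrite !mxE; ring.
    rewrite enormZ ger0_norm ?ltW // (_ : d * _ = e / 2); first lra.
    by rewrite /d; field; rewrite gt_eqF.
  move=> /(_ (Hray _ Hx)); rewrite gauge_scal // ?addr_ge0 ?(ltW d0) // => hg.
  have : 0 <= gauge x by exact: gauge_ge0.
  rewrite le_eqVlt => /orP[/eqP <-//|gx]; nra.
split; first by apply/gaugeP => //; exact: ltW.
apply/enorm_ballP; exists (r * (1 - gauge x)); first by rewrite mulr_gt0 // subr_gt0.
move=> y yx Hy; apply/gaugeP => //; have := gauge_lipl Hx Hy.
have : enorm (y - x) / r < 1 - gauge x by rewrite ltr_pdivrMr // mulrC.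
lra.
Qed.

Lemma bdP x : bd x <-> H x /\ gauge x = 1.
Proof.
split=> [[Kx nx]|[Hx g1]].
  have Hx := st_sub S Kx; split => //; apply/eqP; rewrite eq_le (gaugeP Hx).1 //= leNgt.
  by apply/negP => g1; apply: nx; apply/relintP.
by split; [apply/gaugeP; rewrite ?g1 | move/relintP => /(_ Hx); rewrite g1 ltxx].
Qed.

Lemma radial_bd x : H x -> 0 < gauge x -> bd (radial x).
Proof.
move=> Hx g0; apply/bdP; split; first exact: Hray.
by rewrite gauge_scal ?invr_ge0 ?(ltW g0) // mulVf // gt_eqF.
Qed.

Lemma radialE x : bd x -> radial x = x.
Proof. by case/bdP => Hx g1; rewrite /radial g1 invr1 scale1r addrC subrK. Qed.

Lemma gauge_cone a t : bd a -> 0 <= t -> gauge (segpt c a t) = t.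
Proof. by case/bdP => Ha g1 t0; rewrite segptE gauge_scal // g1 mulr1. Qed.

Lemma radial_cone a t : bd a -> 0 < t -> radial (segpt c a t) = a.
Proof.
move=> ba t0; rewrite /radial gauge_cone ?ltW // segptE [c + t *: _]addrC addrK scalerA.
by rewrite mulVf ?gt_eqF // scale1r addrC subrK.
Qed.

Lemma cext_cone f a t : bd a -> 0 <= t -> cext f (segpt c a t) = t *: f a.
Proof.
move=> ba t0; rewrite /cext gauge_cone //; move: t0; rewrite le_eqVlt => /orP[/eqP <-|t0].
  by rewrite !scale0r.
by rewrite radial_cone.
Qed.

Lemma cext_bd f x : bd x -> cext f x = f x.
Proof. by move=> bx; rewrite /cext radialE //; case/bdP: bx => _ ->; rewrite scale1r. Qed.

Lemma cone_cover x : bd !=set0 -> K x -> exists2 a, bd a & cone [set a] x.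
Proof.
move=> [b bb] Kx; have Hx := st_sub S Kx; have := gauge_ge0 Hx.
rewrite le_eqVlt => /orP[/eqP g0|g0].
  exists b => //; exists 0, b; split => //; first by rewrite lexx ler01.
  rewrite segpt0; have := gauge_diam Hx; rewrite -g0 mulr0 => h.
  by apply/eqP; rewrite -subr_eq0 -enorm_eq0 eq_le h enorm_ge0.
exists (radial x); first exact: radial_bd.
exists (gauge x), (radial x); split => //; first by rewrite ltW //=; exact: (gaugeP Hx).1.
by rewrite segptE /radial [c + _ - c]addrC addKr scalerA mulfV ?gt_eqF // scale1r addrC subrK.
Qed.

Lemma cext_bound f M x : 0 <= M -> (forall y, bd y -> enorm (f y) <= M) -> bd !=set0 -> K x -> enorm (cext f x) <= M.
Proof.
move=> M0 fM b0 Kx; have [a ba [t [b [/andP[t0 t1] -> ->]]]] := cone_cover b0 Kx.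
rewrite cext_cone // enormZ ger0_norm //; apply: le_trans (fM a ba).
by rewrite ler_piMl // enorm_ge0.
Qed.

(** The increment splits into a radial part, controlled by the Lipschitz bound of the gauge ([st]),
    and an angular part at the common scale [s] ([sab]). *)
Lemma cone_lip A f L M : A `<=` bd -> 0 <= L -> 0 <= M ->
  (forall x y, A x -> A y -> enorm (f x - f y) <= L * enorm (x - y)) ->
  (forall x, A x -> enorm (f x) <= M) ->
  forall x y, cone A x -> cone A y -> enorm (cext f x - cext f y) <= (L * (1 + D / r) + M / r) * enorm (x - y).
Proof.
move=> Ab L0 M0 fL fM _ _ [s [a [/andP[s0 s1] Aa ->]]] [t [b [/andP[t0 t1] Ab' ->]]].
have [ba bb] := (Ab a Aa, Ab b Ab'); rewrite !cext_cone //.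
set d := enorm (segpt c a s - segpt c b t).
have st : `|s - t| <= d / r.
  rewrite -(gauge_cone ba s0) -(gauge_cone bb t0); apply: gauge_lip; rewrite segptE; apply: Hray.
    by case/bdP: ba.
  by case/bdP: bb.
have sab : s * enorm (a - b) <= d + d / r * D.
  rewrite -[s in leLHS]ger0_norm // -enormZ.
  have -> : s *: (a - b) = (segpt c a s - segpt c b t) - (s - t) *: (b - c).
    by rewrite !segptE; apply/rowP => i; rewrite !mxE; ring.
  apply: (le_trans (ler_enormB _ _)); rewrite lerD2l enormZ; apply: ler_pM; rewrite ?enorm_ge0 //.
  by apply: (st_diam S); case: bb.
have -> : s *: f a - t *: f b = s *: (f a - f b) + (s - t) *: f b.
  by apply/rowP => i; rewrite !mxE; ring.
apply: (le_trans (ler_enormD _ _)); rewrite !enormZ ger0_norm //.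
have h1 : s * enorm (f a - f b) <= L * (d + d / r * D).
  apply: (@le_trans _ _ (s * (L * enorm (a - b)))); first by rewrite ler_wpM2l // fL.
  by rewrite mulrCA ler_wpM2l.
have h2 : `|s - t| * enorm (f b) <= d / r * M by apply: ler_pM; rewrite ?enorm_ge0 // fM.
apply: (le_trans (lerD h1 h2)); rewrite le_eqVlt; apply/orP; left; apply/eqP; field.
by rewrite gt_eqF.
Qed.

Lemma cone_closed A : compact A -> closed (cone A).
Proof.
move=> cA; pose f (u : R * pt R) := segpt c u.2 u.1.
have cf : continuous f.
  move=> u; rewrite /f; under eq_fun do rewrite segptE; apply: cvgD; first exact: cvg_cst.
  apply: cvgZ; first exact: cvg_fst.
  by apply: cvgB; [exact: cvg_snd | exact: cvg_cst].
have cc : compact (f @` (`[0, 1]%classic `*` A)).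
  apply: continuous_compact; first exact: continuous_subspaceT.
  by apply: compact_setX => //; exact: segment_compact.
suff -> : cone A = f @` (`[0, 1]%classic `*` A) by apply: compact_closed cc; exact: norm_hausdorff.
apply/seteqP; split=> z.
  by move=> [t [a [t01 Aa ->]]]; exists (t, a) => //; split => //=; rewrite in_itv.
by move=> [[t a] [/= t01 Aa] <-]; exists t, a; split => //; move: t01; rewrite in_itv.
Qed.

(** The radial projection of the segment from [x] to [y] is a path in the boundary. The condition
    [|x - y| <= r / 2] keeps the gauge above 1/2 on the segment, so the path stays close to [x];
    [path_meet] does the rest. This lemma turns metric closeness into combinatorial incidence. *)
Lemma bd_path (A B : set (pt R)) x y : bd x -> bd y -> enorm (x - y) <= r / 2 -> closed A -> closed B ->
  (forall z, bd z -> A z \/ B z) -> A x -> B y ->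
  exists z, [/\ bd z, A z, B z & enorm (z - x) <= 2 * (1 + D / r) * enorm (x - y)].
Proof.
move=> bx by_ xy cA cB AB Ax By; have [Hx gx] := (bdP x).1 bx; have [Hy gy] := (bdP y).1 by_.
have Hs t : H (segpt x y t) by rewrite segptE; exact: aH.
have gs t : 0 <= t <= 1 -> 1 / 2 <= gauge (segpt x y t).
  move=> /andP[t0 t1]; have := gauge_lip Hx (Hs t); rewrite gx enormB segpt_distl //.
  have : t * enorm (x - y) / r <= 1 / 2.
    rewrite ler_pdivrMr //; have : t * enorm (x - y) <= enorm (x - y) by rewrite ler_piMl ?enorm_ge0.
    lra.
  rewrite ler_norml => h /andP[h1 h2]; lra.
have gc : continuous (gauge \o segpt x y).
  apply: (@lip1_continuous _ _ _ (enorm (x - y) / r)) => s t /=; apply: (le_trans (gauge_lip (Hs s) (Hs t))).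
  by rewrite segpt_dist mulrAC mulrC mulrCA mulrC.
have rc t : 0 <= t <= 1 -> {for t, continuous (radial \o segpt x y)}.
  move=> t01; rewrite /radial /comp; apply: cvgD; first exact: cvg_cst.
  apply: cvgZ; last by apply: cvgB; [exact: segpt_cont | exact: cvg_cst].
  by apply: cvgV; [rewrite gt_eqF // (lt_le_trans _ (gs t t01)) // divr_gt0 | exact: gc].
have rb t : 0 <= t <= 1 -> bd (radial (segpt x y t)).
  by move=> t01; apply: radial_bd => //; rewrite (lt_le_trans _ (gs t t01)) // divr_gt0.
have [|||t [t01 [At Bt]]] := path_meet ler01 rc cA cB.
- by move=> t /rb/AB.
- by rewrite /= segpt0 radialE.
- by rewrite /= segpt1 radialE.
exists (radial (segpt x y t)); split => //; first exact: rb.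
set z := segpt x y t; have g12 := gs t t01; rewrite -/z in g12.
have g0 : 0 < gauge z by rewrite (lt_le_trans _ g12) // divr_gt0.
have -> : radial z - x = (gauge z)^-1 *: ((z - x) + (1 - gauge z) *: (x - c)).
  by rewrite /radial; apply/rowP => i; rewrite !mxE; field; rewrite gt_eqF.
have [t0 t1] := andP t01; have zx : enorm (z - x) <= enorm (x - y).
  by rewrite segpt_distl // ler_piMl ?enorm_ge0.
rewrite enormZ ger0_norm ?invr_ge0 ?(ltW g0) // mulrC ler_pdivrMr //.
apply: (@le_trans _ _ (enorm (x - y) + enorm (x - y) / r * D)).
  apply: (le_trans (ler_enormD _ _)); apply: lerD => //; rewrite enormZ; apply: ler_pM; rewrite ?enorm_ge0 //.
    rewrite -gx; apply: (le_trans (gauge_lip Hx (Hs t))); rewrite -/z enormB.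
    by rewrite ler_pdivrMr // divfK ?gt_eqF.
  by apply: (st_diam S); case: bx.
have q : 0 <= (1 + D / r) * enorm (x - y).
  by rewrite mulr_ge0 ?enorm_ge0 // addr_ge0 // divr_ge0 ?(st_D S) // ltW.
have -> : enorm (x - y) + enorm (x - y) / r * D = (1 + D / r) * enorm (x - y) by field; rewrite gt_eqF.
have g1 : 0 <= 2 * gauge z - 1 by lra.
have := mulr_ge0 q g1; move: (1 + D / r) (enorm (x - y)) (gauge z) => p n g; lra.
Qed.

End Star.

Section Sets.
Context {R : realType}.
Implicit Types (A B H K : set (pt R)) (x y z u v n p q : pt R).

Lemma diam_ub A x y : compact A -> A x -> A y -> enorm (x - y) <= diam A.
Proof.
move=> /compactE[_ [C hC]] Ax Ay; apply: ub_le_sup; last by exists (x, y).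
exists (C + C) => _ [[a b] [/= Aa Ab] <-]; apply: (le_trans (ler_enormB _ _)).
by rewrite lerD // hC.
Qed.

Lemma diam_mono A B : A !=set0 -> compact B -> A `<=` B -> diam A <= diam B.
Proof.
move=> [x Ax] cB AB; apply: ge_sup; first by exists (enorm (x - x)); exists (x, x).
by move=> _ [[a b] [/= Aa Ab] <-]; apply: diam_ub => //; exact: AB.
Qed.

Lemma segment_closed p q : compact (segment p q).
Proof.
apply: continuous_compact; last exact: segment_compact.
by apply: continuous_subspaceT => t; have := @segpt_cont R p q t.
Qed.

Lemma segment_l p q : segment p q p.
Proof. by apply/segptP; exists 0; rewrite lexx ler01 segpt0. Qed.
Lemma segment_r p q : segment p q q.
Proof. by apply/segptP; exists 1; rewrite lexx ler01 segpt1. Qed.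

Lemma orth2 u v : exists k, [/\ k != 0, dot k u = 0 & dot k v = 0].
Proof.
pose N : 'M[R]_(3, 2) := \matrix_(i, j) (if j == 0 then u 0 i else v 0 i).
have /rowV0Pn[k /sub_kermxP kN k0] : kermx N != 0.
  rewrite -mxrank_eq0 mxrank_ker -lt0n subn_gt0.
  by apply: (leq_ltn_trans (rank_leq_col _)).
exists k; split=> //.
  have := congr1 (fun Z : 'M[R]_(1, 2) => Z ord0 ord0) kN; rewrite !mxE => e; rewrite -[RHS]e.
  by apply: eq_bigr => i _; rewrite !mxE.
have := congr1 (fun Z : 'M[R]_(1, 2) => Z ord0 (lift ord0 ord0)) kN; rewrite !mxE => e; rewrite -[RHS]e.
by apply: eq_bigr => i _; rewrite !mxE.
Qed.

Lemma ray_exit K x u : compact K -> K x -> u != 0 ->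
  exists t, [/\ 0 <= t, K (x + t *: u) & forall s, t < s -> ~ K (x + s *: u)].
Proof.
move=> /compactE[cK [C hC]] Kx u0; have un : 0 < enorm u by rewrite enorm_gt0.
pose S := [set t | 0 <= t /\ K (x + t *: u)].
have S0 : S 0 by split=> //; rewrite scale0r addr0.
have hS : has_sup S.
  split; first by exists 0.
  exists ((C + C) / enorm u) => t [t0 /hC ht]; rewrite ler_pdivlMr // -[t]ger0_norm // -enormZ.
  have -> : t *: u = (x + t *: u) - x by rewrite [x + _]addrC addrK.
  by apply: (le_trans (ler_enormB _ _)); rewrite lerD // hC.
have ubS t : S t -> t <= sup S by move=> St; apply: ub_le_sup hS.2 _ St.
exists (sup S); split.
- exact: ubS.
- apply: cK; apply/closureE => e e0; have e1 : 0 < e / enorm u by exact: divr_gt0.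
  have [t St ht] := sup_adherent e1 hS; exists (x + t *: u); first exact: St.2.
  have -> : x + t *: u - (x + sup S *: u) = (t - sup S) *: u by apply/rowP => i; rewrite !mxE; ring.
  rewrite enormZ -ltr_pdivlMr // distrC ger0_norm ?subr_ge0 ?ubS //; lra.
- move=> s hs Ks; have : S s by split => //; apply: le_trans (ltW hs); exact: ubS.
  by move/ubS; rewrite leNgt hs.
Qed.

Lemma plane_unit H : is_plane H -> exists c n, enorm n = 1 /\ H = [set x | dot n (x - c) = 0].
Proof.
move=> [c [n [n0 ->]]]; have nn : 0 < enorm n by rewrite enorm_gt0.
exists c, ((enorm n)^-1 *: n); split.
  by rewrite enormZ ger0_norm ?invr_ge0 ?(ltW nn) // mulVf // gt_eqF.
apply/seteqP; split=> x /=; rewrite dotZl; first by move=> ->; rewrite mulr0.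
by move/eqP; rewrite mulf_eq0 invr_eq0 gt_eqF //= => /eqP.
Qed.

Lemma plane_dir c n x y : dot n (x - c) = 0 -> (dot n (y - c) = 0 <-> dot n (y - x) = 0).
Proof. by rewrite !dotE => h; split => h'; lra. Qed.

Lemma relint_dir c n A x u : relint [set x | dot n (x - c) = 0] A x -> dot n (x - c) = 0 -> dot n u = 0 ->
  exists2 e, 0 < e & forall t, `|t| < e -> A (x + t *: u).
Proof.
move=> [Ax /enorm_ballP[e e0 h]] Hx nu0.
have u1 : 0 < enorm u + 1 by rewrite ltr_wpDl ?enorm_ge0.
exists (e / (enorm u + 1)); first exact: divr_gt0.
move=> t; rewrite ltr_pdivlMr // => ht; apply: h => /=.
  rewrite [x + _]addrC addrK enormZ; apply: le_lt_trans ht; rewrite ler_wpM2l //; lra.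
by apply/(plane_dir _ Hx); rewrite [x + _]addrC addrK dotZr nu0 mulr0.
Qed.

(** Identifies the plane in the definition of a polygon with the plane in the star-shapedness
    assumption. *)
Lemma plane_unique H H' A : is_plane H -> is_plane H' -> relint H A !=set0 -> A `<=` H -> A `<=` H' -> H = H'.
Proof.
move=> /plane_unit[c [n [n1 ->]]] /plane_unit[c' [n' [n1' ->]]] [x rx] AH AH'.
have Ax := rx.1; have Hx := AH x Ax; have Hx' := AH' x Ax; rewrite /= in Hx Hx'.
have par u : dot n u = 0 -> dot n' u = 0.
  move=> nu0; have [e e0 h] := relint_dir rx Hx nu0.
  have := AH' _ (h (e / 2) _); rewrite gtr0_norm ?divr_gt0 // => /(_ ltac:(lra)) /=.
  move/(plane_dir _ Hx'); rewrite [x + _]addrC addrK dotZr => /eqP.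
  by rewrite mulf_eq0 gt_eqF ?divr_gt0 //= => /eqP.
have d1 : dot n n = 1 by rewrite -enorm2 n1 expr1n.
have d1' : dot n' n' = 1 by rewrite -enorm2 n1' expr1n.
have e : n' = dot n' n *: n.
  apply/eqP; rewrite -subr_eq0 -dot_eq0; apply/eqP.
  have h : dot n (n' - dot n' n *: n) = 0 by rewrite !dotE d1 mulr1 dotC subrr.
  have h' := par _ h; rewrite dotDl h' dotNl dotZl h; lra.
have k0 : dot n' n != 0 by apply: contra_eq_neq n1' => k0; rewrite e k0 scale0r enorm0 eq_sym oner_eq0.
have dn u : dot n' u = dot n' n * dot n u by rewrite {1}e dotZl.
apply/seteqP; split=> y /=.
  by move/(plane_dir _ Hx) => h; apply/(plane_dir _ Hx'); rewrite dn h mulr0.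
move/(plane_dir _ Hx'); rewrite dn => /eqP; rewrite mulf_eq0 (negbTE k0) => /eqP h.
by apply/(plane_dir _ Hx).
Qed.

End Sets.

Lemma fin_enum T (A : set T) : finite_set A -> exists n (f : 'I_n -> T), A = range f.
Proof.
case: (pselect (A !=set0)) => [[a0 Aa0]|A0 _]; last first.
  exists 0%N, (fun i : 'I_0 => match i with Ordinal m hm => False_rect T (notF hm) end).
  apply/seteqP; split=> [x Ax|x [[i hi]]]; first by case: A0; exists x.
  by [].
move=> fA; have /finite_seqP[s es] : finite_set (A : set {classic T}) by [].
exists (size s), (fun i => nth (a0 : {classic T}) s i); rewrite es; apply/seteqP; split => x /=.
  move=> xs; have h : (index (x : {classic T}) s < size s)%N by rewrite index_mem.
  by exists (Ordinal h) => //=; rewrite nth_index.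
by move=> [i _ <-]; exact: mem_nth.
Qed.

Lemma fin_closed (T : topologicalType) I (A : set I) (F : I -> set T) : finite_set A ->
  (forall i, A i -> closed (F i)) -> closed (\bigcup_(i in A) F i).
Proof. by move=> fA cF; apply: (@closed_bigcup T {classic I} A F). Qed.

(** * Polygons and polyhedra as star-shaped sets; linear functionals on them *)

Section Polygons.
Context {R : realType}.
Implicit Types (F G : polygon R) (E : polyhedron R) (x y z u v n p q : pt R).

Lemma edge_nodes F e : is_polygon F -> pg_edges F e -> exists p q,
  [/\ p != q, e = segment p q, pg_nodes F p & pg_nodes F q].
Proof.
move=> [_ [he _]] Fe; have [p [q [pq ee]]] := he e Fe; exists p, q; split => //.
  by exists e => //; exists q.
exists e => //; exists p; split; first by rewrite eq_sym.
rewrite ee; apply/seteqP; split => z /segptP[t [/andP[t0 t1] ->]]; apply/segptP; exists (1 - t); split; rewrite ?subr_ge0 ?t1 ?lerBlDr ?lerDl //.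
  by apply/rowP => i; rewrite !mxE; ring.
by apply/rowP => i; rewrite !mxE; ring.
Qed.

Lemma edge_sub F e : is_polygon F -> pg_edges F e -> e `<=` pg_set F.
Proof.
move=> [_ [_ [_ [_ [_ [H [_ _ _ hb]]]]]]] Fe x ex.
have : (\bigcup_(e in pg_edges F) e) x by exists e.
by rewrite -hb => -[].
Qed.

Lemma node_in F p : is_polygon F -> pg_nodes F p -> pg_set F p.
Proof.
move=> pF [e Fe [q [_ ee]]]; apply: (edge_sub pF Fe); rewrite ee; exact: segment_l.
Qed.

Lemma edge_compact F e : is_polygon F -> pg_edges F e -> compact e.
Proof. by move=> pF /(edge_nodes pF)[p [q [_ -> _ _]]]; exact: segment_closed. Qed.

(** Replaces inclusion in the convex hull of the nodes: move within the plane along a direction in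
    which the functional does not decrease until the boundary is reached, then along an edge to its
    better end point. *)
Lemma polygon_max F m x : is_polygon F -> pg_set F x -> exists2 p, pg_nodes F p & dot m x <= dot m p.
Proof.
move=> pF Fx; case: (pF) => _ [_ [_ [cF [_ [H [pH FH _ hb]]]]]].
have [c [n [n1 eH]]] := plane_unit pH.
have [u [u0 nu0 mu0]] : exists u, [/\ u != 0, dot n u = 0 & 0 <= dot m u].
  have [k [k0 kn _]] := orth2 n n; rewrite dotC in kn.
  have [mk|mk] := lerP 0 (dot m k); first by exists k.
  by exists (- k); rewrite oppr_eq0 !dotNr kn oppr0 oppr_ge0 ltW.
have [t [t0 Ft ht]] := ray_exit cF Fx u0.
have Ht : dot n (x + t *: u - c) = 0 by have := FH _ Ft; rewrite eH.
have : (pg_set F `\` relint H (pg_set F)) (x + t *: u).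
  split => //; rewrite eH => rt; have [e e0 h] := relint_dir rt Ht nu0.
  apply: (ht (t + e / 2)); first by rewrite ltrDl divr_gt0.
  have := h (e / 2); rewrite gtr0_norm ?divr_gt0 // scalerDl addrA; apply; lra.
rewrite hb => -[e Fe]; have [p [q [_ -> Np Nq]]] := edge_nodes pF Fe.
move=> /segptP[s [/andP[s0 s1] ey]].
have : dot m x <= (1 - s) * dot m p + s * dot m q.
  have : dot m x <= dot m (x + t *: u) by rewrite dotDr dotZr lerDl mulr_ge0.
  by rewrite ey /segpt dotDr !dotZr.
have [pq|pq] := lerP (dot m p) (dot m q) => h.
  exists q => //; apply: (le_trans h); have : 0 <= (1 - s) * (dot m q - dot m p) by rewrite mulr_ge0 // subr_ge0.
  lra.
exists p => //; apply: (le_trans h); have : 0 <= s * (dot m p - dot m q) by rewrite mulr_ge0 // subr_ge0 ltW.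
lra.
Qed.

Lemma polygon_face F gam : 0 < gam -> is_polygon F ->
  (exists H, [/\ is_plane H, pg_set F `<=` H & star_shaped_ball H (pg_set F) (gam * diam (pg_set F))]) ->
  exists H c0 n c, [/\ enorm n = 1, H = [set x | dot n (x - c0) = 0],
    star H (pg_set F) c (gam * diam (pg_set F)) (diam (pg_set F)),
    bd H (pg_set F) = \bigcup_(e in pg_edges F) e & 0 < diam (pg_set F)].
Proof.
move=> g0 pF [H' [pH' FH' [c [Hc hs]]]]; case: (pF) => _ [_ [_ [cF [[x0 Fx0] [H [pH FH hcl hb]]]]]].
have rn : relint H (pg_set F) !=set0.
  have : closure (relint H (pg_set F)) x0 by rewrite hcl.
  by move=> /closureE/(_ 1 ltr01)[y ry _]; exists y.
have eH := plane_unique pH pH' rn FH FH'; rewrite -{}eH in FH' pH' Hc hs.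
have [c0 [n [n1 eH]]] := plane_unit pH.
have dF : 0 < diam (pg_set F).
  have [x rx] := rn; have Fx := rx.1; have Hx : dot n (x - c0) = 0 by have := FH _ Fx; rewrite eH.
  have [k [k0 kn _]] := orth2 n n; rewrite dotC in kn; rewrite eH in rx.
  have [e e0 h] := relint_dir rx Hx kn.
  have Fy := h (e / 2); rewrite gtr0_norm ?divr_gt0 // in Fy.
  apply: lt_le_trans (diam_ub cF (Fy ltac:(lra)) Fx).
  by rewrite [x + _]addrC addrK enormZ mulr_gt0 ?enorm_gt0 // normr_gt0 gt_eqF // divr_gt0.
exists H, c0, n, c; split=> //.
have rg : 0 <= gam * diam (pg_set F) by rewrite mulr_ge0 ?ltW.
have Fc : pg_set F c by apply: (hs c Hc _).1; rewrite subrr enorm0.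
split => //; first exact: affine_plane.
- exact: mulr_gt0.
- exact: ltW.
- by move=> x Fx; exact: diam_ub.
- by move=> y Hy hy; exact: (hs y Hy hy).1.
- by move=> y x t Hy hy Fx t01; apply: (hs y Hy hy).2 Fx _ _; apply/segptP; exists t.
Qed.

Lemma polyhedron_elem E gam : 0 < gam -> is_polyhedron E ->
  star_shaped_ball setT (ph_set E) (gam * diam (ph_set E)) ->
  exists c, [/\ star setT (ph_set E) c (gam * diam (ph_set E)) (diam (ph_set E)),
    bd setT (ph_set E) = frontier (ph_set E) & 0 < diam (ph_set E)].
Proof.
move=> g0 [_ _ _ [cE [x0 Ex0]] [hcl hfr]] [c [_ hs]].
have dE : 0 < diam (ph_set E).
  have [x /interiorE[e e0 h]] : interior (ph_set E) !=set0.
    have : closure (interior (ph_set E)) x0 by rewrite hcl.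
    by move=> /closureE/(_ 1 ltr01)[y ry _]; exists y.
  have [k [k0 _ _]] := orth2 0 (0 : pt R).
  have kk : 0 < enorm k by rewrite enorm_gt0.
  pose t := e / (2 * enorm k); have t0 : 0 < t by rewrite divr_gt0 // mulr_gt0.
  have tk : enorm (t *: k) = e / 2 by rewrite enormZ gtr0_norm // /t; field; rewrite gt_eqF.
  have Ex : ph_set E x by apply: h; rewrite subrr enorm0.
  have Ey : ph_set E (x + t *: k) by apply: h; rewrite [x + _]addrC addrK tk; lra.
  by apply: lt_le_trans (diam_ub cE Ey Ex); rewrite [x + _]addrC addrK tk divr_gt0.
exists c; split => //; last first.
  rewrite /bd /frontier -(closure_id _).1; last by case/compactE: cE.
  apply/seteqP; split=> x [Ex h]; split => //; contradict h.
    by split=> //; move: h => /interiorE[e e0 he]; apply/enorm_ballP; exists e => // y /he.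
  by move: h => [_ /enorm_ballP[e e0 he]]; apply/interiorE; exists e => // y /he; exact.
have rg : 0 <= gam * diam (ph_set E) by rewrite mulr_ge0 ?ltW.
split => //.
- exact: mulr_gt0.
- exact: ltW.
- by move=> x Ex; apply: diam_ub => //; apply: (hs c I _).1; rewrite subrr enorm0.
- by move=> y _ hy; exact: (hs y I hy).1.
- by move=> y x t _ hy Ex t01; apply: (hs y I hy).2 Ex _ _; apply/segptP; exists t.
Qed.

Lemma polyhedron_max E m x : is_polyhedron E -> ph_set E x -> exists2 p, ph_nodes E p & dot m x <= dot m p.
Proof.
move=> [_ hF _ [cE _] [_ hfr]] Ex.
have [u [u0 mu0]] : exists u, u != 0 /\ 0 <= dot m u.
  have [k [k0 _ km]] := orth2 m m; by exists k; rewrite dotC km.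
have [t [t0 Et ht]] := ray_exit cE Ex u0.
have : frontier (ph_set E) (x + t *: u).
  split; first exact: subset_closure.
  move=> /interiorE[e e0 h]; have un : 0 < enorm u by rewrite enorm_gt0.
  pose s := e / (2 * enorm u); have s0 : 0 < s by rewrite divr_gt0 // mulr_gt0.
  apply: (ht (t + s)); first by rewrite ltrDl.
  apply: h; have -> : x + (t + s) *: u - (x + t *: u) = s *: u by apply/rowP => i; rewrite !mxE; ring.
  by rewrite enormZ gtr0_norm // (_ : _ * _ = e / 2); [lra | rewrite /s; field; rewrite gt_eqF].
rewrite hfr => -[F EF Ft]; have [p Np hp] := polygon_max m (hF F EF) Ft.
exists p; first by exists F.
by apply: le_trans hp; rewrite dotDr dotZr lerDl mulr_ge0.
Qed.

End Polygons.

Section Exit.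
Context {R : realType}.
Implicit Types (A B H K : set (pt R)) (x y z n p q : pt R).

(** The exit time is the supremum of the initial intervals spent in [B]; the last clause, points
    outside [B] right after it, is what [push] will contradict. *)
Lemma first_exit B (s : R -> pt R) a b : closed B -> continuous s -> a <= b -> B (s a) -> ~ B (s b) ->
  exists t, [/\ a <= t < b, forall u, a <= u <= t -> B (s u), frontier B (s t) &
    forall e, 0 < e -> exists u, t < u < t + e /\ ~ B (s u)].
Proof.
move=> cB cs ab Ba nb.
pose S := [set t | a <= t <= b /\ forall u, a <= u <= t -> B (s u)].
have Sa : S a.
  by split; [rewrite lexx | move=> u /andP[u1 u2]; rewrite (_ : u = a) //; apply/eqP; rewrite eq_le u1 u2].
have hS : has_sup S by split; [exists a | exists b => t [/andP[]]].
have ubS t : S t -> t <= sup S by move=> St; apply: ub_le_sup hS.2 _ St.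
have leb : sup S <= b by apply: ge_sup; [exists a | move=> t [/andP[]]].
have near_s t (P : set (pt R)) : nbhs (s t) P -> exists2 e, 0 < e & forall u, `|u - t| < e -> P (s u).
  move=> /(cs t) /nbhs_ballP[e /= e0 h]; exists e => // u hu; apply: h.
  by rewrite /ball /= distrC.
have BS u : a <= u <= sup S -> B (s u).
  move=> /andP[u1 u2]; apply: cB => P /near_s[e e0 h].
  have [t St ht] := sup_adherent e0 hS.
  have [ut|ut] := lerP u t; first by exists (s u); split; [apply: St.2; rewrite u1 | apply: h; rewrite subrr normr0].
  exists (s t); split; first by apply: St.2; rewrite lexx (andP St.1).1.
  by apply: h; rewrite distrC ger0_norm; lra.
have BSS : B (s (sup S)) by apply: BS; rewrite ubS //= lexx.
have ltb : sup S < b by rewrite lt_neqAle leb andbT; apply: contra_notN nb => /eqP <-.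
have ex e : 0 < e -> exists u, sup S < u < sup S + e /\ ~ B (s u).
  move=> e0; apply: contrapT => hn.
  pose v := Num.min b (sup S + e / 2).
  have [v1 v2] : v <= b /\ v <= sup S + e / 2 by rewrite !ge_min !lexx orbT.
  have vS : sup S < v by rewrite lt_min ltb ltrDl divr_gt0.
  have : S v; last by move/ubS; lra.
  split; first by rewrite v1 andbT (le_trans _ (ltW vS)) // ubS.
  move=> u /andP[u1 u2]; have [us|us] := lerP u (sup S); first by apply: BS; rewrite u1.
  apply: contrapT => nu; apply: hn; exists u; split => //; rewrite us /=; lra.
exists (sup S); split => //; first by rewrite ubS.
split; first exact: subset_closure.
move=> /near_s[e e0 h]; have [u [/andP[u1 u2] nBu]] := ex e e0.
by apply/nBu/h; rewrite ger0_norm; lra.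
Qed.

Lemma ray_cont x (u : pt R) : continuous (fun t : R => x + t *: u).
Proof.
apply: (@lip1_continuous _ _ _ `|u|) => s t; rewrite (_ : x + s *: u - (x + t *: u) = (s - t) *: u); first by rewrite normrZ mulrC.
by rewrite scalerBl opprD addrACA subrr add0r.
Qed.

(* Near a relatively interior point of a face, the cones over the face with
   apex [b] contain the points just off the plane, on the side of [b]. *)
Lemma push n c0 K E x b m : relint [set z | dot n (z - c0) = 0] K x -> dot n (x - c0) = 0 ->
  (forall z t, K z -> 0 <= t <= 1 -> E (segpt z b t)) -> dot n (b - c0) < 0 -> 0 < dot n m ->
  exists2 e, 0 < e & forall s, 0 < s < e -> E (x - s *: m).
Proof.
move=> [Kx /enorm_ballP[e e0 h]] Hx hE nb nm.
pose k := - dot n m / dot n (b - c0); have k0 : 0 < k.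
  by rewrite /k mulNr -mulrN -invrN divr_gt0 // oppr_gt0.
have hk : dot n m = - (k * dot n (b - c0)) by rewrite /k divfK ?lt_eqF // opprK.
clearbody k.
(* [k] makes [w] parallel to the plane, so that [x - s *: m] lies on the segment from a point of the
   plane near [x] to the apex [b]. *)
pose w := - m - k *: (b - x).
have w1 : 0 < enorm w + 1 by rewrite ltr_wpDl ?enorm_ge0.
exists (Num.min (1 / (2 * k)) (e / (2 * (enorm w + 1)))); first by rewrite lt_min !divr_gt0 // mulr_gt0.
move=> s; rewrite lt_min => /and3P[s0 s1 s2].
have sk : s * k < 1 / 2.
  by move: s1; rewrite ltr_pdivlMr ?mulr_gt0 //; lra.
have sk1 : 0 < 1 - s * k by lra.
pose y := x + (s / (1 - s * k)) *: w.
have -> : x - s *: m = segpt y b (s * k).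
  by rewrite segptE /y /w; apply/rowP => i; rewrite !mxE; field; rewrite gt_eqF.
apply: hE; last by rewrite mulr_ge0 ?(ltW s0) ?(ltW k0) //=; lra.
apply: h.
  rewrite /y [x + _]addrC addrK enormZ ger0_norm; last by rewrite divr_ge0 // ltW.
  rewrite mulrAC ltr_pdivrMr //; move: s2; rewrite ltr_pdivlMr ?mulr_gt0 // => s2.
  have : 0 < e * (1 / 2 - s * k) by rewrite mulr_gt0 //; lra.
  have := enorm_ge0 w; lra.
apply/(plane_dir _ Hx); rewrite /y [x + _]addrC addrK dotZr.
rewrite (_ : dot n w = 0) ?mulr0 // /w.
have -> : b - x = (b - c0) - (x - c0) by apply/rowP => i; rewrite !mxE; ring.
move: Hx nb hk; move: (b - c0) (x - c0) => p q Hx nb hk.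
by rewrite !dotDr !dotNr dotZr dotDr dotNr Hx hk; ring.
Qed.

End Exit.

(** * Non-incident edges and faces are far apart *)

Section Separation.
Context {R : realType}.
Implicit Types (F G : polygon R) (E : polyhedron R) (x y z p q c : pt R).

Lemma node_edge F p : is_polygon F -> pg_nodes F p -> exists2 e, pg_edges F e & endpoint e p /\ e p.
Proof.
move=> pF [e Fe ep]; exists e => //; split=> //.
by case: ep => q [_ ->]; exact: segment_l.
Qed.

(** [bd_path] between the edge [e] and the union of the other edges of the face: the meeting point
    is common to two edges, hence an end point of [e]. *)
Lemma edge_separation F H c r D e e1 x y : is_polygon F -> star H (pg_set F) c r D ->
  bd H (pg_set F) = \bigcup_(e in pg_edges F) e ->
  pg_edges F e -> pg_edges F e1 -> e <> e1 -> e x -> e1 y -> enorm (x - y) <= r / 2 ->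
  exists2 p, endpoint e p & enorm (p - x) <= 2 * (1 + D / r) * enorm (x - y).
Proof.
move=> pF S hb Fe Fe1 ne ex e1y xy.
pose B := \bigcup_(f in [set f | pg_edges F f /\ f <> e]) f.
have cl f : pg_edges F f -> closed f by move=> /(edge_compact pF)/compactE[].
have cB : closed B.
  apply: fin_closed => [|f [Ff _]]; last exact: cl.
  by case: pF => ff _; apply: sub_finite_set ff => f [].
have bx f z : pg_edges F f -> f z -> bd H (pg_set F) z by move=> Ff fz; rewrite hb; exists f.
have [||z [bz ez [f [Ff nf] fz] hz]] := bd_path S (bx _ _ Fe ex) (bx _ _ Fe1 e1y) xy (cl _ Fe) cB _ ex.
- move=> z; rewrite hb => -[f Ff fz]; have [<-|fe] := pselect (f = e); first by left.
  by right; exists f.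
- by exists e1 => //; split => // h; apply: ne.
have [//|e0|[p [ep _ e0]]] := (pF.2.2.1 e f Fe Ff) _; first by move=> h; apply: nf.
  by exfalso; have : (e `&` f) z by []; rewrite e0.
exists p => //; suff <- : z = p by [].
by have : (e `&` f) z by []; rewrite e0.
Qed.

Definition diams_ok (gam : R) E := forall F, ph_faces E F -> exists H c0 n c, [/\ enorm n = 1, H = [set x | dot n (x - c0) = 0],
    star H (pg_set F) c (gam * diam (pg_set F)) (diam (pg_set F)),
    bd H (pg_set F) = \bigcup_(e in pg_edges F) e & 0 < diam (pg_set F)].

(* Points of a face lying close to an edge [e] not belonging to it, or of another
   edge, are close to an end point of [e]. *)
Lemma face_separation (gam rho d : R) E c e x z G : 0 < gam -> is_polyhedron E ->
  star setT (ph_set E) c (gam * diam (ph_set E)) (diam (ph_set E)) ->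
  bd setT (ph_set E) = frontier (ph_set E) -> 0 < diam (ph_set E) -> diams_ok gam E ->
  ph_edges E e -> e x -> (forall F, ph_faces E F -> pg_edges F e -> rho <= diam (pg_set F)) -> rho <= diam (ph_set E) ->
  let k := 2 * (1 + gam^-1) in 0 < d -> k * d <= gam * rho / 2 ->
  ph_faces E G -> pg_set G z -> (~ pg_edges G e \/ exists2 e1, pg_edges G e1 & e1 <> e /\ e1 z) ->
  enorm (x - z) <= d -> exists2 p, endpoint e p & enorm (p - x) <= k ^+ 2 * d.
Proof.
move=> g0 pE S hb dE hF [F0 EF0 Fe0] ex hrho hrhoE k d0 kd EG Gz hGz xz.
case: (pE) => fF hp hm _ [_ hfr].
have kE : 2 * (1 + diam (ph_set E) / (gam * diam (ph_set E))) = k.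
  by rewrite /k; congr (2 * (1 + _)); field; rewrite !gt_eqF.
have k2 : 2 <= k by rewrite /k mulrDr mulr1 lerDl mulr_ge0 // invr_ge0 ltW.
have dk : d <= k * d by rewrite ler_peMl ?(ltW d0) //; lra.
have kk : k * d <= k ^+ 2 * d by rewrite expr2 -mulrA ler_peMl ?(le_trans _ dk) ?(ltW d0) //; lra.
have two G0 e1 y : ph_faces E G0 -> pg_edges G0 e -> pg_edges G0 e1 -> e1 <> e -> e1 y -> enorm (x - y) <= k * d ->
    exists2 p, endpoint e p & enorm (p - x) <= k ^+ 2 * d.
  move=> EG0 Ge Ge1 ne ye xy; have [H [c0 [n [cF [n1 eH SF hbF dF]]]]] := hF _ EG0.
  have [||p ep hp'] := edge_separation (hp _ EG0) SF hbF Ge Ge1 _ ex ye; first by move=> h; apply: ne.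
    apply: (le_trans xy); apply: (le_trans kd); rewrite ler_pM2r ?invr_gt0 // ler_pM2l //.
    exact: hrho.
  exists p => //; apply: (le_trans hp'); rewrite (_ : 2 * _ = k); last first.
    by rewrite /k; congr (2 * (1 + _)); field; rewrite !gt_eqF.
  by rewrite expr2 -mulrA ler_pM2l //; lra.
have [Ge|nGe] := pselect (pg_edges G e).
  case: hGz => [//|[e1 Ge1 [ne e1z]]].
  by apply: (two G e1 z) => //; exact: le_trans dk.
(* A boundary path from [x] to [z] passes from the faces having the edge [e] to the others at some
   [w]. There [w] is a node, or lies on an edge different from [e], of a face that has [e]; this
   reduces to the planar case [two]. *)
pose A := \bigcup_(F in [set F | ph_faces E F /\ pg_edges F e]) pg_set F.
pose B := \bigcup_(F in [set F | ph_faces E F /\ ~ pg_edges F e]) pg_set F.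
have cl F : ph_faces E F -> closed (pg_set F).
  by move=> /hp; case=> _ [_ [_ [/compactE[]]]].
have cA : closed A by apply: fin_closed => [|F [EF _]]; [apply: sub_finite_set fF => F [] | exact: cl].
have cB : closed B by apply: fin_closed => [|F [EF _]]; [apply: sub_finite_set fF => F [] | exact: cl].
have bE F y : ph_faces E F -> pg_set F y -> bd setT (ph_set E) y by move=> EF Fy; rewrite hb hfr; exists F.
have xF0 := edge_sub (hp _ EF0) Fe0 ex.
have [||||w [bw [F1 [EF1 Fe1] F1w] [F2 [EF2 Fe2] F2w]]] := bd_path S (bE _ _ EF0 xF0) (bE _ _ EG Gz) _ cA cB.
- apply: (le_trans xz); apply: (le_trans dk); apply: (le_trans kd).
  by rewrite ler_pM2r ?invr_gt0 // ler_pM2l.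
- move=> y; rewrite hb hfr => -[F EF Fy]; have [Fe|Fe] := pselect (pg_edges F e).
    by left; exists F.
  by right; exists F.
- by exists F0.
- by exists G.
rewrite kE => hw; have {}hw : enorm (x - w) <= k * d.
  by rewrite enormB (le_trans hw) // ler_wpM2l //; lra.
have F12 : F1 <> F2 by move=> h; apply: Fe2; rewrite -h.
case: (hm _ _ EF1 EF2 F12) => [e0|[p [Np1 Np2 e0]]|[e1 [Fe11 Fe21 e0]]].
- by exfalso; have : (pg_set F1 `&` pg_set F2) w by []; rewrite e0.
- have wp : w = p by have : (pg_set F1 `&` pg_set F2) w by []; rewrite e0.
  have [e1 Fe1' [ep e1p]] := node_edge (hp _ EF1) Np1.
  have [ee|ne] := pselect (e1 = e); last by apply: (two F1 e1 w); rewrite ?wp // -?wp.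
  by exists p; [rewrite -ee | rewrite -wp enormB (le_trans hw)].
- have e1w : e1 w by have : (pg_set F1 `&` pg_set F2) w by []; rewrite e0.
  by apply: (two F1 e1 w) => // h; apply: Fe2; rewrite -h.
Qed.

(** [bd_path] between [F] and the union of the other faces: the meeting point lies on an edge of
    [F], since distinct faces meet in a node or in an edge. *)
Lemma face_boundary_separation (gam d : R) E c F G x z : 0 < gam -> is_polyhedron E ->
  star setT (ph_set E) c (gam * diam (ph_set E)) (diam (ph_set E)) ->
  bd setT (ph_set E) = frontier (ph_set E) -> 0 < diam (ph_set E) ->
  ph_faces E F -> ph_faces E G -> F <> G -> pg_set F x -> pg_set G z ->
  let k := 2 * (1 + gam^-1) in 0 < d -> d <= gam * diam (ph_set E) / 2 -> enorm (x - z) <= d ->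
  exists e y, [/\ pg_edges F e, e y & enorm (y - x) <= k * d].
Proof.
move=> g0 pE S hb dE EF EG FG Fx Gz k d0 dk xz.
case: (pE) => fF hp hm _ [_ hfr].
have kE : 2 * (1 + diam (ph_set E) / (gam * diam (ph_set E))) = k.
  by rewrite /k; congr (2 * (1 + _)); field; rewrite !gt_eqF.
have k2 : 2 <= k by rewrite /k mulrDr mulr1 lerDl mulr_ge0 // invr_ge0 ltW.
pose B := \bigcup_(F' in [set F' | ph_faces E F' /\ F' <> F]) pg_set F'.
have cl F' : ph_faces E F' -> closed (pg_set F').
  by move=> /hp; case=> _ [_ [_ [/compactE[]]]].
have cB : closed B by apply: fin_closed => [|F' [EF' _]]; [apply: sub_finite_set fF => F' [] | exact: cl].
have bE F' y : ph_faces E F' -> pg_set F' y -> bd setT (ph_set E) y by move=> EF' Fy; rewrite hb hfr; exists F'.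
have [||||w [bw F1w [F2 [EF2 F2n] F2w]]] := bd_path S (bE _ _ EF Fx) (bE _ _ EG Gz) _ (cl _ EF) cB.
- exact: le_trans xz dk.
- move=> y; rewrite hb hfr => -[F' EF' Fy]; have [<-|Fe] := pselect (F' = F); first by left.
  by right; exists F'.
- by [].
- by exists G => //; split=> // h; apply: FG.
rewrite kE => hw; have {}hw : enorm (w - x) <= k * d.
  by rewrite (le_trans hw) // ler_wpM2l //; lra.
have F12 : F <> F2 by move=> h; apply: F2n.
case: (hm _ _ EF EF2 F12) => [e0|[p [Np1 Np2 e0]]|[e1 [Fe11 Fe21 e0]]].
- by exfalso; have : (pg_set F `&` pg_set F2) w by []; rewrite e0.
- have wp : w = p by have : (pg_set F `&` pg_set F2) w by []; rewrite e0.
  have [e1 Fe1' [ep e1p]] := node_edge (hp _ EF) Np1.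
  by exists e1, w; split => //; rewrite wp.
- by exists e1, w; split => //; have : (pg_set F `&` pg_set F2) w by []; rewrite e0.
Qed.

Lemma ph_edge_frontier E e : is_polyhedron E -> ph_edges E e -> e `<=` frontier (ph_set E).
Proof.
move=> [_ hp _ _ [_ hfr]] [F EF Fe] x ex; rewrite hfr; exists F => //.
exact: edge_sub (hp _ EF) Fe _ ex.
Qed.

Lemma meet_frontier E E' : is_polyhedron E -> elements_meet_properly E E' ->
  ph_set E `&` ph_set E' `<=` frontier (ph_set E).
Proof.
move=> pE; case: (pE) => [_ hp _ _ [_ hfr]] [->//|[p [[F EF Fp] _ ->]] _ ->|[e [Ee _ ->]]|[F [EF _ ->]]].
- by rewrite hfr; exists F => //; exact: node_in (hp _ EF) Fp.
- exact: ph_edge_frontier.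
- by move=> x Fx; rewrite hfr; exists F.
Qed.

Lemma interior_disjoint E E' x : is_polyhedron E -> (E <> E' -> elements_meet_properly E E') ->
  interior (ph_set E) x -> ph_set E' x -> E = E'.
Proof.
move=> pE hm ix E'x; apply: contrapT => /hm h.
by have [] := meet_frontier pE h (conj (interior_subset ix) E'x).
Qed.

End Separation.

(** * Weak derivatives of Lipschitz maps *)

Section Density.
Context {R : realType}.
Notation lam := (@lebesgue_measure R).

Lemma cumulative_of (m : R -> R) (c : R) : (forall s t, s <= t -> 0 <= m t - m s <= c * (t - s)) ->
  exists f : cumulative R R, f = m :> (R -> R).
Proof.
move=> hm.
have nd : nondecreasing m by move=> s t st; have /andP[] := hm s t st; rewrite subr_ge0.
have rc : right_continuous m.
  move=> x; apply: cvg_at_right_filter; apply/cvgrPdist_lt => e e0; near=> y.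
  have c1 : 0 < `|c| + 1 by rewrite ltr_wpDl.
  have : `|y - x| < e / (`|c| + 1).
    by near: y; apply/nbhs_ballP; exists (e / (`|c| + 1)); [exact: divr_gt0 | move=> z; rewrite /ball /= distrC].
  have key s t : s <= t -> `|m t - m s| <= (`|c| + 1) * `|t - s|.
    move=> st; have /andP[a b] := hm s t st; rewrite (ger0_norm a) (ger0_norm (_ : 0 <= t - s)) ?subr_ge0 // (le_trans b) // ler_wpM2r ?subr_ge0 //.
    by rewrite (le_trans (ler_norm c)) // lerDl.
  rewrite ltr_pdivlMr // mulrC; apply: le_lt_trans.
  by case/orP: (le_total x y) => /key; rewrite // distrC [`|_ - x|]distrC.
by by exists (HB.pack_for (cumulative R R) m (isCumulative.Build R _ R m nd rc)).
Unshelve. all: by end_near. Qed.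

Lemma stieltjes_itv (f : cumulative R R) a b : a <= b -> lebesgue_stieltjes_measure f `]a, b] = (f b - f a)%:E.
Proof.
move=> ab; rewrite /lebesgue_stieltjes_measure/= /measure_extension/= measurable_mu_extE/=; last by exists (a, b).
by rewrite wlength_itv_bnd.
Qed.

(** The Stieltjes measures of [m] and of [c t - m] add up to [c] times Lebesgue measure, so Lebesgue
    null sets are null for both. *)
Lemma lip_dominated (m m2 : cumulative R R) (c : R) : 0 < c -> (forall t, m2 t = c * t - m t) ->
  forall A, measurable A -> lam A = 0 -> lebesgue_stieltjes_measure m A = 0.
Proof.
move=> c0 hm A mA lA.
have ci : 0 <= c^-1 by rewrite invr_ge0 ltW.
pose mu := mscale (NngNum ci) (measure_add (lebesgue_stieltjes_measure m) (lebesgue_stieltjes_measure m2)).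
have muE B : mu B = (c^-1%:E * (lebesgue_stieltjes_measure m B + lebesgue_stieltjes_measure m2 B))%E.
  by rewrite -measure_addE.
have : lam A = mu A.
  apply: lebesgue_measure_unique => // _ [[a b] /= ab <-].
  apply: etrans (esym (muE _)).
  have [ab'|ba] := leP a b; last by rewrite set_itv_ge ?bnd_simp -?leNgt ?ltW // !measure0 adde0 mule0.
  rewrite /lebesgue_measure !stieltjes_itv // -EFinD -EFinM !hm /=; congr EFin; by field; rewrite gt_eqF.
rewrite lA muE => /esym/eqP; rewrite mule_eq0 => /orP[|].
  by rewrite eqe invr_eq0 gt_eqF.
by rewrite padde_eq0 ?measure_ge0 // => /andP[/eqP].
Qed.

Lemma lip_density (m : R -> R) (c a b : R) : 0 < c -> (forall s t, s <= t -> 0 <= m t - m s <= c * (t - s)) -> a < b ->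
  exists f : R -> R, lam.-integrable setT (EFin \o f) /\
   forall x y, a <= x -> x <= y -> y <= b -> (\int[lam]_(t in `]x, y]) (f t)%:E = (m y - m x)%:E)%E.
Proof.
move=> c0 hm ab; have [cm ecm] := cumulative_of hm.
have hm2 s t : s <= t -> 0 <= (c * t - m t) - (c * s - m s) <= c * (t - s).
  by move=> /hm /andP[h1 h2]; apply/andP; split; lra.
have [cm2 ecm2] := cumulative_of hm2.
pose mu := lebesgue_stieltjes_measure cm.
have mab : measurable (`]a, b] : set (measurableTypeR R)) by exact: measurable_itv.
have fab : (mu `]a, b]%classic < +oo)%E by rewrite /mu stieltjes_itv ?ltW // ltry.
(* Restriction to []a, b]] makes the Stieltjes measure finite before Radon-Nikodym is applied. *)
pose nu := mfrestr mab fab.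
have dom : nu `<< lam.
  apply/null_content_dominatesP => A mA lA; rewrite /nu /mfrestr /mrestr.
  apply: (@lip_dominated cm cm2 c c0); [by move=> t; rewrite ecm2 ecm | exact: measurableI | ].
  by apply: (subset_measure0 _ _ _ lA) => //; exact: measurableI.
have [f [f0 ffin intf fE]] := radon_nikodym_sigma_finite dom.
exists (fine \o f); split.
  by apply: eq_integrable intf => // x _ /=; rewrite fineK.
move=> x y ax xy yb; transitivity (\int[lam]_(t in `]x, y]) f t)%E.
  by apply: eq_integral => t _; rewrite fineK.
rewrite -fE; last exact: measurable_itv.
transitivity (mu (`]x, y]%classic `&` `]a, b]%classic)); first by [].
rewrite setIidl; first by rewrite /mu stieltjes_itv // ecm.
by move=> z /=; rewrite !in_itv /= => /andP[xz zy]; rewrite (le_lt_trans ax xz) (le_trans zy yb).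
Qed.

Lemma quot_cvg (V : normedModType R) (f : V -> R) x v : derivable f x v ->
  (fun n => n.+1%:R * (f (n.+1%:R^-1 *: v + x) - f x)) @ \oo --> 'D_v f x.
Proof.
move=> df; pose u (n : nat) : R := n.+1%:R^-1.
have u0 : u n @[n --> \oo] --> 0^'.
  move=> B hB; have h1 : \forall n \near \oo, u n != 0 -> B (u n) := @cvg_harmonic R _ hB.
  have h2 : \forall n \near \oo, B (u n).
    by apply: filterS h1 => n; apply; rewrite /u invr_eq0 pnatr_eq0.
  exact: h2.
have := cvg_comp _ _ u0 df; apply: cvg_trans; apply: near_eq_cvg; near=> n.
by rewrite /= /u invrK.
Unshelve. all: by end_near. Qed.

(** Adding [K t] makes [k] nondecreasing with slope at most [2 K], and [K] is subtracted from the
    density afterwards. The almost everywhere fundamental theorem of calculus identifies the density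
    with the limit of the forward quotients that define [jac]. *)
Lemma lip_density_K (k : R -> R) (K a b : R) : 0 < K -> (forall s t, `|k s - k t| <= K * `|s - t|) -> a < b ->
  exists f : R -> R, lam.-integrable `]a, b] (EFin \o f) /\
   (\int[lam]_(t in `]a, b]) (f t)%:E = (k b - k a)%:E)%E /\
   {ae lam, forall t, a < t < b -> (fun n => n.+1%:R * (k (n.+1%:R^-1 + t) - k t)) @ \oo --> f t}.
Proof.
move=> K0 hk ab; pose m t := k t + K * t.
have hm s t : s <= t -> 0 <= m t - m s <= 2 * K * (t - s).
  move=> st; have := hk t s; rewrite (ger0_norm (_ : 0 <= t - s)) ?subr_ge0 // ler_norml => /andP[h1 h2].
  by rewrite /m; apply/andP; split; lra.
have K2 : 0 < 2 * K by rewrite mulr_gt0.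
have [f [intf hf]] := lip_density K2 hm ab.
have mitv : measurable (`]a, b] : set (measurableTypeR R)) by exact: measurable_itv.
have intfab : lam.-integrable `]a, b] (EFin \o f) by exact: integrableS intf.
have lab : lam `]a, b]%classic = (b - a)%:E by rewrite lebesgue_measure_itv /= lte_fin ab EFinB.
exists (fun t => f t - K).
have intc : lam.-integrable `]a, b] (EFin \o cst K).
  apply: measurable_bounded_integrable => //; first by apply: (eq_ind_r (fun z => z < +oo)%E _ lab); rewrite ltry.
  exact: bounded_cst.
split; last split.
- by have := integrableB mitv intfab intc.
- transitivity (\int[lam]_(t in `]a, b]) ((f t)%:E - K%:E))%E; first by apply: eq_integral => t _; rewrite EFinB.
  rewrite integralB // hf ?(ltW ab) //.
  have -> : (\int[lam]_(x in `]a, b]) K%:E = (K * (b - a))%:E)%E.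
    by apply: etrans (integral_cst lam mitv K%:E) _; rewrite EFinM; congr (_ * _)%E; exact: lab.
  by rewrite -EFinB; congr EFin; rewrite /m; ring.
- pose F x := (\int[lam]_(t in `]-oo, x]) (f t))%R.
  have intfy y : lam.-integrable `]-oo, y] (EFin \o f) by apply: integrableS intf => //; exact: measurable_itv.
  have := FTC1Ny intfy (open_integrable_locally openT intf).
  apply: filterS; first exact: (ae_filter_ringOfSetsType lam).
  move=> t [dF eF] /andP[at_ tb].
  have FB x y : a <= x -> x <= y -> y <= b -> F y - F x = m y - m x.
    move=> ax xy yb; rewrite /F (@Rintegral_itvB _ f -oo%O (BRight y) x) // /Rintegral hf //.
  have := quot_cvg dF; rewrite -derive1E eF.
  move=> /cvgrPdist_lt h1; apply/cvgrPdist_lt => e e0.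
  near=> n.
  have h2 : t + n.+1%:R^-1 <= b.
    near: n; have bt : 0 < b - t by rewrite subr_gt0.
    near=> n; rewrite -lerBrDl ltW //; near: n; exact: (near_infty_natSinv_lt (PosNum bt)).
  have h3 : `|f t - n.+1%:R * (F (n.+1%:R^-1 *: 1 + t) - F t)| < e by near: n; exact: h1.
  move: h3; rewrite [_ *: 1]mulr1 [_ + t]addrC FB ?(ltW at_) // ?lerDl ?invr_ge0 //.
  have -> : n.+1%:R * (m (t + n.+1%:R^-1) - m t) = n.+1%:R * (k (t + n.+1%:R^-1) - k t) + K.
    by rewrite /m; field.
  by rewrite opprD addrA addrAC.
Unshelve. all: by end_near. Qed.

End Density.

(** * Measurability, integration by parts on lines, Fubini *)

Section Meas.
Context {R : realType}.
Notation lam := (@lebesgue_measure R).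

Lemma limn_sup_bound (u : R^nat) a b : (forall n, a <= u n <= b) -> a <= limn_sup u <= b.
Proof.
move=> hu.
have ub : has_ubound (range u) by exists b => _ [n _ <-]; have /andP[] := hu n.
have lb : has_lbound (range u) by exists a => _ [n _ <-]; have /andP[] := hu n.
have eq : limn_sup u = inf (range (sups u)).
  by apply/cvg_lim => //; exact: cvg_sups_inf.
have hs n : a <= sups u n <= b.
  apply/andP; split.
    have /andP[h1 _] := hu n; apply: (le_trans h1); apply: ub_le_sup; first exact: has_ubound_sdrop.
    by exists n => /=.
  apply: ge_sup; first by exists (u n), n => /=.
  by move=> _ [k _ <-]; have /andP[] := hu k.
rewrite eq; apply/andP; split.
  apply: lb_le_inf; first by exists (sups u 0%N), 0%N.
  by move=> _ [n _ <-]; have /andP[] := hs n.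
have /andP[_ h2] := hs 0%N; apply: le_trans h2; apply: ge_inf; last by exists 0%N.
by exists a => _ [n _ <-]; have /andP[] := hs n.
Qed.

Lemma integrable_bounded d (T : measurableType d) (mu : {measure set T -> \bar R}) (A : set T) (f : T -> R) C :
  measurable A -> (mu A < +oo)%E -> measurable_fun setT f -> (forall x, `|f x| <= C) -> (forall x, ~ A x -> f x = 0) ->
  mu.-integrable setT (EFin \o f).
Proof.
move=> mA fA mf hC h0.
have -> : EFin \o f = (EFin \o f) \_ A.
  apply/funext => x; rewrite patchE; case: ifPn => // /negP; rewrite inE => nA /=; by rewrite h0.
have [hm _] := @integrable_mkcond _ _ _ mu A (EFin \o f) mA; apply: hm; apply: measurable_bounded_integrable => //; first exact: measurable_funTS.
exists C; split; first exact: num_real.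
by move=> M CM x _; exact: le_trans (hC x) (ltW CM).
Qed.

(** Measurability for the product sigma-algebra on triples: [f] is the pointwise limit of its values
    at grid points of mesh [1 / (n + 1)], and each approximation takes countably many values on
    boxes. *)
Lemma measurable_cont (f : pt R -> R) : continuous f -> measurable_fun setT (f \o vec3).
Proof.
move=> cf; pose q n (x : R) : int := Num.floor (n.+1%:R * x).
pose g n (t : int * int * int) : pt R := vec3 (t.1.1%:~R / n.+1%:R, t.1.2%:~R / n.+1%:R, t.2%:~R / n.+1%:R).
pose Q n (u : R * R * R) := (q n u.1.1, q n u.1.2, q n u.2).
apply: (@measurable_fun_cvg _ _ R setT (fun n u => f (g n (Q n u))) (f \o vec3)).
  move=> n _ B mB; rewrite setTI.
  have mq a : measurable (q n @^-1` [set a]).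
    have -> : q n @^-1` [set a] = `[a%:~R / n.+1%:R, (a + 1)%:~R / n.+1%:R[%classic.
      apply/seteqP; split => x /=; rewrite in_itv /=.
        move=> <-; rewrite ler_pdivrMr // ltr_pdivlMr // mulrC; exact: floor_itv.
      by rewrite ler_pdivrMr // ltr_pdivlMr // mulrC => h; apply/eqP; rewrite floor_eq.
    exact: measurable_itv.
  have -> : (fun u => f (g n (Q n u))) @^-1` B =
      \bigcup_(t : int * int * int) ([set u | B (f (g n t)) /\ Q n u = t]).
    apply/seteqP; split => [u Bu|u [t _ [Bt Qt]]]; first by exists (Q n u).
    by rewrite /= Qt.
  apply: countable_bigcupT_measurable => // t.
  have [Bt|nB] := pselect (B (f (g n t))); last first.
    rewrite (_ : [set u | _] = set0) //; by apply/seteqP; split => u // -[].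
  rewrite (_ : [set u | _] = (q n @^-1` [set t.1.1] `*` q n @^-1` [set t.1.2]) `*` q n @^-1` [set t.2]).
    by apply: measurableX; [apply: measurableX|].
  case: t Bt => [[a b] c] Bt; apply/seteqP; split => [[[x y] z] /= [_ [h1 h2 h3]] //|[[x y] z] /= [[h1 h2] h3]].
  by split => //; rewrite /Q /= h1 h2 h3.
move=> u _; apply: (cvg_comp (fun n => g n (Q n u)) f); last exact: cf.
apply/cvgrPdist_le => e e0; near=> n.
apply: mx_norm_le; first exact: ltW.
move=> i0 j; rewrite (ord1 i0) !mxE.
have key x : `|x - (q n x)%:~R / n.+1%:R| <= e.
  apply: (@le_trans _ _ n.+1%:R^-1); last by rewrite ltW //; near: n; exact: (near_infty_natSinv_lt (PosNum e0)).
  have /andP[h1 h2] := floor_itv (n.+1%:R * x).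
  have -> : x - (q n x)%:~R / n.+1%:R = (n.+1%:R * x - (q n x)%:~R) / n.+1%:R by field.
  rewrite normrM (@ger0_norm _ n.+1%:R^-1) // ler_piMl // ger0_norm ?subr_ge0 //.
  by rewrite lerBlDl ltW // -[X in _ < _ + X]/(1%:~R) -intrD.
by case: j => [[|[|[|j]]] hj] //=.
Unshelve. all: by end_near. Qed.

(* Integrate the derivative of the Lipschitz function [g * phi], which vanishes at both ends. *)
Lemma weak_slice (g phi dphi : R -> R) (K C B : R) : 0 < K -> 0 < C -> 0 < B ->
  (forall s t, `|g s - g t| <= K * `|s - t|) -> (forall s t, `|g s * phi s - g t * phi t| <= C * `|s - t|) ->
  (forall t, (fun n => n.+1%:R * (phi (n.+1%:R^-1 + t) - phi t)) @ \oo --> dphi t) ->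
  (forall t, B <= `|t| -> phi t = 0 /\ dphi t = 0) ->
  let H t := g t * dphi t + limn_sup (fun n => n.+1%:R * (g (n.+1%:R^-1 + t) - g t)) * phi t in
  measurable_fun setT H -> (\int[lam]_t (H t)%:E = 0)%E.
Proof.
move=> K0 C0 B0 gL kL hphi supp H mH.
have BB : - B < B by lra.
pose I := `]- B, B]%classic : set R.
have [fg [_ [_ ag]]] := lip_density_K K0 gL BB; have [fk [intk [eqk ak]]] := lip_density_K C0 kL BB.
have mitv : measurable (I : set (measurableTypeR R)) by exact: measurable_itv.
have -> : (\int[lam]_t (H t)%:E = \int[lam]_(t in I) (H t)%:E)%E.
  rewrite [RHS]integral_mkcond; apply: eq_integral => t _; rewrite patchE; case: ifPn => // /negP; rewrite inE /I /= in_itv /= => nt.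
  have [|h1 h2] := supp t; last by rewrite /H h1 h2 !mulr0 addr0.
  by rewrite leNgt; apply/negP; rewrite ltr_norml => /andP[h1 h2]; apply: nt; rewrite h1 ltW.
transitivity (\int[lam]_(t in I) (fk t)%:E)%E; last first.
  have [p1 _] := supp B (ler_norm B); have [|p2 _] := supp (- B); first by rewrite normrN ler_norm.
  by rewrite eqk p1 p2 !mulr0 subrr.
apply: ae_eq_integral => //.
- by apply/measurable_EFinP; exact: measurable_funTS.
- exact: measurable_int intk.
have F := ae_filter_ringOfSetsType lam.
have aB : {ae lam, forall t, t != B}.
  exists [set B]; split; [exact: measurable_set1 | exact: lebesgue_measure_set1 | by move=> t /= /negP; rewrite negbK => /eqP].
move: ag ak aB; apply: filterS3 => t hg hk tB; rewrite /I /= in_itv /= => /andP[t1 t2].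
have tt : - B < t < B by rewrite t1 lt_neqAle tB.
congr EFin; rewrite /H; have h1 := hg tt; have h2 := hk tt.
rewrite (cvg_limn_inf_sup h1).2.
have gc : (fun n => g (n.+1%:R^-1 + t)) @ \oo --> g t.
  apply/cvgrPdist_le => e e0; near=> n; apply: (le_trans (gL _ _)).
  rewrite opprD addrCA subrr addr0 normrN ger0_norm // -ler_pdivlMl //.
  by rewrite ltW //; near: n; have eK : 0 < K^-1 * e by [rewrite mulr_gt0 // invr_gt0]; exact: (near_infty_natSinv_lt (PosNum eK)).
(* Discrete product rule; by uniqueness of limits the integrand is almost everywhere the density of
   [g * phi]. *)
have h3 : (fun n => n.+1%:R * (g (n.+1%:R^-1 + t) * phi (n.+1%:R^-1 + t) - g t * phi t)) @ \oo --> g t * dphi t + fg t * phi t.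
  have -> : (fun n => n.+1%:R * (g (n.+1%:R^-1 + t) * phi (n.+1%:R^-1 + t) - g t * phi t)) =
     (fun n => g (n.+1%:R^-1 + t) * (n.+1%:R * (phi (n.+1%:R^-1 + t) - phi t)) + (n.+1%:R * (g (n.+1%:R^-1 + t) - g t)) * phi t).
    by apply/funext => n; ring.
  by apply: cvgD; apply: cvgM => //; exact: cvg_cst.
exact: (cvg_unique _ h3 h2).
Unshelve. all: by end_near. Qed.

Definition itvB (B : R) : set R := `]- B, B]%classic.
Definition cube (B : R) : set (R * R * R) := (itvB B `*` itvB B) `*` itvB B.

Lemma box_measure (B : R) : 0 < B -> measurable (cube B) /\
  ((@leb3 R) (cube B) < +oo)%E /\ ((lam \x lam)%E (itvB B `*` itvB B) < +oo)%E.
Proof.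
move=> B0; have mI : measurable (itvB B : set R) by exact: measurable_itv.
have mI2 : measurable (itvB B `*` itvB B : set (R * R)) by exact: measurableX.
split; first exact: measurableX.
have lI : lam (itvB B) = (B + B)%:E by rewrite /itvB lebesgue_measure_itv /= lte_fin (_ : - B < B) ?EFinN ?oppeK //; lra.
have l2 : (lam \x lam)%E (itvB B `*` itvB B) = ((B + B) * (B + B))%:E.
  by rewrite (@product_measure1E _ _ (measurableTypeR R) (measurableTypeR R) R lam lam (itvB B) (itvB B) mI mI) EFinM; congr (_ * _)%E.
have l3 : (@leb3 R) (cube B) = ((B + B) * (B + B) * (B + B))%:E.
  have p := @product_measure1E _ _ (measurableTypeR R * measurableTypeR R)%type (measurableTypeR R) R (lam \x lam)%E lam (itvB B `*` itvB B) (itvB B) mI2 mI.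
  by apply: (eq_trans p); rewrite EFinM; congr (_ * _)%E.
by rewrite l3 l2 !ltry.
Qed.

Notation T1 := (measurableTypeR R).

Lemma itvB_cover (x : R) : exists N : nat, forall n, (N <= n)%N -> itvB n.+1%:R x.
Proof.
exists (Num.bound `|x|) => n Nn; rewrite /itvB /= in_itv /=.
have := archi_boundP (normr_ge0 x); rewrite ltr_norml => /andP[h1 h2].
have h3 : (Num.bound `|x|)%:R <= n.+1%:R :> R by rewrite ler_nat (leq_trans Nn).
by rewrite (ltW (lt_le_trans h2 h3)) andbT (le_lt_trans _ h1) // lerN2.
Qed.

Lemma lam2_sigma_finite : sigma_finite setT (lam \x lam)%E.
Proof.
exists (fun n : nat => itvB n.+1%:R `*` itvB n.+1%:R).
  apply/seteqP; split => // -[x y] _; have [N hN] := itvB_cover x; have [N' hN'] := itvB_cover y.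
  by exists (maxn N N') => //; split; [apply: hN; exact: leq_maxl | apply: hN'; exact: leq_maxr].
move=> n; split; last by have [_ []] := @box_measure n.+1%:R (ltr0Sn _ _).
by apply: measurableX; exact: measurable_itv.
Qed.

(** The planar measure packed as sigma-finite, so that Fubini applies to [leb3] as plane times
    line. *)
Definition lam2 : {sigma_finite_measure set (T1 * T1)%type -> \bar R} :=
  HB.pack_for {sigma_finite_measure set (T1 * T1)%type -> \bar R} (lam \x lam)%E
    (@Measure_isSigmaFinite.Build _ _ _ (lam \x lam)%E lam2_sigma_finite).

Lemma leb3_21 (H : R * R * R -> R) : (@leb3 R).-integrable setT (EFin \o H) ->
  (\int[lam]_z \int[lam2]_v (H (v, z))%:E = \int[@leb3 R]_u (H u)%:E)%E.
Proof. move=> iH; exact: (@integral21_prod_meas1 _ _ _ _ R lam2 lam (EFin \o H) iH). Qed.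
Lemma leb3_12 (H : R * R * R -> R) : (@leb3 R).-integrable setT (EFin \o H) ->
  (\int[lam2]_v \int[lam]_z (H (v, z))%:E = \int[@leb3 R]_u (H u)%:E)%E.
Proof. move=> iH; exact: (@integral12_prod_meas1 _ _ _ _ R lam2 lam (EFin \o H) iH). Qed.
Lemma lam2_21 (H : R * R -> R) : lam2.-integrable setT (EFin \o H) ->
  (\int[lam]_y \int[lam]_x (H (x, y))%:E = \int[lam2]_u (H u)%:E)%E.
Proof. move=> iH; exact: (@integral21_prod_meas1 _ _ _ _ R lam lam (EFin \o H) iH). Qed.
Lemma lam2_12 (H : R * R -> R) : lam2.-integrable setT (EFin \o H) ->
  (\int[lam]_x \int[lam]_y (H (x, y))%:E = \int[lam2]_u (H u)%:E)%E.
Proof. move=> iH; exact: (@integral12_prod_meas1 _ _ _ _ R lam lam (EFin \o H) iH). Qed.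

(** Boundedness and support in a cube give integrability, and Fubini lets the direction with
    vanishing line integrals be integrated first. *)
Lemma iterated_zero (H : R * R * R -> R) (C B : R) : 0 < B -> measurable_fun setT H -> (forall u, `|H u| <= C) ->
  (forall u, ~ cube B u -> H u = 0) ->
  (forall y z, \int[lam]_x (H (x, y, z))%:E = 0)%E \/ (forall x z, \int[lam]_y (H (x, y, z))%:E = 0)%E \/
  (forall x y, \int[lam]_z (H (x, y, z))%:E = 0)%E ->
  (\int[@leb3 R]_u (H u)%:E = 0)%E.
Proof.
move=> B0 mH hC h0 hz; have [mB [fB fB2]] := box_measure B0.
have iH : (@leb3 R).-integrable setT (EFin \o H) by apply: (@integrable_bounded _ _ (@leb3 R) (cube B) H C).
have mI : measurable (itvB B : set R) by exact: measurable_itv.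
have mI2 : measurable (itvB B `*` itvB B : set (R * R)) by exact: measurableX.
have mHz z : measurable_fun setT (fun v : R * R => H (v, z)) by apply: measurableT_comp => //; exact: pair2_measurable.
have iHz z : lam2.-integrable setT (EFin \o (fun v : R * R => H (v, z))).
  apply: (@integrable_bounded _ _ lam2 (itvB B `*` itvB B) _ C) => //; first exact: mHz.
  by move=> v nv; apply: h0 => -[].
case: hz => [hx|[hy|hz]].
- rewrite -(leb3_21 iH); apply: integral0_eq => z _; rewrite -(lam2_21 (iHz z)).
  by apply: integral0_eq => y _; exact: hx.
- rewrite -(leb3_21 iH); apply: integral0_eq => z _; rewrite -(lam2_12 (iHz z)).
  by apply: integral0_eq => x _; exact: hy.
- by rewrite -(leb3_12 iH); apply: integral0_eq => -[x y] _; exact: hz.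
Qed.

End Meas.

(** * Weak Jacobian of the identity plus a Lipschitz map *)

Section Weak.
Context {R : realType} (w : pt R -> pt R) (eps : R).
Hypotheses (e0 : 0 < eps) (we : forall x y, enorm (w x - w y) <= eps * enorm (x - y)).
Implicit Types (x y : pt R) (i j : 'I_3).
Let G x := x + w x.
Definition ej j : pt R := delta_mx 0 j.
Definition quot i j (n : nat) x := n.+1%:R * (G (n.+1%:R^-1 *: ej j + x) 0 i - G x 0 i).
(* The upper limits exist everywhere and are measurable; almost everywhere they
   are the partial derivatives of [G]. *)
Definition jac x : 'M[R]_3 := \matrix_(i, j) limn_sup (fun n => quot i j n x).

Lemma ej_norm j : enorm (ej j) = 1.
Proof.
rewrite /enorm /dot (bigD1 j) //= big1 ?addr0; first by rewrite mxE !eqxx mulr1 sqrtr1.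
by move=> k kj; rewrite mxE (negbTE kj) andbF mulr0.
Qed.

Lemma quot_bound i j n x : `|quot i j n x - (i == j)%:R| <= eps.
Proof.
have -> : quot i j n x - (i == j)%:R = n.+1%:R * (w (n.+1%:R^-1 *: ej j + x) - w x) 0 i.
  rewrite /quot /G !mxE eq_sym; case: (j == i) => /=; field; rewrite nat1r pnatr_eq0 //.
rewrite normrM ger0_norm // -ler_pdivlMl // (le_trans (coord_le_enorm _ _)) // (le_trans (we _ _)) //.
by rewrite addrK enormZ ej_norm mulr1 ger0_norm // mulrC.
Qed.

Lemma quot_range i j n x : (i == j)%:R - eps <= quot i j n x <= (i == j)%:R + eps.
Proof. by have := quot_bound i j n x; rewrite ler_norml => /andP[h1 h2]; apply/andP; split; lra. Qed.

Lemma jac_bound x i j : `|jac x i j - (i == j)%:R| <= eps.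
Proof.
have /andP[h1 h2] := limn_sup_bound (fun n => quot_range i j n x).
by rewrite mxE ler_norml; apply/andP; split; lra.
Qed.

Lemma G_lip x y : enorm (G x - G y) <= (1 + eps) * enorm (x - y).
Proof.
have -> : G x - G y = (x - y) + (w x - w y) by rewrite /G opprD addrACA.
by rewrite mulrDl mul1r (le_trans (ler_enormD _ _)) // lerD2l.
Qed.

Lemma G_cont i : continuous (fun x => G x 0 i).
Proof.
apply: (@elip_continuous _ _ _ (1 + eps)) => x y.
have -> : G x 0 i - G y 0 i = (G x - G y) 0 i by rewrite !mxE.
exact: le_trans (coord_le_enorm _ _) (G_lip x y).
Qed.

Lemma quot_cont i j n : continuous (quot i j n).
Proof.
apply: (@elip_continuous _ _ _ (n.+1%:R * (2 * (1 + eps)))) => x y.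
have -> : quot i j n x - quot i j n y = n.+1%:R * ((G (n.+1%:R^-1 *: ej j + x) - G (n.+1%:R^-1 *: ej j + y)) 0 i - (G x - G y) 0 i).
  by rewrite /quot !mxE; ring.
rewrite normrM ger0_norm // -mulrA ler_pM2l // (le_trans (ler_normB _ _)) //.
have h1 := le_trans (coord_le_enorm _ i) (G_lip (n.+1%:R^-1 *: ej j + x) (n.+1%:R^-1 *: ej j + y)).
have h2 := le_trans (coord_le_enorm _ i) (G_lip x y).
have ec : n.+1%:R^-1 *: ej j + x - (n.+1%:R^-1 *: ej j + y) = x - y by rewrite opprD addrACA subrr add0r.
rewrite ec in h1; apply: (le_trans (lerD h1 h2)).
by rewrite -mulrA mulr_natl mulr2n.
Qed.

Lemma measurable_jac i j : measurable_fun setT (fun u => jac (vec3 u) i j).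
Proof.
under eq_fun do rewrite mxE.
apply: measurable_fun_limn_sup => [u _|u _|n].
- by exists ((i == j)%:R + eps) => _ [n _ <-]; have /andP[] := quot_range i j n (vec3 u).
- by exists ((i == j)%:R - eps) => _ [n _ <-]; have /andP[] := quot_range i j n (vec3 u).
- by apply: (@measurable_cont R (quot i j n)); exact: quot_cont.
Qed.

End Weak.

Lemma Linfty_le (R : realType) (D : set (pt R)) (f : pt R -> R) (c : R) : 0 <= c -> (forall x, D x -> `|f x| <= c) -> (Linfty D f <= c%:E)%E.
Proof.
move=> c0 hf; rewrite /Linfty unlock /Lnorm; case: ifP => _; last by rewrite lee_fin.
apply/ess_sup_inf.ess_supP; apply: nearW => u /=; rewrite lee_fin indicE.
have [|nD] := boolP (vec3 u \in D); rewrite ?mul0r ?normr0 // mul1r inE; exact: hf.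
Qed.

Lemma fin_add_eq0 (R : realType) (a b : \bar R) : a \is a fin_num -> (a + b = 0)%E -> (a = - b)%E.
Proof. by move: a b => [a||] [b||] //= _ [] /eqP; rewrite addr_eq0 => /eqP ->. Qed.

Lemma compact_support_bounded (R : realType) (K : set (pt R)) (f : pt R -> R) : compact K -> continuous f ->
  (forall x, ~ K x -> f x = 0) -> exists2 C, 0 < C & forall x, `|f x| <= C.
Proof.
move=> cK cf f0; have := continuous_compact (continuous_subspaceT cf) cK => /compact_bounded[M [_ hM]].
exists (`|M| + 1); first by rewrite ltr_wpDl.
move=> x; have [Kx|nK] := pselect (K x); last by rewrite f0 // normr0 addr_ge0.
by apply: hM; [rewrite (le_lt_trans (ler_norm M)) // ltrDl | exists x].
Qed.

Section WeakJacobian.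
Context {R : realType} (w : pt R -> pt R) (eps : R).
Hypotheses (e0 : 0 < eps) (we : forall x y, enorm (w x - w y) <= eps * enorm (x - y)).
Implicit Types (x y : pt R) (i j : 'I_3).
Notation G := (fun x => x + w x).
Notation lam := (@lebesgue_measure R).

Lemma vec3_coord (u : R * R * R) B : ~ cube B u -> B <= enorm (vec3 u).
Proof.
move=> nc; rewrite leNgt; apply/negP => h; apply: nc.
have c j := le_lt_trans (coord_le_enorm (vec3 u) j) h.
have := c (Ordinal (isT : 2 < 3)%N); have := c (Ordinal (isT : 1 < 3)%N); have := c (Ordinal (isT : 0 < 3)%N).
rewrite !mxE /= !ltr_norml; case: u {h c} => [[x y] z] /= /andP[a1 a2] /andP[b1 b2] /andP[c1 c2].
by rewrite /cube /itvB; split; [split|]; rewrite /= in_itv /= ?a1 ?b1 ?c1 /= ltW.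
Qed.

Lemma vec3_split j (a b c : R) : let f (k : nat) (x : R) := if k == val j then 0 else x in
  vec3 (a, b, c) = vec3 (a, b, c) 0 j *: ej j + vec3 (f 0%N a, f 1%N b, f 2%N c).
Proof.
apply/rowP => k; case: j => [[|[|[|j]]] hj] //; case: k => [[|[|[|k]]] hk] //=;
  by rewrite !mxE /= ?mulr0 ?mulr1 ?add0r ?addr0.
Qed.

(** [weak_slice] on every line parallel to the [j]-th axis, summed by Fubini. Since [w] is defined
    on the whole space, [O] enters only through the support of the test function. *)
Lemma weak_jacobian_lip (O : set (pt R)) : weak_jacobian O G (jac w).
Proof.
move=> i j phi [sphi [K [cK KO phi0]]].
have C1 : Ck 1 phi := sphi 1%N; have [dphi cdphi] := C1.
have cphi : continuous phi := sphi 0%N.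
pose d x := 'D_(ej j) phi x; have cd : continuous d := cdphi (ej j).
have hphi x : (fun n => n.+1%:R * (phi (n.+1%:R^-1 *: ej j + x) - phi x)) @ \oo --> d x.
  by apply: quot_cvg; exact: diff_derivable.
have [clK [BK hBK]] := (compactE K).1 cK.
have d0 x : ~ K x -> d x = 0.
  move=> nK; have /interiorE[r r0 hr] : interior (~` K) x.
    by have /interior_id -> := closed_openC clK.
  apply: (cvg_unique _ (hphi x)); first exact: norm_hausdorff.
  apply: cvg_near_cst; near=> n.
  have hn : n.+1%:R^-1 < r by near: n; exact: (near_infty_natSinv_lt (PosNum r0)).
  rewrite !phi0 ?subrr ?mulr0 //; apply: hr; rewrite addrK enormZ ej_norm mulr1 ger0_norm //.
have [Cp Cp0 hCp] := compact_support_bounded cK cphi phi0.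
have [Cd Cd0 hCd] := compact_support_bounded cK cd d0.
pose B := `|BK| + 1; have B0 : 0 < B by rewrite ltr_wpDl.
have KB x : K x -> enorm x < B by move=> /hBK h; rewrite (le_lt_trans h) // (le_lt_trans (ler_norm BK)) // ltrDl.
pose g x := G x 0 i; have gL x y : `|g x - g y| <= (1 + eps) * enorm (x - y).
  have -> : g x - g y = (G x - G y) 0 i by rewrite /g !mxE.
  exact: le_trans (coord_le_enorm _ _) (G_lip we x y).
have e1 : 0 < 1 + eps by rewrite addr_gt0.
pose CG := `|g 0| + (1 + eps) * B; have CG0 : 0 < CG by rewrite ltr_wpDl // mulr_gt0.
have gK x : K x -> `|g x| <= CG.
  move=> /KB hx; rewrite -[g x](subrK (g 0)) (le_trans (ler_normD _ _)) // addrC lerD2l (le_trans (gL _ _)) //.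
  by rewrite subr0 ler_pM2l // ltW.
pose H (u : R * R * R) := g (vec3 u) * d (vec3 u) + jac w (vec3 u) i j * phi (vec3 u).
have jb x : `|jac w x i j| <= 1 + eps.
  have := jac_bound we x i j; rewrite !ler_norml => /andP[h1 h2].
  by move: h1 h2; case: (i == j) => /= h1 h2; apply/andP; split; lra.
have mg : measurable_fun setT (g \o vec3) by apply: measurable_cont; exact: G_cont.
have md : measurable_fun setT (d \o vec3) by exact: measurable_cont.
have mp : measurable_fun setT (phi \o vec3) by exact: measurable_cont.
have mj := measurable_jac we i j.
have ma : measurable_fun setT (fun u => g (vec3 u) * d (vec3 u)) by exact: measurable_funM mg md.
have mb : measurable_fun setT (fun u => jac w (vec3 u) i j * phi (vec3 u)) by exact: measurable_funM mj mp.
have mH : measurable_fun setT H by exact: measurable_funD ma mb.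
have outK u : ~ cube B u -> ~ K (vec3 u).
  by move=> /vec3_coord hc /KB; rewrite ltNge hc.
have ab u : `|g (vec3 u) * d (vec3 u)| <= CG * Cd.
  have [/gK h|nK] := pselect (K (vec3 u)); last by rewrite d0 // mulr0 normr0 mulr_ge0 // ltW.
  by rewrite normrM ler_pM.
have bb u : `|jac w (vec3 u) i j * phi (vec3 u)| <= (1 + eps) * Cp by rewrite normrM ler_pM.
have kL x s t : `|g (s *: ej j + x) * phi (s *: ej j + x) - g (t *: ej j + x) * phi (t *: ej j + x)| <= ((1 + eps) * Cp + CG * Cd) * `|s - t|.
  have dst a b : a *: ej j + x - (b *: ej j + x) = (a - b) *: ej j by rewrite opprD addrACA subrr addr0 scalerBl.
  have pL a b : `|phi (a *: ej j + x) - phi (b *: ej j + x)| <= Cd * `|a - b|.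
    have [q [_ ->]] := segment_MVT (a *: ej j + x) (b *: ej j + x) dphi.
    rewrite dst dotZr -derive_grad // normrM mulrC ler_wpM2r //; exact: hCd.
  have gs a b : `|g (a *: ej j + x) - g (b *: ej j + x)| <= (1 + eps) * `|a - b|.
    by rewrite (le_trans (gL _ _)) // dst enormZ ej_norm mulr1.
  (* [g] is unbounded, so in the product rule it is evaluated at a point of the support [K]; this
     requires choosing which of the two points comes first. *)
  have core a b : K (a *: ej j + x) \/ ~ K (b *: ej j + x) -> `|g (a *: ej j + x) * phi (a *: ej j + x) - g (b *: ej j + x) * phi (b *: ej j + x)| <= ((1 + eps) * Cp + CG * Cd) * `|a - b|.
    have [Ka _|na] := pselect (K (a *: ej j + x)); last first.
      by case=> // nb; rewrite (phi0 _ na) (phi0 _ nb) !mulr0 subrr normr0 mulr_ge0 // addr_ge0 // mulr_ge0 // ltW.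
    have -> : g (a *: ej j + x) * phi (a *: ej j + x) - g (b *: ej j + x) * phi (b *: ej j + x) =
      (g (a *: ej j + x) - g (b *: ej j + x)) * phi (b *: ej j + x) + g (a *: ej j + x) * (phi (a *: ej j + x) - phi (b *: ej j + x)) by ring.
    rewrite (le_trans (ler_normD _ _)) // !normrM mulrDl lerD //.
      by rewrite [leRHS]mulrAC ler_pM.
    by rewrite -mulrA ler_pM // gK.
  have [Ks|ns] := pselect (K (s *: ej j + x)); first by apply: core; left.
  by rewrite distrC [`|s - t|]distrC; apply: core; right.
(* The normalisation [x0 0 j = 0] makes the parameter equal to the [j]-th coordinate, so the support
   lies in [|t| < B]. *)
have slice x0 : x0 0 j = 0 -> measurable_fun setT (fun t : R => g (t *: ej j + x0) * d (t *: ej j + x0) + jac w (t *: ej j + x0) i j * phi (t *: ej j + x0)) ->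
    (\int[lam]_t (g (t *: ej j + x0) * d (t *: ej j + x0) + jac w (t *: ej j + x0) i j * phi (t *: ej j + x0))%:E = 0)%E.
  move=> x00 ms.
  have kp : 0 < (1 + eps) * Cp + CG * Cd by rewrite addr_gt0 // mulr_gt0.
  have eqH t : g (t *: ej j + x0) * d (t *: ej j + x0) + limn_sup (fun n => n.+1%:R * (g ((n.+1%:R^-1 + t) *: ej j + x0) - g (t *: ej j + x0))) * phi (t *: ej j + x0) = g (t *: ej j + x0) * d (t *: ej j + x0) + jac w (t *: ej j + x0) i j * phi (t *: ej j + x0).
    have -> : jac w (t *: ej j + x0) i j = limn_sup (fun n => quot w i j n (t *: ej j + x0)) by rewrite mxE.
    have -> // : (fun n => n.+1%:R * (g ((n.+1%:R^-1 + t) *: ej j + x0) - g (t *: ej j + x0))) = (fun n => quot w i j n (t *: ej j + x0)).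
    by apply/funext => n; rewrite /quot /g scalerDl addrA.
  have W := @weak_slice R (fun t => g (t *: ej j + x0)) (fun t => phi (t *: ej j + x0)) (fun t => d (t *: ej j + x0)) (1 + eps) _ B e1 kp B0 _ (kL x0) _ _.
  under eq_integral do rewrite -eqH.
  apply: W.
  - by move=> s t; rewrite (le_trans (gL _ _)) // opprD addrACA subrr addr0 -scalerBl enormZ ej_norm mulr1.
  - move=> t; have := hphi (t *: ej j + x0).
    by under eq_fun do rewrite addrA -scalerDl.
  - move=> t Bt; have nK : ~ K (t *: ej j + x0).
      move=> /KB; rewrite ltNge; apply/negP; rewrite negbK (le_trans Bt) //.
      by rewrite (le_trans _ (coord_le_enorm _ j)) // !mxE x00 !eqxx mulr1 addr0.
    by rewrite phi0 // d0.
  - by apply: eq_measurable_fun ms => t _; rewrite eqH.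
have z0 : (\int[@leb3 R]_u (H u)%:E = 0)%E.
  apply: (@iterated_zero R H (CG * Cd + (1 + eps) * Cp) B B0 mH).
  - by move=> u; rewrite (le_trans (ler_normD _ _)) // lerD.
  - by move=> u /outK nK; rewrite /H d0 // phi0 // !mulr0 addr0.
  - have sl (c : R -> R * R * R) : (exists x0, x0 0 j = 0 /\ forall t, vec3 (c t) = t *: ej j + x0) -> measurable_fun setT c ->
        (\int[lam]_t (H (c t))%:E = 0)%E.
      move=> [x0 [x00 hc]] mc; rewrite -[RHS](slice x0 x00).
        by apply: eq_integral => t _; rewrite /H hc.
      have : measurable_fun setT (H \o c) by exact: measurableT_comp mH mc.
      by apply: eq_measurable_fun => t _; rewrite /H /= hc.
    have m1 (y z : R) : measurable_fun setT (fun x : R => (x, y, z)).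
      by do 2 (apply: measurable_fun_pair => //).
    have m2 (x z : R) : measurable_fun setT (fun y : R => (x, y, z)).
      by do 2 (apply: measurable_fun_pair => //).
    have m3 (x y : R) : measurable_fun setT (fun z : R => (x, y, z)).
      by do 2 (apply: measurable_fun_pair => //).
    case: (j) sl => [[|[|[|k]]] hk] // sl; [left|right; left|right; right] => a b; apply: sl => //.
    + by exists (vec3 (0, a, b)); split; [rewrite mxE | move=> t; rewrite (vec3_split (Ordinal hk)) mxE].
    + by exists (vec3 (a, 0, b)); split; [rewrite mxE | move=> t; rewrite (vec3_split (Ordinal hk)) mxE].
    + by exists (vec3 (a, b, 0)); split; [rewrite mxE | move=> t; rewrite (vec3_split (Ordinal hk)) mxE].
have oO (f : R * R * R -> R) : (forall u, ~ K (vec3 u) -> f u = 0) ->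
    (\int[@leb3 R]_(u in vec3 @^-1` O) (f u)%:E = \int[@leb3 R]_u (f u)%:E)%E.
  move=> hf; rewrite integral_mkcond; apply: eq_integral => u _; rewrite patchE; case: ifPn => // /negP; rewrite inE /= => nO.
  by rewrite hf // => /KO.
have [mB [fB _]] := box_measure B0.
have iA : (@leb3 R).-integrable setT (EFin \o (fun u => g (vec3 u) * d (vec3 u))).
  by apply: (@integrable_bounded _ _ _ (@leb3 R) (cube B) _ (CG * Cd)) => // u /outK nK; rewrite d0 // mulr0.
have iB : (@leb3 R).-integrable setT (EFin \o (fun u => jac w (vec3 u) i j * phi (vec3 u))).
  by apply: (@integrable_bounded _ _ _ (@leb3 R) (cube B) _ ((1 + eps) * Cp)) => // u /outK nK; rewrite phi0 // mulr0.
rewrite (oO (fun u => g (vec3 u) * d (vec3 u))); last by move=> u nK; rewrite d0 // mulr0.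
rewrite (oO (fun u => jac w (vec3 u) i j * phi (vec3 u))); last by move=> u nK; rewrite phi0 // mulr0.
exact: (fin_add_eq0 (integrable_fin_num measurableT iA) (etrans (esym (integralD measurableT iA iB)) z0)).
Unshelve. all: by end_near. Qed.

End WeakJacobian.

(** Leibniz formula: six permutations, and each product of three entries changes by at most
    [3 e (1 + e)^2] by telescoping. *)
Lemma det3_perturb (R : realType) (J : 'M[R]_3) (e : R) : 0 <= e -> (forall i j, `|J i j - (i == j)%:R| <= e) ->
  `|\det J - 1| <= 18 * (e * (1 + e) ^+ 2).
Proof.
move=> e0 hJ.
have b1 i j : `|J i j| <= 1 + e.
  rewrite -[J i j](subrK (i == j)%:R) addrC (le_trans (ler_normD _ _)) // lerD //.
  by case: (i == j); rewrite ?normr1 // normr0.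
have b2 (i j : 'I_3) : `|(i == j)%:R : R| <= 1 + e.
  by case: (i == j); rewrite ?normr1 ?normr0 ?lerDl // addr_ge0.
have p3 (a b c a' b' c' : R) : `|a - a'| <= e -> `|b - b'| <= e -> `|c - c'| <= e -> `|b| <= 1 + e -> `|c| <= 1 + e ->
    `|a'| <= 1 + e -> `|b'| <= 1 + e -> `|a * b * c - a' * b' * c'| <= 3 * (e * (1 + e) ^+ 2).
  move=> h1 h2 h3 h4 h5 h6 h7.
  have -> : a * b * c - a' * b' * c' = (a - a') * (b * c) + (b - b') * (a' * c) + (c - c') * (a' * b') by ring.
  have k (x y z : R) : `|x| <= e -> `|y| <= 1 + e -> `|z| <= 1 + e -> `|x * (y * z)| <= e * (1 + e) ^+ 2.
    by move=> k1 k2 k3; rewrite !normrM expr2; do 2 (apply: ler_pM => //; try exact: mulr_ge0).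
  have := k _ _ _ h1 h4 h5; have := k _ _ _ h2 h6 h5; have := k _ _ _ h3 h6 h7 => q1 q2 q3.
  apply: (le_trans (ler_normD _ _)); apply: (le_trans (lerD (ler_normD _ _) (lexx _))); move: q1 q2 q3; lra.
rewrite -[X in \det J - X](det1 R 3) /determinant -sumrB (le_trans (ler_norm_sum _ _ _)) //.
apply: (@le_trans _ _ (\sum_(s : 'S_3) 3 * (e * (1 + e) ^+ 2))).
  apply: ler_sum => s _; rewrite -mulrBr normrM normrX normrN1 expr1n mul1r !big_ord_recl !big_ord0 !mulr1 !mxE !mulrA.
  have hh i1 j1 i2 j2 i3 j3 := p3 _ _ _ _ _ _ (hJ i1 j1) (hJ i2 j2) (hJ i3 j3) (b1 i2 j2) (b1 i3 j3) (b2 i1 j1) (b2 i2 j2).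
  have -> : 3 * e * (1 + e) * (1 + e) = 3 * (e * (1 + e) ^+ 2) by ring.
  exact: hh.
rewrite sumr_const card_Sn -mulrnAl -mulrnA; exact: lexx.
Qed.

(** * Reduction of the estimates to a Lipschitz displacement; the empty domain *)

Section Param.
Context {R : realType} (Om : set (pt R)) (h C eps : R) (M : set (polyhedron R)) (w : pt R -> pt R).
Hypotheses (e0 : 0 < eps) (we : forall x y, enorm (w x - w y) <= eps * enorm (x - y)).

Lemma W1infty_id_plus (D : set (pt R)) : bounded_set D -> W1infty D (fun x => x + w x) (jac w).
Proof.
move=> /bounded_enormP[B hB]; split; last exact: (weak_jacobian_lip e0 we).
- move=> i; split; first by apply: measurable_funTS; apply: measurable_cont; exact: G_cont.
  apply: (@le_lt_trans _ _ (`|(0 + w 0) 0 i| + (1 + eps) * `|B|)%:E); last exact: ltry.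
  have p1 : 0 <= 1 + eps by rewrite addr_ge0 // ltW.
  apply: Linfty_le => [|x /hB xB]; first by rewrite addr_ge0 // mulr_ge0.
  have -> : (x + w x) 0 i = (0 + w 0) 0 i + ((x + w x) - (0 + w 0)) 0 i by rewrite !mxE; ring.
  rewrite (le_trans (ler_normD _ _)) // lerD2l (le_trans (coord_le_enorm _ _)) // (le_trans (G_lip we _ _)) //.
  by rewrite subr0 ler_wpM2l // (le_trans xB) // ler_norm.
- move=> i j; split; first by apply: measurable_funTS; exact: measurable_jac.
  apply: (@le_lt_trans _ _ (1 + eps)%:E); last exact: ltry.
  apply: Linfty_le => [|x _]; first by rewrite addr_ge0 // ltW.
  have := jac_bound we x i j; case: (i == j) => /=; rewrite ?subr0 => hj; last by rewrite (le_trans hj) // lerDr.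
  by rewrite -[jac w x i j](subrK 1) addrC (le_trans (ler_normD _ _)) // normr1 lerD2l.
Qed.

Lemma lip_parametrization : bounded_set (bulk M) -> 0 <= C * h ^+ 2 -> 18 * (eps * (1 + eps) ^+ 2) <= C * h ->
  (forall x, exterior_bulk M x -> enorm (w x) <= C * h ^+ 2) ->
  homeomorphism_on (bulk M) (closure Om) (fun x => x + w x) ->
  (forall x, surface M x -> x + w x = normal_projection Om x) ->
  (forall x, (bulk M `\` exterior_bulk M) x -> w x = 0) ->
  bulk_parametrization Om h C M (fun x => x + w x).
Proof.
move=> bB C2 hC hw H1 H2 H3; split => //; first by move=> x /H3 ->; rewrite addr0.
have ee : eps <= C * h.
  apply: le_trans hC; rewrite mulrA [18 * eps]mulrC -mulrA ler_pMr //.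
  have : 1 <= (1 + eps) ^+ 2 by rewrite expr_ge1 ?addr_ge0 ?ler_wpDr // ltW.
  by move: (_ ^+ 2) => z; lra.
have C1 := le_trans (ltW e0) ee.
exists (jac w); split; first exact: W1infty_id_plus.
- apply: Linfty_le => // x _; rewrite normr_id; apply: (le_trans _ ee); apply: mx_norm_le; first exact: ltW.
  by move=> i j; rewrite !mxE; have := jac_bound we x i j; rewrite mxE.
- apply: Linfty_le => // x _; apply: (le_trans _ hC); apply: det3_perturb; first exact: ltW.
  exact: jac_bound.
- apply: Linfty_le => // x /hw; rewrite addrAC subrr add0r ger0_norm //; exact: enorm_ge0.
Qed.
End Param.

Lemma empty_boundary (R : realType) (Om : set (pt R)) : open Om -> bounded_set Om -> ~ (frontier Om !=set0) -> Om = set0.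
Proof.
move=> oO /bounded_enormP[B hB] nG; apply/seteqP; split => // y Oy; exfalso; apply: nG.
pose x : pt R := ((`|B| + 1) *: ej ord0).
have nx : ~ Om x.
  move=> /hB; rewrite enormZ ej_norm mulr1 ger0_norm ?addr_ge0 //; have := ler_norm B; move: (`|B|) => z; lra.
by have [t [_ ht]] := cross oO nx Oy; exists (segpt x y t).
Qed.

(** Degenerate case: without boundary there are no feet, so the Fermi stripe is empty, and both the
    domain and the mesh are empty. *)
Lemma empty_parametrization (R : realType) (Om : set (pt R)) (h gam gam2 C : R) (M : set (polyhedron R)) :
  open Om -> bounded_set Om -> ~ (frontier Om !=set0) -> 0 < C -> 0 < h ->
  bulk_surface_mesh Om h gam gam2 M ->
  exists G : pt R -> pt R, bulk_parametrization Om h (C) M G /\ forall E, ~ M E.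
Proof.
move=> oO bO nG C0 h0 HM; have O0 := empty_boundary oO bO nG.
have st : fermi_stripe Om = set0.
  apply/seteqP; split => // x [N [_ _ hN]] /hN[a [[Ga _] _]]; exfalso; apply: nG; by exists a.
have bM : bulk M = set0 by have := mesh_bulk_approx HM; rewrite st !setD0 => ->.
have ME E : ~ M E.
  by move=> m; have [_ _ _ [_ [x Ex]] _] := mesh_polyhedra HM m; have : bulk M x by [exists E]; rewrite bM.
have bx x : ~ exterior_bulk M x by move=> [E [/ME]].
exists (fun x => x + 0); split => //.
have Ch : 0 < C * h by rewrite mulr_gt0.
pose e := Num.min 1 (C * h / 72).
have e0 : 0 < e by rewrite lt_min ltr01 divr_gt0 // ltr0n.
have [e1 e2] : e <= 1 /\ 72 * e <= C * h.
  split; first by rewrite ge_min lexx.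
  by rewrite mulrC -ler_pdivlMr ?ltr0n // ge_min lexx orbT.
have eC : 18 * (e * (1 + e) ^+ 2) <= C * h.
  have e3 : (1 + e) ^+ 2 <= 4 by move: e0 e1; move: (e) => z; nra.
  apply: le_trans e2; have : e * (1 + e) ^+ 2 <= e * 4 by rewrite ler_pM2l.
  by move: (e * _) => z; move: (e) => y; lra.
apply: (@lip_parametrization R Om h C e M (fun=> 0)) => //.
- by move=> x y; rewrite subrr enorm0 mulr_ge0 ?enorm_ge0 // ltW.
- by apply/bounded_enormP; exists 0 => x; rewrite bM.
- by rewrite mulr_ge0 ?sqr_ge0 // ltW.
- by move=> x /bx.
- exists id; rewrite bM O0 closure0; split => //; exact: continuous_subspace0.
- by rewrite /surface bM => x []; rewrite closure0.
Qed.

(** * The cube inscribed in a ball *)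

Section Ball.
Context {R : realType}.
Implicit Types (x y p a b v : pt R).
Notation s3 := (Num.sqrt 3 : R).

Lemma Ck_cst (W : normedModType R) k (c : W) : Ck k (fun _ : pt R => c).
Proof.
elim: k c => [|k IH] c /=; first exact: cst_continuous.
split=> [x|v]; first exact: differentiable_cst.
have -> : (fun x : pt R => 'D_v (fun=> c) x) = (fun=> 0) by apply/funext => x; exact: derive_cst.
exact: IH.
Qed.

Lemma sdiff_dotl u x : sdiff (dot u) x (dot u).
Proof.
apply: sdiff_lin; first by move=> a y z /=; rewrite dotDr dotZr.
exists (2 * enorm u) => v; rewrite (le_trans (dot_abs _ _)) // mulrAC mulrC.
by rewrite ler_wpM2r ?enorm_ge0 // enorm_le_norm.
Qed.

Lemma Ck_dotl k u : Ck k (dot u : pt R -> R).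
Proof.
case: k => [|k] /=; first exact: dot_continuous.
split=> [x|v]; first exact: sdiff_differentiable (sdiff_dotl u x).
have -> : (fun x : pt R => 'D_v (dot u) x) = (fun=> dot u v) by apply/funext => x; exact: sdiff_derive (sdiff_dotl u x).
exact: Ck_cst.
Qed.

(** Radius [sqrt 3] puts the corners of the cube of side 2 on the sphere. *)
Definition phi3 x : R := dot x x - 3.

Lemma phi3_sdiff x : sdiff phi3 x (dot (2 *: x)).
Proof.
have [lin bd _] := sdiff_dotl (2 *: x) x; split => // e e0.
exists (e / 8); first by rewrite divr_gt0.
move=> y z hy hz.
have -> : phi3 y - phi3 z - dot (2 *: x) (y - z) = dot ((y - x) + (z - x)) (y - z).
  by rewrite /phi3 !dotE (dotC z y); ring.
rewrite (le_trans (dot_abs _ _)) //.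
have h1 := ler_enormD (y - x) (z - x); have h2 := enorm_le_norm (y - x); have h3 := enorm_le_norm (z - x); have h4 := enorm_le_norm (y - z).
have h5 : enorm ((y - x) + (z - x)) <= e / 2 by move: h1 h2 h3 hy hz; lra.
apply: (@le_trans _ _ (e / 2 * (2 * `|y - z|))); last by rewrite mulrA divfK ?gt_eqF.
by apply: ler_pM => //; exact: enorm_ge0.
Qed.

Lemma phi3_sd x : differentiable phi3 x.
Proof. exact: sdiff_differentiable (phi3_sdiff x). Qed.

Lemma phi3_derive x v : 'D_v phi3 x = dot (2 *: v) x.
Proof. by rewrite (sdiff_derive v (phi3_sdiff x)) !dotZl dotC. Qed.

Lemma smooth_phi3 : smooth phi3.
Proof.
case=> [|k] /=; first by move=> x; exact: differentiable_continuous (phi3_sd x).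
split=> [x|v]; first exact: phi3_sd.
have -> : (fun x : pt R => 'D_v phi3 x) = dot (2 *: v) by apply/funext => x; exact: phi3_derive.
exact: Ck_dotl.
Qed.

Definition ball3 : set (pt R) := [set x | dot x x < 3].

Lemma s3_gt0 : 0 < s3. Proof. by rewrite sqrtr_gt0. Qed.
Lemma s3_sqr : s3 ^+ 2 = 3. Proof. by rewrite sqr_sqrtr. Qed.

Lemma ball3E x : ball3 x <-> enorm x < s3.
Proof. by rewrite /ball3 /enorm /= ltr_sqrt. Qed.

Lemma ball3_open : open ball3.
Proof.
rewrite openE => x /ball3E h; apply/interiorE; exists (s3 - enorm x); first by rewrite subr_gt0.
move=> y hy; apply/ball3E; have := enorm_lip y x; rewrite ler_norml => /andP[_]; lra.
Qed.

Lemma ball3_bounded : bounded_set ball3.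
Proof. by apply/bounded_enormP; exists s3 => x /ball3E /ltW. Qed.

Lemma closure_ball3 x : closure ball3 x <-> enorm x <= s3.
Proof.
have s0 := s3_gt0; split.
  have cl : closed [set x | enorm x <= s3].
    by apply: (@lip_closed R (@enorm R) 1 s3) => a b; rewrite mul1r; exact: enorm_lip.
  by move=> /(@closure_closed_sub _ _ _ cl); apply=> // y /ball3E /ltW.
move=> hx; apply/closureE => e e0.
pose t := Num.min 1 (e / (2 * s3)).
have t0 : 0 < t by rewrite lt_min ltr01 divr_gt0 // mulr_gt0.
have t1 : t <= 1 by rewrite ge_min lexx.
have te : t * (2 * s3) <= e by rewrite -ler_pdivlMr ?mulr_gt0 // ge_min lexx orbT.
exists ((1 - t) *: x).
  apply/ball3E.
  rewrite enormZ ger0_norm ?subr_ge0 //.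
  have := enorm_ge0 x; move: (enorm x) hx => z; nra.
have -> : (1 - t) *: x - x = - (t *: x) by rewrite scalerBl scale1r addrAC subrr add0r.
rewrite enormN enormZ gtr0_norm //; have := enorm_ge0 x; move: (enorm x) hx => z; nra.
Qed.

Lemma sphereE p : frontier ball3 p <-> enorm p = s3.
Proof.
rewrite GamP; last exact: ball3_open.
rewrite closure_ball3 ball3E; split; first by move=> [h1 /negP]; rewrite -leNgt => h2; apply/eqP; rewrite eq_le h1 h2.
by move=> ->; rewrite lexx ltxx.
Qed.

Lemma ball3_smooth : smooth_boundary ball3.
Proof.
move=> p /sphereE hp; exists phi3; split; first exact: smooth_phi3.
  exists p; rewrite phi3_derive dotZl -enorm2 hp s3_sqr; apply/eqP; lra.
by near=> x; rewrite /ball3 /phi3 /= subr_lt0.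
Unshelve. all: by end_near. Qed.

Definition rproj x : pt R := (s3 / enorm x) *: x.

Lemma rproj_norm x : x != 0 -> enorm (rproj x) = s3.
Proof.
rewrite -enorm_gt0 => x0; have s0 := s3_gt0.
by rewrite enormZ ger0_norm ?divr_ge0 ?ltW // mulfVK ?gt_eqF.
Qed.

Lemma rproj_nearest x a : x != 0 -> nearest ball3 x a <-> a = rproj x.
Proof.
move=> x0; have pn := rproj_norm x0; have s0 := s3_gt0; have ss := s3_sqr; have xp : 0 < enorm x by rewrite enorm_gt0.
have dist : enorm (x - rproj x) = `|enorm x - s3|.
  have -> : x - rproj x = (1 - s3 / enorm x) *: x by rewrite scalerBl scale1r.
  rewrite enormZ -[X in _ * X](gtr0_norm xp) -normrM; congr (`|_|); field; by rewrite gt_eqF.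
split=> [[/sphereE na ha]|->]; last first.
  split; first exact/sphereE.
  by move=> b /sphereE nb; rewrite dist -nb enorm_lip.
have := ha (rproj x); rewrite dist => /(_ ((sphereE _).2 pn)).
rewrite -(@ler_pXn2r _ 2) ?nnegrE ?enorm_ge0 // real_normK ?num_real // enorm2 !dotE -!enorm2 na (dotC a x) => h.
apply/eqP; rewrite -subr_eq0 -enorm_eq0 -sqrf_eq0 enorm2 eq_le dot_ge0 andbT.
rewrite !dotE -!enorm2 na (dotC a x).
have h2 : enorm x * s3 <= dot x a by move: h; nra.
have e1 : s3 / enorm x * (s3 / enorm x * enorm x ^+ 2) = s3 ^+ 2 by field; rewrite gt_eqF.
have e2 : s3 ^+ 2 <= s3 / enorm x * dot x a.
  by rewrite expr2 -mulrA ler_pM2l // ler_pdivlMl.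
rewrite mulrN e1; move: e2; move: (s3 / enorm x * dot x a) (s3 ^+ 2) => u z; lra.
Qed.

Lemma ball3_foot x a : x != 0 -> normal_foot ball3 x a <-> a = rproj x.
Proof.
move=> x0; have oO := ball3_open; have bO := ball3_bounded; have [R0 R00 hg] := tube_ex oO bO ball3_smooth.
have G0 : frontier ball3 !=set0 by exists (rproj x); apply/sphereE; exact: rproj_norm.
rewrite -rproj_nearest //; split.
  exact: (foot_nearest bO hg G0).
exact: (nearest_foot oO bO R00 hg G0).
Qed.

Lemma ball3_projection x : x != 0 -> normal_projection ball3 x = rproj x.
Proof. by move=> x0; apply: xget_unique => [|y]; rewrite ball3_foot. Qed.

Lemma ball3_stripe x : x != 0 -> fermi_stripe ball3 x.
Proof.
move=> x0; exists [set x | x != 0] => //; split.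
- rewrite openE => y /= y0; apply/interiorE; exists (enorm y); rewrite ?enorm_gt0 // => z.
  by apply: contraTneq => ->; rewrite sub0r enormN ltxx.
- by move=> y /sphereE ny /=; rewrite -enorm_gt0 ny s3_gt0.
- by move=> y /= y0; exists (rproj y); split=> [|b]; rewrite ball3_foot.
Qed.

End Ball.

(** * The cube as a polyhedron *)

Section Cube.
Context {R : realType}.
Implicit Types (x y p q : pt R) (i j k l : 'I_3) (b c d : bool).

Definition sg b : R := if b then -1 else 1.
Lemma sg_norm b : `|sg b| = 1. Proof. by case: b; rewrite /sg ?normrN normr1. Qed.
Lemma sg_inj b c : sg b = sg c -> b = c. Proof. by case: b; case: c; rewrite /sg //; lra. Qed.
Lemma sg_ex (z : R) : `|z| = 1 -> exists b, z = sg b.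
Proof.
move=> h; have [z0|z0] := lerP 0 z; first by exists false; rewrite /sg /= -h ger0_norm.
by exists true; rewrite /sg /= -h ltr0_norm // opprK.
Qed.

Lemma third i j : i != j -> exists k, [/\ k != i, k != j & forall l, [\/ l = i, l = j | l = k]].
Proof.
pose o n (h : (n < 3)%N) := Ordinal h.
have all3 (P : 'I_3 -> Prop) : P (@o 0 isT) -> P (@o 1 isT) -> P (@o 2 isT) -> forall l, P l.
  by move=> h0 h1 h2 [[|[|[|m]]] hm] //; [move: h0|move: h1|move: h2]; congr P; apply: val_inj.
move: i; apply: (all3); move: j; apply: (all3) => // _;
 [exists (@o 2 isT)|exists (@o 1 isT)|exists (@o 2 isT)|exists (@o 0 isT)|exists (@o 1 isT)|exists (@o 0 isT)];
 split => //; apply: all3; by [apply: Or31|apply: Or32|apply: Or33].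
Qed.

Lemma others i : exists j k, [/\ j != i, k != i & forall l, [\/ l = i, l = j | l = k]].
Proof.
have [j ji] : exists j : 'I_3, i != j.
  by have [->|ni] := eqVneq i ord0; [exists (lift ord0 ord0) | exists ord0].
by have [k [ki kj h]] := third ji; exists j, k; rewrite eq_sym.
Qed.

Lemma dot_ej i x : dot (ej i) x = x 0 i.
Proof.
rewrite /dot (bigD1 i) //= big1 ?addr0; first by rewrite mxE !eqxx mul1r.
by move=> k ki; rewrite mxE (negbTE ki) andbF mul0r.
Qed.

Definition cubeS : set (pt R) := [set x : pt R | `|x| <= 1].
Definition FS i b : set (pt R) := [set x : pt R | `|x| <= 1 /\ x 0 i = sg b].
Definition ES i b j c : set (pt R) := [set x : pt R | [/\ `|x| <= 1, x 0 i = sg b & x 0 j = sg c]].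
Definition mk i b j c (z : R) : pt R := \row_l (if l == i then sg b else if l == j then sg c else z).
Definition FP i b : polygon R := Polygon (FS i b) [set e | exists j c, j != i /\ e = ES i b j c].
Definition CP : polyhedron R := Polyhedron cubeS [set F | exists i b, F = FP i b].

Lemma norm_le1 x : `|x| <= 1 <-> forall l, `|x 0 l| <= 1.
Proof.
split=> [h l|h]; first exact: le_trans (mx_coord_le_norm _ _ _) h.
by apply: mx_norm_le => // i l; rewrite (ord1 i).
Qed.

Lemma norm_eq1 x : `|x| <= 1 -> ~ `|x| < 1 -> exists l, `|x 0 l| = 1.
Proof.
move=> /norm_le1 x1 nx; apply: contrapT => h; apply: nx.
have hl l : `|x 0 l| < 1 by rewrite lt_neqAle x1 andbT; apply/eqP => e; apply: h; exists l.
have [j [k [_ _ hk]]] := others ord0.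
apply: (@le_lt_trans _ _ (Num.max `|x 0 ord0| (Num.max `|x 0 j| `|x 0 k|))); last by rewrite !gt_max !hl.
apply: mx_norm_le; first by rewrite le_max normr_ge0.
by move=> i l; rewrite (ord1 i) !le_max; case: (hk l) => ->; rewrite lexx ?orbT.
Qed.

Lemma mk_i i b j c z : mk i b j c z 0 i = sg b. Proof. by rewrite mxE eqxx. Qed.
Lemma mk_j i b j c z : i != j -> mk i b j c z 0 j = sg c.
Proof. by move=> ij; rewrite mxE eq_sym (negbTE ij) eqxx. Qed.
Lemma mk_k i b j c z k : k != i -> k != j -> mk i b j c z 0 k = z.
Proof. by move=> ki kj; rewrite mxE (negbTE ki) (negbTE kj). Qed.
Lemma mk_norm i b j c z : `|z| <= 1 -> `|mk i b j c z| <= 1.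
Proof. by move=> z1; apply/norm_le1 => l; rewrite mxE; do 2 (case: ifP => _; first by rewrite sg_norm). Qed.
Lemma mk_ES i b j c z : i != j -> `|z| <= 1 -> ES i b j c (mk i b j c z).
Proof. by move=> ij z1; split; [exact: mk_norm | exact: mk_i | exact: mk_j]. Qed.
Lemma mk_eq i b j c k x : (forall l, [\/ l = i, l = j | l = k]) -> k != i -> k != j -> i != j -> x 0 i = sg b -> x 0 j = sg c ->
  x = mk i b j c (x 0 k).
Proof.
move=> h ki kj ij xi xj; apply/rowP => l.
by case: (h l) => ->; rewrite ?mk_i ?mk_j // mk_k.
Qed.

Lemma ES_seg i b j c d : i != j -> ES i b j c = segment (mk i b j c (sg d)) (mk i b j c (sg (~~ d))).
Proof.
move=> ij; have [k [ki kj hk]] := third ij.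
apply/seteqP; split=> [x [/norm_le1 x1 xi xj]|x].
  have := x1 k; rewrite ler_norml => /andP[u1 u2].
  exists ((1 - sg d * x 0 k) / 2).
    by rewrite /= in_itv /=; case: (d); rewrite /sg; apply/andP; split; lra.
  apply/rowP => l; rewrite !mxE; case: (hk l) => ->.
  + by rewrite eqxx xi; lra.
  + by rewrite eq_sym (negbTE ij) eqxx xj; lra.
  + by rewrite (negbTE ki) (negbTE kj); case: (d); rewrite /sg /=; lra.
move=> [t]; rewrite /= in_itv /= => /andP[t0 t1] <-; split.
- apply/norm_le1 => l; rewrite !mxE; case: (l == i); first by rewrite -mulrDl subrK mul1r sg_norm.
  case: (l == j); first by rewrite -mulrDl subrK mul1r sg_norm.
  by rewrite ler_norml; case: (d); rewrite /sg /=; apply/andP; split; lra.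
- by rewrite !mxE eqxx -mulrDl subrK mul1r.
- by rewrite !mxE eq_sym (negbTE ij) eqxx -mulrDl subrK mul1r.
Qed.

Lemma mk_neq i b j c d : i != j -> mk i b j c (sg d) != mk i b j c (sg (~~ d)).
Proof.
move=> ij; have [k [ki kj hk]] := third ij; apply/eqP => /rowP/(_ k); rewrite !mk_k // => /sg_inj.
by case: d.
Qed.

Lemma ES_endpoint i b j c d : i != j -> endpoint (ES i b j c) (mk i b j c (sg d)).
Proof. by move=> ij; exists (mk i b j c (sg (~~ d))); split; [exact: mk_neq | exact: ES_seg]. Qed.

Lemma ES_edge i b j c : i != j -> is_edge (ES i b j c).
Proof. by move=> ij; have [q [pq e]] := ES_endpoint b c true ij; exists (mk i b j c (sg true)), q. Qed.

Definition corner p := forall l, `|p 0 l| = 1.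

(** Both extreme values of [[-1, 1]] are convex combinations of [a] and [e], which must then be the
    extreme values. It shows that any end point of an edge, in whatever representation, is a
    corner. *)
Lemma end_aux (a e t s : R) : `|a| <= 1 -> `|e| <= 1 -> 0 <= t <= 1 -> 0 <= s <= 1 ->
  (1 - t) * a + t * e = 1 -> (1 - s) * a + s * e = -1 -> `|a| = 1.
Proof.
rewrite !ler_norml => /andP[a1 a2] /andP[e1 e2] /andP[t0 t1] /andP[s0 s1] h1 h2.
have [->|an] := eqVneq a 1; first by rewrite normr1.
have [->|am] := eqVneq a (-1); first by rewrite normrN normr1.
have {an}a2 : a < 1 by rewrite lt_neqAle an.
have {am}a1 : -1 < a by rewrite lt_neqAle eq_sym am.
have t2 : t = 1 by nra.
have s2 : s = 1 by nra.
by move: h1 h2; rewrite t2 s2; lra.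
Qed.

Lemma ES_corner i b j c p : i != j -> endpoint (ES i b j c) p -> corner p.
Proof.
move=> ij [q [pq eE]]; have [k [ki kj hk]] := third ij.
have [p1 pi pj] : ES i b j c p by rewrite eE; exact: segment_l.
have [q1 _ _] : ES i b j c q by rewrite eE; exact: segment_r.
move: p1 q1 => /norm_le1 p1 /norm_le1 q1.
have up : ES i b j c (mk i b j c 1) by apply: mk_ES; rewrite ?normr1.
have dn : ES i b j c (mk i b j c (-1)) by apply: mk_ES; rewrite ?normrN ?normr1.
rewrite eE in up dn; case: up => t; case: dn => s; rewrite /= !in_itv /= => s01 /rowP/(_ k) + t01 /rowP/(_ k).
rewrite !mk_k // !mxE => h1 h2 l; case: (hk l) => ->; rewrite ?pi ?pj ?sg_norm //.
exact: end_aux (p1 k) (q1 k) t01 s01 h2 h1.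
Qed.

Lemma ESC i b j c : ES i b j c = ES j c i b.
Proof. by apply/seteqP; split=> x []. Qed.

Lemma FS_cap i b j c : i != j -> FS i b `&` FS j c = ES i b j c.
Proof. by move=> ij; apply/seteqP; split=> [x [[x1 xi] [_ xj]]|x [x1 xi xj]]. Qed.

Lemma cube_closed : closed cubeS.
Proof.
apply: (@lip_closed R (fun x => `|x|) 1 1) => x y; rewrite mul1r (le_trans _ (norm_le_enorm _)) //.
exact: ler_dist_dist.
Qed.

Lemma cube_compact : compact cubeS.
Proof.
apply/compactE; split; first exact: cube_closed.
by exists 2 => x x1; rewrite (le_trans (enorm_le_norm x)) // -[leRHS]mulr1 ler_wpM2l.
Qed.

Lemma FS_closed i b : closed (FS i b).
Proof.
have -> : FS i b = cubeS `&` [set x : pt R | `|x 0 i - sg b| <= 0].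
  by apply/seteqP; split=> x []; rewrite /= normr_le0 subr_eq0 => h /eqP.
apply: closedI; first exact: cube_closed.
apply: (@lip_closed R (fun x => `|x 0 i - sg b|) 1 0) => x y; rewrite mul1r (le_trans (ler_dist_dist _ _)) //.
have -> : x 0 i - sg b - (y 0 i - sg b) = (x - y) 0 i by rewrite !mxE; ring.
exact: coord_le_enorm.
Qed.

Lemma FS_compact i b : compact (FS i b).
Proof.
by apply: (subclosed_compact _ cube_compact); [exact: FS_closed | move=> x []].
Qed.

Lemma FS_center i b : FS i b (sg b *: ej i).
Proof.
split; first by rewrite (le_trans (norm_le_enorm _)) // enormZ ej_norm sg_norm mulr1.
by rewrite !mxE !eqxx mulr1.
Qed.

Definition HP i b : set (pt R) := [set x : pt R | x 0 i = sg b].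

Lemma HP_plane i b : is_plane (HP i b).
Proof.
exists (sg b *: ej i), (ej i); split; first by rewrite -enorm_gt0 ej_norm.
apply/seteqP; split=> x; rewrite /HP /= dot_ej !mxE !eqxx mulr1; first by move=> ->; rewrite subrr.
by move/eqP; rewrite subr_eq0 => /eqP.
Qed.

Lemma FS_relint i b x : relint (HP i b) (FS i b) x <-> FS i b x /\ forall l, l != i -> `|x 0 l| < 1.
Proof.
have [j [k [ji ki hk]]] := others i.
split=> [[[x1 xi] /enorm_ballP[e e0 he]]|[[x1 xi] hl]]; split => //.
  move=> l li; rewrite lt_neqAle ((norm_le1 x).1 x1 l) andbT; apply/eqP => /sg_ex[c xc].
  pose y := x + (e / 2 * sg c) *: ej l.
  have yx : enorm (y - x) < e.
    rewrite /y addrAC subrr add0r enormZ ej_norm mulr1 normrM sg_norm mulr1 gtr0_norm ?divr_gt0 //.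
    by rewrite ltr_pdivrMr // ltr_pMr // ltr1n.
  have [|/norm_le1/(_ l)] := he y yx; first by rewrite /HP /y /= !mxE xi eq_sym (negbTE li) andbF mulr0 addr0.
  rewrite /y !mxE !eqxx mulr1 xc ler_norml; case: (c); rewrite /sg => /andP[u1 u2]; move: e0 u1 u2; lra.
apply/enorm_ballP; exists (Num.min (1 - `|x 0 j|) (1 - `|x 0 k|)); first by rewrite lt_min !subr_gt0 !hl.
move=> y; rewrite lt_min => /andP[yj yk] yi; split => //; apply/norm_le1 => l.
have tri m : `|y 0 m| <= `|x 0 m| + enorm (y - x).
  rewrite -[y 0 m](subrK (x 0 m)) addrC (le_trans (ler_normD _ _)) // lerD2l.
  have -> : y 0 m - x 0 m = (y - x) 0 m by rewrite !mxE.
  exact: coord_le_enorm.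
case: (hk l) => ->; first by rewrite yi sg_norm.
  by have := tri j; move: yj; lra.
by have := tri k; move: yk; lra.
Qed.

Lemma FS_closure_relint i b : closure (relint (HP i b) (FS i b)) = FS i b.
Proof.
apply/seteqP; split; first by apply: closure_closed_sub; [exact: FS_closed | move=> x []].
move=> x [x1 xi]; apply/closureE => e e0.
pose z := sg b *: ej i; pose t := Num.min 1 (e / (enorm (z - x) + 1) / 2).
have n1 : 0 < enorm (z - x) + 1 by rewrite ltr_wpDl ?enorm_ge0.
have t0 : 0 < t by rewrite lt_min ltr01 !divr_gt0.
have t1 : t <= 1 by rewrite ge_min lexx.
have te : t * (enorm (z - x) + 1) < e.
  apply: (@le_lt_trans _ _ (e / 2)); last by rewrite ltr_pdivrMr // ltr_pMr // ltr1n.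
  by rewrite -ler_pdivlMr // mulrAC ge_min lexx orbT.
have yE l : (x + t *: (z - x)) 0 l = (1 - t) * x 0 l + t * (sg b * (l == i)%:R) by rewrite !mxE eqxx /=; ring.
exists (x + t *: (z - x)); last first.
  rewrite addrAC subrr add0r enormZ gtr0_norm //; apply: le_lt_trans te.
  by rewrite ler_pM2l // lerDl.
have yi : (x + t *: (z - x)) 0 i = sg b by rewrite yE eqxx xi /= mulr1; ring.
have yl l : l != i -> `|(x + t *: (z - x)) 0 l| < 1.
  move=> li; rewrite yE (negbTE li) !mulr0 addr0 normrM ger0_norm ?subr_ge0 //.
  by have := (norm_le1 x).1 x1 l; have := normr_ge0 (x 0 l); move: (`|_|) t0 t1 => u; nra.
apply/FS_relint; split => //; split => //; apply/norm_le1 => l.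
have [->|li] := eqVneq l i; first by rewrite yi sg_norm.
exact/ltW/yl.
Qed.

Lemma FS_boundary i b : FS i b `\` relint (HP i b) (FS i b) = \bigcup_(e in pg_edges (FP i b)) e.
Proof.
apply/seteqP; split=> x.
  move=> [Fx nr]; apply: contrapT => h; apply: nr; apply/FS_relint; split => // l li.
  rewrite lt_neqAle ((norm_le1 x).1 Fx.1 l) andbT; apply/eqP => /sg_ex[c xc]; apply: h.
  by exists (ES i b l c); [exists l, c | case: Fx].
move=> [_ [j [c [ji ->]]] [x1 xi xj]]; split => //.
by move=> /FS_relint[_ /(_ j ji)]; rewrite xj sg_norm ltxx.
Qed.

Lemma finite_param (T : finType) (U : Type) (f : T -> U) (A : set U) : (forall u, A u -> exists t, u = f t) -> finite_set A.
Proof.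
move=> h; apply: (@sub_finite_set _ _ (range f)); first by move=> u /h[t ->]; exists t.
by apply: finite_image; exact: finite_finset.
Qed.

Lemma FP_polygon i b : is_polygon (FP i b).
Proof.
split.
  by apply: (@finite_param ('I_3 * bool)%type _ (fun jc => ES i b jc.1 jc.2)) => e [j [c [_ ->]]]; exists (j, c).
split; first by move=> e [j [c [ji ->]]]; apply: ES_edge; rewrite eq_sym.
split.
  move=> _ _ [j [c [ji ->]]] [j' [c' [ji' ->]]] ne.
  have [jj|jj] := eqVneq j j'.
    left; subst j'; apply/seteqP; split => // x [[_ _ x1] [_ _ x2]].
    by apply: ne; have -> : c = c' by apply: sg_inj; rewrite -x1 x2.
  right; exists (mk i b j c (sg c')); have ij : i != j by rewrite eq_sym.
  have ij' : i != j' by rewrite eq_sym.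
  have j'j : j' != j by rewrite eq_sym.
  have [k [ki kj hk]] := third ij.
  have ek : j' = k by case: (hk j') => e; move: ji' j'j; rewrite e ?eqxx.
  have eq1 : mk i b j c (sg c') = mk i b j' c' (sg c).
    apply/rowP => l; rewrite !mxE; have [//|li] := eqVneq l i.
    have [->|lj] := eqVneq l j; first by rewrite (negbTE jj).
    by case: (hk l) => el; rewrite ?el -?ek ?eqxx //; move: li lj; rewrite el eqxx.
  split; [exact: ES_endpoint | by rewrite eq1; exact: ES_endpoint |].
  apply/seteqP; split=> [x [[x1 xi xj] [_ _ xj']]|x ->].
    by rewrite /= (mk_eq hk ki kj ij xi xj) -ek xj'.
  split; first by apply: mk_ES => //; rewrite sg_norm.
  by rewrite eq1; apply: mk_ES => //; rewrite sg_norm.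
split; first exact: FS_compact.
split; first by exists (sg b *: ej i); exact: FS_center.
exists (HP i b); split; [exact: HP_plane | by move=> x [] | exact: FS_closure_relint | exact: FS_boundary].
Qed.

Lemma FP_meet F F' : ph_faces CP F -> ph_faces CP F' -> F <> F' -> faces_meet_properly F F'.
Proof.
move=> [i [b ->]] [i' [b' ->]] ne; have [ii|ii] := eqVneq i i'.
  subst i'; apply: Or31; apply/seteqP; split => // x [[_ x1] [_ x2]].
  by apply: ne; have -> : b = b' by apply: sg_inj; rewrite -x1 x2.
apply: Or33; exists (ES i b i' b'); split; last exact: FS_cap.
  by exists i', b'; rewrite eq_sym.
by exists i, b; rewrite ESC.
Qed.

Lemma cube_ball : cubeS = closed_ball 0 1.
Proof. by rewrite closed_ballE //; apply/seteqP; split=> x; rewrite /cubeS /closed_ball_ /= sub0r normrN. Qed.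

Lemma cube_interior x : interior cubeS x <-> `|x| < 1.
Proof. by rewrite cube_ball interior_closed_ballE // -ball_normE /ball_ /= sub0r normrN. Qed.

Lemma cube_frontier : frontier cubeS = \bigcup_(F in ph_faces CP) pg_set F.
Proof.
rewrite /frontier (_ : closure cubeS = cubeS); last by rewrite -(closure_id _).1 //; exact: cube_closed.
apply/seteqP; split=> x.
  move=> [x1 nx]; have [l /sg_ex[b xl]] : exists l, `|x 0 l| = 1.
    by apply: norm_eq1 => // h; apply: nx; exact/cube_interior.
  by exists (FP l b); [exists l, b | ].
move=> [_ [i [b ->]] [x1 xi]]; split => // /cube_interior; apply/negP; rewrite -leNgt -(sg_norm b) -xi.
exact: mx_coord_le_norm.
Qed.

Lemma cube_regular : closure (interior cubeS) = cubeS.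
Proof.
apply/seteqP; split; first by apply: closure_closed_sub; [exact: cube_closed | exact: interior_subset].
move=> x; rewrite {1}/cubeS /= => x1; apply/closureE => e e0; pose t := Num.min 1 (e / 4).
have t0 : 0 < t by rewrite lt_min ltr01 divr_gt0.
have t1 : t <= 1 by rewrite ge_min lexx.
have te : t * 4 <= e by rewrite -ler_pdivlMr // ge_min lexx orbT.
exists ((1 - t) *: x).
  apply/cube_interior; rewrite normrZ ger0_norm ?subr_ge0 //.
  have := normr_ge0 x; move: (`|x|) x1 t0 t1 => u; nra.
have -> : (1 - t) *: x - x = - (t *: x) by rewrite scalerBl scale1r addrAC subrr add0r.
rewrite enormN enormZ gtr0_norm //.
have := enorm_le_norm x; move: (`|x|) (enorm x) x1 => u v; nra.
Qed.

Lemma CP_polyhedron : is_polyhedron CP.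
Proof.
split.
- by apply: (@finite_param ('I_3 * bool)%type _ (fun ib => FP ib.1 ib.2)) => F [i [b ->]]; exists (i, b).
- by move=> F [i [b ->]]; exact: FP_polygon.
- exact: FP_meet.
- by split; [exact: cube_compact | exists 0; rewrite /= /cubeS /= normr0].
- by split; [exact: cube_regular | exact: cube_frontier].
Qed.

End Cube.

(** * The one-element mesh of the ball and its parametrizations *)

Section CubeMesh.
Context {R : realType}.
Implicit Types (x y p q : pt R) (i j k l : 'I_3) (b c d : bool).
Notation s3 := (Num.sqrt 3 : R).
Notation cS := (@cubeS R).
Notation CP := (@CP R).

Lemma corner_enorm p : corner p -> enorm p = s3.
Proof.
move=> hp; congr Num.sqrt; rewrite /dot !big_ord_recl big_ord0.
have e l : p 0 l * p 0 l = 1 by have [b ->] := sg_ex (hp l); case: b; rewrite /sg ?mulrNN mulr1.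
by rewrite !e; lra.
Qed.

Lemma node_corner i b p : pg_nodes (FP i b) p -> corner p.
Proof. by move=> [e [j [c [ji ->]]]]; apply: ES_corner; rewrite eq_sym. Qed.

Lemma corner_dist p q : corner p -> corner q -> p <> q -> 2 <= enorm (p - q).
Proof.
move=> hp hq pq; have [l pl] : exists l, p 0 l <> q 0 l.
  by apply: contrapT => h; apply: pq; apply/rowP => l; apply: contrapT => hl; apply: h; exists l.
apply: le_trans (coord_le_enorm _ l); rewrite !mxE.
have [b eb] := sg_ex (hp l); have [c ec] := sg_ex (hq l); move: pl; rewrite eb ec.
case: b {eb}; case: c {ec}; rewrite /sg // => _; rewrite ler_normr; apply/orP; [right|left]; lra.
Qed.

Lemma cube_diam (A : set (pt R)) : A !=set0 -> A `<=` cS -> diam A <= 4.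
Proof.
move=> [a Aa] AC; apply: ge_sup; first by exists (enorm (a - a)), (a, a).
move=> _ [[x y] [/= /AC x1 /AC y1] <-]; apply: (le_trans (enorm_le_norm _)).
have := ler_normB x y; move: x1 y1; rewrite /cubeS /=; lra.
Qed.

Lemma cube_convex x y : cS x -> cS y -> segment x y `<=` cS.
Proof.
move=> x1 y1 z [t]; rewrite /= in_itv /= => /andP[t0 t1] <-.
rewrite /cubeS /= (le_trans (ler_normD _ _)) // !normrZ !ger0_norm ?subr_ge0 //.
move: x1 y1; rewrite /cubeS /=; move: (`|x|) (`|y|) => u v; nra.
Qed.

Lemma face_nonzero i b x : FS i b x -> x != 0.
Proof. by move=> [_ xi]; apply/eqP => x0; move: xi; rewrite x0 mxE /sg; case: b; lra. Qed.

Lemma cube_surface : surface [set CP] = \bigcup_(F in ph_faces CP) pg_set F.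
Proof. by rewrite /surface /bulk bigcup_set1 /= cube_frontier. Qed.

Lemma surface_nonzero x : surface [set CP] x -> x != 0.
Proof. by rewrite cube_surface => -[_ [i [b ->]] /face_nonzero]. Qed.

Lemma mesh_facesE F : mesh_faces [set CP] F -> ph_faces CP F.
Proof. by move=> [_ ->]. Qed.

(** Only the centre can lie outside the Fermi stripe, so a single element qualifies. All diameters
    are at most 4, which is compared with unit balls for [gamma1 = 1 / 4] and with the node distance
    2 for [gamma2 = 1 / 2]. *)
Lemma cube_mesh : bulk_surface_mesh ball3 4 (1 / 4) (1 / 2) [set CP].
Proof.
have nC : cS !=set0 by exists 0; rewrite /cubeS /= normr0.
have nF i b : @FS R i b !=set0 by exists (sg b *: ej i); exact: FS_center.
have FC i b : FS i b `<=` cS by move=> x [].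
split.
- exact: finite_set1.
- by move=> _ ->; exact: CP_polyhedron.
- rewrite /bulk bigcup_set1 /=; apply/seteqP; split=> x [_ ns]; split => //;
    have -> : x = 0 by apply/eqP; apply: contrapT => /negP /ball3_stripe.
    by rewrite /ball3 /= dot0l.
  by rewrite /cubeS /= normr0.
- rewrite cube_surface; apply/seteqP; split=> x [F].
    move=> FF Fx; exists F => //; split; first by exists CP.
    by rewrite cube_surface => y Fy; exists F.
  by move=> [/mesh_facesE FF _] Fx; exists F.
- by move=> _ ->; exact: cube_diam.
- split; first by move=> _ _ -> ->.
  by move=> F F' /mesh_facesE h /mesh_facesE h'; exact: FP_meet.
- move=> F [/mesh_facesE[i [b ->]] _] p /node_corner hp; apply/sphereE; exact: corner_enorm.
- by move=> F [/mesh_facesE[i [b ->]] _] x /face_nonzero /ball3_stripe.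
- split.
    move=> _ ->; exists 0; split => // y _ hy; have d4 := cube_diam nC (fun x h => h).
    have y1 : cS y.
      rewrite subr0 in hy; rewrite /cubeS /= (le_trans (norm_le_enorm y)) // (le_trans hy) //=; lra.
    by split => // x x1; exact: cube_convex.
  move=> F /mesh_facesE[i [b ->]]; exists (HP i b); split; [exact: HP_plane | by move=> x [] |].
  have [c1 c2] := @FS_center R i b; exists (sg b *: ej i); split; first exact: c2.
  move=> y yi hy; have d4 := cube_diam (nF i b) (@FC i b).
  have e1 : enorm (y - sg b *: ej i) <= 1 by move: hy; rewrite /=; lra.
  have Fy : FS i b y.
    split => //; apply/norm_le1 => l; have [->|li] := eqVneq l i; first by rewrite yi sg_norm.
    have := le_trans (coord_le_enorm _ l) e1; by rewrite !mxE (negbTE li) andbF mulr0 subr0.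
  split => // x [x1 xi] z xz; split; first exact: cube_convex x1 Fy.1 _ xz.
  by move: xz => [t _ <-]; rewrite !mxE xi yi -mulrDl subrK mul1r.
- have key (A : set (pt R)) p q : A !=set0 -> A `<=` cS -> corner p -> corner q -> p <> q -> 1 / 2 * diam A <= enorm (p - q).
    move=> A0 AC hp hq pq; have := corner_dist hp hq pq; have := cube_diam A0 AC; lra.
  split.
    by move=> _ -> p q [_ [i [b ->]] /node_corner hp] [_ [i' [b' ->]] /node_corner hq]; exact: key.
  by move=> F /mesh_facesE[i [b ->]] p q /node_corner hp /node_corner hq; exact: (key _ p q (nF i b) (@FC i b) hp hq).
Qed.

(** Counting: eight corners do not fit among four nodes. *)
Lemma CP_not_tetrahedron : ~ is_tetrahedron CP.
Proof.
move=> [p [nodes _]]; pose i : 'I_3 := ord0; pose j : 'I_3 := lift ord0 ord0.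
have ij : i != j by []; have [k [ki kj hk]] := third ij.
pose cn (t : bool * bool * bool) := mk i t.1.1 j t.1.2 (sg t.2) : pt R.
have hn t : exists o, p o = cn t.
  have : ph_nodes CP (cn t).
    exists (FP i t.1.1); first by exists i, t.1.1.
    exists (ES i t.1.1 j t.1.2); first by exists j, t.1.2; rewrite eq_sym.
    exact: ES_endpoint.
  by rewrite nodes => -[m _ e]; exists m.
have [f hf] := choice hn.
have finj : injective f.
  move=> [[b c] d] [[b' c'] d'] e; have : cn (b, c, d) = cn (b', c', d') by rewrite -!hf e.
  move=> /rowP h; have := h i; have := h j; have := h k.
  by rewrite /cn !mk_i !mk_j ?mk_k //= => /sg_inj -> /sg_inj -> /sg_inj ->.
by have := leq_card f finj; rewrite !card_prod !card_bool card_ord.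
Qed.

(** With [u z = z / N2 z], which is bounded by [c], the Lipschitz constant of [u] near [y] is of
    order [1 / N2 y]; the factor [N1 y <= c * N2 y] compensates this singularity at the origin. *)
Lemma radial_lip (N1 N2 : pt R -> R) (c : R) : 0 <= c ->
  (forall x y, `|N1 x - N1 y| <= enorm (x - y)) -> (forall x y, `|N2 x - N2 y| <= enorm (x - y)) ->
  (forall x, 0 <= N1 x <= c * N2 x) -> (forall x, 0 <= N2 x) -> (forall x, enorm x <= c * N2 x) ->
  forall x y, enorm ((N1 x / N2 x) *: x - (N1 y / N2 y) *: y) <= (c + c * (1 + c)) * enorm (x - y).
Proof.
move=> c0 L1 L2 h1 n2 h2 x y; pose u z := (N2 z)^-1 *: z.
have u0 z : N2 z = 0 -> z = 0.
  by move=> e; apply/eqP; rewrite -enorm_eq0 eq_le enorm_ge0 andbT; have := h2 z; rewrite e mulr0.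
have uc z : enorm (u z) <= c.
  rewrite enormZ; have [e|e] := eqVneq (N2 z) 0; first by rewrite (u0 z e) enorm0 mulr0.
  have p : 0 < N2 z by rewrite lt_neqAle eq_sym e n2.
  by rewrite gtr0_norm ?invr_gt0 // ler_pdivrMl // mulrC.
have -> : (N1 x / N2 x) *: x - (N1 y / N2 y) *: y = (N1 x - N1 y) *: u x + N1 y *: (u x - u y).
  by rewrite /u scalerBl scalerBr !scalerA addrA subrK.
rewrite (le_trans (ler_enormD _ _)) // mulrDl lerD //.
  by rewrite enormZ mulrC ler_pM // enorm_ge0.
have /andP[p1 q1] := h1 y.
have [e|e] := eqVneq (N2 y) 0.
  have -> : N1 y = 0 by apply/eqP; rewrite eq_le p1 andbT; move: q1; rewrite e mulr0.
  by rewrite scale0r enorm0 !mulr_ge0 ?addr_ge0 ?enorm_ge0.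
have p : 0 < N2 y by rewrite lt_neqAle eq_sym e n2.
have -> : u x - u y = (N2 y)^-1 *: ((x - y) + (N2 y - N2 x) *: u x).
  rewrite /u; have [ex|ex] := eqVneq (N2 x) 0.
    by rewrite (u0 x ex) !scaler0 addr0 !sub0r scalerN.
  apply/rowP => l; rewrite !mxE; field; by rewrite e ex.
rewrite scalerA enormZ ger0_norm ?divr_ge0 ?(ltW p) //.
rewrite -mulrA ler_pM ?divr_ge0 ?(ltW p) ?enorm_ge0 ?ler_pdivrMr //.
rewrite (le_trans (ler_enormD _ _)) // mulrDl mul1r lerD2l enormZ mulrC ler_pM ?enorm_ge0 //.
by rewrite distrC.
Qed.

Lemma norm_elip x y : `| `|x| - `|y| | <= enorm (x - y).
Proof. exact: le_trans (ler_dist_dist _ _) (norm_le_enorm _). Qed.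

Lemma norm_le2 x : 0 <= `|x| <= 2 * enorm x.
Proof. by rewrite normr_ge0 (le_trans (norm_le_enorm x)) // ler_peMl ?enorm_ge0 // ler1n. Qed.

(** Along each ray, cube surfaces (spheres of the maximum norm) go to Euclidean spheres; [cubeH] is
    the inverse. *)
Definition cubeG x : pt R := s3 *: ((`|x| / enorm x) *: x).
Definition cubeH x : pt R := s3^-1 *: ((enorm x / `|x|) *: x).

Lemma s3_le2 : s3 <= 2.
Proof. by rewrite -(@ler_pXn2r _ 2) ?nnegrE ?sqrtr_ge0 // s3_sqr; lra. Qed.

Lemma cubeG_lip x y : enorm (cubeG x - cubeG y) <= 16 * enorm (x - y).
Proof.
have s0 := @s3_gt0 R; have h := @radial_lip (fun x => `|x|) (@enorm R) 2 (ler0n _ 2) norm_elip (@enorm_lip R) norm_le2 (@enorm_ge0 R).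
rewrite -scalerBr enormZ gtr0_norm //.
have {}h := h (fun x => ler_peMl (enorm_ge0 x) (ler1n R 2)) x y.
have := s3_le2; have := enorm_ge0 (x - y); move: h s0; move: (enorm (x - y)) (enorm _) s3 => u v s; nra.
Qed.

Lemma cubeH_lip x y : enorm (cubeH x - cubeH y) <= s3^-1 * (8 * enorm (x - y)).
Proof.
have s0 := @s3_gt0 R; rewrite -scalerBr enormZ gtr0_norm ?invr_gt0 // ler_pM2l ?invr_gt0 //.
have h := @radial_lip (@enorm R) (fun x => `|x|) 2 (ler0n _ 2) (@enorm_lip R) norm_elip _ (fun x => normr_ge0 x) (@enorm_le_norm R) x y.
apply: le_trans (h _) _; first by move=> z; rewrite enorm_ge0 enorm_le_norm.
by rewrite ler_wpM2r ?enorm_ge0 //; lra.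
Qed.

Lemma cubeG_norm x : enorm (cubeG x) = s3 * `|x|.
Proof.
have s0 := @s3_gt0 R; rewrite !enormZ gtr0_norm // ger0_norm ?divr_ge0 ?enorm_ge0 //; congr (_ * _).
have [->|x0] := eqVneq x 0; first by rewrite normr0 mul0r mul0r.
by rewrite divfK // enorm_eq0.
Qed.

Lemma cubeH_norm x : s3 * `|cubeH x| = enorm x.
Proof.
have s0 := @s3_gt0 R.
have -> : `|cubeH x| = s3^-1 * (enorm x / `|x| * `|x|).
  by rewrite normrZ [`|_ *: x|]normrZ (@gtr0_norm _ s3^-1) ?invr_gt0 // (@ger0_norm _ (enorm x / _)) // divr_ge0 // enorm_ge0.
rewrite mulVKf ?gt_eqF //.
have [->|x0] := eqVneq x 0; first by rewrite normr0 mulr0 enorm0.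
by rewrite divfK // normr_eq0.
Qed.

Lemma cubeHG x : cubeH (cubeG x) = x.
Proof.
have s0 := @s3_gt0 R; have [->|x0] := eqVneq x 0; first by rewrite /cubeG /cubeH !scaler0.
have nx : `|x| != 0 by rewrite normr_eq0.
have ex : enorm x != 0 by rewrite enorm_eq0.
have sn : s3 != 0 by rewrite gt_eqF.
rewrite /cubeH cubeG_norm /cubeG !normrZ gtr0_norm // ger0_norm ?divr_ge0 ?enorm_ge0 // (@ger0_norm _ (enorm x)^-1) ?invr_ge0 ?enorm_ge0 // !scalerA.
rewrite (_ : _ * _ = 1) ?scale1r //; field; by rewrite sn ex nx.
Qed.

Lemma cubeGH x : cubeG (cubeH x) = x.
Proof.
have s0 := @s3_gt0 R; have [->|x0] := eqVneq x 0; first by rewrite /cubeG /cubeH !scaler0.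
have nx : `|x| != 0 by rewrite normr_eq0.
have ex : enorm x != 0 by rewrite enorm_eq0.
have sn : s3 != 0 by rewrite gt_eqF.
rewrite /cubeG /cubeH !enormZ !normrZ !(@gtr0_norm _ s3^-1) ?invr_gt0 // !ger0_norm ?divr_ge0 ?enorm_ge0 // !scalerA.
rewrite (_ : _ * _ = 1) ?scale1r //; field; by rewrite sn ex nx.
Qed.

(** Ensures that the negative statement about all parametrizations of this mesh is not vacuous. *)
Lemma cube_parametrization : exists (C : R) (G : pt R -> pt R), 0 < C /\ bulk_parametrization ball3 4 C [set CP] G.
Proof.
pose w x := cubeG x - x; have eG x : x + w x = cubeG x by rewrite /w addrC subrK.
have wL x y : enorm (w x - w y) <= 17 * enorm (x - y).
  have -> : w x - w y = (cubeG x - cubeG y) - (x - y) by rewrite /w; move: (cubeG x) (cubeG y) => u v; apply/rowP => l; rewrite !mxE; ring.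
  have := ler_enormB (cubeG x - cubeG y) (x - y); have := cubeG_lip x y; lra.
pose C : R := 18 * (17 * (1 + 17) ^+ 2).
have C0 : 0 < C by rewrite /C; do 2 (apply: mulr_gt0; first by rewrite ltr0n); rewrite exprn_gt0 // addr_gt0 // ltr0n.
have C34 : 34 <= C.
  rewrite /C; have : 1 <= (1 + 17 : R) ^+ 2 by rewrite expr_ge1 // ?lerDl ?addr_ge0 ?ler0n.
  by move: (_ ^+ 2) => z; lra.
exists C, (fun x => x + w x); split => //.
have bk : bulk [set CP] = cS by rewrite /bulk bigcup_set1.
apply: (lip_parametrization (eps := 17)) => //; rewrite ?ltr0n //.
- by rewrite bk; have /compactE[_ ?] := @cube_compact R; apply/bounded_enormP.
- by rewrite mulr_ge0 ?sqr_ge0 // ltW.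
- by rewrite -/C ler_peMr ?(ltW C0) // ler1n.
- move=> x [_ [-> _]] /= x1; have w0 : w 0 = 0 by rewrite /w /cubeG scaler0 scaler0 subr0.
  have := wL x 0; rewrite w0 !subr0 => h; apply: (le_trans h).
  have := enorm_le_norm x; move: x1; rewrite /cubeS /= => x1 x2.
  have : C * 1 <= C * 4 ^+ 2 by rewrite ler_pM2l // expr_ge1 ?ler0n ?ler1n.
  by move: C34; move: (C * 4 ^+ 2) (C) (enorm x) (`|x|) x1 x2 => *; lra.
- exists cubeH; rewrite bk; split.
  + apply: continuous_subspaceT; apply: (@elip_continuous _ _ _ 16) => x y; rewrite !eG.
    exact: le_trans (norm_le_enorm _) (cubeG_lip x y).
  + apply: continuous_subspaceT; apply: (@elip_continuous _ _ _ (s3^-1 * 8)) => x y.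
    by rewrite (le_trans (norm_le_enorm _)) // (le_trans (cubeH_lip x y)) // mulrA.
  + move=> x x1; rewrite eG; split; last exact: cubeHG.
    by apply/closure_ball3; rewrite cubeG_norm ler_piMr ?sqrtr_ge0.
  + move=> y /closure_ball3 y1; rewrite eG; split; last exact: cubeGH.
    by rewrite /cubeS /= -(@ler_pM2l _ s3) ?s3_gt0 // cubeH_norm mulr1.
- move=> x Sx; have x0 := surface_nonzero Sx; rewrite eG ball3_projection // /cubeG /rproj scalerA.
  have -> : `|x| = 1; last by rewrite div1r.
  move: Sx; rewrite /surface bk => -[]; rewrite (_ : closure cS = cS); last by rewrite -(closure_id _).1 //; exact: cube_closed.
  move=> x1 nx; apply/eqP; rewrite eq_le x1 leNgt; apply/negP => h; apply: nx; exact/cube_interior.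
- move=> x [Bx nB]; exfalso; apply: nB; exists CP; last by rewrite bk in Bx.
  split => //; left; exists (FP ord0 true); first by exists ord0, true.
  by rewrite cube_surface => y Fy; exists (FP ord0 true) => //; exists ord0, true.
Qed.

Lemma quot_cvg_vec (W : normedModType R) (f : pt R -> W) x v : derivable f x v ->
  (fun n => n.+1%:R *: (f (n.+1%:R^-1 *: v + x) - f x)) @ \oo --> 'D_v f x.
Proof.
move=> df; pose u (n : nat) : R := n.+1%:R^-1.
have u0 : u n @[n --> \oo] --> 0^'.
  move=> B hB; have h1 : \forall n \near \oo, u n != 0 -> B (u n) := @cvg_harmonic R _ hB.
  have h2 : \forall n \near \oo, B (u n).
    by apply: filterS h1 => n; apply; rewrite /u invr_eq0 pnatr_eq0.
  exact: h2.
have := cvg_comp _ _ u0 df; apply: cvg_trans; apply: near_eq_cvg; near=> n.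
by rewrite /= /u invrK.
Unshelve. all: by end_near. Qed.

(** Difference quotients with positive steps determine a directional derivative that exists, so
    values on one side, within a face or within the cube, are enough. *)
Lemma derive_ray (W : normedModType R) (f g : pt R -> W) x v : derivable f x v -> derivable g x v -> f x = g x ->
  (forall t : R, 0 < t <= 1 -> f (t *: v + x) = g (t *: v + x)) -> 'D_v f x = 'D_v g x.
Proof.
move=> df dg e0 e1; apply: (cvg_unique _ (quot_cvg_vec df)); first exact: norm_hausdorff.
have E : (fun n => n.+1%:R *: (g (n.+1%:R^-1 *: v + x) - g x)) = (fun n => n.+1%:R *: (f (n.+1%:R^-1 *: v + x) - f x)).
  by apply/funext => n; rewrite e0 e1 // invr_gt0 ltr0n /= invf_le1 // ler1n.
by have := quot_cvg_vec dg; rewrite E.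
Qed.

Lemma derive_chain (U V W : normedModType R) (f : U -> V) (g : V -> W) (x v : U) : differentiable f x -> differentiable g (f x) ->
  'D_v (g \o f) x = 'D_('D_v f x) g (f x).
Proof. by move=> df dg; rewrite (deriveE v df) (deriveE _ dg) (deriveE v (differentiable_comp df dg)) diff_comp. Qed.

Lemma derive_dirD (V W : normedModType R) (f : V -> W) (x u v : V) : differentiable f x -> 'D_(u + v) f x = 'D_u f x + 'D_v f x.
Proof. by move=> df; rewrite (deriveE _ df) (deriveE u df) (deriveE v df) linearD. Qed.

Lemma derive_dirN (V W : normedModType R) (f : V -> W) (x v : V) : differentiable f x -> 'D_(- v) f x = - 'D_v f x.
Proof. by move=> df; rewrite (deriveE _ df) (deriveE v df) linearN. Qed.

Lemma derive_dir0 (V W : normedModType R) (f : V -> W) (x : V) : differentiable f x -> 'D_0 f x = 0.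
Proof. by move=> df; rewrite (deriveE _ df) linear0. Qed.

Lemma rproj_diff x : x != 0 -> differentiable (@rproj R) x.
Proof.
move=> x0; have [L hL] : sd (@rproj R) x.
  apply: (@sdZ _ _ _ (fun y : pt R => s3 / enorm y) id); last exact: sd_id.
  apply: sdM; first exact: sd_cst.
  by apply: sd_inv; [apply: sd_enorm => //; exact: sd_id | rewrite enorm_gt0].
exact: sdiff_differentiable hL.
Qed.

(* At the midpoint [x0 = (1, 1, 0)] of an edge both adjacent faces are mapped by
   the radial projection, which forces the derivative of a smooth extension of
   [G] to kill the radial direction [x0] there. *)
Lemma cube_not_diffeomorphic (C : R) (G : pt R -> pt R) : bulk_parametrization ball3 4 C [set CP] G ->
  ~ diffeomorphism_on cS G.
Proof.
move=> GP [P [Q [[dP _] [dQ _] hPQ]]].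
pose i : 'I_3 := ord0; pose j : 'I_3 := lift ord0 ord0.
have ij : i != j by []; have ji : j != i by [].
pose x0 : pt R := ej i + ej j.
have x0i : x0 0 i = 1 by rewrite !mxE !eqxx (negbTE ij) addr0.
have x0j : x0 0 j = 1 by rewrite !mxE !eqxx (negbTE ji) add0r.
have x0l l : 0 <= x0 0 l <= 1.
  rewrite !mxE /=; have [->|li] := eqVneq l i; first by rewrite (negbTE ij) addr0 ler01 lexx.
  by case: (l == j); rewrite add0r ?ler01 ?lexx.
have nz : x0 != 0 by apply/eqP => e; move: x0i; rewrite e mxE => /eqP; rewrite eq_sym oner_eq0.
have faceP m y : FS m false y -> P y = rproj y.
  move=> Fy; have [-> _] := hPQ y Fy.1; have n0 := face_nonzero Fy.
  rewrite (param_surface GP) ?ball3_projection // cube_surface; exists (FP m false) => //.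
  by exists m, false.
have onF m m' t : m != m' -> x0 0 m' = 1 -> 0 <= t <= 1 -> x0 0 m = 1 -> FS m' false (t *: - ej m + x0).
  move=> mm xm' /andP[t0 t1] xm; have v l : (t *: - ej m + x0) 0 l = x0 0 l - t * (l == m)%:R by rewrite !mxE eqxx /=; ring.
  split; last by rewrite v xm' eq_sym (negbTE mm) mulr0 subr0.
  apply/norm_le1 => l; rewrite v ler_norml; have [lm|lm] := eqVneq l m.
    by rewrite lm xm mulr1; apply/andP; split; lra.
  have /andP[u1 u2] := x0l l; rewrite mulr0 subr0 u2 andbT; lra.
have x0F m : x0 0 m = 1 -> FS m false x0.
  move=> xm; split => //; apply/norm_le1 => l; have /andP[u1 u2] := x0l l.
  by rewrite ger0_norm.
have dr := rproj_diff nz.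
(* The direction [- ej m] runs from [x0] into the face where the coordinate [m'] equals 1, and there
   [P] is the radial projection. *)
have key m m' : m != m' -> x0 0 m = 1 -> x0 0 m' = 1 -> 'D_(- ej m) P x0 = 'D_(- ej m) (@rproj R) x0.
  move=> mm xm xm'; apply: derive_ray; try exact: diff_derivable.
    by apply: faceP (x0F m' xm').
  by move=> t /andP[t0 t1]; apply: faceP; apply: (onF m m') => //; rewrite t1 ltW.
have ki := key i j ij x0i x0j; have kj := key j i ji x0j x0i.
(* The radial projection is constant along the ray through [x0]. *)
have dr0 : 'D_x0 (@rproj R) x0 = 0.
  rewrite -(derive_cst (rproj x0) x0 x0); apply: derive_ray => //; first exact: diff_derivable.
  move=> t /andP[t0 _]; rewrite /cst -[X in _ + X]scale1r -scalerDl.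
  have t1 : 0 < t + 1 by rewrite addr_gt0.
  have xp : enorm x0 != 0 by rewrite enorm_eq0.
  rewrite /rproj enormZ gtr0_norm // scalerA; congr (_ *: _); field; by rewrite xp gt_eqF.
have dP0 : 'D_(- x0) P x0 = 0.
  have nx : - x0 = - ej i + - ej j by rewrite /x0 opprD.
  have -> : 'D_(- x0) P x0 = 'D_(- ej i) P x0 + 'D_(- ej j) P x0 by rewrite {1}nx; exact: derive_dirD.
  have -> : 'D_(- ej i) P x0 + 'D_(- ej j) P x0 = 'D_(- ej i) (@rproj R) x0 + 'D_(- ej j) (@rproj R) x0 by rewrite ki kj.
  by rewrite -(derive_dirD _ _ dr) -nx (derive_dirN _ dr) dr0 oppr0.
(* The segment from [x0] towards the centre stays in the cube, where [Q \o P] is the identity; its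
   derivative should be [- x0], but the chain rule gives 0. *)
have : 'D_(- x0) (Q \o P) x0 = 'D_(- x0) id x0.
  have cS0 (t : R) : 0 <= t <= 1 -> cS (t *: - x0 + x0).
    move=> /andP[t0 t1]; have -> : t *: - x0 + x0 = (1 - t) *: x0 by rewrite scalerBl scale1r scalerN addrC.
    rewrite /cubeS /= normrZ ger0_norm ?subr_ge0 // mulr_ile1 ?subr_ge0 ?normr_ge0 //; first by rewrite lerBlDr lerDl.
    exact: (x0F i x0i).1.
  have QP y : cS y -> Q (P y) = y by move=> cy; have [-> ->] := hPQ y cy.
  apply: derive_ray.
  - by apply: diff_derivable; exact: differentiable_comp.
  - exact: derivable_id.
  - by apply: QP; have := x0F i x0i => -[].
  - by move=> t /andP[t0 t1]; apply: QP; apply: cS0; rewrite t1 ltW.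
rewrite (derive_chain _ (dP x0) (dQ (P x0))) dP0 (derive_dir0 (dQ (P x0))) derive_id => /esym/eqP.
by rewrite oppr_eq0 (negbTE nz).
Qed.

End CubeMesh.

(* Otherwise [done] and [lra] may unfold distances and norms. *)
(** * The polyhedral surface and the exact boundary *)

Opaque oriented_distance normal_projection normal diam enorm dot.

Section MeshConstants.
Context {R : realType}.
(** The constant [2 * (1 + D / r)] of [bd_path] for [r = gam * D]. *)
Definition kap (gam : R) := 2 * (1 + gam^-1).
(** Slope of [od] on a surface face per unit of face diameter: [gam^-1] from the tilt of the face, 8
    from [tangent_lip]. *)
Definition Cflat (gam R0 : R) := (gam^-1 + 8) / R0.
(** The first summand contradicts the node produced by [face_separation], 16 keeps tilts below 1/16,
    and the last one provides the closeness required by the separation lemmas and the bound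
    [5 / gam] used in [below]. *)
Definition Kgap (gam : R) := kap gam ^+ 2 * (kap gam + 1) + 16 + (2 * kap gam * (kap gam + 1) + 5) / gam.
End MeshConstants.

Section Mesh.
Context {R : realType} (Om : set (pt R)) (R0 : R) (T : tube Om R0).
Variables (gam gam2 h : R) (M : set (polyhedron R)).
Hypotheses (g0 : 0 < gam) (h0 : 0 < h) (hs : h <= R0 / 200).
Hypothesis (hk : Cflat gam R0 * h * (Kgap gam + kap gam) <= 1).
Hypothesis HM : bulk_surface_mesh Om h gam gam2 M.
Implicit Types (F G : polygon R) (E : polyhedron R) (x y z p q c n u : pt R).
Notation Gam := (frontier Om).
Notation od := (oriented_distance Om).
Notation nu := (normal Om).
Notation A := (normal_projection Om).
Notation dm := (fun F => diam (pg_set F)).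
Notation dE := (fun E => diam (ph_set E)).
Let r0 := tb_pos T.

Lemma kap2 : 2 < kap gam.
Proof. by rewrite /kap mulrDr mulr1 ltrDl mulr_gt0 // invr_gt0. Qed.

Lemma Mface F : mesh_faces M F -> is_polygon F /\ exists H c0 n c, [/\ enorm n = 1, H = [set x | dot n (x - c0) = 0],
    star H (pg_set F) c (gam * dm F) (dm F),
    bd H (pg_set F) = \bigcup_(e in pg_edges F) e & 0 < dm F].
Proof.
move=> MF; have [E ME EF] := MF; have pF : is_polygon F by case: (mesh_polyhedra HM ME) => _ /(_ F EF).
by split => //; apply: polygon_face => //; exact: (mesh_V1 HM).2.
Qed.

Lemma Melem E : M E -> is_polyhedron E /\ exists c, [/\ star setT (ph_set E) c (gam * dE E) (dE E),
      bd setT (ph_set E) = frontier (ph_set E) & 0 < dE E].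
Proof.
move=> ME; have pE := mesh_polyhedra HM ME; split=> //; apply: polyhedron_elem => //.
exact: (mesh_V1 HM).1.
Qed.

Lemma Mdiams E : M E -> diams_ok gam E.
Proof. by move=> ME F EF; apply: (Mface _).2; exists E. Qed.

Lemma face_sub E F : M E -> ph_faces E F -> pg_set F `<=` ph_set E.
Proof.
move=> /(mesh_polyhedra HM)[_ _ _ [cE _] [_ hfr]] EF x Fx.
have : frontier (ph_set E) x by rewrite hfr; exists F.
by case=> + _; rewrite -(closure_id _).1 //; case/compactE: cE.
Qed.

Lemma face_diam E F : M E -> ph_faces E F -> dm F <= dE E.
Proof.
move=> ME EF; have [[_ [_ [_ [_ [F0 _]]]]] _] := Mface (ex_intro2 _ _ E ME EF).
by have [_ _ _ [cE _] _] := mesh_polyhedra HM ME; apply: diam_mono => //; exact: face_sub.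
Qed.

Lemma face_h F : mesh_faces M F -> 0 < dm F <= h.
Proof.
move=> MF; have [_ [_ [_ [_ [_ [_ _ _ _ ->]]]]]] := Mface MF.
by have [E ME EF] := MF; rewrite (le_trans (face_diam ME EF)) // (mesh_F1 HM).
Qed.

Lemma bulk_compact : compact (bulk M).
Proof.
have fM := mesh_finite HM; have cE E : M E -> compact (ph_set E) by move=> /(mesh_polyhedra HM)[_ _ _ [cE _] _].
apply/compactE; split; first by apply: fin_closed => // E /cE/compactE[].
have [n [f eM]] := fin_enum fM.
have /choice[C hC] : forall i : 'I_n, exists C, 0 <= C /\ forall x, ph_set (f i) x -> enorm x <= C.
  move=> i; have /cE/compactE[_ [C hC]] : M (f i) by rewrite eM; exists i.
  by exists `|C|; split => // x /hC hx; rewrite (le_trans hx) // ler_norm.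
exists (\sum_i C i) => x [E]; rewrite eM => -[i _ <-] /(hC i).2 hx; apply: (le_trans hx).
by rewrite (bigD1 i) //= lerDl sumr_ge0 // => j _; case: (hC j).
Qed.

Lemma surface_bulk x : surface M x -> bulk M x.
Proof. by case=> + _; rewrite -(closure_id _).1 //; case/compactE: bulk_compact. Qed.

Lemma surfaceP x : surface M x -> exists2 F, surface_faces M F & pg_set F x.
Proof. by rewrite (mesh_surface HM) => -[F]; exists F. Qed.

Lemma face_node F : mesh_faces M F -> exists p, pg_nodes F p.
Proof.
move=> /Mface[pF _]; have [x Fx] := pF.2.2.2.2.1.
by have [p Np _] := polygon_max 0 pF Fx; exists p.
Qed.

Lemma face_dist F x y : mesh_faces M F -> pg_set F x -> pg_set F y -> enorm (x - y) <= dm F.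
Proof. by move=> /Mface[[_ [_ [_ [cF _]]]] _]; exact: diam_ub. Qed.

Lemma surface_rdist x : surface M x -> rdist Om x <= h.
Proof.
move=> /surfaceP[F sF Fx]; have MF := sF.1; have [p Np] := face_node MF.
have Gp := mesh_F3 HM sF Np; apply: (le_trans (rdist_le x Gp)).
have [pF _] := Mface MF; have Fp := node_in pF Np.
by apply: (le_trans (face_dist MF Fx Fp)); case/andP: (face_h MF).
Qed.

Lemma bulk_far x : h < rdist Om x -> (bulk M x <-> Om x).
Proof.
by apply: (agree_far T) => //; [exact: ltW | exact: bulk_compact | exact: surface_rdist | exact: mesh_bulk_approx HM].
Qed.

(** Expansion of [od] at [y]: besides the tilt [e], the quadratic error contributes [2 * rho / R0]
    and the turning of the normal between [p0] and [y] contributes [6 * rho / R0]. *)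
Lemma tangent_lip p0 x y e rho : Gam p0 -> enorm (x - p0) <= rho -> enorm (y - p0) <= rho -> rho <= R0 / 2 ->
  `|dot (nu p0) (x - y)| <= e * enorm (x - y) -> `|od x - od y| <= (e + 8 * rho / R0) * enorm (x - y).
Proof.
move=> Gp hx hy hrho he.
have hp : od p0 = 0 := tod0 T Gp; have Ap : A p0 = p0 := tA_Gam T Gp.
have oy : `|od y| <= R0 / 2.
  by have := tod_lip T y p0; rewrite hp subr0 => h1; apply: (le_trans h1); exact: le_trans hrho.
have q0 : `|od p0| <= R0 / 2 by rewrite hp normr0 divr_ge0 // ltW.
have h1 := todQ T x oy; have h2 := tg_lip T oy q0; rewrite Ap in h2.
have xy : enorm (x - y) <= 2 * rho.
  by apply: (le_trans (enorm_triangle p0 x y)); rewrite (enormB p0) mulr_natl mulr2n lerD.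
have -> : od x - od y = (od x - od y - dot (nu (A y)) (x - y)) + dot (nu (A y) - nu p0) (x - y) + dot (nu p0) (x - y).
  by rewrite [dot (_ - _) _]dotDl dotNl; ring.
have h3 : `|dot (nu (A y) - nu p0) (x - y)| <= 6 * rho / R0 * enorm (x - y).
  apply: (le_trans (dot_abs _ _)); rewrite ler_wpM2r ?enorm_ge0 //; apply: (le_trans h2).
  by rewrite mulrAC ler_pM2r ?invr_gt0 // ler_pM2l.
have h4 : enorm (x - y) ^+ 2 / R0 <= 2 * rho / R0 * enorm (x - y).
  by rewrite expr2 mulrAC ler_wpM2r ?enorm_ge0 // ler_pM2r ?invr_gt0.
apply: (le_trans (ler_normD _ _)); apply: (le_trans (lerD (ler_normD _ _) (lexx _))).
apply: (le_trans (lerD (lerD (le_trans h1 h4) h3) he)).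
by rewrite -!mulrDl ler_wpM2r ?enorm_ge0 // le_eqVlt; apply/orP; left; apply/eqP; ring.
Qed.

(** Near-tangency of a surface face: [n] is the normal of its plane, oriented like the outward
    normal at the node [p0], and [dm F / (gam * R0)] measures the angle between the two. *)
Definition flat_at F p0 n := [/\ pg_nodes F p0 /\ pg_set F p0, Gam p0, enorm n = 1,
  (enorm (n - nu p0) <= 1 / 8 /\ enorm (nu p0 - dot n (nu p0) *: n) <= dm F / (gam * R0)) /\
   (forall x, pg_set F x -> dot n (x - p0) = 0) /\
   pg_set F `\` relint [set x | dot n (x - p0) = 0] (pg_set F) = \bigcup_(e in pg_edges F) e &
  forall u, dot n u = 0 -> `|dot (nu p0) u| <= dm F / (gam * R0) * enorm u].

Lemma Cflat_ge : gam^-1 / R0 <= Cflat gam R0.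
Proof. by rewrite /Cflat ler_pM2r ?invr_gt0 // lerDl. Qed.

Lemma Kc_gt0 : 16 + 5 / gam <= Kgap gam + kap gam.
Proof.
have k2 := kap2; have gi : 0 < gam^-1 by rewrite invr_gt0.
have : 0 <= (2 * kap gam * (kap gam + 1)) / gam by rewrite divr_ge0 ?(ltW g0) // !mulr_ge0 //; lra.
have : 0 <= kap gam ^+ 2 * (kap gam + 1) by rewrite mulr_ge0 ?sqr_ge0 //; lra.
rewrite /Kgap mulrDl; lra.
Qed.

Lemma Ch_small : Cflat gam R0 * h <= 1 / 16 /\ Cflat gam R0 * h <= gam / 5.
Proof.
have k1 := Kc_gt0; have gi : 0 < 5 / gam by rewrite divr_gt0.
have C0 : 0 <= Cflat gam R0 * h.
  by rewrite mulr_ge0 ?(ltW h0) // divr_ge0 ?(ltW r0) // addr_ge0 // invr_ge0 ltW.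
have h1 := hk; split.
  have : Cflat gam R0 * h * 16 <= Cflat gam R0 * h * (Kgap gam + kap gam) by rewrite ler_wpM2l //; lra.
  lra.
have : Cflat gam R0 * h * (5 / gam) <= Cflat gam R0 * h * (Kgap gam + kap gam) by rewrite ler_wpM2l //; lra.
move=> h2; have {}h2 := le_trans h2 h1; move: h2; rewrite mulrA ler_pdivrMr // mul1r; lra.
Qed.

Lemma face_eps F : mesh_faces M F -> dm F / (gam * R0) <= Cflat gam R0 * h.
Proof.
move=> /face_h/andP[d0 dh]; have := Cflat_ge; rewrite -invfM => Cg.
rewrite mulrC; apply: ler_pM => //; rewrite ?invr_ge0 ?mulr_ge0 ?ltW //.
Qed.

(** Nodes lie on the boundary, hence within [dm^2 / R0] of the tangent plane at [p0]; [polygon_max]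
    carries this to the whole face. Evaluating at opposite points of the inscribed disc of radius
    [gam * dm] turns the height bound into the slope bound [dm / (gam * R0)]. *)
Lemma surf_flat F : surface_faces M F -> exists p0 n, flat_at F p0 n.
Proof.
move=> sF; have MF := sF.1; have [pF [H [c0 [n [c [n1 eH SF hb dF]]]]]] := Mface MF.
have [p0 Np] := face_node MF; have Gp := mesh_F3 HM sF Np; have Fp := node_in pF Np.
have hp : od p0 = 0 := tod0 T Gp; have Ap : A p0 = p0 := tA_Gam T Gp.
have nu1p : enorm (nu p0) = 1 by rewrite -Ap (tnu1 T).
pose v := nu p0; pose e := dm F / (gam * R0).
have gr : 0 < gam * R0 by rewrite mulr_gt0.
have e0 : 0 <= e by rewrite divr_ge0 // ltW.
have e16 : e <= 1 / 16 by apply: le_trans (face_eps MF) Ch_small.1.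
have nodeb q : pg_nodes F q -> `|dot v (q - p0)| <= dm F ^+ 2 / R0.
  move=> Nq; have Gq := mesh_F3 HM sF Nq.
  have := @todQ _ _ _ T p0 q; rewrite hp (tod0 T Gq) Ap subrr sub0r normrN normr0 => /(_ (divr_ge0 (ltW r0) (ler0n _ 2))) h1.
  apply: (le_trans h1); rewrite ler_pM2r ?invr_gt0 // ler_pXn2r ?nnegrE ?enorm_ge0 ?(ltW dF) //.
  exact: face_dist MF (node_in pF Nq) Fp.
have faceb x : pg_set F x -> `|dot v (x - p0)| <= dm F ^+ 2 / R0.
  move=> Fx; have [q Nq hq] := polygon_max v pF Fx; have [q' Nq' hq'] := polygon_max (- v) pF Fx.
  have := nodeb _ Nq; have := nodeb _ Nq'; rewrite !ler_norml !dotDr !dotNl in hq hq' *.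
  by move=> /andP[a1 a2] /andP[a3 a4]; apply/andP; split; lra.
have Hn x : pg_set F x -> dot n (x - c0) = 0 by move=> /(st_sub SF); rewrite eH.
have eHp : [set x | dot n (x - c0) = 0] = [set x | dot n (x - p0) = 0].
  by apply/seteqP; split => x /=; move/(plane_dir _ (Hn _ Fp)).
have dirb u : dot n u = 0 -> `|dot v u| <= e * enorm u.
  move=> nu0; have [->|u0] := eqVneq u 0; first by rewrite dot0r normr0 enorm0 mulr0.
  have uu : 0 < enorm u by rewrite enorm_gt0.
  have Hc := st_c SF; rewrite eH /= in Hc.
  pose t := gam * dm F / enorm u; have t0 : 0 < t by rewrite divr_gt0 // mulr_gt0.
  have inF s : `|s| = t -> pg_set F (c + s *: u).
    move=> st; apply: (st_ball SF).
      by rewrite eH /=; apply/(plane_dir _ Hc); rewrite [c + _]addrC addrK dotZr nu0 mulr0.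
    by rewrite [c + _]addrC addrK enormZ st /t divfK // gt_eqF.
  have : t * `|dot v u| <= dm F ^+ 2 / R0.
    move: (faceb _ (inF t (gtr0_norm t0))) (faceb _ (inF (- t) (etrans (normrN t) (gtr0_norm t0)))).
    rewrite !dotDr !dotZr !ler_norml => /andP[a1 a2] /andP[a3 a4].
    by rewrite -[t in leLHS]gtr0_norm // -normrM ler_norml; apply/andP; split; lra.
  rewrite mulrC -ler_pdivlMr // => h1; apply: (le_trans h1).
  by rewrite le_eqVlt; apply/orP; left; apply/eqP; rewrite /t /e; field; rewrite !gt_eqF.
have key m : enorm m = 1 -> (forall u, dot m u = 0 <-> dot n u = 0) -> 0 <= dot m v -> flat_at F p0 m.
  move=> m1 hm mv; have mm : dot m m = 1 by rewrite -enorm2 m1 expr1n.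
  have vv : dot v v = 1 by rewrite -enorm2 nu1p expr1n.
  pose w := v - dot m v *: m.
  have mw : dot m w = 0 by rewrite /w dotDr dotNr dotZr mm mulr1 subrr.
  have vw : dot v w = enorm w ^+ 2.
    by rewrite enorm2 {2}/w dotDl dotNl dotZl mw mulr0 subr0.
  have we : enorm w <= e.
    have [w0|w0] := eqVneq (enorm w) 0; first by rewrite w0.
    have wp : 0 < enorm w by rewrite lt_neqAle eq_sym w0 enorm_ge0.
    have := dirb w ((hm w).1 mw); rewrite vw ger0_norm ?sqr_ge0 // expr2 ler_pM2r //.
  have sw : dot m v ^+ 2 = 1 - enorm w ^+ 2.
    rewrite -vw /w dotDr dotNr dotZr vv (dotC v m); ring.
  have s1 : 1 - e <= dot m v.
    rewrite -(@ler_pXn2r _ 2) ?nnegrE ?subr_ge0 //; last lra.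
    rewrite sw; have : enorm w ^+ 2 <= e ^+ 2 by rewrite ler_pXn2r ?nnegrE ?enorm_ge0.
    nra.
  have s2 : dot m v <= 1 by have := dot_le m v; rewrite m1 nu1p mulr1.
  have mv8 : enorm (m - v) <= 1 / 8.
    have -> : m - v = (1 - dot m v) *: m - w by rewrite /w; apply/rowP => i; rewrite !mxE; ring.
    apply: (le_trans (ler_enormB _ _)); rewrite enormZ m1 mulr1 ger0_norm ?subr_ge0 //; lra.
  have eHm : [set x | dot n (x - p0) = 0] = [set x | dot m (x - p0) = 0].
    by apply/seteqP; split => x /=; move/hm.
  split => //; last by move=> u /hm; exact: dirb.
  split; first by split.
  split; first by move=> x Fx; apply/hm; have := Hn _ Fx; move/(plane_dir _ (Hn _ Fp)).
  by rewrite -hb /bd eH eHp eHm.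
have [nv|nv] := lerP 0 (dot n v); first by exists p0, n; apply: key.
exists p0, (- n); apply: key; rewrite ?enormN // ?dotNl ?oppr_ge0 ?(ltW nv) // => u.
by rewrite dotNl; split => [/eqP|->]; rewrite ?oppr0 // oppr_eq0 => /eqP.
Qed.

Lemma flat_lip F p0 n x y : mesh_faces M F -> flat_at F p0 n -> pg_set F x -> pg_set F y ->
  `|od x - od y| <= Cflat gam R0 * dm F * enorm (x - y).
Proof.
move=> MF [[Np Fp] Gp n1 [_ [hF _]] hu] Fx Fy; have /andP[d0 dh] := face_h MF.
have := @tangent_lip p0 x y (dm F / (gam * R0)) (dm F) Gp (face_dist MF Fx Fp) (face_dist MF Fy Fp) _ _.
have -> : dm F / (gam * R0) + 8 * dm F / R0 = Cflat gam R0 * dm F.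
  by rewrite /Cflat; field; rewrite !gt_eqF.
apply.
  by have := hs; have := r0; lra.
apply: hu; have := hF _ Fx; have := hF _ Fy; rewrite !dotDr !dotNr; lra.
Qed.

Lemma surf_lip F x y : surface_faces M F -> pg_set F x -> pg_set F y ->
  `|od x - od y| <= Cflat gam R0 * dm F * enorm (x - y).
Proof. by move=> sF; have [p0 [n hf]] := surf_flat sF; exact: flat_lip sF.1 hf. Qed.

Lemma surf_od F x : surface_faces M F -> pg_set F x -> `|od x| <= Cflat gam R0 * dm F ^+ 2.
Proof.
move=> sF Fx; have [p Np] := face_node sF.1; have [pF _] := Mface sF.1.
have Fp := node_in pF Np; have := surf_lip sF Fx Fp; rewrite (tod0 T (mesh_F3 HM sF Np)) subr0 => h1.
apply: (le_trans h1); rewrite expr2 mulrA ler_wpM2l ?face_dist //; last exact: sF.1.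
have /andP[d0 _] := face_h sF.1.
by rewrite mulr_ge0 ?(ltW d0) // divr_ge0 ?(ltW r0) // addr_ge0 // invr_ge0 ltW.
Qed.

End Mesh.

Lemma slope_arith (R : realType) (p q a b c e x y : R) : - e <= x - y - a -> - q <= b -> e <= 3 * p -> c <= 24 * p -> 0 <= p ->
  x - y < - (q + 40 * p) -> a + c - b < 0.
Proof. by move=> *; lra. Qed.

(** * The polyhedral surface as a graph of small slope over the boundary *)

Section Graph.
Context {R : realType} (Om : set (pt R)) (R0 : R) (T : tube Om R0).
Variables (gam gam2 h : R) (M : set (polyhedron R)).
Hypotheses (g0 : 0 < gam) (h0 : 0 < h) (hs : h <= R0 / 200).
Hypothesis (hk : Cflat gam R0 * h * (Kgap gam + kap gam) <= 1).
Hypothesis HM : bulk_surface_mesh Om h gam gam2 M.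
Implicit Types (F G : polygon R) (E : polyhedron R) (x y z p q c n u m : pt R).
Notation Gam := (frontier Om).
Notation od := (oriented_distance Om).
Notation nu := (normal Om).
Notation A := (normal_projection Om).
Notation dm := (fun F => diam (pg_set F)).
Notation dE := (fun E => diam (ph_set E)).
Let r0 := tb_pos T.

Lemma Kg1 : kap gam ^+ 2 * (kap gam + 1) < Kgap gam.
Proof.
have k2 := kap2 g0; have q : 0 < (2 * kap gam * (kap gam + 1) + 5) / gam.
  rewrite divr_gt0 // addr_gt0 //; rewrite mulr_gt0 //; [rewrite mulr_gt0 // |]; lra.
by rewrite /Kgap -addrA ltrDl addr_gt0.
Qed.
Lemma Kg2 : 2 * kap gam * (kap gam + 1) + 5 <= gam * Kgap gam.
Proof.
have k2 := kap2 g0; have -> : gam * Kgap gam = gam * (kap gam ^+ 2 * (kap gam + 1) + 16) + (2 * kap gam * (kap gam + 1) + 5).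
  by rewrite /Kgap; field; rewrite gt_eqF.
rewrite lerDr mulr_ge0 ?(ltW g0) // addr_ge0 // mulr_ge0 ?sqr_ge0 //; lra.
Qed.
Lemma Kg3 : kap gam + 1 < Kgap gam.
Proof.
apply: le_lt_trans Kg1; have k2 := kap2 g0; rewrite ler_peMl //; [lra | rewrite expr2; nra].
Qed.

(** Along a short path in the bulk starting on [F1], far from its nodes, the elements met keep a
    common feature: an edge of [F1] if one is close to [x1], and [F1] itself otherwise. Losing it
    would produce an end point of that edge, or an edge of [F1], too close to [x1]. So [E] has this
    feature and is large. *)
Lemma star_in F1 x1 y E t : mesh_faces M F1 -> pg_set F1 x1 -> 0 < t ->
  (forall p, pg_nodes F1 p -> (Kgap gam + kap gam) * t <= enorm (x1 - p)) ->
  (forall s, 0 <= s <= 1 -> bulk M (segpt x1 y s)) -> enorm (x1 - y) <= t ->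
  M E -> interior (ph_set E) y -> Kgap gam * t <= dE E.
Proof.
move=> MF1 F1x t0 hnode hseg xy ME iy; have [E1 ME1 E1F1] := MF1.
have k2 := kap2 g0; have kg1 := Kg1; have kg2 := Kg2; have kg3 := Kg3.
have fM := mesh_finite HM.
have clE E' : M E' -> closed (ph_set E') by move=> /(mesh_polyhedra HM)[_ _ _ [/compactE[cE _] _] _].
have zx s : 0 <= s <= 1 -> enorm (segpt x1 y s - x1) <= t.
  by move=> /andP[s0 s1]; rewrite segpt_distl // (le_trans _ xy) // ler_piMl ?enorm_ge0.
have Eeq E' : M E' -> ph_set E' y -> E = E'.
  by move=> ME' E'y; apply: (interior_disjoint (mesh_polyhedra HM ME) _ iy E'y); exact: (mesh_F2 HM).1.
(* If no element at [y] has the feature [P], somewhere on the path an element with [P] touches one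
   without. *)
have meet (P : polyhedron R -> Prop) : P E1 -> (forall E', M E' -> P E' -> ph_set E' y -> False) ->
    exists z E2 E3, [/\ enorm (z - x1) <= t, M E2 /\ P E2, M E3 /\ ~ P E3, ph_set E2 z & ph_set E3 z].
  move=> P1 Py.
  pose Q := \bigcup_(E' in [set E' | M E' /\ P E']) ph_set E'.
  pose Q' := \bigcup_(E' in [set E' | M E' /\ ~ P E']) ph_set E'.
  have cQ : closed Q by apply: fin_closed => [|E' [/clE]] //; apply: sub_finite_set fM => E' [].
  have cQ' : closed Q' by apply: fin_closed => [|E' [/clE]] //; apply: sub_finite_set fM => E' [].
  have cs : forall s, 0 <= s <= 1 -> {for s, continuous (segpt x1 y)} by move=> s _; exact: segpt_cont.
  have [|||s [s01 [[E2 [ME2 P2] E2z] [E3 [ME3 P3] E3z]]]] := path_meet ler01 cs cQ cQ'.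
  - move=> s /hseg[E' ME' E'z]; have [PE|PE] := pselect (P E'); [left|right]; by exists E'.
  - by rewrite segpt0; exists E1 => //; exact: (face_sub HM ME1 E1F1).
  - rewrite segpt1; have [|E' ME' E'y] := hseg 1; first by rewrite ler01 lexx.
    rewrite segpt1 in E'y; exists E' => //; split => // PE'; exact: (Py E').
  by exists (segpt x1 y s), E2, E3; split => //; exact: zx.
(* First case: the feature is an edge [e] close to [x1]. Its end points are far, so [e] is long and
   so is every element or face having it. *)
have [[e [x0 [Fe ex0 hx0]]]|nedge] := pselect (exists e x0, [/\ pg_edges F1 e, e x0 & enorm (x0 - x1) <= kap gam * t]).
- have epn p : endpoint e p -> Kgap gam * t <= enorm (p - x0).
    move=> ep; have Np : pg_nodes F1 p by exists e.
    have := hnode p Np; have := enorm_triangle x0 x1 p; rewrite (enormB x1 x0) (enormB x0 p) mulrDl.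
    move: hx0; move: (enorm _) (enorm _) (enorm _) => a b c'; lra.
  have [p ep] : exists p, endpoint e p.
    by have [_ [/(_ e Fe)[p [q [pq ee]]] _]] := (Mface g0 HM MF1).1; exists p, q.
  have hrho G : mesh_faces M G -> pg_edges G e -> Kgap gam * t <= dm G.
    move=> MG Ge; have [pG _] := Mface g0 HM MG; apply: (le_trans (epn p ep)).
    apply: (face_dist g0 HM MG); last exact: edge_sub Ge _ ex0.
    by apply: (node_in pG); exists e.
  have hrhoE E' : M E' -> ph_edges E' e -> Kgap gam * t <= dE E'.
    move=> ME' [G EG Ge]; apply: (le_trans (hrho G _ Ge)); first by exists E'.
    exact: (face_diam g0 HM).
  have [[E' [ME' [E'e E'y]]]|nE] := pselect (exists E', M E' /\ (ph_edges E' e /\ ph_set E' y)).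
    by rewrite (Eeq E' ME' E'y); exact: hrhoE.
  exfalso.
  have [||z [E2 [E3 [zx1 [ME2 E2e] [ME3 E3e] E2z E3z]]]] := meet (fun E' => ph_edges E' e).
  + by exists F1.
  + by move=> E' ME' E'e E'y; apply: nE; exists E'.
  have xz : enorm (x0 - z) <= (kap gam + 1) * t.
    have := enorm_triangle x1 x0 z; rewrite (enormB x1 z) mulrDl mul1r.
    by move: hx0 zx1; move: (enorm _) (enorm _) (enorm _) => a b c'; lra.
  have [pE2 [c2 [S2 hb2 d2]]] := Melem g0 HM ME2.
  have sep G : ph_faces E2 G -> pg_set G z -> (~ pg_edges G e \/ exists2 e1, pg_edges G e1 & e1 <> e /\ e1 z) -> False.
    move=> E2G Gz hG.
    have [||p' ep' hp'] := face_separation g0 pE2 S2 hb2 d2 (Mdiams g0 HM ME2) E2e ex0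
       (fun F' EF' => hrho F' (ex_intro2 _ _ E2 ME2 EF')) (hrhoE _ ME2 E2e) _ _ E2G Gz hG xz.
    * by rewrite mulr_gt0 //; lra.
    * rewrite -/(kap gam); have := ler_wpM2r (ltW t0) kg2.
      by move: (kap gam) (Kgap gam) => k K; lra.
    have := epn p' ep'; rewrite -/(kap gam) in hp' => h1.
    have : kap gam ^+ 2 * (kap gam + 1) * t < Kgap gam * t by rewrite ltr_pM2r.
    by move: hp' h1; rewrite mulrA; move: (enorm _) => a; lra.
  have E23 : E2 <> E3 by move=> he; apply: E3e; rewrite -he.
  have zz : (ph_set E2 `&` ph_set E3) z by [].
  case: ((mesh_F2 HM).1 _ _ ME2 ME3 E23) => [e0|[p' [[G E2G Gp] _ e0]]|[e1 [[G E2G Ge1] E3e1 e0]]|[G [E2G E3G e0]]];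
    rewrite e0 in zz => //.
  + rewrite zz in E2z xz sep *; have [pG _] := Mface g0 HM (ex_intro2 _ _ E2 ME2 E2G).
    have [e1 Ge1 [ep1 e1p]] := node_edge pG Gp.
    have [ee|ne] := pselect (e1 = e).
      rewrite ee in ep1; have := epn _ ep1; rewrite enormB => h1.
      have : (kap gam + 1) * t < Kgap gam * t by rewrite ltr_pM2r.
      by move: h1 xz; move: (enorm _) => a; lra.
    by apply: (sep G) => //; [exact: node_in Gp | right; exists e1].
  + have [pG _] := Mface g0 HM (ex_intro2 _ _ E2 ME2 E2G).
    apply: (sep G) => //; first exact: edge_sub Ge1 _ zz.
    by right; exists e1 => //; split => // he; apply: E3e; rewrite -he.
  + by apply: (sep G) => //; left => Ge; apply: E3e; exists G.
(* Second case: all edges of [F1] are farther than [kap gam * t], and the feature is the face [F1]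
   itself. *)
- have hF1 : Kgap gam * t <= dm F1.
    have [p Np] := face_node g0 HM MF1; have [pF1 _] := Mface g0 HM MF1.
    have := hnode p Np; have := face_dist g0 HM MF1 F1x (node_in pF1 Np).
    have : 0 <= kap gam * t by rewrite mulr_ge0 ?(ltW t0) //; lra.
    by rewrite mulrDl; move: (enorm _) (diam _) => a b; lra.
  have hE' E' : M E' -> ph_faces E' F1 -> Kgap gam * t <= dE E'.
    by move=> ME' EF1; apply: (le_trans hF1); exact: (face_diam g0 HM).
  have tk : t <= kap gam * t by rewrite ler_peMl ?(ltW t0) //; lra.
  have [[E' [ME' [E'F E'y]]]|nE] := pselect (exists E', M E' /\ (ph_faces E' F1 /\ ph_set E' y)).
    by rewrite (Eeq E') // hE'.
  exfalso.
  have [||z [E2 [E3 [zx1 [ME2 E2F] [ME3 E3F] E2z E3z]]]] := meet (fun E' => ph_faces E' F1).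
  + by [].
  + by move=> E' ME' E'e E'y; apply: nE; exists E'.
  have [pE2 [c2 [S2 hb2 d2]]] := Melem g0 HM ME2.
  have nz e : pg_edges F1 e -> ~ e z.
    by move=> Fe ez; apply: nedge; exists e, z; split => //; exact: le_trans zx1 tk.
  have sep G : ph_faces E2 G -> pg_set G z -> F1 <> G -> False.
    move=> E2G Gz FG.
    have [||e [w [Fe ew hw]]] := @face_boundary_separation _ gam t E2 c2 F1 G x1 z g0 pE2 S2 hb2 d2 E2F E2G FG F1x Gz t0.
    * have := hE' _ ME2 E2F; rewrite -(ler_pM2l g0) => h1.
      have k5 : 0 <= kap gam * (kap gam + 1) by rewrite mulr_ge0 //; lra.
      have := ler_wpM2r (ltW t0) kg2; have := mulr_ge0 k5 (ltW t0).
      by move: h1; move: (diam _) (kap gam) (Kgap gam) => d k K; lra.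
    * by rewrite enormB.
    by apply: nedge; exists e, w.
  have E23 : E2 <> E3 by move=> he; apply: E3F; rewrite -he.
  have zz : (ph_set E2 `&` ph_set E3) z by [].
  case: ((mesh_F2 HM).1 _ _ ME2 ME3 E23) => [e0|[p' [[G E2G Gp] _ e0]]|[e1 [[G E2G Ge1] E3e1 e0]]|[G [E2G E3G e0]]];
    rewrite e0 in zz => //.
  + rewrite zz in nz sep *; have [pG _] := Mface g0 HM (ex_intro2 _ _ E2 ME2 E2G).
    have [FG|FG] := pselect (F1 = G); last by apply: (sep G) => //; exact: node_in Gp.
    by have [e1 Ge1 [ep1 e1p]] := node_edge pG Gp; apply: (nz e1) => //; rewrite FG.
  + have [pG _] := Mface g0 HM (ex_intro2 _ _ E2 ME2 E2G).
    have [FG|FG] := pselect (F1 = G); first by apply: (nz e1) => //; rewrite FG.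
    by apply: (sep G) => //; exact: edge_sub Ge1 _ zz.
  + by apply: (sep G) => // he; apply: E3F; rewrite he.
Qed.

Lemma fiber_od p t : Gam p -> `|t| <= R0 / 2 -> od (p + t *: nu p) = t.
Proof. by move=> Gp ht; case: (tfiber T Gp ht). Qed.
Lemma h_lt : h < R0 / 2.
Proof. by have := hs; have := r0; lra. Qed.

Lemma fiber_up p t : Gam p -> h < t -> t <= R0 / 2 -> ~ bulk M (p + t *: nu p).
Proof.
move=> Gp ht tR; have t0 : 0 < t by have := h0; lra.
have q : `|t| <= R0 / 2 by rewrite gtr0_norm.
have o := fiber_od Gp q; move=> /(bulk_far T g0 h0 HM); rewrite (trdist T) o gtr0_norm // => /(_ ht) Oz.
have := od_in Oz; rewrite (trdist T) o gtr0_norm // ; move: t0; lra.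
Qed.

Lemma bulk_closed : closed (bulk M).
Proof. by have /compactE[] := bulk_compact HM. Qed.

Lemma exit_up p t0 : Gam p -> t0 <= R0 / 2 -> bulk M (p + t0 *: nu p) ->
  exists t1, [/\ t0 <= t1, t1 < R0 / 2, surface M (p + t1 *: nu p) & forall t, t0 <= t <= t1 -> bulk M (p + t *: nu p)].
Proof.
move=> Gp t0R B0.
have [t1 [/andP[a b] hB fr _]] := first_exit bulk_closed (@ray_cont _ p (nu p)) t0R B0 (fiber_up Gp h_lt (lexx _)).
by exists t1.
Qed.

Lemma surf_small x : surface M x -> `|od x| <= h.
Proof. by move=> /(surface_rdist g0 HM); rewrite (trdist T). Qed.

Lemma norm_half x : `|od x| <= h -> `|od x| <= R0 / 2.
Proof. by move=> hx; apply: (le_trans hx); exact/ltW/h_lt. Qed.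

Lemma flat_dot F p0 n m : flat_at Om R0 gam F p0 n -> enorm (m - nu p0) <= 3 / 4 -> 0 < dot n m.
Proof.
move=> [_ Gp n1 [[nn _] _] _] hm; have -> : dot n m = dot n n + dot n (nu p0 - n) + dot n (m - nu p0).
  by rewrite !dotDr !dotNr; ring.
have := dot_abs n (nu p0 - n); have := dot_abs n (m - nu p0); rewrite n1 !mul1r (enormB (nu p0)).
rewrite -enorm2 n1 expr1n !ler_norml => /andP[a _] /andP[b _].
by move: a b nn hm; move: (enorm _) (enorm _) (dot _ _) (dot _ _) => *; lra.
Qed.

Lemma Kc_pos : 0 < Kgap gam + kap gam.
Proof. by apply: lt_le_trans (Kc_gt0 g0); rewrite addr_gt0 // divr_gt0. Qed.

Lemma Cflat_pos : 0 < Cflat gam R0.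
Proof. by rewrite divr_gt0 // addr_gt0 // invr_gt0. Qed.

Lemma K5 : 5 / gam <= Kgap gam.
Proof.
have k2 := kap2 g0; have kp : 0 <= kap gam by apply: le_trans (ltW k2).
rewrite ler_pdivrMr // mulrC; apply: le_trans Kg2; rewrite lerDr mulr_ge0 //; [exact: mulr_ge0 | exact: addr_ge0].
Qed.

(** [od] vanishes at the nodes and has slope at most [Cflat * h] on the face, so a point of height
    [t] is far from them; [hk] is exactly the smallness needed. *)
Lemma node_gap F x p t : surface_faces M F -> pg_set F x -> od x = t -> 0 < t -> pg_nodes F p ->
  (Kgap gam + kap gam) * t <= enorm (x - p).
Proof.
move=> sF Fx ox t0 Np; have [pF _] := Mface g0 HM sF.1; have := surf_lip T g0 h0 hs hk HM sF Fx (node_in pF Np).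
rewrite (tod0 T (mesh_F3 HM sF Np)) subr0 ox gtr0_norm // => h1.
have K0 := Kc_pos; have C0 := Cflat_pos.
have h2 : Cflat gam R0 * dm F * (Kgap gam + kap gam) <= 1.
  apply: le_trans hk; rewrite ler_wpM2r ?(ltW K0) // ler_wpM2l ?(ltW C0) //.
  by case/andP: (face_h g0 HM sF.1).
rewrite mulrC; apply: (le_trans (ler_wpM2r (ltW K0) h1)).
by rewrite mulrAC -[leRHS]mul1r ler_wpM2r ?enorm_ge0.
Qed.

(** Follow the normal fibre outwards to its exit height [t1 >= od x]. The exit face has remote nodes
    by [node_gap], and [star_in], applied to the fibre segment back to [x], makes [E] large compared
    with [t1]. *)
Lemma high_point E x : M E -> interior (ph_set E) x -> 0 < od x -> od x <= R0 / 2 -> Kgap gam * od x <= dE E.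
Proof.
move=> ME iE t0 tR; have Ex := interior_subset iE.
have Gq := tGam T x; have ex := tA T x; have nq := tnu1 T x.
have Bx : bulk M (A x + od x *: nu (A x)) by rewrite -ex; exists E.
have K0 : 0 < Kgap gam by apply: lt_le_trans K5; rewrite divr_gt0.
move: (od x) (A x) t0 tR Gq ex nq Bx => t q t0 tR Gq ex nq Bx.
have [t1 [t01 t1R sx hb]] := exit_up Gq tR Bx.
have t1p : 0 < t1 := lt_le_trans t0 t01.
have ox : od (q + t1 *: nu q) = t1 by apply: fiber_od Gq _; rewrite gtr0_norm // ltW.
have [F1 sF1 F1x] := surfaceP HM sx.
have hn p := node_gap sF1 F1x ox t1p (p := p).
move: (nu q) nq ex hb sx F1x hn {ox Bx} => v nq ex hb sx F1x hn.
apply: (@le_trans _ _ (Kgap gam * t1)); first by rewrite ler_pM2l.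
have td : 0 <= t1 - t by rewrite subr_ge0.
apply: (star_in sF1.1 F1x t1p hn _ _ ME iE) => [s /andP[s0 s1]|].
  have -> : segpt (q + t1 *: v) x s = q + ((1 - s) * t1 + s * t) *: v.
    by rewrite ex /segpt; apply/rowP => i; rewrite !mxE; ring.
  have s1' : 0 <= 1 - s by rewrite subr_ge0.
  apply: hb; apply/andP; split; rewrite -subr_ge0.
    by rewrite (_ : _ - _ = (1 - s) * (t1 - t)); [exact: mulr_ge0 | ring].
  by rewrite (_ : _ - _ = s * (t1 - t)); [exact: mulr_ge0 | ring].
have -> : q + t1 *: v - x = (t1 - t) *: v by rewrite ex; apply/rowP => i; rewrite !mxE; ring.
by rewrite enormZ nq mulr1 ger0_norm // gerBl ltW.
Qed.

(** If the star centre were not below the plane of [F], shifting it outwards by half the inner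
    radius would give an interior point of height at least [gam * dE E / 4]. With [Kgap >= 5 / gam],
    [high_point] would yield [5 / 4 * dE E <= dE E]. *)
Lemma below F E c p0 n : surface_faces M F -> M E -> ph_faces E F ->
  star setT (ph_set E) c (gam * dE E) (dE E) -> flat_at Om R0 gam F p0 n -> dot n (c - p0) < 0.
Proof.
move=> sF ME EF S hf; rewrite ltNge; apply/negP => hc.
have MF := sF.1; case: (hf) => [[Np Fp] Gp n1 [[nn nw] [hF _]] hu].
have hp : od p0 = 0 := tod0 T Gp; have Ap : A p0 = p0 := tA_Gam T Gp.
have nup : enorm (nu p0) = 1 by rewrite -Ap (tnu1 T).
have [pE [_ [_ _ d0]]] := Melem g0 HM ME.
have cE : compact (ph_set E) by case: (mesh_polyhedra HM ME) => _ _ _ [cE _] _.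
have Ep : ph_set E p0 := face_sub HM ME EF Fp.
pose r := gam * dE E; have rp : 0 < r by exact: mulr_gt0.
pose c' := c + (r / 2) *: nu p0.
have c'c : enorm (c' - c) = r / 2 by rewrite /c' [c + _]addrC addrK enormZ nup mulr1 gtr0_norm // divr_gt0.
have iE : interior (ph_set E) c'.
  apply/interiorE; exists (r / 2); first exact: divr_gt0.
  move=> y hy; apply: (st_ball S) => //; have := enorm_triangle c' y c; rewrite c'c -/r.
  by move: hy; move: (enorm _) (enorm _) => a b; lra.
have Ec' := interior_subset iE; have Ec : ph_set E c.
  by apply: (st_ball S) => //; rewrite subrr enorm0 ltW.
have dh : dE E <= h := mesh_F1 HM ME.
have e0 : dm F / (gam * R0) <= h / (gam * R0).
  by rewrite ler_pM2r ?invr_gt0 ?mulr_gt0 //; case/andP: (face_h g0 HM MF).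
have odc : dE E * (gam / 4) <= od c'.
  have q0 : `|od p0| <= R0 / 2 by rewrite hp normr0 divr_ge0 // ltW.
  have := todQ T c' q0; rewrite hp Ap subr0 ler_norml => /andP[h1 _].
  have h2 : enorm (c' - p0) ^+ 2 / R0 <= dE E * (h / R0).
    rewrite mulrA ler_pM2r ?invr_gt0 // expr2; have := diam_ub cE Ec' Ep.
    by move=> h2; apply: ler_pM; rewrite ?enorm_ge0 // (le_trans h2).
  have h3 : dot (nu p0) (c' - p0) = dot (nu p0) (c - p0) + r / 2.
    have -> : c' - p0 = (c - p0) + (r / 2) *: nu p0.
      by rewrite /c'; move: (nu p0) => a; apply/rowP => i; rewrite !mxE; ring.
    by rewrite dotDr dotZr -enorm2 nup expr1n mulr1.
  have h4 : - (h / (gam * R0) * dE E) <= dot (nu p0) (c - p0).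
    have -> : dot (nu p0) (c - p0) = dot n (nu p0) * dot n (c - p0) + dot (nu p0 - dot n (nu p0) *: n) (c - p0).
      by rewrite [dot (_ - _) _]dotDl dotNl dotZl; ring.
    have s0 : 0 < dot n (nu p0) by apply: (flat_dot hf); rewrite subrr enorm0.
    have p1 : 0 <= dot n (nu p0) * dot n (c - p0) by rewrite mulr_ge0 // ltW.
    have : `|dot (nu p0 - dot n (nu p0) *: n) (c - p0)| <= h / (gam * R0) * dE E.
      apply: (le_trans (dot_abs _ _)); apply: ler_pM; rewrite ?enorm_ge0 ?(le_trans nw) //.
      exact: diam_ub.
    rewrite ler_norml => /andP[p2 _]; move: p1 p2; move: (dot n (nu p0) * dot n (c - p0)) (dot (nu p0 - _) _) => a b; lra.
  have h5 : h / (gam * R0) + h / R0 <= gam / 5.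
    apply: le_trans (Ch_small T g0 h0 hk).2; rewrite /Cflat.
    have -> : h / (gam * R0) + h / R0 = (gam^-1 + 1) * (h / R0) by field; rewrite !gt_eqF.
    by rewrite mulrAC -mulrA ler_pM2r ?divr_gt0 //; lra.
  have h6 := ler_wpM2l (ltW d0) h5; rewrite h3 in h1; rewrite /r in h1.
  have := mulr_gt0 d0 g0; move: h1 h2 h4 h6.
  move: (od c') (dot _ _) (_ / R0) (h / R0) (h / (gam * R0)) (diam _) => a b c1 d e f; lra.
have t0 : 0 < od c' by apply: lt_le_trans odc; rewrite mulr_gt0 // divr_gt0.
have odc2 : od c' <= R0 / 2.
  have := tod_lip T c' p0; rewrite hp subr0 => h1; have h2 := diam_ub cE Ec' Ep.
  apply: (le_trans (ler_norm _)); apply: (le_trans h1); apply: (le_trans h2); apply: (le_trans dh).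
  exact/ltW/h_lt.
have hK := high_point ME iE t0 odc2.
have : 5 / gam * (dE E * (gam / 4)) <= Kgap gam * od c'.
  by apply: ler_pM odc => //; [rewrite divr_ge0 // ltW | rewrite mulr_ge0 ?(ltW d0) // divr_ge0 // ltW | exact: K5].
have -> : 5 / gam * (dE E * (gam / 4)) = 5 / 4 * dE E by field; rewrite gt_eqF.
by move: hK d0; move: (Kgap gam * od c') (diam _) => a b; lra.
Qed.

Definition mesh_edge (e : set (pt R)) := exists2 F, mesh_faces M F & pg_edges F e.

Lemma mesh_edge_segment e : mesh_edge e -> exists p q, p != q /\ e = segment p q.
Proof. by move=> [F MF Fe]; have [[_ [/(_ e Fe) ee _]] _] := Mface g0 HM MF. Qed.

Lemma mesh_faces_finite : finite_set (mesh_faces M).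
Proof. by apply: bigcup_finite (mesh_finite HM) _ => E ME; case: (mesh_polyhedra HM ME). Qed.

Lemma mesh_edges_finite : finite_set mesh_edge.
Proof.
have -> : mesh_edge = \bigcup_(F in mesh_faces M) pg_edges F by apply/seteqP; split => e [F MF Fe]; exists F.
by apply: bigcup_finite mesh_faces_finite _ => F MF; have [[fF _] _] := Mface g0 HM MF.
Qed.

(** A segment that points inwards at all surface faces cannot leave the bulk: at a first exit, in
    the relative interior of a face, the element lies below that face and contains the points just
    past the exit by [push]. *)
Lemma slope_in y x : interior (bulk M) y ->
  (forall F p0 n t, surface_faces M F -> flat_at Om R0 gam F p0 n -> 0 <= t <= 1 -> pg_set F (segpt y x t) -> dot n (x - y) < 0) ->
  (forall e t, mesh_edge e -> 0 < t <= 1 -> ~ e (segpt y x t)) ->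
  bulk M x.
Proof.
move=> iy hn he; apply: contrapT => nBx.
have By0 : bulk M (segpt y x 0) by rewrite segpt0; exact: interior_subset.
have nBx1 : ~ bulk M (segpt y x 1) by rewrite segpt1.
have [t [/andP[t0 t1] hB fr hout]] := first_exit bulk_closed (@segpt_cont _ y x) (@ler01 R) By0 nBx1.
have tp : 0 < t.
  by rewrite lt_neqAle t0 andbT; apply/eqP => e; case: fr => _; rewrite -e segpt0.
have [F sF Fz] := surfaceP HM fr.
have [p0 [n hf]] := surf_flat T g0 h0 hk HM sF.
have t01 : 0 <= t <= 1 by rewrite t0 ltW.
have nv := hn _ _ _ _ sF hf t01 Fz.
have [pF _] := Mface g0 HM sF.1.
case: (hf) => [_ _ _ [_ [hF hb]] _].
have rz : relint [set x | dot n (x - p0) = 0] (pg_set F) (segpt y x t).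
  apply: contrapT => nr; have : (pg_set F `\` relint [set x | dot n (x - p0) = 0] (pg_set F)) (segpt y x t) by [].
  by rewrite hb => -[e Fe]; apply: he; [exists F => //; exact: sF.1 | rewrite tp ltW].
have [E ME EF] := sF.1; have [pE [c [S _ dp]]] := Melem g0 HM ME.
have bc := below sF ME EF S hf.
have starE z s : pg_set F z -> 0 <= s <= 1 -> ph_set E (segpt z c s).
  move=> Fz' hs'; apply: (st_star S) => //; last exact: (face_sub HM ME EF).
  by rewrite subrr enorm0 mulr_ge0 // ltW.
have nm : 0 < dot n (y - x) by rewrite -opprB dotNr oppr_gt0.
have [e e0 he'] := push rz (hF _ Fz) starE bc nm.
have [u [/andP[tu ue] nBu]] := hout e e0; apply: nBu; exists E => //.
have -> : segpt y x u = segpt y x t - (u - t) *: (y - x) by rewrite /segpt; apply/rowP => i; rewrite !mxE; ring.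
by apply: he'; rewrite subr_gt0 tu /= ltrBlDl.
Qed.

(* A generic perturbation of [x] makes the segment from [y] to [x] avoid all edges. *)
Lemma generic_end y x eps : 0 < eps ->
  exists2 x', enorm (x' - x) < eps & forall e t, mesh_edge e -> 0 < t <= 1 -> ~ e (segpt y x' t).
Proof.
move=> e0; have [k [f ef]] := fin_enum mesh_edges_finite.
have hk' i : exists n, n != 0 /\ forall z, f i z -> dot n (z - y) = 0.
  have [p [q [pq fe]]] : exists p q, p != q /\ f i = segment p q by apply: mesh_edge_segment; rewrite ef; exists i.
  have [n [n0 np nq]] := orth2 (p - y) (q - y); exists n; split => // z; rewrite fe => /segptP[t [_ ->]].
  have -> : segpt p q t - y = (1 - t) *: (p - y) + t *: (q - y) by rewrite /segpt; apply/rowP => j; rewrite !mxE; ring.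
  by rewrite dotDr !dotZr np nq !mulr0 addr0.
have [n hn] := choice hk'.
have [|x' [_ x'x hx']] := avoid (l := [seq (n i, dot (n i) y) | i <- enum 'I_k]) (@affineT R) (I : setT x) e0.
  move=> _ /mapP[i _ ->] /=; exists (y + n i) => //; rewrite dotDr -subr_eq0 [dot _ y + _]addrC addrK -enorm2.
  by rewrite expf_eq0 /= enorm_eq0; case: (hn i).
exists x' => // e t; rewrite ef => -[i _ <-] /andP[t0 t1] fz.
have := hx' (n i, dot (n i) y) (map_f _ (mem_enum _ i)); rewrite /= => /eqP; apply.
have [_ /(_ _ fz)] := hn i; rewrite segptE [y + _]addrC addrK dotZr => /eqP; rewrite mulf_eq0 gt_eqF //= dotDr dotNr subr_eq0.
by move/eqP.
Qed.

Lemma bulk_regular : bulk M `<=` closure (interior (bulk M)).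
Proof.
move=> x [E ME]; have [_ _ _ _ [<- _]] := mesh_polyhedra HM ME; apply: closure_subset.
by apply: interiorS => z Ez; exists E.
Qed.

(** Critical slope divided by [h]: [gam^-1] from the tilt of the faces, while 40 exceeds the
    [3 + 24] of the quadratic error and of the turning normal in [slope_dot]. *)
Definition Kod := (gam^-1 + 40) / R0.

Lemma Kod_gt0 : 0 < Kod.
Proof. by rewrite divr_gt0 // addr_gt0 // invr_gt0. Qed.

Lemma slope_open x y : od x - od y < - (Kod * h * enorm (x - y)) ->
  exists2 e, 0 < e <= h / 4 & forall x' y', enorm (x' - x) < e -> enorm (y' - y) < e ->
    od x' - od y' < - (Kod * h * enorm (x' - y')).
Proof.
move=> hxy; pose d := - (Kod * h * enorm (x - y)) - (od x - od y).
have d0 : 0 < d by rewrite subr_gt0.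
have K0 : 0 < Kod * h by rewrite mulr_gt0 // Kod_gt0.
have K1 : 0 < 2 * (1 + Kod * h) by rewrite mulr_gt0 // addr_gt0.
exists (Num.min (h / 4) (d / (2 * (1 + Kod * h)))).
  by rewrite lt_min ge_min lexx andbT !divr_gt0.
move=> x' y' /(lt_le_trans) hx /(lt_le_trans) hy.
have hx' := hx (d / (2 * (1 + Kod * h))); have hy' := hy (d / (2 * (1 + Kod * h))).
rewrite ge_min lexx orbT in hx' hy'; move: (hx' isT) (hy' isT) => {hx hy hx' hy'}.
rewrite !ltr_pdivlMr // => hx hy.
have := tod_lip T x' x; have := tod_lip T y' y; rewrite !ler_norml => /andP[a1 _] /andP[_ a2].
have t1 : enorm (x' - y') <= enorm (x' - x) + enorm (x - y) + enorm (y' - y).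
  by apply: (le_trans (enorm_triangle x x' y')); rewrite -addrA lerD2l (le_trans (enorm_triangle y x y')) // (enormB y y').
have := ler_wpM2l (ltW K0) t1; move: hx hy a1 a2; rewrite /d.
move: (enorm _) (enorm _) (enorm _) (enorm _) (od x) (od y) (od x') (od y') (Kod * h) => *; lra.
Qed.

(** The normals of all surface faces met are close to the normal at the projection of [y], so a
    steep decrease of [od] forces an inward direction at each of them. *)
Lemma slope_dot y x F p0 n t : enorm (x - y) <= 3 * h -> `|od y| <= 2 * h -> od x - od y < - (Kod * h * enorm (x - y)) ->
  surface_faces M F -> flat_at Om R0 gam F p0 n -> 0 <= t <= 1 -> pg_set F (segpt y x t) -> dot n (x - y) < 0.
Proof.
move=> xy oy hod sF hf /andP[t0 t1] Fz; have [[Np Fp] Gp n1 [[nn nw] _] _] := hf.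
have MF := sF.1; have /andP[_ dh] := face_h g0 HM MF.
have ir : 0 < R0^-1 by rewrite invr_gt0.
have p0y : enorm (p0 - y) <= 4 * h.
  apply: (le_trans (enorm_triangle (segpt y x t) _ _)); have := face_dist g0 HM MF Fp Fz.
  rewrite segpt_distl // (enormB y x); have := ler_wpM2r (enorm_ge0 (x - y)) t1; rewrite mul1r.
  by move: dh xy; move: (t * enorm (x - y)) (enorm (x - y)) (enorm (p0 - _)) (diam _) => a b c d; lra.
have oy2 : `|od y| <= R0 / 2.
  by apply: (le_trans oy); move: hs r0; lra.
have op : `|od p0| <= R0 / 2 by rewrite (tod0 T Gp) normr0 divr_ge0 // ltW.
have g1 := tg_lip T op oy2; rewrite (tA_Gam T Gp) in g1.
have q := todQ T x oy2.
have s0 : 0 < dot n (nu p0) by apply: (flat_dot hf); rewrite subrr enorm0.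
have e1 : enorm (x - y) ^+ 2 / R0 <= 3 * h / R0 * enorm (x - y).
  by rewrite expr2 mulrAC ler_wpM2r ?enorm_ge0 // ler_pM2r.
have e2 : 6 / R0 * enorm (p0 - y) <= 24 * h / R0.
  by rewrite mulrAC ler_pM2r // (_ : 24 * h = 6 * (4 * h)) ?ler_pM2l //; ring.
have e3 : `|dot (nu p0 - nu (A y)) (x - y)| <= 24 * h / R0 * enorm (x - y).
  by apply: (le_trans (dot_abs _ _)); rewrite ler_wpM2r ?enorm_ge0 // (le_trans g1).
have e4 : `|dot (nu p0 - dot n (nu p0) *: n) (x - y)| <= gam^-1 * h / R0 * enorm (x - y).
  apply: (le_trans (dot_abs _ _)); rewrite ler_wpM2r ?enorm_ge0 // (le_trans nw) //.
  by rewrite invfM mulrA ler_pM2r // mulrC ler_pM2l ?invr_gt0.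
have eK : Kod * h * enorm (x - y) = gam^-1 * h / R0 * enorm (x - y) + 40 * (h / R0 * enorm (x - y)).
  by rewrite /Kod; field; rewrite !gt_eqF.
have pos : 0 <= h / R0 * enorm (x - y) by rewrite mulr_ge0 ?enorm_ge0 // divr_ge0 // ltW.
rewrite -(pmulr_rlt0 _ s0).
have : dot n (nu p0) * dot n (x - y) = dot (nu (A y)) (x - y) + dot (nu p0 - nu (A y)) (x - y) - dot (nu p0 - dot n (nu p0) *: n) (x - y).
  by rewrite !dotDl !dotNl dotZl; ring.
move=> ->; rewrite eK in hod; move: q e1 e3 e4 pos hod; rewrite !ler_norml => /andP[q1 _] e1 /andP[_ e3] /andP[e4 _].
move: e1 e3; have -> : 3 * h / R0 * enorm (x - y) = 3 * (h / R0 * enorm (x - y)) by rewrite !mulrA.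
have -> : 24 * h / R0 * enorm (x - y) = 24 * (h / R0 * enorm (x - y)) by rewrite !mulrA.
by move: q1 e4; exact: slope_arith.
Qed.

(** Subgraph property. The steepness is an open condition, so [y] may be moved into the interior and
    [x] into general position before [slope_in] is applied; closedness gives [x] back. *)
Lemma slope_bulk y x : bulk M y -> enorm (x - y) <= 2 * h -> od x - od y < - (Kod * h * enorm (x - y)) -> `|od y| <= h ->
  bulk M x.
Proof.
move=> By xy hod oy; have [e /andP[e0 eh] he] := slope_open hod.
apply: bulk_closed; apply/closureE => d d0.
have m0 : 0 < Num.min d e by rewrite lt_min d0.
have /closureE/(_ e e0)[y' iy' y'y] := bulk_regular By.
have [x' x'x hx'] := generic_end y' x m0.
move: x'x; rewrite lt_min => /andP[x'd x'e].
exists x' => //; apply: (slope_in iy') hx' => F p0 n t sF hf t01 Fz.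
apply: (slope_dot _ _ _ sF hf t01 Fz).
- apply: (le_trans (enorm_triangle x _ _)); have := enorm_triangle y x y'; rewrite (enormB y y').
  by move: x'e y'y xy eh; move: (enorm _) (enorm _) (enorm _) (enorm _) => *; lra.
- have := tod_lip T y' y; have := ler_normD (od y' - od y) (od y); rewrite subrK.
  by move: y'y oy eh h0; move: (enorm _) `|od y'| `|od y| `|od y' - od y| => *; lra.
- exact: he.
Qed.

(** If one of the points were too low with respect to the other, [slope_bulk] would put a whole
    neighbourhood of it into the bulk, so it would not lie on the surface. *)
Lemma surf_od_lip x y : surface M x -> surface M y -> enorm (x - y) <= h -> `|od x - od y| <= Kod * h * enorm (x - y).
Proof.
have key x' y' : surface M x' -> surface M y' -> enorm (x' - y') <= h -> od y' - od x' <= Kod * h * enorm (x' - y').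
  move=> sx sy xy; rewrite leNgt; apply/negP => hlt.
  have hod : od x' - od y' < - (Kod * h * enorm (x' - y')) by rewrite ltrNr opprB.
  have [e /andP[e0 eh] he] := slope_open hod.
  case: sx => _; apply; apply/interiorE; exists e => // z zx.
  apply: (@slope_bulk y'); [exact: surface_bulk HM _ sy| | | exact: surf_small].
    apply: (le_trans (enorm_triangle x' _ _)).
    by move: zx xy eh h0; move: (enorm _) (enorm _) => *; lra.
  by apply: he => //; rewrite subrr enorm0.
move=> sx sy xy; rewrite ler_norml; apply/andP; split.
  by rewrite lerNl opprB key.
by rewrite enormB key // enormB.
Qed.

End Graph.

(** * Extension of the displacement to the elements *)

Transparent dot.
Lemma dotS (R : realType) (x y : pt R) : dot x y = \sum_i x 0 i * y 0 i.
Proof. by []. Qed.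
Opaque dot.

(* [m i], [c i] are the linear part and the constant of the [i]-th barycentric coordinate. *)
Record bary (R : realType) (E : polyhedron R) (p m : 'I_4 -> pt R) (c : 'I_4 -> R) : Prop := Bary {
  bary_nodes : ph_nodes E = range p;
  bary_hull : ph_set E = convex_hull (range p);
  bary_dual : forall i j, dot (m i) (p j) + c i = (i == j)%:R }.

Lemma dot_suml (R : realType) I (r : seq I) (P : pred I) (f : I -> pt R) x :
  dot x (\sum_(i <- r | P i) f i) = \sum_(i <- r | P i) dot x (f i).
Proof.
by elim/big_rec2: _ => [|i y z _ <-]; [rewrite -[X in dot x X](scale0r x) dotZr mul0r | rewrite dotDr].
Qed.

(** The matrix with rows [(p i, 1)] is invertible: a kernel vector would confine the nodes, hence
    [E], to a plane, although [E] has interior points. *)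
Lemma bary_ex (R : realType) (E : polyhedron R) : is_polyhedron E -> is_tetrahedron E -> exists p m c, bary E p m c.
Proof.
move=> [_ _ _ [_ [x0 Ex0]] [hcl _]] [p [hn hE]].
have [z iz] : exists z, interior (ph_set E) z.
  have : closure (interior (ph_set E)) x0 by rewrite hcl.
  by move=> /closureE/(_ 1 ltr01)[y iy _]; exists y.
pose P : 'M[R]_(4, 3 + 1) := \matrix_(i < 4) row_mx (p i) (const_mx 1).
have PE i (v : 'rV[R]_(3 + 1)) : \sum_k v 0 k * P i k = dot (lsubmx v) (p i) + v 0 (rshift 3 0).
  rewrite big_split_ord /= big_ord1; congr (_ + _).
    by rewrite dotS; apply: eq_bigr => k _; rewrite !mxE (unsplitK (inl k)).
  by rewrite mxE row_mxEr mxE mulr1.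
have uP : (P : 'M[R]_4) \in unitmx.
  rewrite unitmxE unitfE; apply/negP => /eqP; rewrite -det_tr => /eqP/det0P[v v0 /rowP vP].
  pose n := lsubmx (v : 'rV[R]_(3 + 1)); pose d := v 0 (rshift 3 0 : 'I_(3 + 1)).
  have hp i : dot n (p i) + d = 0.
    rewrite -PE; have := vP i; rewrite [LHS]mxE [RHS]mxE => e; apply: etrans e; apply: eq_bigr => k _; by rewrite [P^T _ _]mxE.
  have hE' x : ph_set E x -> dot n x + d = 0.
    rewrite hE => -[k [w [q [w0 w1 hq ->]]]]; rewrite dot_suml.
    rewrite -[d]mul1r -w1 mulr_suml -big_split /=; apply: big1 => j _.
    by have [i _ <-] := hq j; rewrite dotZr -mulrDr hp mulr0.
  have n0 : n != 0.
    apply: contra_neq v0 => n0; have d0 : d = 0.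
      by have := hp 0; rewrite n0 dot0l add0r.
    rewrite -[v](@hsubmxK _ 1 3 1) -/n n0; apply/rowP => j; rewrite !mxE; case: splitP => k hk; rewrite !mxE //.
    by rewrite -d0 /d; congr (v _ _); apply/val_inj; rewrite /= ord1 in hk *.
  have /interiorE[e e0 he] := iz; have en : 0 < enorm n by rewrite enorm_gt0.
  have h1 := hE' _ (interior_subset iz).
  have h2 : dot n (z + (e / 2 / enorm n) *: n) + d = 0.
    apply/hE'/he; rewrite [z + _]addrC addrK enormZ ger0_norm ?divr_ge0 ?(ltW en) ?(ltW e0) //.
    by rewrite divfK ?gt_eqF // ltr_pdivrMr // mulr_natr mulr2n ltrDl.
  move: h2; rewrite dotDr dotZr -enorm2 addrAC h1 add0r => /eqP.
  by rewrite mulf_eq0 expf_eq0 /= !gt_eqF // !divr_gt0.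
pose Q := invmx (P : 'M[R]_4).
exists p, (fun i => lsubmx ((col i Q)^T : 'rV[R]_(3 + 1))), (fun i => (col i Q)^T 0 (rshift 3 0 : 'I_(3 + 1))); split=> // i j.
rewrite -PE; have := mulmxV uP; rewrite -/Q => /matrixP/(_ j i); rewrite !mxE eq_sym => <-.
by apply: eq_bigr => k _; rewrite mulrC !mxE.
Qed.

Lemma segmentC (R : realType) (p q : pt R) : segment p q = segment q p.
Proof.
suff h (a b : pt R) : segment a b `<=` segment b a by apply/seteqP; split; exact: h.
move=> z /segptP[t [/andP[t0 t1] ->]]; apply/segptP; exists (1 - t); split.
  by rewrite subr_ge0 t1 lerBlDr lerDl.
by apply/rowP => i; rewrite !mxE; ring.
Qed.

Section Bary.
Context {R : realType} (E : polyhedron R) (p m : 'I_4 -> pt R) (c : 'I_4 -> R).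
Hypothesis B : bary E p m c.
Definition lam i x : R := dot (m i) x + c i.

Lemma lam_node i j : lam i (p j) = (i == j)%:R.
Proof. exact: (bary_dual B). Qed.

Lemma lam_comb n (w : 'I_n -> R) q i : \sum_k w k = 1 -> lam i (\sum_k w k *: q k) = \sum_k w k * lam i (q k).
Proof.
move=> w1; rewrite /lam dot_suml; under [RHS]eq_bigr do rewrite mulrDr.
by rewrite big_split /= -mulr_suml w1 mul1r; congr (_ + _); apply: eq_bigr => k _; rewrite dotZr.
Qed.

Lemma node_inj : injective p.
Proof.
move=> i j e; apply/eqP; have := lam_node i j; rewrite -e lam_node eqxx => /eqP.
by case: (i == j) => //; rewrite oner_eq0.
Qed.

Lemma lam_ge0 x i : ph_set E x -> 0 <= lam i x.
Proof.
rewrite (bary_hull B) => -[k [w [q [w0 w1 hq ->]]]]; rewrite lam_comb //; apply: sumr_ge0 => l _.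
by have [j _ <-] := hq l; rewrite lam_node mulr_ge0.
Qed.

Lemma lam_sum x : ph_set E x -> \sum_i lam i x = 1.
Proof.
rewrite (bary_hull B) => -[k [w [q [w0 w1 hq ->]]]]; under eq_bigr do rewrite lam_comb //.
rewrite exchange_big /= -[RHS]w1; apply: eq_bigr => l _; have [j _ <-] := hq l.
rewrite -mulr_sumr (bigD1 j) //= lam_node eqxx big1 ?addr0 ?mulr1 // => i ij.
by rewrite lam_node (negbTE ij).
Qed.

Lemma lam_le1 x i : ph_set E x -> lam i x <= 1.
Proof.
move=> Ex; rewrite -(lam_sum Ex) (bigD1 i) //= lerDl; apply: sumr_ge0 => j _; exact: lam_ge0.
Qed.

Lemma lam_bary x : ph_set E x -> x = \sum_i lam i x *: p i.
Proof.
rewrite {1}(bary_hull B) => -[k [w [q [w0 w1 hq ->]]]].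
transitivity (\sum_i \sum_k0 (w k0 * lam i (q k0)) *: p i); last by apply: eq_bigr => i _; rewrite lam_comb // scaler_suml.
rewrite exchange_big /=; apply: eq_bigr => l _; have [j _ ej] := hq l; rewrite -ej.
rewrite (bigD1 j) //= lam_node eqxx mulr1 big1 ?addr0 // => i ij.
by rewrite lam_node (negbTE ij) mulr0 scale0r.
Qed.

Lemma hull_sub : range p `<=` ph_set E.
Proof.
move=> _ [i _ <-]; rewrite (bary_hull B); exists 1%N, (fun=> 1), (fun=> p i); split => //.
- by rewrite big_ord1.
- by rewrite big_ord_recl big_ord0 scale1r addr0.
Qed.

Lemma lam_lip i x y : `|lam i x - lam i y| <= enorm (m i) * enorm (x - y).
Proof.
rewrite /lam opprD addrACA subrr addr0 -dotNr -dotDr; exact: dot_abs.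
Qed.

(** A barycentric coordinate varies by at most 1 across a diameter of length [2 r] of the inscribed
    ball. *)
Lemma m_bound z r i : 0 < r -> (forall y, enorm (y - z) <= r -> ph_set E y) -> enorm (m i) <= (2 * r)^-1.
Proof.
move=> r0 hb; have [->|n0] := eqVneq (enorm (m i)) 0; first by rewrite invr_ge0 mulr_ge0 // ltW.
have np : 0 < enorm (m i) by rewrite lt_neqAle eq_sym n0 enorm_ge0.
pose u := (r / enorm (m i)) *: m i.
have un : enorm u = r by rewrite enormZ ger0_norm ?divr_ge0 ?(ltW r0) ?(ltW np) // divfK.
have E1 : ph_set E (z + u) by apply: hb; rewrite [z + _]addrC addrK un.
have E2 : ph_set E (z - u) by apply: hb; rewrite [z - _]addrC addrK enormN un.
have := lam_le1 i E1; have := lam_ge0 i E2; rewrite /lam !dotDr dotNr /u dotZr -enorm2.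
have -> : r / enorm (m i) * enorm (m i) ^+ 2 = r * enorm (m i) by field.
move=> h1 h2; rewrite -[(2 * r)^-1]mul1r ler_pdivlMr ?mulr_gt0 // mulrA mulrAC mulrC.
by move: h1 h2; move: (enorm (m i)) (dot (m i) z) => a b; lra.
Qed.

Lemma lam_face F i x : is_polygon F -> ph_faces E F -> pg_set F `<=` ph_set E -> pg_set F x -> ~ pg_nodes F (p i) -> lam i x = 0.
Proof.
move=> pF EF FE Fx nF; apply/eqP; rewrite eq_le lam_ge0 ?andbT; last exact: FE.
have [q Nq h] := polygon_max (m i) pF Fx.
have [j _ ej] : range p q by rewrite -(bary_nodes B); exists F.
have ij : (i == j) = false by apply/eqP => e; apply: nF; rewrite e ej.
by apply: (@le_trans _ _ (lam i q)); [rewrite /lam lerD2r | rewrite -ej lam_node ij].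
Qed.

Lemma lam_segment a b' t i : lam i (segpt (p a) (p b') t) = (1 - t) * (i == a)%:R + t * (i == b')%:R.
Proof. by rewrite -!lam_node /lam /segpt dotDr !dotZr; ring. Qed.

(** If [F] has a third node [l], take a relatively interior point with nonzero [l]-coordinate and go
    through the midpoint of [p i] and [p j] to the boundary of [F]. The exit point keeps positive
    coordinates [i] and [j], so these are the end points of the edge containing it. With only two
    nodes any edge will do. *)
Lemma face_edge F i j : is_polygon F -> ph_faces E F -> pg_set F `<=` ph_set E -> pg_nodes F (p i) -> pg_nodes F (p j) ->
  i != j -> pg_edges F (segment (p i) (p j)).
Proof.
move=> pF EF FE Ni Nj ij.
have [_ [ hed [_ [cF [_ [H [pH FH hcl hb]]]]]]] := pF.
have edge_pq e : pg_edges F e -> exists a b, [/\ a != b, e = segment (p a) (p b), pg_nodes F (p a) & pg_nodes F (p b)].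
  move=> Fe; have [q1 [q2 [q12 ee N1 N2]]] := edge_nodes pF Fe.
  have [a _ ea] : range p q1 by rewrite -(bary_nodes B); exists F.
  have [b _ eb] : range p q2 by rewrite -(bary_nodes B); exists F.
  by exists a, b; rewrite ea eb; split => //; apply: contra_neq q12 => ab; rewrite -ea -eb ab.
have symE a b : segment (p a) (p b) = segment (p b) (p a) by exact: segmentC.
have done_ e a b : pg_edges F e -> e = segment (p a) (p b) -> i \in [:: a; b] -> j \in [:: a; b] -> pg_edges F (segment (p i) (p j)).
  move=> Fe ee; rewrite ee {ee} in Fe; rewrite !inE => /orP[/eqP ia|/eqP ib] /orP[/eqP ja|/eqP jb]; rewrite ?ia ?ja ?ib ?jb ?eqxx // in ij *.
  by rewrite symE.
have [[l [Nl li lj]]|nl] := pselect (exists l, [/\ pg_nodes F (p l), l != i & l != j]); last first.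
  have [e Fe _] := Ni; have [a [b [ab ee Na Nb]]] := edge_pq e Fe.
  have nij k : pg_nodes F (p k) -> k \in [:: i; j].
    move=> Nk; rewrite !inE; apply: contrapT => /negP; rewrite negb_or => /andP[ki kj]; by apply: nl; exists k.
  apply: (done_ e a b) => //; move: (nij a Na) (nij b Nb) ab; rewrite !inE => /orP[]/eqP -> /orP[]/eqP ->; rewrite ?eqxx ?orbT //.
pose z := segpt (p i) (p j) (1 / 2).
have lz k : lam k z = ((k == i)%:R + (k == j)%:R) / 2 by rewrite lam_segment; field.
have [x0 rx0 hx0] : exists2 x0, relint H (pg_set F) x0 & lam l x0 != 0.
  have e0 : 0 < (enorm (m l) + 1)^-1 by rewrite invr_gt0 ltr_wpDl ?enorm_ge0.
  have : closure (relint H (pg_set F)) (p l) by rewrite hcl; exact: node_in pF Nl.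
  move=> /closureE/(_ _ e0)[y iy ye]; exists y => //.
  apply/negP => /eqP l0; have := lam_lip l y (p l); rewrite l0 lam_node eqxx sub0r normrN normr1.
  move=> h; move: ye; rewrite -[_^-1]mul1r ltr_pdivlMr ?ltr_wpDl ?enorm_ge0 // mulrDr mulr1 => h'.
  by move: h h' (enorm_ge0 (y - p l)); move: (enorm (m l)) (enorm (y - p l)) => a d; lra.
have Fx0 := rx0.1; have Ex0 := FE _ Fx0.
have Hz : H z.
  by rewrite /z segptE; apply: (affine_plane pH); apply: FH; apply: (node_in pF).
have u0 : z - x0 != 0.
  by apply: contra_neq hx0 => /eqP; rewrite subr_eq0 => /eqP <-; rewrite lz (negbTE li) (negbTE lj) addr0 mul0r.
have [s [s0 Fs hs]] := ray_exit cF Fx0 u0.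
set y := x0 + s *: (z - x0) in Fs.
have ly k : lam k y = (1 - s) * lam k x0 + s * lam k z by rewrite /lam /y dotDr dotZr dotDr dotNr; ring.
have [c1 [n [n1 eH]]] := plane_unit pH; have hx : dot n (x0 - c1) = 0 by have := FH _ Fx0; rewrite eH.
have nu0 : dot n (z - x0) = 0 by apply/(plane_dir _ hx); have := Hz; rewrite eH.
have nr : ~ relint H (pg_set F) y.
  rewrite eH => ry; have hy : dot n (y - c1) = 0 by have := FH _ Fs; rewrite eH.
  have [e e0 he] := relint_dir ry hy nu0; apply: (hs (s + e / 2)); first by rewrite ltrDl divr_gt0.
  have -> : x0 + (s + e / 2) *: (z - x0) = y + (e / 2) *: (z - x0) by rewrite /y scalerDl addrA.
  by apply: he; rewrite gtr0_norm ?divr_gt0 // ltr_pdivrMr // mulr_natr mulr2n ltrDl.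
have sp : 0 < s.
  rewrite lt_neqAle s0 andbT; apply/eqP => e; apply: nr.
  by rewrite /y -e scale0r addr0.
have s1 : s <= 1.
  have := lam_ge0 l (FE _ Fs); rewrite ly lz (negbTE li) (negbTE lj) addr0 mul0r mulr0 addr0.
  by rewrite pmulr_lge0 ?subr_ge0 // lt_neqAle eq_sym hx0 lam_ge0.
have : (\bigcup_(e in pg_edges F) e) y by rewrite -hb.
move=> [e Fe ey]; have [a [b [ab ee Na Nb]]] := edge_pq e Fe.
have {}ey := ey; rewrite ee in ey; case/segptP: ey => t [_ yt].
have inn k : k \in [:: i; j] -> k \in [:: a; b].
  rewrite !inE => hk; have : 0 < lam k y.
    rewrite ly ltr_wpDl ?mulr_ge0 ?subr_ge0 ?lam_ge0 // mulr_gt0 // lz divr_gt0 //.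
    by case/orP: hk => /eqP ->; rewrite eqxx ?[j == i]eq_sym (negbTE ij) ?addr0 ?add0r.
  by rewrite yt lam_segment; case: (k == a); case: (k == b); rewrite //= !mulr0 addr0 ltxx.
by apply: (done_ e a b); rewrite ?inn ?inE ?eqxx ?orbT.
Qed.

End Bary.

(** * A bounded cutoff of class C^1 for barycentric coordinates *)

Section Clamp.
Context {R : realType}.

Definition ppart (t : R) := if 0 <= t then t else 0.
Definition psq (t : R) := ppart t ^+ 2.
(** Identity on [[0, 1]], constant [-1/2] below [-1] and [3/2] above 2, with slope in [[0, 1]]. It
    keeps the arguments of the projection inside the tube on the whole space, without leaving the
    class C^1. *)
Definition clamp (t : R) := t + (psq (- t) - psq (- 1 - t) - psq (t - 1) + psq (t - 2)) / 2.

Lemma psq_diff s t : `|psq s - psq t| <= (`|s| + `|t|) * `|s - t|.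
Proof.
rewrite /psq subr_sqr normrM mulrC; apply: ler_pM => //.
  rewrite (le_trans (ler_normD _ _)) // lerD // /ppart; case: ifP => // _; rewrite normr0 //.
rewrite /ppart; case: ifP => hs; case: ifP => ht //; rewrite ?subrr ?normr0 // ?subr0 ?sub0r ?normrN.
  by move/negbT: ht; rewrite -ltNge => ht; rewrite !ger0_norm ?subr_ge0 //; lra.
by move/negbT: hs; rewrite -ltNge => hs; rewrite distrC !ger0_norm ?subr_ge0 //; lra.
Qed.

Lemma sd_psq (t : R) : sd psq t.
Proof.
have [t0|t0|t0] := ltgtP t 0.
- apply: (@sd_near R _ _ (fun=> 0 : R) psq t (- t)) (sd_cst _ _); first by rewrite oppr_gt0.
  move=> y; rewrite ltr_norml => /andP[_ hy]; rewrite /psq /ppart ifF ?expr0n //.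
  by apply/negP => h; lra.
- apply: (@sd_near R _ _ (fun y : R => y * y : R) psq t t) => //; last by apply: sdM; exact: sd_id.
  move=> y; rewrite ltr_norml => /andP[hy _]; rewrite /psq /ppart ifT //; lra.
- exists (fun=> 0); rewrite t0; split.
  + by move=> a u v; rewrite scaler0 addr0.
  + by exists 0 => v; rewrite normr0 mul0r.
  + move=> e e0; exists (e / 2); first exact: divr_gt0.
    move=> y z; rewrite !subr0 => hy hz; apply: (le_trans (psq_diff _ _)).
    by rewrite ler_wpM2r //; lra.
Qed.

Lemma sd_clamp (t : R) : sd clamp t.
Proof.
have ssub (a b : R) : sd (fun t : R => psq (a + b * t)) t.
  apply: (@sd_comp _ _ _ _ (fun t : R => a + b * t : R) psq); last exact: sd_psq.
  by apply: sdD; [exact: sd_cst | apply: sdM; [exact: sd_cst | exact: sd_id]].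
have -> : clamp = fun t : R => t + ((psq (0 + (-1) * t) + (-1) * psq (-1 + (-1) * t)) + ((-1) * psq (-1 + 1 * t) + psq (-2 + 1 * t))) * (1 / 2).
  apply/funext => u; rewrite /clamp; rewrite -[0 + _](_ : - u = _); last by ring.
  rewrite -[-1 + -1 * u](_ : - 1 - u = _); last by ring.
  rewrite -[-1 + 1 * u](_ : u - 1 = _); last by ring.
  rewrite -[-2 + 1 * u](_ : u - 2 = _); last by ring.
  by field.
apply: sdD; first exact: sd_id.
apply: sdM; last exact: sd_cst.
apply: sdD; apply: sdD => //; apply: sdM => //; exact: sd_cst.
Qed.

Lemma clampE t : 0 <= t <= 1 -> clamp t = t.
Proof.
move=> /andP[t0 t1]; rewrite /clamp /psq /ppart.
case: ifP => h1; case: ifP => h2; case: ifP => h3; case: ifP => h4; nra.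
Qed.

Lemma clamp_bound t : `|clamp t| <= 3 / 2.
Proof.
rewrite ler_norml /clamp /psq /ppart.
by case: ifP => h1; case: ifP => h2; case: ifP => h3; case: ifP => h4; apply/andP; split; nra.
Qed.

Lemma clamp_low (s t : R) : s <= t -> t <= 1 / 2 -> 0 <= clamp t - clamp s <= t - s.
Proof.
move=> st t1; rewrite /clamp /psq /ppart.
have e1 : (0 <= t - 1) = false by apply/negP; lra.
have e2 : (0 <= t - 2) = false by apply/negP; lra.
have e3 : (0 <= s - 1) = false by apply/negP; lra.
have e4 : (0 <= s - 2) = false by apply/negP; lra.
rewrite e1 e2 e3 e4 {e1 e2 e3 e4}.
case: ifP => [|/negbT]; rewrite -?ltNge => h1; case: ifP => [|/negbT]; rewrite -?ltNge => h2;
  case: ifP => [|/negbT]; rewrite -?ltNge => h3; case: ifP => [|/negbT]; rewrite -?ltNge => h4; try lra; apply/andP; split; nra.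
Qed.

(** Reduces the slope bound to [t <= 1 / 2], where half of the cutoff terms vanish. *)
Lemma clamp_sym (t : R) : clamp (1 - t) = 1 - clamp t.
Proof.
rewrite /clamp; have -> : - 1 - (1 - t) = t - 2 by ring.
have -> : - (1 - t) = t - 1 by ring.
have -> : 1 - t - 1 = - t by ring.
have -> : 1 - t - 2 = - 1 - t by ring.
by field.
Qed.

Lemma clamp_lip s t : `|clamp s - clamp t| <= `|s - t|.
Proof.
wlog st : s t / s <= t.
  by move=> h; case/orP: (le_total s t) => [/h//|/h]; rewrite distrC (distrC s).
rewrite distrC (distrC s) (ger0_norm (_ : 0 <= t - s)) ?subr_ge0 //.
suff : 0 <= clamp t - clamp s <= t - s by move=> /andP[a b]; rewrite ger0_norm.
have up u v : u <= v -> 1 / 2 <= u -> 0 <= clamp v - clamp u <= v - u.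
  move=> uv u1; have l1 : 1 - v <= 1 - u by lra.
  have l2 : 1 - u <= 1 / 2 by lra.
  by have := clamp_low l1 l2; rewrite !clamp_sym => /andP[a b]; apply/andP; split; lra.
have [t1|t1] := lerP t (1 / 2); first exact: clamp_low.
have [s1|s1] := lerP (1 / 2) s; first exact: up.
have /andP[a b] := @clamp_low s (1 / 2) (ltW s1) (lexx _); have /andP[c d] := up (1 / 2) t (ltW t1) (lexx _).
by apply/andP; split; lra.
Qed.

End Clamp.

(** * The explicit displacement on tetrahedra *)

Lemma od_arith (R : realType) (a b c d e p : R) : 0 <= p -> `|a - b - (c + d)| <= e -> e <= 12 * p -> `|c| <= 36 * p -> `|d| <= p -> `|a - b| <= 60 * p.
Proof.
rewrite !ler_norml => p0 /andP[h1 h2] h3 /andP[h4 h5] /andP[h6 h7]; apply/andP; split; lra.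
Qed.

Lemma coef_arith (R : realType) (a : R) : 0 <= a -> 360 * a + 4 * (107 * a) <= 800 * a.
Proof. by move=> a0; rewrite mulrA -mulrDl ler_wpM2r // -natrM -natrD ler_nat. Qed.

Section TetMap.
Context {R : realType} (Om : set (pt R)) (R0 : R) (T : tube Om R0).
Variables (gam h : R) (E : polyhedron R) (p m : 'I_4 -> pt R) (c : 'I_4 -> R) (k : 'I_4 -> 'I_4 -> bool).
Hypotheses (g0 : 0 < gam) (h0 : 0 < h) (hs : h <= R0 / 200).
Notation Gam := (frontier Om).
Notation od := (oriented_distance Om).
Notation nu := (normal Om).
Notation A := (normal_projection Om).
Variable D : R.
Hypotheses (D0 : 0 < D) (Dh : D <= h) (pD : forall i j, enorm (p i - p j) <= D).
Hypotheses (mD : forall i, enorm (m i) <= (2 * (gam * D))^-1) (kG : forall i j, k i j -> Gam (p i) /\ Gam (p j)).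
Implicit Types (x y : pt R).
Let r0 := tb_pos T.

Definition disp x : pt R := A x - x.
Definition tl x i := clamp (lam m c i x).
(** [k i j] will mean that the edge from [p i] to [p j] lies on the surface. A foot moves only along
    such edges, so it equals [x] on a surface edge or face containing [p i], and equals the node
    [p i] if no surface edge is involved. *)
Definition foot i (t : 'I_4 -> R) := p i + \sum_j (if k i j then t j *: (p j - p i) else 0).
(** Mean of the displacements at the feet. Since the weights sum to one, it reproduces [disp] on
    surface edges and faces, and it vanishes on the other edges because [disp] is zero at nodes on
    the boundary. No division occurs, whence the class C^1. *)
Definition tetmap x : pt R := \sum_i (if `[< Gam (p i) >] then tl x i *: disp (foot i (tl x)) else 0).

Lemma dispE x : disp x = - od x *: nu (A x).
Proof. by rewrite /disp {2}(tA T x) opprD addrA subrr add0r scaleNr. Qed.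

Lemma disp_Gam x : Gam x -> disp x = 0.
Proof. by move=> Gx; rewrite /disp (tA_Gam T Gx) subrr. Qed.

Lemma disp_norm x : enorm (disp x) = `|od x|.
Proof. by rewrite dispE enormZ normrN (tnu1 T) mulr1. Qed.

Lemma disp_lip x y : `|od x| <= R0 / 2 -> `|od y| <= R0 / 2 ->
  enorm (disp x - disp y) <= `|od x - od y| + `|od y| * (6 / R0 * enorm (x - y)).
Proof.
move=> hx hy; rewrite !dispE.
have -> : - od x *: nu (A x) - - od y *: nu (A y) = - ((od x - od y) *: nu (A x) + od y *: (nu (A x) - nu (A y))).
  by move: (od x) (od y) (nu (A x)) (nu (A y)) => a b u v; apply/rowP => i; rewrite !mxE; ring.
rewrite enormN (le_trans (ler_enormD _ _)) // !enormZ (tnu1 T) mulr1 lerD2l ler_wpM2l //.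
exact: (tg_lip T).
Qed.

Definition sdist (t s : 'I_4 -> R) := \sum_i `|t i - s i|.
Definition coef_ok (t : 'I_4 -> R) := forall i, `|t i| <= 3 / 2.

Lemma tl_ok x : coef_ok (tl x).
Proof. by move=> i; exact: clamp_bound. Qed.

Lemma sdist_ge0 t s : 0 <= sdist t s.
Proof. exact: sumr_ge0. Qed.

Lemma sdist_lip x y : sdist (tl x) (tl y) <= 2 / (gam * D) * enorm (x - y).
Proof.
have gD : 0 < gam * D by rewrite mulr_gt0.
apply: (@le_trans _ _ (\sum_(i < 4) ((2 * (gam * D))^-1 * enorm (x - y)))).
  apply: ler_sum => i _; apply: (le_trans (clamp_lip _ _)); apply: (le_trans (lam_lip _ _ _ _ _)).
  by rewrite ler_wpM2r ?enorm_ge0.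
rewrite sumr_const card_ord -mulr_natl le_eqVlt; apply/orP; left; apply/eqP; field.
by rewrite !gt_eqF.
Qed.

Lemma foot_diff i t s : foot i t - foot i s = \sum_j (if k i j then (t j - s j) *: (p j - p i) else 0).
Proof.
rewrite /foot opprD addrACA subrr add0r -sumrB; apply: eq_bigr => j _.
by case: ifP; rewrite ?subr0 // scalerBl.
Qed.

Lemma foot_lip2 i t s : enorm (foot i t - foot i s) <= D * sdist t s.
Proof.
rewrite foot_diff (le_trans (enorm_sum _ _ _)) // /sdist mulr_sumr; apply: ler_sum => j _.
case: ifP => _; last by rewrite enorm0 mulr_ge0 // ltW.
by rewrite enormZ mulrC ler_wpM2r.
Qed.

Lemma foot0 i : foot i (fun=> 0) = p i.
Proof. by rewrite /foot big1 ?addr0 // => j _; case: ifP; rewrite ?scale0r. Qed.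

Lemma sdist_bound t s : coef_ok t -> coef_ok s -> sdist t s <= 12.
Proof.
move=> ht hss; apply: (@le_trans _ _ (\sum_(i < 4) (3 : R))); last by rewrite sumr_const card_ord -mulr_natl; lra.
by apply: ler_sum => j _; apply: (le_trans (ler_normB _ _)); have := ht j; have := hss j; lra.
Qed.

Lemma ok0 : coef_ok (fun=> 0).
Proof. by move=> i; rewrite normr0; lra. Qed.

Lemma sdist0 t : coef_ok t -> sdist t (fun=> 0) <= 6.
Proof.
move=> ht; apply: (@le_trans _ _ (\sum_(i < 4) (3 / 2 : R))); last by rewrite sumr_const card_ord -mulr_natl; lra.
by apply: ler_sum => j _; rewrite subr0.
Qed.

Lemma foot_near i t : coef_ok t -> enorm (foot i t - p i) <= 6 * D.
Proof.
move=> ht; rewrite -[X in _ - X](foot0 i) mulrC (le_trans (foot_lip2 _ _ _)) // ler_wpM2l ?(ltW D0) //; exact: sdist0.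
Qed.

Lemma foot_tube i t : coef_ok t -> Gam (p i) -> `|od (foot i t)| <= R0 / 30.
Proof.
move=> ht Gp; have := tod_lip T (foot i t) (p i); rewrite (tod0 T Gp) subr0 => h1.
apply: (le_trans h1); apply: (le_trans (foot_near i ht)); move: hs Dh r0; move: D h R0 => d h' r *; lra.
Qed.

Lemma sd_sum (f : 'I_4 -> pt R -> pt R) x : (forall i, sd (f i) x) -> sd (fun y => \sum_i f i y) x.
Proof.
move=> hf; have -> : (fun y => \sum_i f i y) = \sum_i f i by apply/funext => y; rewrite fct_sumE.
elim/big_rec: _ => [|i g _ sg]; first exact: (sd_cst (0 : pt R)).
exact: sdD (hf i) sg.
Qed.

Lemma tetmap_sd x : sd tetmap x.
Proof.
have stl i : sd (tl^~ i) x.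
  apply: (@sd_comp _ _ _ _ (lam m c i) clamp); last exact: sd_clamp.
  by apply: sdD; [apply: sd_dot; [exact: sd_cst | exact: sd_id] | exact: sd_cst].
apply: sd_sum => i; case: (pselect (Gam (p i))) => Gp; last first.
  rewrite (_ : `[< _ >] = false); last by apply/asboolP.
  exact: (sd_cst (0 : pt R)).
rewrite (_ : `[< _ >] = true); last by apply/asboolP.
apply: sdZ => //; apply: (@sd_comp _ _ _ _ (fun x => foot i (tl x)) disp).
  apply: sdD; first exact: sd_cst.
  apply: sd_sum => j; case: (k i j); last exact: (sd_cst (0 : pt R)).
  by apply: sdZ => //; exact: sd_cst.
apply: sdD.
  apply: (tA_sd T); apply: (le_lt_trans (foot_tube (tl_ok x) Gp)).
  by rewrite ltr_pM2l // ltf_pV2 ?posrE // ltr_nat.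
apply: (@sd_near R _ _ (fun y : pt R => (-1) *: y) _ _ 1) => //; first by move=> y _; rewrite scaleN1r.
by apply: sdZ; [exact: sd_cst | exact: sd_id].
Qed.

Lemma q_ge0 : 0 <= h * D / R0.
Proof. by rewrite divr_ge0 ?mulr_ge0 // ltW. Qed.

Lemma foot_half i t : coef_ok t -> Gam (p i) -> `|od (foot i t)| <= R0 / 2.
Proof.
by move=> ht Gp; apply: (le_trans (foot_tube ht Gp)); rewrite ler_pM2l // lef_pV2 ?posrE // ler_nat.
Qed.

(** The gain over the trivial bound [D * sdist t s] comes from [kG]: both ends of a surface edge lie
    on the boundary, so the edge is tangential up to [h * D / R0]. The quadratic error, the turning
    normal and this term give 12, 36 and 1, at most 60 in all. *)
Lemma foot_od i t s : coef_ok t -> coef_ok s -> Gam (p i) -> `|od (foot i t) - od (foot i s)| <= 60 * (h * D / R0 * sdist t s).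
Proof.
move=> ht hss Gp; have ox := foot_half ht Gp; have oy := foot_half hss Gp.
have op : `|od (p i)| <= R0 / 2 by rewrite (tod0 T Gp) normr0 divr_ge0 // ltW.
have hD := q_ge0; have S0 := sdist_ge0 t s.
have q := todQ T (foot i t) oy.
have e1 : enorm (foot i t - foot i s) ^+ 2 / R0 <= 12 * (h * D / R0 * sdist t s).
  have -> : 12 * (h * D / R0 * sdist t s) = (h * 12) * (D * sdist t s) / R0 by field; rewrite gt_eqF.
  rewrite ler_pM2r ?invr_gt0 // expr2; apply: ler_pM; rewrite ?enorm_ge0 ?foot_lip2 //.
  by apply: (le_trans (foot_lip2 _ _ _)); apply: ler_pM; rewrite ?(ltW D0) // sdist_bound.
have e2 : `|dot (nu (A (foot i s)) - nu (p i)) (foot i t - foot i s)| <= 36 * (h * D / R0 * sdist t s).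
  apply: (le_trans (dot_abs _ _)).
  have g1 := tg_lip T oy op; rewrite (tA_Gam T Gp) in g1.
  have -> : 36 * (h * D / R0 * sdist t s) = (6 / R0 * (6 * h)) * (D * sdist t s) by field; rewrite gt_eqF.
  apply: ler_pM; rewrite ?enorm_ge0 ?foot_lip2 //; apply: (le_trans g1); rewrite ler_wpM2l ?divr_ge0 ?(ltW r0) //.
  by apply: (le_trans (foot_near _ hss)); rewrite ler_pM2l.
have e3 : `|dot (nu (p i)) (foot i t - foot i s)| <= (h * D / R0) * sdist t s.
  rewrite foot_diff dot_suml (le_trans (ler_norm_sum _ _ _)) // /sdist mulr_sumr; apply: ler_sum => j _.
  case: ifP => [/kG[_ Gj]|_]; last by rewrite dot0r normr0 mulr_ge0.
  rewrite dotZr normrM mulrC ler_wpM2r //.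
  have := todQ T (p j) op; rewrite (tod0 T Gp) (tod0 T Gj) subrr sub0r normrN (tA_Gam T Gp) => /le_trans; apply.
  rewrite ler_pM2r ?invr_gt0 // expr2; apply: ler_pM; rewrite ?enorm_ge0 //; exact: le_trans (pD _ _) Dh.
have eq : dot (nu (A (foot i s))) (foot i t - foot i s) =
   dot (nu (A (foot i s)) - nu (p i)) (foot i t - foot i s) + dot (nu (p i)) (foot i t - foot i s).
  by rewrite -dotDl subrK.
rewrite eq in q; move: q e1 e2 e3; have := mulr_ge0 hD S0.
exact: od_arith.
Qed.

Lemma foot_od0 i t : coef_ok t -> Gam (p i) -> `|od (foot i t)| <= 360 * (h * D / R0).
Proof.
move=> ht Gp; have := foot_od ht ok0 Gp; rewrite foot0 (tod0 T Gp) subr0 => /le_trans; apply.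
have -> : 360 * (h * D / R0) = 60 * (h * D / R0 * 6) by ring.
by rewrite ler_pM2l //; apply: ler_wpM2l; [exact: q_ge0 | exact: sdist0].
Qed.

Lemma foot_disp i t s : coef_ok t -> coef_ok s -> Gam (p i) -> enorm (disp (foot i t) - disp (foot i s)) <= 71 * (h * D / R0 * sdist t s).
Proof.
move=> ht hss Gp; apply: (le_trans (disp_lip (foot_half ht Gp) (foot_half hss Gp))).
have e1 := foot_od ht hss Gp.
have e2 : `|od (foot i s)| * (6 / R0 * enorm (foot i t - foot i s)) <= 360 * (h * D / R0) * (6 / R0 * (h * sdist t s)).
  have r6 : 0 <= 6 / R0 by rewrite divr_ge0 // ltW.
  apply: ler_pM; [exact: normr_ge0 | by rewrite mulr_ge0 ?enorm_ge0 | exact: foot_od0 | ].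
  by apply: (ler_wpM2l r6); apply: (le_trans (foot_lip2 _ _ _)); rewrite ler_wpM2r ?sdist_ge0.
have e3 : 360 * (h * D / R0) * (6 / R0 * (h * sdist t s)) <= 11 * (h * D / R0 * sdist t s).
  have -> : 360 * (h * D / R0) * (6 / R0 * (h * sdist t s)) = (2160 * (h / R0)) * (h * D / R0 * sdist t s) by field; rewrite gt_eqF.
  apply: ler_wpM2r; first exact: mulr_ge0 q_ge0 (sdist_ge0 _ _).
  have : h / R0 <= 1 / 200 by rewrite ler_pdivrMr // mulrC mulrA mulr1.
  by move: (h / R0) => a; lra.
apply: (le_trans (lerD e1 (le_trans e2 e3))); rewrite -mulrDl; apply: ler_wpM2r; [exact: mulr_ge0 q_ge0 (sdist_ge0 _ _) | lra].
Qed.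

Lemma tetmap_lip x y : enorm (tetmap x - tetmap y) <= 1600 / (gam * R0) * h * enorm (x - y).
Proof.
have q0 := q_ge0; have S0 := sdist_ge0 (tl x) (tl y).
apply: (@le_trans _ _ (800 * (h * D / R0 * sdist (tl x) (tl y)))); last first.
  have -> : 1600 / (gam * R0) * h * enorm (x - y) = 800 * (h * D / R0 * (2 / (gam * D) * enorm (x - y))).
    by field; rewrite !gt_eqF.
  have := sdist_lip x y; move: (h * D / R0) (sdist _ _) (_ * enorm _) q0 => a b d q0 hb.
  by rewrite ler_pM2l ?ltr0n //; exact: ler_wpM2l.
rewrite /tetmap -sumrB (le_trans (enorm_sum _ _ _)) //.
(* 107 dominates [3 / 2 * 71]: clamped weights are at most 3/2 and 71 is the constant of
   [foot_disp]. Summing over four nodes gives [360 + 4 * 107 <= 800]. *)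
apply: (@le_trans _ _ (\sum_i (360 * (h * D / R0) * `|tl x i - tl y i| + 107 * (h * D / R0 * sdist (tl x) (tl y))))); last first.
  rewrite big_split /= -mulr_sumr -/(sdist (tl x) (tl y)) sumr_const card_ord -[X in _ + X]mulr_natl.
  move: (mulr_ge0 q0 S0); rewrite -[360 * _ * _]mulrA; move: (h * D / R0 * _) => a; exact: coef_arith.
apply: ler_sum => i _; case: (pselect (Gam (p i))) => Gp; last first.
  rewrite (_ : `[< _ >] = false); last by apply/asboolP.
  have e0 : enorm (0 - 0 : pt R) = 0 by rewrite subrr enorm0.
  rewrite e0; apply: addr_ge0; apply: mulr_ge0; [|exact: normr_ge0|exact: ler0n|exact: mulr_ge0 q0 S0].
  by apply: mulr_ge0; [exact: ler0n | exact: q0].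
rewrite (_ : `[< _ >] = true); last by apply/asboolP.
have -> : tl x i *: disp (foot i (tl x)) - tl y i *: disp (foot i (tl y)) =
   (tl x i - tl y i) *: disp (foot i (tl x)) + tl y i *: (disp (foot i (tl x)) - disp (foot i (tl y))).
  by move: (disp _) (disp _) (tl x i) (tl y i) => u v a b; apply/rowP => l; rewrite !mxE; ring.
apply: (le_trans (ler_enormD _ _)); rewrite !enormZ disp_norm lerD //.
  by rewrite mulrC ler_wpM2r // foot_od0 //; exact: tl_ok.
apply: (@le_trans _ _ (3 / 2 * (71 * (h * D / R0 * sdist (tl x) (tl y))))).
  by apply: ler_pM; rewrite ?enorm_ge0 ?foot_disp ?tl_ok //; exact: tl_ok.
by move: (mulr_ge0 q0 S0); move: (h * D / R0 * _) => a; lra.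
Qed.

End TetMap.

(** * Edge data and compatibility of the tetrahedral formula across faces *)

Section Data.
Context {R : realType} (Om : set (pt R)) (R0 : R) (T : tube Om R0).
Variables (gam gam2 h : R) (M : set (polyhedron R)).
Hypotheses (g0 : 0 < gam) (h0 : 0 < h) (hs : h <= R0 / 200).
Hypothesis (hk : Cflat gam R0 * h * (Kgap gam + kap gam) <= 1).
Hypothesis HM : bulk_surface_mesh Om h gam gam2 M.
Implicit Types (F G : polygon R) (E : polyhedron R) (x y z p q : pt R).
Notation Gam := (frontier Om).
Notation od := (oriented_distance Om).
Notation nu := (normal Om).
Notation A := (normal_projection Om).
Notation dm := (fun F => diam (pg_set F)).
Notation dE := (fun E => diam (ph_set E)).
Notation disp := (disp Om).
Let r0 := tb_pos T.
Notation S := (surface M).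

Lemma segment_infinite p q : p != q -> ~ finite_set (segment p q).
Proof.
move=> pq fs; apply: infinite_nat; pose f (n : nat) := segpt p q (n.+1%:R)^-1.
have inj : injective f.
  move=> a b /eqP; rewrite /f -subr_eq0 -enorm_eq0 segpt_dist mulf_eq0 enorm_eq0 (subr_eq0 p) (negbTE pq) orbF normr_eq0 subr_eq0.
  by move=> /eqP/invr_inj/eqP; rewrite eqr_nat => /eqP[].
have -> : [set: nat] = f @^-1` segment p q.
  apply/seteqP; split => n // _; apply/segptP; exists (n.+1%:R)^-1; split => //.
  by rewrite invr_ge0 ler0n /= invf_le1 ?ler1n ?ltr0n.
by apply: finite_preimage fs => a b _ _; exact: inj.
Qed.

(** Finitely many surface faces cover the edge. If it were an edge of none of them, each would meet
    it in a finite set, because faces and edges meet properly, and a segment is infinite. This is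
    needed because (F3) speaks of nodes of surface faces. *)
Lemma surface_edge e : mesh_edge M e -> e `<=` S -> exists2 F, surface_faces M F & pg_edges F e.
Proof.
move=> [F0 MF0 Fe] eS; have [pF0 _] := Mface g0 HM MF0.
have [p [q [pq ee]]] : is_edge e by case: pF0 => _ [/(_ e Fe)].
apply: contrapT => nF; apply: (segment_infinite pq); rewrite -ee.
have -> : e = \bigcup_(F in surface_faces M) (e `&` pg_set F).
  apply/seteqP; split => x; last by move=> [F _ []].
  by move=> ex; have [F sF Fx] := surfaceP HM (eS x ex); exists F.
apply: bigcup_finite => [|F sF]; first by apply: sub_finite_set (mesh_faces_finite HM) => F [].
have nFe : ~ pg_edges F e by move=> hF; apply: nF; exists F.
have F0F : F0 <> F by move=> hF; apply: nFe; rewrite -hF.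
have sub : e `&` pg_set F `<=` e `&` (pg_set F0 `&` pg_set F).
  by move=> x [ex Fx]; split => //; split => //; exact: edge_sub Fe _ ex.
apply: (sub_finite_set sub).
case: ((mesh_F2 HM).2 _ _ MF0 sF.1 F0F) => [->|[r [_ _ ->]]|[e1 [Fe1 F1e1 ->]]].
- by rewrite setI0.
- by apply: (@sub_finite_set _ _ [set r]) => // x [].
- have ne : e <> e1 by move=> hF; apply: nFe; rewrite hF.
  case: pF0 => _ [_ [/(_ e e1 Fe Fe1 ne)+ _]] => -[->//|[r [_ _ ->]]].
  exact: finite_set1.
Qed.

Lemma endpoint_Gam e p : mesh_edge M e -> e `<=` S -> endpoint e p -> Gam p.
Proof. by move=> Me /(surface_edge Me)[F sF Fe] ep; apply: (mesh_F3 HM sF); exists e. Qed.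

Definition wedge e x : pt R := if `[< e `<=` S >] then disp x else 0.

Lemma wedge_end e p : mesh_edge M e -> endpoint e p -> wedge e p = 0.
Proof.
move=> Me ep; rewrite /wedge; case: asboolP => // eS; apply: (disp_Gam T); exact: endpoint_Gam ep.
Qed.

Definition L1 := 2 * Cflat gam R0 * h.

Lemma L1_gt0 : 0 < L1.
Proof. by apply: mulr_gt0 => //; apply: mulr_gt0 => //; exact: (Cflat_pos T g0). Qed.

Lemma disp_surf_lip F x y : surface_faces M F -> pg_set F x -> pg_set F y -> enorm (disp x - disp y) <= L1 * enorm (x - y).
Proof.
move=> sF Fx Fy; have C0 := Cflat_pos T g0; have /andP[d0 dh] := face_h g0 HM sF.1.
have sub z : pg_set F z -> `|od z| <= R0 / 2.
  by move=> Fz; apply: (norm_half T hs); apply: (surf_small T g0 HM); apply: sF.2.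
apply: (le_trans (disp_lip T (sub _ Fx) (sub _ Fy))).
have a1 := surf_lip T g0 h0 hs hk HM sF Fx Fy.
have a2 := surf_od T g0 h0 hs hk HM sF Fy.
have a3 : `|od y| * (6 / R0 * enorm (x - y)) <= Cflat gam R0 * dm F * enorm (x - y).
  rewrite [leLHS]mulrA; apply: ler_wpM2r; first exact: enorm_ge0.
  apply: (@le_trans _ _ (Cflat gam R0 * dm F ^+ 2 * (6 / R0))).
    by apply: ler_wpM2r a2; rewrite divr_ge0 // ltW.
  have -> : Cflat gam R0 * dm F ^+ 2 * (6 / R0) = Cflat gam R0 * dm F * (6 * dm F / R0) by ring.
  rewrite -[leRHS]mulr1; apply: ler_wpM2l; first by rewrite mulr_ge0 // ltW.
  rewrite ler_pdivrMr // mul1r; move: dh hs h0; move: (diam _) => d *; lra.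
have a4 : Cflat gam R0 * dm F * enorm (x - y) <= Cflat gam R0 * h * enorm (x - y).
  by apply: ler_wpM2r; [exact: enorm_ge0 | rewrite ler_pM2l].
have -> : L1 * enorm (x - y) = Cflat gam R0 * h * enorm (x - y) + Cflat gam R0 * h * enorm (x - y).
  by rewrite /L1; ring.
by apply: lerD; [exact: le_trans a1 a4 | exact: le_trans a3 a4].
Qed.

Lemma wedge_lip e x y : mesh_edge M e -> e x -> e y -> enorm (wedge e x - wedge e y) <= L1 * enorm (x - y).
Proof.
move=> Me ex ey; rewrite /wedge; case: asboolP => eS; last by rewrite subrr enorm0 mulr_ge0 ?enorm_ge0 // ltW // L1_gt0.
have [F sF Fe] := surface_edge Me eS; have [pF _] := Mface g0 HM sF.1.
by apply: (disp_surf_lip sF); apply: (edge_sub pF Fe).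
Qed.

Section Tets.
Variables (P Mx : polyhedron R -> 'I_4 -> pt R) (cc : polyhedron R -> 'I_4 -> R).
Hypothesis HP : forall E, M E -> is_tetrahedron E -> bary E (P E) (Mx E) (cc E).

Definition kE E i j : bool := `[< ph_edges E (segment (P E i) (P E j)) /\ segment (P E i) (P E j) `<=` S >].
Definition tW E x : pt R := tetmap Om (P E) (Mx E) (cc E) (kE E) x.

Lemma mesh_edgeI E F e : M E -> ph_faces E F -> pg_edges F e -> mesh_edge M e.
Proof. by move=> ME EF Fe; exists F => //; exists E. Qed.

Lemma kE_Gam E i j : M E -> kE E i j -> Gam (P E i) /\ Gam (P E j).
Proof.
move=> ME /asboolP[[F EF Fe] eS]; have Me := mesh_edgeI ME EF Fe.
have pq : P E i != P E j.
  apply/eqP => e; have [a [b [ab]]] := mesh_edge_segment g0 HM Me; rewrite e => eab.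
  have pt1 z : segment (P E j) (P E j) z -> z = P E j.
    by move=> /segptP[t [_ ->]]; rewrite segptE subrr scaler0 addr0.
  have ea : a = P E j by apply: pt1; rewrite eab; exact: segment_l.
  have eb : b = P E j by apply: pt1; rewrite eab; exact: segment_r.
  by move: ab; rewrite ea eb eqxx.
split; apply: (endpoint_Gam Me eS); first by exists (P E j).
by exists (P E i); split; [rewrite eq_sym | exact: segmentC].
Qed.

Lemma tl_lam E x i : M E -> is_tetrahedron E -> ph_set E x -> tl (Mx E) (cc E) x i = lam (Mx E) (cc E) i x.
Proof. by move=> ME tE Ex; apply: clampE; rewrite (lam_ge0 (HP ME tE)) // (lam_le1 (HP ME tE)). Qed.

Definition Lt := 1600 / (gam * R0) * h.

Lemma node_dist E i j : M E -> is_tetrahedron E -> enorm (P E i - P E j) <= dE E.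
Proof.
move=> ME tE; have [_ _ _ [cE _] _] := mesh_polyhedra HM ME.
by apply: diam_ub => //; apply: (hull_sub (HP ME tE)); eexists.
Qed.

Lemma tW_props E : M E -> is_tetrahedron E -> (forall x, sd (tW E) x) /\ (forall x y, enorm (tW E x - tW E y) <= Lt * enorm (x - y)).
Proof.
move=> ME tE; have [pE [c0 [St _ d0]]] := Melem g0 HM ME; have Dh := mesh_F1 HM ME.
have mD i : enorm (Mx E i) <= (2 * (gam * dE E))^-1.
  apply: (m_bound (HP ME tE) (z := c0)); first by rewrite mulr_gt0.
  by move=> y hy; apply: (st_ball St).
split => [x|x y].
  by apply: (tetmap_sd T (Mx E) (cc E) (kE E) hs d0 Dh) => i j; exact: node_dist.
apply: (tetmap_lip T (cc E) g0 h0 hs d0 Dh _ mD) => i j; first exact: node_dist.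
exact: (kE_Gam ME).
Qed.

Lemma tW_nonexterior E x : M E -> ~ exterior M E -> tW E x = 0.
Proof.
move=> ME nE; have k0 i j : kE E i j = false.
  by apply/asboolP => -[h1 h2]; apply: nE; right; exists (segment (P E i) (P E j)).
rewrite /tW /tetmap big1 // => i _; case: asboolP => // Gi; rewrite /foot big1 ?addr0 ?(disp_Gam T) ?scaler0 //.
by move=> j _; rewrite k0.
Qed.

Lemma tet_edge E F e : M E -> is_tetrahedron E -> ph_faces E F -> pg_edges F e ->
  exists a b, [/\ a != b, e = segment (P E a) (P E b), pg_nodes F (P E a) & pg_nodes F (P E b)].
Proof.
move=> ME tE EF Fe; have [pF _] := Mface g0 HM (ex_intro2 _ _ E ME EF).
have B := HP ME tE; have [q1 [q2 [q12 ee N1 N2]]] := edge_nodes pF Fe.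
have [a _ ea] : range (P E) q1 by rewrite -(bary_nodes B); exists F.
have [b _ eb] : range (P E) q2 by rewrite -(bary_nodes B); exists F.
by exists a, b; rewrite ea eb; split => //; apply: contra_neq q12 => ab; rewrite -ea -eb ab.
Qed.

Lemma tW_edge E F e x : M E -> is_tetrahedron E -> ph_faces E F -> pg_edges F e -> e x -> tW E x = wedge e x.
Proof.
move=> ME tE EF Fe ex; have Me := mesh_edgeI ME EF Fe; have B := HP ME tE.
have [pF _] := Mface g0 HM (ex_intro2 _ _ E ME EF).
have Ex : ph_set E x by apply: (face_sub HM ME EF); exact: edge_sub Fe _ ex.
have [a [b [ab ee _ _]]] := tet_edge ME tE EF Fe.
have /segptP[t [_ xt]] : segment (P E a) (P E b) x by rewrite -ee.
have tlx i : tl (Mx E) (cc E) x i = (1 - t) * (i == a)%:R + t * (i == b)%:R.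
  by rewrite tl_lam // xt (lam_segment B).
have ba : b != a by rewrite eq_sym.
have kab : kE E a b = `[< e `<=` S >] by rewrite ee; apply/asboolP/asboolP => [[]|h1] //; split => //; exists F => //; rewrite -ee.
have kba : kE E b a = `[< e `<=` S >].
  by rewrite ee segmentC; apply/asboolP/asboolP => [[]|h1] //; split => //; exists F => //; rewrite segmentC -ee.
have inner i j : i != j -> (forall l, l != i -> l != j -> tl (Mx E) (cc E) x l = 0) ->
    foot (P E) (kE E) i (tl (Mx E) (cc E) x) = P E i + (if kE E i j then tl (Mx E) (cc E) x j *: (P E j - P E i) else 0).
  move=> ij hl; rewrite /foot; congr (_ + _); rewrite (bigD1 j) //= big1 ?addr0 // => l lj.
  case: ifP => // _; have [->|li] := eqVneq l i; first by rewrite subrr scaler0.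
  by rewrite hl // scale0r.
have other l : l != a -> l != b -> tl (Mx E) (cc E) x l = 0.
  by move=> la lb; rewrite tlx (negbTE la) (negbTE lb) !mulr0 addr0.
have ta : tl (Mx E) (cc E) x a = 1 - t by rewrite tlx eqxx (negbTE ab) mulr0 addr0 mulr1.
have tb : tl (Mx E) (cc E) x b = t by rewrite tlx eqxx (negbTE ba) mulr0 add0r mulr1.
rewrite /tW /tetmap (bigD1 a) //= (bigD1 b) //= big1 ?addr0; last first.
  by move=> l /andP[la lb]; case: ifP => // _; rewrite other // scale0r.
rewrite (inner a b) // (inner b a) //; last by move=> l lb la; exact: other.
rewrite kab kba ta tb /wedge; case: (asboolP (e `<=` S)) => eS.
  have [Ga Gb] : Gam (P E a) /\ Gam (P E b) by apply: (kE_Gam ME); rewrite kab; apply/asboolP.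
  have ga : `[< Gam (P E a) >] = true by apply/asboolP.
  have gb : `[< Gam (P E b) >] = true by apply/asboolP.
  rewrite ga gb.
  have -> : P E a + t *: (P E b - P E a) = x by rewrite xt segptE.
  have -> : P E b + (1 - t) *: (P E a - P E b) = x by rewrite xt; apply/rowP => i; rewrite !mxE; ring.
  by rewrite -scalerDl subrK scale1r.
have z0 (a' : R) q : (if `[< Gam q >] then a' *: disp (q + 0) else 0) = 0.
  by case: asboolP => // Gq; rewrite addr0 (disp_Gam T Gq) scaler0.
by rewrite !z0 addr0.
Qed.

Lemma node_edge_end F p : mesh_faces M F -> pg_nodes F p -> exists2 e, pg_edges F e & endpoint e p /\ e p.
Proof. by move=> MF; have [pF _] := Mface g0 HM MF; exact: node_edge. Qed.

Lemma tW_node E F p : M E -> is_tetrahedron E -> ph_faces E F -> pg_nodes F p -> tW E p = 0.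
Proof.
move=> ME tE EF Np; have [e Fe [ep1 ep2]] := node_edge_end (ex_intro2 _ _ E ME EF) Np.
by rewrite (tW_edge ME tE EF Fe ep2) (wedge_end (mesh_edgeI ME EF Fe)).
Qed.

(* The restriction of [tW E] to a face depends on the face only. *)
Definition trace (N : set (pt R)) (p : 'I_4 -> pt R) (l : pt R -> R) : pt R :=
  \sum_(i | p i \in N) (if `[< Gam (p i) >] then
     l (p i) *: disp (p i + \sum_(j | p j \in N) (if `[< segment (p i) (p j) `<=` S >] then l (p j) *: (p j - p i) else 0)) else 0).

(** The nodes of a common face are numbered differently in its two tetrahedra; sums are reindexed by
    the nodes themselves. *)
Lemma node_sum (V : nmodType) (N : set (pt R)) (p p' : 'I_4 -> pt R) (f : pt R -> V) : injective p -> injective p' ->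
  N `<=` range p -> N `<=` range p' -> \sum_(i | p i \in N) f (p i) = \sum_(i | p' i \in N) f (p' i).
Proof.
move=> ip ip' Np Np'.
have e (r : 'I_4 -> pt R) : \sum_(i | r i \in N) f (r i) = \sum_(q <- [seq r i | i <- index_enum 'I_4 & r i \in N]) f q.
  by rewrite big_map big_filter.
rewrite !e; apply: perm_big; apply: uniq_perm; rewrite ?map_inj_uniq ?filter_uniq ?index_enum_uniq // => q.
apply/mapP/mapP => -[i]; rewrite mem_filter => /andP[Ni _] ->.
  have [j _ ej] := Np' _ (set_mem Ni); exists j => //; by rewrite mem_filter ej Ni mem_index_enum.
have [j _ ej] := Np _ (set_mem Ni); exists j => //; by rewrite mem_filter ej Ni mem_index_enum.
Qed.

Lemma trace_indep (N : set (pt R)) (p p' : 'I_4 -> pt R) (l : pt R -> R) : injective p -> injective p' -> N `<=` range p -> N `<=` range p' -> trace N p l = trace N p' l.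
Proof.
move=> ip ip' Np Np'.
transitivity (\sum_(i | p i \in N) (fun q => if `[< Gam q >] then
     l q *: disp (q + \sum_(j | p' j \in N) (if `[< segment q (p' j) `<=` S >] then l (p' j) *: (p' j - q) else 0)) else 0) (p i)).
  apply: eq_bigr => i _ /=; congr (if _ then _ *: disp (_ + _) else _).
  exact: (node_sum (fun q => if `[< segment (p i) q `<=` S >] then l q *: (q - p i) else 0)).
exact: (node_sum (fun q => if `[< Gam q >] then
     l q *: disp (q + \sum_(j | p' j \in N) (if `[< segment q (p' j) `<=` S >] then l (p' j) *: (p' j - q) else 0)) else 0)).
Qed.

(** Barycentric coordinate labelled by the node instead of its number, so that two elements can be
    compared. *)
Definition ell E x q : R := \sum_i (if P E i == q then lam (Mx E) (cc E) i x else 0).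

Lemma ellE E x i : M E -> is_tetrahedron E -> ell E x (P E i) = lam (Mx E) (cc E) i x.
Proof.
move=> ME tE; have ip := node_inj (HP ME tE); rewrite /ell (bigD1 i) //= eqxx big1 ?addr0 // => j ji.
by rewrite (inj_eq ip) (negbTE ji).
Qed.

Lemma face_nodes_range E F : M E -> is_tetrahedron E -> ph_faces E F -> pg_nodes F `<=` range (P E).
Proof. by move=> ME tE EF q Nq; rewrite -(bary_nodes (HP ME tE)); exists F. Qed.

Lemma lam_off E F x i : M E -> is_tetrahedron E -> ph_faces E F -> pg_set F x -> P E i \notin pg_nodes F -> lam (Mx E) (cc E) i x = 0.
Proof.
move=> ME tE EF Fx nF; have [pF _] := Mface g0 HM (ex_intro2 _ _ E ME EF).
apply: (lam_face (HP ME tE) pF EF (face_sub HM ME EF) Fx); by move=> hN; move/negP: nF; apply; rewrite inE.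
Qed.

Lemma face_segment E F i j : M E -> is_tetrahedron E -> ph_faces E F -> P E i \in pg_nodes F -> P E j \in pg_nodes F ->
  i != j -> pg_edges F (segment (P E i) (P E j)).
Proof.
move=> ME tE EF /set_mem Ni /set_mem Nj ij; have [pF _] := Mface g0 HM (ex_intro2 _ _ E ME EF).
exact: (face_edge (HP ME tE) pF EF (face_sub HM ME EF)).
Qed.

Lemma tW_trace E F x : M E -> is_tetrahedron E -> ph_faces E F -> pg_set F x -> tW E x = trace (pg_nodes F) (P E) (ell E x).
Proof.
move=> ME tE EF Fx; have Ex := face_sub HM ME EF Fx; rewrite /tW /tetmap /trace [LHS](bigID (fun i => P E i \in pg_nodes F)) /=.
rewrite [X in _ + X]big1 ?addr0; last first.
  by move=> i nF; case: ifP => // _; rewrite tl_lam // (lam_off ME tE EF Fx nF) scale0r.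
apply: eq_bigr => i Ni; case: ifP => // _; rewrite tl_lam // ellE //; congr (_ *: disp (_ + _)).
rewrite [LHS](bigID (fun i => P E i \in pg_nodes F)) /= [X in _ + X]big1 ?addr0; last first.
  by move=> j nF; case: ifP => // _; rewrite tl_lam // (lam_off ME tE EF Fx nF) scale0r.
apply: eq_bigr => j Nj; rewrite tl_lam // ellE //.
have [->|ij] := eqVneq i j; first by rewrite subrr scaler0 !if_same.
congr (if _ then _ else _); apply/asboolP/asboolP => [[]//|h1]; split => //; exists F => //.
exact: (face_segment ME tE EF).
Qed.

Lemma tW_agree E E' F x : M E -> is_tetrahedron E -> ph_faces E F -> M E' -> is_tetrahedron E' -> ph_faces E' F ->
  pg_set F x -> tW E x = tW E' x.
Proof.
move=> ME tE EF ME' tE' EF' Fx; rewrite (tW_trace ME tE EF Fx) (tW_trace ME' tE' EF' Fx).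
have Ex' := face_sub HM ME' EF' Fx.
rewrite (trace_indep (p' := P E')); first last.
- exact: face_nodes_range EF'.
- exact: face_nodes_range EF.
- exact: node_inj (HP ME' tE').
- exact: node_inj (HP ME tE).
(* The affine coordinates of [E] are evaluated at the barycentric representation of [x] in [E'],
   where only nodes of [F] carry weight. *)
have el q : q \in pg_nodes F -> ell E x q = ell E' x q.
  move=> Nq; have [i _ ei] := face_nodes_range ME tE EF (set_mem Nq); have [i' _ ei'] := face_nodes_range ME' tE' EF' (set_mem Nq).
  rewrite -{1}ei -ei' !ellE // {1}(lam_bary (HP ME' tE') Ex') (lam_comb _ _ _ _ (lam_sum (HP ME' tE') Ex')).
  rewrite (bigD1 i') //= ei' -ei (lam_node (HP ME tE)) eqxx mulr1 big1 ?addr0 // => j ji'.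
  have [Nj|Nj] := boolP (P E' j \in pg_nodes F); last by rewrite (lam_off ME' tE' EF' Fx Nj) mul0r.
  have [k _ ek] := face_nodes_range ME tE EF (set_mem Nj); rewrite -ek (lam_node (HP ME tE)).
  case: eqP => [ik|]; last by rewrite mulr0.
  by move: ji'; rewrite -(inj_eq (node_inj (HP ME' tE'))) ei' -ei ik ek eqxx.
apply: eq_bigr => i Ni; rewrite el //; congr (if _ then _ *: disp (_ + _) else _).
by apply: eq_bigr => j Nj; rewrite el.
Qed.

Lemma face_lam_sum E F x : M E -> is_tetrahedron E -> ph_faces E F -> pg_set F x ->
  \sum_(i | P E i \in pg_nodes F) ell E x (P E i) = 1 /\ \sum_(i | P E i \in pg_nodes F) ell E x (P E i) *: P E i = x.
Proof.
move=> ME tE EF Fx; have Ex := face_sub HM ME EF Fx; have B := HP ME tE; split.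
  rewrite -(lam_sum B Ex) [RHS](bigID (fun i => P E i \in pg_nodes F)) /= [X in _ = _ + X]big1 ?addr0.
    by apply: eq_bigr => i _; rewrite ellE.
  by move=> i; exact: lam_off.
rewrite [RHS](lam_bary B Ex) [RHS](bigID (fun i => P E i \in pg_nodes F)) /= [X in _ = _ + X]big1 ?addr0.
  by apply: eq_bigr => i _; rewrite ellE.
by move=> i /(lam_off ME tE EF Fx) ->; rewrite scale0r.
Qed.

Lemma tW_surface E F x : M E -> is_tetrahedron E -> ph_faces E F -> pg_set F `<=` S -> pg_set F x -> tW E x = disp x.
Proof.
move=> ME tE EF FS Fx; have [pF _] := Mface g0 HM (ex_intro2 _ _ E ME EF); rewrite (tW_trace ME tE EF Fx).
have [s1 s2] := face_lam_sum ME tE EF Fx; have sF : surface_faces M F by split => //; exists E.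
transitivity (\sum_(i | P E i \in pg_nodes F) ell E x (P E i) *: disp x); last by rewrite -scaler_suml s1 scale1r.
apply: eq_bigr => i Ni; rewrite (_ : `[< _ >] = true); last first.
  by apply/asboolP; apply: (mesh_F3 HM sF); exact: set_mem.
(* All nodes of a surface face are joined by surface edges and the coordinates sum to one, so every
   foot is [x]. *)
congr (_ *: disp _); transitivity (P E i + \sum_(j | P E j \in pg_nodes F) (ell E x (P E j) *: P E j - ell E x (P E j) *: P E i)).
  congr (_ + _); apply: eq_bigr => j Nj; rewrite -scalerBr (_ : `[< _ >] = true) //; apply/asboolP.
  have [->|ij] := eqVneq i j.
    move=> z /segptP[t [_ ->]]; rewrite segptE subrr scaler0 addr0; apply: FS; apply: (node_in pF); exact: set_mem.
  move=> z hz; apply: FS; exact: edge_sub (face_segment ME tE EF Ni Nj ij) _ hz.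
by rewrite sumrB s2 -scaler_suml s1 scale1r addrC subrK.
Qed.

Lemma tW_zero E F x : M E -> is_tetrahedron E -> ph_faces E F -> (forall e, pg_edges F e -> ~ e `<=` S) -> pg_set F x -> tW E x = 0.
Proof.
move=> ME tE EF nS Fx; rewrite (tW_trace ME tE EF Fx); apply: big1 => i Ni; case: asboolP => // Gi.
rewrite big1 ?addr0 ?(disp_Gam T) ?scaler0 // => j Nj; case: asboolP => // hS.
have [->|ij] := eqVneq i j; first by rewrite subrr scaler0.
by case: (nS _ (face_segment ME tE EF Ni Nj ij)).
Qed.

End Tets.
End Data.

(** * Piecewise Lipschitz fields *)

Section Piecewise.
Context {R : realType}.
Implicit Types (K A : set (pt R)) (f g : pt R -> pt R) (L : R).

(** Weaker than a Lipschitz bound on [K], which is not convex; in exchange it passes to finite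
    unions with the same constant and survives homogeneous extension. *)
Definition pwlip K f L := exists P : set (set (pt R)), [/\ finite_set P,
  forall A, P A -> [/\ compact A, A `<=` K & forall x y, A x -> A y -> enorm (f x - f y) <= L * enorm (x - y)]
  & K `<=` \bigcup_(A in P) A].

Lemma pwlip_le K f L L' : L <= L' -> pwlip K f L -> pwlip K f L'.
Proof.
move=> LL [P [fP hP KP]]; exists P; split => // A PA; have [cA AK hA] := hP A PA; split => // x y Ax Ay.
by apply: (le_trans (hA x y Ax Ay)); rewrite ler_wpM2r ?enorm_ge0.
Qed.

Lemma pwlip_eq K f g L : (forall x, K x -> f x = g x) -> pwlip K f L -> pwlip K g L.
Proof.
move=> fg [P [fP hP KP]]; exists P; split => // A PA; have [cA AK hA] := hP A PA; split => // x y Ax Ay.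
by rewrite -!fg ?hA //; exact: AK.
Qed.

Lemma pwlip1 K f L : compact K -> (forall x y, K x -> K y -> enorm (f x - f y) <= L * enorm (x - y)) -> pwlip K f L.
Proof.
move=> cK hf; exists [set K]; split; first exact: finite_set1.
  by move=> A ->; split.
by move=> x Kx; exists K.
Qed.

Lemma pwlip_bigcup I (J : set I) (K : I -> set (pt R)) f L : finite_set J -> (forall i, J i -> pwlip (K i) f L) ->
  pwlip (\bigcup_(i in J) K i) f L.
Proof.
move=> fJ hK; have /choice[P hP] : forall i, exists P : set (set (pt R)), J i -> [/\ finite_set P,
  forall A, P A -> [/\ compact A, A `<=` K i & forall x y, A x -> A y -> enorm (f x - f y) <= L * enorm (x - y)]
  & K i `<=` \bigcup_(A in P) A].
  by move=> i; have [/hK[P hP]|nJ] := pselect (J i); [exists P | exists set0].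
exists (\bigcup_(i in J) P i); split.
- by apply: bigcup_finite => // i /hP[].
- move=> A [i Ji PA]; have [_ /(_ A PA)[cA AK hA] _] := hP i Ji; split => // x Ax; exists i => //; exact: AK.
- move=> x [i Ji Kx]; have [_ _ /(_ x Kx)[A PA Ax]] := hP i Ji; by exists A => //; exists i.
Qed.

Lemma pwlip_cone H K c r D f L N : star H K c r D -> bd H K !=set0 -> 0 <= L -> 0 <= N ->
  pwlip (bd H K) f L -> (forall x, bd H K x -> enorm (f x) <= N) -> pwlip K (cext K c f) (L * (1 + D / r) + N / r).
Proof.
move=> S b0 L0 N0 [P [fP hP KP]] hN.
have cK A : A `<=` bd H K -> cone c A `<=` K.
  move=> Ab z [t [a [/andP[t0 t1] /Ab ba ->]]].
  have -> : segpt c a t = segpt a c (1 - t) by apply/rowP => i; rewrite !mxE; ring.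
  apply: (st_star S); [exact: st_c S | by rewrite subrr enorm0 ltW // (st_r S) | by case: ba | by rewrite subr_ge0 t1 lerBlDr lerDl].
exists [set cone c A | A in P]; split.
- exact: finite_image.
- move=> _ [A PA <-]; have [cA AK hA] := hP A PA; split.
  + by apply: subclosed_compact (cK _ AK); [exact: cone_closed | exact: st_compact S].
  + exact: cK.
  + by apply: (cone_lip S AK L0 N0 hA) => x /AK; exact: hN.
- move=> x Kx; have [a ba [t [b [t01 -> ->]]]] := cone_cover S b0 Kx.
  have [A PA Aa] := KP a ba; exists (cone c A); first by exists A.
  by exists t, a.
Qed.

(** The closed pieces cover the parameter interval, and [pw_lip1] is applied to the scalar component
    of [f] along [f y - f x], which avoids any loss from comparing norms. *)
Lemma pwlip_seg K f L x y : pwlip K f L -> (forall t, 0 <= t <= 1 -> K (segpt x y t)) -> enorm (f x - f y) <= L * enorm (x - y).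
Proof.
move=> [P [fP hP KP]] hK; have [n [A eP]] := fin_enum fP.
pose u := f y - f x; pose g (t : R) : R := dot u (f (segpt x y t)).
have [fxy|fxy] := eqVneq u 0.
  have [A0 PA0 A0x] : (\bigcup_(A in P) A) (segpt x y 0) by apply: KP; apply: hK; rewrite lexx ler01.
  have [_ _ /(_ _ _ A0x A0x)] := hP _ PA0; rewrite !subrr !enorm0 mulr0 => _.
  rewrite -enormN opprB -/u fxy enorm0.
  have [->|xy] := eqVneq x y; first by rewrite subrr enorm0 mulr0.
  have [n0|n0] := lerP 0 L; first by rewrite mulr_ge0 ?enorm_ge0.
  (* For [L < 0] every piece contains at most one point of the segment, so [n] pieces cannot contain
     [n + 1] equidistant points. *)
  exfalso.
  have hA i s t : A i (segpt x y s) -> A i (segpt x y t) -> s = t.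
    move=> As At; have PA : P (A i) by rewrite eP; exists i.
    have [_ _ /(_ _ _ As At)] := hP _ PA; rewrite segpt_dist => h1.
    have h2 := le_trans (enorm_ge0 _) h1; apply/eqP; rewrite -subr_eq0 -normr_eq0.
    have xy0 : 0 < enorm (x - y) by rewrite enorm_gt0 subr_eq0.
    by move: h2; rewrite nmulr_rge0 // pmulr_lle0 // normr_le0 normr_eq0.
  have /choice[I hI] : forall s : 'I_n.+1, exists i, A i (segpt x y (s%:R / n.+1%:R)).
    move=> s; have [B] : (\bigcup_(A in P) A) (segpt x y (s%:R / n.+1%:R)).
      by apply/KP/hK; rewrite divr_ge0 //= ler_pdivrMr ?ltr0n // mul1r ler_nat ltnW.
    by rewrite eP => -[i _ <-] Bi; exists i.
  have inj : injective I.
    move=> s t e; have := hI t; rewrite -e => ht; have := hA _ _ _ (hI s) ht.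
    move/(congr1 ( *%R^~ n.+1%:R)); rewrite /= !divfK ?pnatr_eq0 // => /eqP; rewrite eqr_nat => /eqP; exact: val_inj.
  by have := leq_card I inj; rewrite !card_ord ltnn.
have u0 : 0 < enorm u by rewrite enorm_gt0.
have := @pw_lip1 R R n (fun i => [set t | A i (segpt x y t)]) g (enorm u * (L * enorm (x - y))) 0 1 ler01 _ _ _.
rewrite subr0 mulr1 /g segpt1 segpt0 -dotNr -dotDr -enorm2 expr2.
have cl i : closed [set t | A i (segpt x y t)].
  have PA : P (A i) by rewrite eP; exists i.
  have [/compactE[cA _] _ _] := hP _ PA; exact: (closed_comp (fun t _ => @segpt_cont R x y t) cA).
move=> /(_ cl) h1; rewrite -(ler_pM2l u0) enormB.
apply: le_trans (h1 _ _); first exact: ler_norm.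
- move=> t t01; have [B] := KP _ (hK t t01); rewrite eP => -[i _ <-] Bi; by exists i.
- move=> i s t _ _ As At; have PA : P (A i) by rewrite eP; exists i.
  have [_ _ /(_ _ _ As At)] := hP _ PA; rewrite segpt_dist => h2.
  rewrite -dotNr -dotDr; apply: (le_trans (dot_abs _ _)); rewrite -mulrA ler_pM2l //.
  by apply: (le_trans h2); rewrite mulrCA mulrC -mulrA.
Qed.

End Piecewise.

(** * Extension from edges to faces and from faces to elements *)

Section Build.
Context {R : realType} (Om : set (pt R)) (R0 : R) (T : tube Om R0).
Variables (gam gam2 h : R) (M : set (polyhedron R)).
Hypotheses (g0 : 0 < gam) (h0 : 0 < h) (hs : h <= R0 / 200).
Hypothesis (hk : Cflat gam R0 * h * (Kgap gam + kap gam) <= 1).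
Hypothesis HM : bulk_surface_mesh Om h gam gam2 M.
Implicit Types (F G : polygon R) (E : polyhedron R) (x y z p q : pt R).
Notation Gam := (frontier Om).
Notation dm := (fun F => diam (pg_set F)).
Notation dE := (fun E => diam (ph_set E)).
Notation disp := (disp Om).
Notation S := (surface M).
Notation wedge := (wedge Om M).
Variables (P Mx : polyhedron R -> 'I_4 -> pt R) (cc : polyhedron R -> 'I_4 -> R).
Hypothesis HP : forall E, M E -> is_tetrahedron E -> bary E (P E) (Mx E) (cc E).
Notation tW := (tW Om M P Mx cc).

(** Loss in one homogeneous extension of data that are [L]-Lipschitz and bounded by [L * D], when
    the inner radius is [gam * D]. *)
Definition kk := 1 + 2 * gam^-1.
Definition L2 := L1 R0 gam h * kk + Lt R0 gam h.
Definition L3 := L2 * kk.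

Lemma kk_ge1 : 1 <= kk.
Proof. by rewrite lerDl mulr_ge0 // invr_ge0 ltW. Qed.
Lemma Lt_gt0 : 0 < Lt R0 gam h.
Proof. apply: mulr_gt0; last exact: h0. apply: divr_gt0; first by rewrite ltr0n. by apply: mulr_gt0; [exact: g0 | exact: (tb_pos T)]. Qed.
Lemma L1_L2 : L1 R0 gam h * kk <= L2.
Proof. by rewrite lerDl ltW // Lt_gt0. Qed.
Lemma L1k : L1 R0 gam h <= L1 R0 gam h * kk.
Proof. by rewrite ler_peMr ?kk_ge1 // ltW // (L1_gt0 T). Qed.
Lemma Lt_L2 : Lt R0 gam h <= L2.
Proof. by rewrite lerDr mulr_ge0 // ?ltW ?(L1_gt0 T) // (lt_le_trans ltr01 kk_ge1). Qed.
Lemma L2_gt0 : 0 < L2.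
Proof. exact: lt_le_trans Lt_gt0 Lt_L2. Qed.
Lemma L2_L3 : L2 <= L3.
Proof. by rewrite ler_peMr ?kk_ge1 // ltW // L2_gt0. Qed.

Lemma cone_const L D : 0 < D -> L * (1 + D / (gam * D)) + L * D / (gam * D) = L * kk.
Proof. by move=> D0; rewrite /kk; field; rewrite !gt_eqF. Qed.

(** The clauses are what the elements on either side need: common edge values, the tetrahedral
    formula as soon as one neighbour is a tetrahedron, the projection on the surface, and zero data
    for elements that are not exterior. *)
Definition face_ok F w := [/\ forall e x, pg_edges F e -> e x -> w x = wedge e x,
  pwlip (pg_set F) w L2, forall x, pg_set F x -> enorm (w x) <= L2 * dm F,
  forall E x, M E -> is_tetrahedron E -> ph_faces E F -> pg_set F x -> w x = tW E x
  & (pg_set F `<=` S -> forall x, pg_set F x -> w x = disp x) /\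
    ((forall e, pg_edges F e -> ~ e `<=` S) -> forall x, pg_set F x -> w x = 0)].

Lemma node_bound F w L : mesh_faces M F -> (forall e x, pg_edges F e -> e x -> w x = wedge e x) -> 0 <= L ->
  (forall x y, pg_set F x -> pg_set F y -> enorm (w x - w y) <= L * enorm (x - y)) -> forall x, pg_set F x -> enorm (w x) <= L * dm F.
Proof.
move=> MF hw L0 hL x Fx; have [p Np] := face_node g0 HM MF; have [pF _] := Mface g0 HM MF.
have [e Fe [ep1 ep2]] := node_edge pF Np; have Me : mesh_edge M e by exists F.
have wp : w p = 0 by rewrite (hw e) // (wedge_end T g0 HM Me).
have := hL x p Fx (node_in pF Np); rewrite wp subr0 => /le_trans; apply.
by apply: ler_wpM2l => //; apply: (face_dist g0 HM MF Fx); exact: node_in.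
Qed.

Lemma edge_agree F e e' x : mesh_faces M F -> pg_edges F e -> pg_edges F e' -> e x -> e' x -> wedge e x = wedge e' x.
Proof.
move=> MF Fe Fe' ex ex'; have [-> //|ne] := pselect (e = e'); have [pF _] := Mface g0 HM MF.
have [Me Me'] : mesh_edge M e /\ mesh_edge M e' by split; exists F.
case: pF => _ [_ [/(_ e e' Fe Fe' ne)+ _]] => -[e0|[p [ep ep' e0]]].
  by have : (e `&` e') x by []; rewrite e0.
have -> : x = p by have : (e `&` e') x by []; rewrite e0.
by rewrite (wedge_end T g0 HM Me) // (wedge_end T g0 HM Me').
Qed.

(** Priorities: a tetrahedral neighbour dictates the values, because its map must stay C^1;
    otherwise a surface face takes the displacement to the boundary; the remaining faces extend
    their edge data homogeneously. *)
Lemma face_data F : mesh_faces M F -> exists w, face_ok F w.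
Proof.
move=> MF; have [pF [H [c0 [n [c [n1 eH S0 hb d0]]]]]] := Mface g0 HM MF.
have cF : compact (pg_set F) := st_compact S0.
have tet_ok E x : M E -> is_tetrahedron E -> ph_faces E F -> pg_set F x -> (pg_set F `<=` S -> tW E x = disp x) /\
    ((forall e, pg_edges F e -> ~ e `<=` S) -> tW E x = 0).
  by move=> ME tE EF Fx; split => hh; [exact: (tW_surface g0 HM HP ME tE EF) | exact: (tW_zero T g0 HM HP ME tE EF)].
have [[E [ME tE EF]]|nt] := pselect (exists E, [/\ M E, is_tetrahedron E & ph_faces E F]).
  have [_ hL] := tW_props T g0 h0 hs HM HP ME tE.
  exists (tW E); split.
  - by move=> e x Fe ex; exact: (tW_edge T g0 HM HP ME tE EF).
  - by apply: (pwlip_le Lt_L2); apply: pwlip1 => // x y _ _; exact: hL.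
  - move=> x Fx; apply: (@le_trans _ _ (Lt R0 gam h * dm F)); last by rewrite ler_wpM2r ?Lt_L2 // ltW.
    apply: (node_bound MF _ (ltW Lt_gt0)) => // e z Fe ez; exact: (tW_edge T g0 HM HP ME tE EF).
  - by move=> E' x ME' tE' EF' Fx; exact: (tW_agree g0 HM HP ME tE EF ME' tE' EF').
  - by split => hh x Fx; have [a1 a2] := tet_ok E x ME tE EF Fx; auto.
have [FS|nFS] := pselect (pg_set F `<=` S).
  have sF : surface_faces M F by [].
  have we e x : pg_edges F e -> e x -> disp x = wedge e x.
    move=> Fe ex; rewrite /wedge; case: asboolP => // nS; case: nS => z ez; apply: FS; exact: edge_sub Fe _ ez.
  have dl := disp_surf_lip T g0 h0 hs hk HM sF.
  have L12 : L1 R0 gam h <= L2 := le_trans L1k L1_L2.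
  exists disp; split => //.
  - by apply: (pwlip_le L12); exact: pwlip1.
  - move=> x Fx; apply: (@le_trans _ _ (L1 R0 gam h * dm F)); last by rewrite ler_wpM2r // ltW.
    by apply: (node_bound MF we) => //; exact/ltW/(L1_gt0 T).
  - by move=> E x ME tE EF; case: nt; exists E.
  - split => // hn; have [p Np] := face_node g0 HM MF; have [e Fe _] := Np.
    by case: (hn e Fe) => z ez; apply: FS; exact: edge_sub Fe _ ez.
have /choice[f hf] : forall x, exists v, forall e, pg_edges F e -> e x -> v = wedge e x.
  move=> x; have [[e Fe ex]|ne] := pselect (exists2 e, pg_edges F e & e x).
    by exists (wedge e x) => e' Fe' ex'; exact: (edge_agree MF).
  by exists 0 => e Fe ex; case: ne; exists e.
have bE e x : pg_edges F e -> e x -> bd H (pg_set F) x by move=> Fe ex; rewrite hb; exists e.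
have [p Np] := face_node g0 HM MF; have [e0 Fe0 [_ ep0]] := node_edge pF Np.
have b0 : bd H (pg_set F) !=set0 by exists p; exact: bE ep0.
have fN x : bd H (pg_set F) x -> enorm (f x) <= L1 R0 gam h * dm F.
  rewrite hb => -[e Fe ex]; rewrite (hf x e Fe ex); have [q1 [q2 [q12 ee N1 _]]] := edge_nodes pF Fe.
  have Me : mesh_edge M e by exists F.
  have eq1 : e q1 by rewrite ee; exact: segment_l.
  have w0 : wedge e q1 = 0 by apply: (wedge_end T g0 HM Me); exists q2.
  have := wedge_lip T g0 h0 hs hk HM Me ex eq1; rewrite w0 subr0 => /le_trans; apply.
  apply: ler_wpM2l; first exact/ltW/(L1_gt0 T).
  by apply: (face_dist g0 HM MF); apply: (edge_sub pF Fe).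
have L10 := ltW (L1_gt0 T g0 h0).
have pb : pwlip (bd H (pg_set F)) f (L1 R0 gam h).
  rewrite hb; apply: pwlip_bigcup => [|e Fe]; first by case: pF.
  apply: pwlip1 => [|x y ex ey]; first exact: edge_compact Fe.
  rewrite (hf x e Fe ex) (hf y e Fe ey); apply: (wedge_lip T g0 h0 hs hk HM) => //; by exists F.
exists (cext (pg_set F) c f); split.
- by move=> e x Fe ex; rewrite (cext_bd S0) ?(hf x e Fe ex) //; exact: bE ex.
- apply: (pwlip_le L1_L2); rewrite -(cone_const _ d0); apply: (pwlip_cone S0) => //.
  by rewrite mulr_ge0 // ltW.
- move=> x Fx; apply: (@le_trans _ _ (L1 R0 gam h * dm F)); last by rewrite ler_wpM2r ?(ltW d0) // (le_trans L1k L1_L2).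
  by apply: (cext_bound S0) => //; rewrite mulr_ge0 // ltW.
- by move=> E x ME tE EF; case: nt; exists E.
- split => // hn x Fx; apply/eqP; rewrite -enorm_eq0 eq_le enorm_ge0 andbT; apply: (cext_bound S0) => // y.
  rewrite hb => -[e Fe ey]; rewrite (hf y e Fe ey) /wedge; case: asboolP; last by rewrite enorm0.
  by move/(hn e Fe).
Qed.

Variable wF : polygon R -> pt R -> pt R.
Hypothesis hwF : forall F, mesh_faces M F -> face_ok F (wF F).

Lemma wF_node F p : mesh_faces M F -> pg_nodes F p -> wF F p = 0.
Proof.
move=> MF Np; have [pF _] := Mface g0 HM MF; have [e Fe [ep1 ep2]] := node_edge pF Np.
have [he _ _ _ _] := hwF MF; rewrite (he e p Fe ep2); apply: (wedge_end T g0 HM) => //; by exists F.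
Qed.

Lemma wF_agree F F' x : mesh_faces M F -> mesh_faces M F' -> pg_set F x -> pg_set F' x -> wF F x = wF F' x.
Proof.
move=> MF MF' Fx Fx'; have [-> //|ne] := pselect (F = F').
have xx : (pg_set F `&` pg_set F') x by [].
case: ((mesh_F2 HM).2 _ _ MF MF' ne) => [e0|[p [Np Np' e0]]|[e [Fe Fe' e0]]]; rewrite e0 in xx => //.
  by rewrite xx !wF_node.
have [he _ _ _ _] := hwF MF; have [he' _ _ _ _] := hwF MF'.
by rewrite (he e x Fe xx) (he' e x Fe' xx).
Qed.

Definition elem_ok E w := [/\ forall F x, ph_faces E F -> pg_set F x -> w x = wF F x,
  pwlip (ph_set E) w L3, forall x, ph_set E x -> enorm (w x) <= L3 * dE E,
  ~ exterior M E -> forall x, ph_set E x -> w x = 0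
  & is_tetrahedron E -> w = tW E].

Lemma elem_data E : M E -> exists w, elem_ok E w.
Proof.
move=> ME; have [pE [c [S0 hb d0]]] := Melem g0 HM ME.
have MF F : ph_faces E F -> mesh_faces M F by move=> EF; exists E.
have [_ _ _ [_ [z0 Ez0]] [_ hfr]] := pE.
have [p [F0 EF0 Np0]] : exists p, ph_nodes E p by have [p Np _] := polyhedron_max 0 pE Ez0; exists p.
have [pF0 _] := Mface g0 HM (MF _ EF0).
have [tE|nt] := pselect (is_tetrahedron E).
  have [_ hL] := tW_props T g0 h0 hs HM HP ME tE.
  exists (tW E); split => //.
  - by move=> F x EF Fx; have [_ _ _ h3 _] := hwF (MF _ EF); rewrite (h3 E).
  - by apply: (pwlip_le (le_trans Lt_L2 L2_L3)); apply: pwlip1 => //; exact: st_compact S0.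
  - move=> x Ex; have Ep := face_sub HM ME EF0 (node_in pF0 Np0).
    have := hL x p; rewrite (tW_node T g0 HM HP ME tE EF0 Np0) subr0 => /le_trans; apply.
    apply: ler_pM; [exact/ltW/Lt_gt0 | exact: enorm_ge0 | exact: le_trans Lt_L2 L2_L3 | ].
    by apply: diam_ub => //; exact: st_compact S0.
  - by move=> nE x Ex; exact: (tW_nonexterior T).
have /choice[f hf] : forall x, exists v, forall F, ph_faces E F -> pg_set F x -> v = wF F x.
  move=> x; have [[F EF Fx]|nF] := pselect (exists2 F, ph_faces E F & pg_set F x).
    by exists (wF F x) => F' EF' Fx'; apply: wF_agree => //; exact: MF.
  by exists 0 => F EF Fx; case: nF; exists F.
have bE x : bd setT (ph_set E) x -> exists2 F, ph_faces E F & pg_set F x by rewrite hb hfr.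
have b0 : bd setT (ph_set E) !=set0 by exists p; rewrite hb hfr; exists F0 => //; exact: node_in.
have fN x : bd setT (ph_set E) x -> enorm (f x) <= L2 * dE E.
  move=> /bE[F EF Fx]; rewrite (hf x F EF Fx); have [_ _ h2 _ _] := hwF (MF _ EF).
  by apply: (le_trans (h2 x Fx)); rewrite ler_wpM2l ?(face_diam g0 HM) // ltW // L2_gt0.
have L20 := ltW L2_gt0; have N0 : 0 <= L2 * dE E by rewrite mulr_ge0 // ltW.
have pb : pwlip (bd setT (ph_set E)) f L2.
  rewrite hb hfr; apply: pwlip_bigcup => [|F EF]; first by case: pE.
  have [_ h1 _ _ _] := hwF (MF _ EF); apply: pwlip_eq h1 => x Fx; by rewrite (hf x F).
exists (cext (ph_set E) c f); split => //.
- by move=> F x EF Fx; rewrite (cext_bd S0) ?(hf x F) // hb hfr; exists F.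
- by rewrite /L3 -(cone_const _ d0); exact: (pwlip_cone S0).
- move=> x Ex; apply: (@le_trans _ _ (L2 * dE E)); last by rewrite ler_wpM2r ?L2_L3 // ltW.
  exact: (cext_bound S0).
- move=> nE x Ex; apply/eqP; rewrite -enorm_eq0 eq_le enorm_ge0 andbT; apply: (cext_bound S0) => // y /bE[F EF Fy].
  rewrite (hf y F EF Fy); have [_ _ _ _ [_ ->]] := hwF (MF _ EF); rewrite ?enorm0 // => e Fe eS.
  by apply: nE; right; exists e => //; exists F.
Qed.

Variable wE : polyhedron R -> pt R -> pt R.
Hypothesis hwE : forall E, M E -> elem_ok E (wE E).

Lemma wE_agree E E' x : M E -> M E' -> ph_set E x -> ph_set E' x -> wE E x = wE E' x.
Proof.
move=> ME ME' Ex Ex'; have [-> //|ne] := pselect (E = E').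
have xx : (ph_set E `&` ph_set E') x by [].
have [h1 _ _ _ _] := hwE ME; have [h1' _ _ _ _] := hwE ME'.
have MF (G : polyhedron R) F : M G -> ph_faces G F -> mesh_faces M F by move=> MG GF; exists G.
have eF (G : polyhedron R) e F : M G -> ph_faces G F -> pg_edges F e -> e x -> wE G x = wedge e x.
  move=> MG GF Fe ex; have [hg _ _ _ _] := hwE MG; have [pF _] := Mface g0 HM (MF _ _ MG GF).
  rewrite (hg F x GF); last exact: edge_sub Fe _ ex.
  by have [he _ _ _ _] := hwF (MF _ _ MG GF); exact: he.
case: ((mesh_F2 HM).1 _ _ ME ME' ne) => [e0|[p [[F EF Fp] [F' EF' Fp'] e0]]|[e [[F EF Fe] [F' EF' Fe'] e0]]|[F [EF EF' e0]]];
  rewrite e0 in xx => //.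
- have [pF _] := Mface g0 HM (MF _ _ ME EF); have [pF' _] := Mface g0 HM (MF _ _ ME' EF').
  rewrite xx (h1 F p EF) ?(h1' F' p EF'); [|exact: node_in | exact: node_in].
  by rewrite !wF_node //; [exact: MF EF' | exact: MF EF].
- by rewrite (eF E e F) // (eF E' e F').
- by rewrite (h1 F x) // (h1' F x).
Qed.

End Build.

Theorem bulk_field (R : realType) (Om : set (pt R)) (R0 : R) (T : tube Om R0) (gam gam2 h : R) (M : set (polyhedron R)) :
  0 < gam -> 0 < h -> h <= R0 / 200 -> Cflat gam R0 * h * (Kgap gam + kap gam) <= 1 -> bulk_surface_mesh Om h gam gam2 M ->
  exists w : pt R -> pt R, [/\ forall x, surface M x -> w x = disp Om x,
    forall E x, M E -> ~ exterior M E -> ph_set E x -> w x = 0,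
    pwlip (bulk M) w (L3 R0 gam h),
    forall x, bulk M x -> enorm (w x) <= L3 R0 gam h * h
  & forall E, M E -> is_tetrahedron E -> exists W, [/\ forall x, sd W x,
      forall x y, enorm (W x - W y) <= L3 R0 gam h * enorm (x - y) & forall x, ph_set E x -> W x = w x]].
Proof.
move=> g0 h0 hs hk HM.
have /choice[B hB] : forall E, exists pmc : ('I_4 -> pt R) * ('I_4 -> pt R) * ('I_4 -> R), M E -> is_tetrahedron E ->
    bary E pmc.1.1 pmc.1.2 pmc.2.
  move=> E; have [[ME tE]|n] := pselect (M E /\ is_tetrahedron E).
    by have [p [m [c hb]]] := bary_ex (mesh_polyhedra HM ME) tE; exists (p, m, c).
  by exists (fun=> 0, fun=> 0, fun=> 0) => ME tE; case: n.
pose P E := (B E).1.1; pose Mx E := (B E).1.2; pose cc E := (B E).2.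
have HP E : M E -> is_tetrahedron E -> bary E (P E) (Mx E) (cc E) by exact: hB.
have /choice[wF hwF] : forall F, exists w, mesh_faces M F -> face_ok Om R0 gam h M P Mx cc F w.
  move=> F; have [MF|n] := pselect (mesh_faces M F); last by exists (fun=> 0).
  by have [w hw] := face_data T g0 h0 hs hk HM HP MF; exists w.
have /choice[wE hwE] : forall E, exists w, M E -> elem_ok Om R0 gam h M P Mx cc wF E w.
  move=> E; have [ME|n] := pselect (M E); last by exists (fun=> 0).
  by have [w hw] := elem_data T g0 h0 hs HM HP hwF ME; exists w.
have /choice[w hw] : forall x, exists v, forall E, M E -> ph_set E x -> v = wE E x.
  move=> x; have [[E ME Ex]|n] := pselect (bulk M x); last by exists 0 => E ME Ex; case: n; exists E.
  by exists (wE E x) => E' ME' Ex'; exact: (wE_agree T g0 HM hwF hwE).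
have L30 : 0 <= L3 R0 gam h := le_trans (ltW (L2_gt0 T g0 h0)) (L2_L3 T g0 h0).
exists w; split.
- move=> x /(surfaceP HM)[F sF Fx]; have [E ME EF] := sF.1; have Ex := face_sub HM ME EF Fx.
  have [h1 _ _ _ _] := hwE E ME; have [_ _ _ _ [h2 _]] := hwF F sF.1.
  by rewrite (hw x E ME Ex) (h1 F x EF Fx) (h2 sF.2 x Fx).
- by move=> E x ME nE Ex; have [_ _ _ h1 _] := hwE E ME; rewrite (hw x E ME Ex) h1.
- apply: pwlip_bigcup => [|E ME]; first exact: mesh_finite HM.
  by have [_ h1 _ _ _] := hwE E ME; apply: pwlip_eq h1 => x Ex; rewrite (hw x E).
- move=> x [E ME Ex]; have [_ _ h1 _ _] := hwE E ME; rewrite (hw x E ME Ex) (le_trans (h1 x Ex)) //.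
  by rewrite ler_wpM2l // (mesh_F1 HM).
- move=> E ME tE; exists (tW Om M P Mx cc E); have [hsd hL] := tW_props T g0 h0 hs HM HP ME tE; split => //.
    move=> x y; apply: (le_trans (hL x y)); rewrite ler_wpM2r ?enorm_ge0 //.
    exact: le_trans (Lt_L2 T g0 h0) (L2_L3 T g0 h0).
  by move=> x Ex; have [_ _ _ _ h1] := hwE E ME; rewrite (hw x E ME Ex) h1.
Qed.

(** * The global parametrization *)

Lemma eelip_continuous (R : realType) (f : pt R -> pt R) K : (forall x y, enorm (f x - f y) <= K * enorm (x - y)) -> continuous f.
Proof. by move=> hf; apply: (@elip_continuous _ _ _ K) => x y; exact: le_trans (norm_le_enorm _) (hf x y). Qed.

Lemma sdiff_lip_bound (R : realType) (f L : pt R -> pt R) x K : sdiff f x L ->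
  (forall y z, enorm (f y - f z) <= K * enorm (y - z)) -> forall v, enorm (L v) <= K * enorm v.
Proof.
move=> fL hK v; have lL : linear L by case: fL.
have [v0|vp] := eqVneq (enorm v) 0.
  by move/eqP: v0; rewrite enorm_eq0 => /eqP ->; rewrite (lin0 lL) enorm0 mulr0.
have {}vp : 0 < enorm v by rewrite lt_neqAle eq_sym vp enorm_ge0.
apply/ler_addgt0Pr => e e0; have [d d0 hd] := enorm_sdiff fL (divr_gt0 e0 vp).
pose t := d / (2 * enorm v); have t0 : 0 < t by rewrite divr_gt0 // mulr_gt0.
have tv : enorm (t *: v) = d / 2 by rewrite enormZ gtr0_norm // /t; field; rewrite gt_eqF.
have := hd (x + t *: v) x; rewrite [x + _]addrC addrK tv subrr enorm0 => /(_ _ d0) h1.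
have {}h1 : enorm (f (t *: v + x) - f x - L (t *: v)) <= e / enorm v * (d / 2).
  by apply: h1; rewrite ltr_pdivrMr // mulr_natr mulr2n ltrDl.
have h2 := hK (t *: v + x) x; rewrite addrK tv in h2.
have h3 : enorm (L (t *: v)) <= (K + e / enorm v) * (d / 2).
  rewrite mulrDl; apply: (le_trans _ (lerD h2 h1)).
  have := ler_enormB (f (t *: v + x) - f x) (f (t *: v + x) - f x - L (t *: v)).
  by rewrite opprB addrC subrK.
rewrite -tv enormZ in h3; have lZ : L (t *: v) = t *: L v by rewrite -[t *: v]addr0 lL (lin0 lL) addr0.
rewrite lZ enormZ gtr0_norm // mulrCA ler_pM2l // mulrDl divfK ?gt_eqF // in h3.
Qed.

(** The identity [Q + W \o Q = id] linearises to [(Id + dW) dQ = dy], an instance of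
    [sd_implicit]. *)
Lemma inverse_sd (R : realType) (W Q : pt R -> pt R) : (forall x, sd W x) ->
  (forall x y, enorm (W x - W y) <= 1 / 4 * enorm (x - y)) ->
  (forall y, Q y + W (Q y) = y) -> (forall x y, enorm (Q x - Q y) <= 2 * enorm (x - y)) -> forall y, sd Q y.
Proof.
move=> sW W4 QW Q2 y0; have [L hL] := sW (Q y0); have lL : linear L by case: (hL).
apply: (@sd_implicit R Q L id y0 lL).
- exact: sdiff_lip_bound hL W4.
- by [].
- by exists 1 => v; rewrite mul1r.
- move=> e e0; have [d d0 hd] := enorm_sdiff hL (divr_gt0 e0 (ltr0n R 2)).
  exists (d / 2); first exact: divr_gt0.
  move=> x y hx hy.
  have near z : enorm (z - y0) < d / 2 -> enorm (Q z - Q y0) < d.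
    by move=> hz; apply: (le_lt_trans (Q2 _ _)); rewrite mulrC -ltr_pdivlMr.
  have -> : Q x - Q y + L (Q x - Q y) - (x - y) = - (W (Q x) - W (Q y) - L (Q x - Q y)).
    have -> : x - y = Q x - Q y + (W (Q x) - W (Q y)) by rewrite -{1}(QW x) -{1}(QW y) opprD addrACA.
    by move: (W (Q x) - W (Q y)) (L (Q x - Q y)) (Q x - Q y) => b l a; apply/rowP => i; rewrite !mxE; ring.
  rewrite enormN; apply: (le_trans (hd _ _ (near _ hx) (near _ hy))).
  by apply: (le_trans (ler_wpM2l _ (Q2 _ _))); [rewrite divr_ge0 // ltW | rewrite mulrA divfK].
Qed.

Section Global.
Context {R : realType} (Om : set (pt R)) (R0 : R) (T : tube Om R0).
Variables (gam gam2 h : R) (M : set (polyhedron R)).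
Hypotheses (g0 : 0 < gam) (h0 : 0 < h) (hs : h <= R0 / 200).
Hypothesis (hk : Cflat gam R0 * h * (Kgap gam + kap gam) <= 1).
Hypothesis HM : bulk_surface_mesh Om h gam gam2 M.
Implicit Types (F G : polygon R) (E : polyhedron R) (x y z p q : pt R).
Notation Gam := (frontier Om).
Notation od := (oriented_distance Om).
Notation nu := (normal Om).
Notation A := (normal_projection Om).
Notation disp := (disp Om).
Notation S := (surface M).
Notation L3 := (L3 R0 gam h).
Let r0 := tb_pos T.

(** Two end pieces of a chord inside the bulk, plus the Lipschitz constant of [disp] between two
    surface points. *)
Definition L4 := 2 * L3 + (Kod R0 gam * h + 6 / R0 * h).

Lemma L3_gt0 : 0 < L3.
Proof. exact: lt_le_trans (L2_gt0 T g0 h0) (L2_L3 T g0 h0). Qed.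

Lemma L4_ge : 2 * L3 <= L4.
Proof.
rewrite lerDl; apply: addr_ge0; apply: mulr_ge0; rewrite ?(ltW h0) //; first exact/ltW/(Kod_gt0 T).
by rewrite divr_ge0 // ltW.
Qed.

(** Chords longer than [h] use the sup bound, and chords inside the bulk use [pwlip_seg]. Otherwise
    the chord is cut at the first exits from both ends; between these surface points [w] is [disp],
    and [surf_od_lip] applies although the faces may be unrelated. *)
Lemma chord_lip w : (forall x, S x -> w x = disp x) -> pwlip (bulk M) w L3 -> (forall x, bulk M x -> enorm (w x) <= L3 * h) ->
  forall x y, bulk M x -> bulk M y -> enorm (w x - w y) <= L4 * enorm (x - y).
Proof.
move=> wS wp wb x y Bx By; have l3 := L3_gt0; have l4 := L4_ge.
have [xy|xy] := lerP h (enorm (x - y)).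
  apply: (le_trans (ler_enormB _ _)); apply: (le_trans (lerD (wb _ Bx) (wb _ By))).
  rewrite -mulr2n -mulr_natl mulrA; apply: ler_pM => //; last exact: ltW.
  by rewrite mulr_ge0 // ltW.
have [hseg|] := pselect (forall t, 0 <= t <= 1 -> bulk M (segpt x y t)).
  apply: (le_trans (pwlip_seg wp hseg)); rewrite ler_wpM2r ?enorm_ge0 //; apply: le_trans l4.
  by rewrite ler_peMl ?ler1n // ltW.
move=> /existsNP[t0 /not_implyP[/andP[t00 t01] nB]].
have cB := bulk_closed HM.
have Bx0 : bulk M (segpt x y 0) by rewrite segpt0.
have [s [/andP[s0 st] hs1 frs _]] := first_exit cB (@segpt_cont _ x y) t00 Bx0 nB.
have nB' : ~ bulk M (segpt y x (1 - t0)).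
  by have -> : segpt y x (1 - t0) = segpt x y t0 by apply/rowP => i; rewrite !mxE; ring.
have By0 : bulk M (segpt y x 0) by rewrite segpt0.
have t01' : 0 <= 1 - t0 by rewrite subr_ge0.
have [s' [/andP[s0' st'] hs1' frs' _]] := first_exit cB (@segpt_cont _ y x) t01' By0 nB'.
set x' := segpt x y s in frs; set y' := segpt y x s' in frs'.
have ey' : y' = segpt x y (1 - s') by apply/rowP => i; rewrite !mxE; ring.
have ss' : s <= 1 - s' by move: st st'; lra.
have d1 : enorm (x - x') = s * enorm (x - y) by rewrite enormB segpt_distl.
have d2 : enorm (x' - y') = (1 - s' - s) * enorm (x - y).
  by rewrite ey' segpt_dist distrC ger0_norm // subr_ge0.
have d3 : enorm (y - y') = s' * enorm (x - y) by rewrite enormB segpt_distl // (enormB y).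
have e1 : enorm (w x - w x') <= L3 * enorm (x - x').
  apply: (pwlip_seg wp) => t /andP[ta tb].
  have -> : segpt x x' t = segpt x y (t * s) by rewrite [LHS]segptE segptE /x' segptE [X in _ *: X]addrC addKr scalerA.
  by apply: hs1; rewrite mulr_ge0 //= ler_piMl.
have e3 : enorm (w y' - w y) <= L3 * enorm (y - y').
  rewrite enormB; apply: (pwlip_seg wp) => t /andP[ta tb].
  have -> : segpt y y' t = segpt y x (t * s') by rewrite [LHS]segptE segptE /y' segptE [X in _ *: X]addrC addKr scalerA.
  by apply: hs1'; rewrite mulr_ge0 //= ler_piMl.
have e2 : enorm (w x' - w y') <= (Kod R0 gam * h + 6 / R0 * h) * enorm (x' - y').
  have ox := surf_small T g0 HM frs; have oy := surf_small T g0 HM frs'.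
  have xy' : enorm (x' - y') <= h.
    rewrite d2; apply: le_trans (ltW xy); rewrite ler_piMl ?enorm_ge0 //; lra.
  rewrite (wS _ frs) (wS _ frs'); apply: (le_trans (disp_lip T (norm_half T hs ox) (norm_half T hs oy))).
  rewrite [leRHS]mulrDl; apply: lerD; first exact: (surf_od_lip T g0 h0 hs hk HM).
  have -> : 6 / R0 * h * enorm (x' - y') = h * (6 / R0 * enorm (x' - y')) by ring.
  by apply: ler_wpM2r => //; rewrite mulr_ge0 ?enorm_ge0 // divr_ge0 // ltW.
have Kp : 0 <= Kod R0 gam * h + 6 / R0 * h.
  apply: addr_ge0; apply: mulr_ge0; rewrite ?(ltW h0) //; first exact/ltW/(Kod_gt0 T).
  by rewrite divr_ge0 // ltW.
apply: (le_trans (enorm_triangle (w x') _ _)).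
apply: (le_trans (lerD e1 (enorm_triangle (w y') _ _))); apply: (le_trans (lerD (lexx _) (lerD e2 e3))).
rewrite d1 d2 d3 /L4; have := enorm_ge0 (x - y); move: l3 Kp s0 s0' ss'.
move: (enorm _) (Kod R0 gam * h + 6 / R0 * h) L3 => e K L l3 Kp s0 s0' ss' ee.
have a1 : L * (s * e) <= L * e by rewrite ler_pM2l // ler_piMl //; lra.
have a2 : L * (s' * e) <= L * e by rewrite ler_pM2l // ler_piMl //; lra.
have a3 : K * ((1 - s' - s) * e) <= K * e by apply: ler_wpM2l => //; rewrite ler_piMl //; lra.
have -> : (2 * L + K) * e = 2 * (L * e) + K * e by ring.
move: a1 a2 a3; move: (L * (s * e)) (L * (s' * e)) (K * ((1 - s' - s) * e)) (L * e) (K * e) => *; lra.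
Qed.

Lemma out_far z : h < od z -> ~ bulk M z.
Proof.
move=> hz; have hp := lt_trans h0 hz.
have hr : h < rdist Om z by rewrite (trdist T) gtr0_norm.
move=> /(bulk_far T g0 h0 HM hr)/od_in; rewrite (trdist T) gtr0_norm // => e.
by move: hp e; move: (od z) => a hp e; lra.
Qed.

Lemma in_far z : od z < - h -> bulk M z.
Proof.
move=> hz; have hn : od z < 0 by apply: (lt_trans hz); rewrite oppr_lt0.
have hr : h < rdist Om z by rewrite (trdist T) ltr0_norm // ltrNr.
apply/(bulk_far T g0 h0 HM hr); apply: contrapT => /od_out; rewrite (trdist T) => e.
by move: hn; rewrite e ltNge normr_ge0.
Qed.

Hypothesis (h8 : 8 * L4 <= 1).

(** [Q] is the inverse of [Id + w] on the whole space and bends each normal fibre. Since surface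
    points are sent to their projections, a bent fibre meets the surface only at parameter 0
    ([hit]), and its ends at height [3 h] and depth [3 h] are known to lie outside and inside the
    bulk. *)
Lemma image w Q : (forall x, S x -> w x = disp x) -> (forall x y, enorm (w x - w y) <= 2 * L4 * enorm (x - y)) ->
  (forall x, enorm (w x) <= h) -> (forall x, Q (x + w x) = x) -> (forall y, Q y + w (Q y) = y) ->
  (forall x y, enorm (Q x - Q y) <= 2 * enorm (x - y)) ->
  (forall x, bulk M x -> closure Om (x + w x)) /\ (forall y, closure Om y -> bulk M (Q y)).
Proof.
move=> wS wL wh wQ Qw QL.
have cB := bulk_closed HM.
have h3 : 3 * h <= R0 / 2 by move: hs r0; lra.
have oQ y : `|od (Q y) - od y| <= h.
  apply: (le_trans (tod_lip T _ _)); rewrite -[X in Q y - X]Qw opprD addrA subrr add0r enormN; exact: wh.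
have cQ : continuous Q by exact: (eelip_continuous QL).
have hit p t : Gam p -> `|t| <= R0 / 2 -> S (Q (p + t *: nu p)) -> t = 0.
  move=> Gp ht sx; have := Qw (p + t *: nu p); rewrite (wS _ sx) /disp addrC subrK => e.
  by have := fiber_od T Gp ht; rewrite -e (tod0 T (tGam T _)).
have cray p : continuous (fun t : R => Q (p + t *: nu p)).
  by move=> t; apply: continuous_comp; [exact: ray_cont | exact: cQ].
(* A point of the bulk sent outside would start a bent fibre in the bulk at positive height; going
   up it must leave the bulk, contradicting [hit]. *)
have up x : bulk M x -> closure Om (x + w x).
  move=> Bx; apply: contrapT => nc; set y := x + w x in nc.
  have Qy : Q y = x := wQ x; have Ay := tA T y.
  have oy : 0 < od y.
    have no : ~ Om y by move=> Oy; apply: nc; exact: subset_closure.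
    have e : 0 <= od y by rewrite (od_out no) (trdist T).
    rewrite lt_neqAle e andbT; apply/eqP => e0.
    have e1 : A y = y by rewrite [RHS]Ay -e0 scale0r addr0.
    by apply: nc; move: (tGam T y); rewrite e1 => /(GamP (tb_open T))[].
  have [q3|q3] := lerP (od y) (2 * h); last first.
    have := oQ y; rewrite Qy ler_norml => /andP[a _]; apply: (@out_far x) => //; move: a q3; move: (od x) (od y) => *; lra.
  have Gp := tGam T y.
  have [| | |t [/andP[t1 t2] _ fr _]] := @first_exit R (bulk M) (fun t : R => Q (A y + t *: nu (A y))) (od y) (3 * h) cB (cray _) _.
  - by move: q3 h0; lra.
  - by rewrite -Ay Qy.
  - have th : `|3 * h| <= R0 / 2 by rewrite ger0_norm // mulr_ge0 // ltW.
    apply: out_far; have := oQ (A y + (3 * h) *: nu (A y)); rewrite (fiber_od T Gp th) ler_norml => /andP[a _].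
    by move: a h0; move: (od _) => *; lra.
  have tp : 0 < t by exact: lt_le_trans t1.
  have := hit _ t Gp _ fr; rewrite gtr0_norm // => e; move: tp; rewrite e ?ltxx //; move: t2 h3; lra.
(* Conversely, interior points [z] approximate [y]; the bent fibre through [z] rises from depth
   [3 h], inside the bulk, and cannot leave it before height 0. *)
split => // y cy; apply: (bulk_closed HM); apply/closureE => e e0.
have /closureE/(_ _ (divr_gt0 e0 (ltr0n R 2)))[z Oz zy] := cy.
exists (Q z); last by apply: (le_lt_trans (QL _ _)); rewrite mulrC -ltr_pdivlMr.
apply: contrapT => nB; have Az := tA T z; have Gp := tGam T z.
have oz : od z < 0.
  have e1 : od z <= 0 by rewrite (od_in Oz) (trdist T) oppr_le0.
  rewrite lt_neqAle e1 andbT; apply/eqP => e2.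
  have e3 : A z = z by rewrite [RHS]Az e2 scale0r addr0.
  by have := Gp; rewrite e3 => /(GamP (tb_open T))[_]; apply.
have [q3|q3] := ltrP (od z) (- (2 * h)).
  apply: nB; apply: in_far; have := oQ z; rewrite ler_norml => /andP[_ a]; move: a q3; move: (od _) (od _) => *; lra.
have [| | |t [/andP[t1 t2] _ fr _]] := @first_exit R (bulk M) (fun t : R => Q (A z + t *: nu (A z))) (- (3 * h)) (od z) cB (cray _) _.
- by apply: le_trans q3; rewrite lerN2 ler_pM2r // ler_nat.
- have th : `|- (3 * h)| <= R0 / 2 by rewrite normrN ger0_norm // mulr_ge0 // ltW.
  apply: in_far; have := oQ (A z + (- (3 * h)) *: nu (A z)); rewrite (fiber_od T Gp th) ler_norml => /andP[_ a].
  by move: a h0; move: (od _) => *; lra.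
- by rewrite -Az.
have tp : t < 0 by exact: lt_trans t2 oz.
have := hit _ t Gp _ fr; rewrite ltr0_norm // => e1; move: tp; rewrite e1 ?ltxx //; move: t1 h3; lra.
Qed.

Theorem global_map : exists w : pt R -> pt R,
  [/\ forall x y, enorm (w x - w y) <= 2 * L4 * enorm (x - y), forall x, enorm (w x) <= L4 * h,
   homeomorphism_on (bulk M) (closure Om) (fun x => x + w x),
   (forall x, S x -> x + w x = A x) /\ (forall E x, M E -> ~ exterior M E -> ph_set E x -> w x = 0)
 & forall E, M E -> is_tetrahedron E -> diffeomorphism_on (ph_set E) (fun x => x + w x)].
Proof.
have [w0 [wS wE wp wb wT]] := bulk_field T g0 h0 hs hk HM.
have l3 := L3_gt0; have l4 := L4_ge; have l4p : 0 < L4 by apply: lt_le_trans l4; rewrite mulr_gt0.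
(* Extension from the bulk to the whole space, where [Id + w] is inverted globally. *)
have [w [ww wL wN]] := mcshane_vec (ltW l4p) (mulr_ge0 (ltW l3) (ltW h0)) (chord_lip wS wp wb) wb.
have wh x : enorm (w x) <= L4 * h by apply: (le_trans (wN x)); rewrite mulrA ler_wpM2r // ltW.
have L4h : L4 * h <= h by rewrite ler_piMl ?(ltW h0) //; move: h8 l4p; lra.
have w4 x y : enorm (w x - w y) <= 1 / 4 * enorm (x - y).
  by apply: (le_trans (wL x y)); rewrite ler_wpM2r ?enorm_ge0 //; move: h8; lra.
have [Q [wQ Qw QL]] := id_plus_lip_bij w4.
have wS' x : S x -> w x = disp x by move=> sx; rewrite ww ?wS //; exact: surface_bulk HM _ sx.
have [im1 im2] := image wS' wL (fun x => le_trans (wh x) L4h) wQ Qw QL.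
exists w; split => //.
- exists Q; split.
  + apply: continuous_subspaceT; apply: (@eelip_continuous _ _ 2) => x y.
    have -> : x + w x - (y + w y) = (x - y) + (w x - w y) by rewrite opprD addrACA.
    apply: (le_trans (ler_enormD _ _)); rewrite mulr_natl mulr2n lerD2l (le_trans (w4 x y)) // ler_piMl ?enorm_ge0 //; lra.
  + apply: continuous_subspaceT; exact: (eelip_continuous QL).
  + by move=> x Bx; split; [exact: im1 | exact: wQ].
  + by move=> y cy; split; [exact: im2 | exact: Qw].
- split => [x sx|E x ME nE Ex]; first by rewrite wS' // /disp addrC subrK.
  by rewrite ww; [exact: wE Ex | exists E].
(* The C^1 formula [W] of the tetrahedron is itself small and defined everywhere, so [Id + W] and
   its global inverse are the two C^1 extensions. *)
- move=> E ME tE; have [W [sW WL WE]] := wT E ME tE.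
  have W4 x y : enorm (W x - W y) <= 1 / 4 * enorm (x - y).
    by apply: (le_trans (WL x y)); rewrite ler_wpM2r ?enorm_ge0 //; move: h8 l4; lra.
  have [Q' [WQ QW QL']] := id_plus_lip_bij W4.
  exists (fun x => x + W x), Q'; split.
  + by apply: sdiff_Ck1 => x; have := sdD (sd_id x) (sW x).
  + apply: sdiff_Ck1; exact: inverse_sd QW QL'.
  + by move=> x Ex; rewrite (WE x Ex) ww; [split => //; rewrite -(WE x Ex) WQ | exists E].
Qed.

End Global.

Lemma parametrization_exists (R : realType) (Om : set (pt R)) (gam gam2 : R) :
  open Om -> bounded_set Om -> smooth_boundary Om -> 0 < gam ->
  exists C h0 : R, 0 < C /\ 0 < h0 /\
  forall (h : R) (M : set (polyhedron R)), 0 < h -> h <= h0 -> bulk_surface_mesh Om h gam gam2 M ->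
  exists G : pt R -> pt R, bulk_parametrization Om h C M G /\
    forall E, M E -> is_tetrahedron E -> diffeomorphism_on (ph_set E) G.
Proof.
move=> oO bO sO g0; have [G0|nG] := pselect (frontier Om !=set0); last first.
  exists 1, 1; do 2 split => //; move=> h M h0 _ HM.
  have [G [GP nE]] := empty_parametrization oO bO nG ltr01 h0 HM.
  by exists G; split => // E /nE.
have [R0 R00 hg] := tube_ex oO bO sO; have T := Tube oO bO G0 R00 hg.
pose C4 := L4 R0 gam 1.
(* All Lipschitz constants of the construction are linear in [h]. *)
have L4E h : L4 R0 gam h = C4 * h by rewrite /C4 /L4 /L3 /L2 /L1 /Lt; ring.
have C40 : 0 < C4.
  have l3 := L3_gt0 T g0 ltr01; have ko := Kod_gt0 T g0; have r6 : 0 < 6 / R0 by rewrite divr_gt0.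
  by rewrite /C4 /L4 !mulr1; move: (L3 _ _ _) (Kod _ _) (6 / R0) l3 ko r6 => x y z; lra.
pose B := Cflat gam R0 * (Kgap gam + kap gam).
have B1 : 0 < `|B| + 1 by rewrite ltr_wpDl.
have h8 : 0 < 8 * C4 by rewrite mulr_gt0.
(* With [eps = 2 * L4 <= 1] the determinant bound is [18 * (2 * C4 * h) * (1 + 1)^2], hence 144. The
   three bounds on [h] ensure smallness relative to the tube, the hypothesis [hk], and
   [8 * L4 <= 1]. *)
exists (144 * C4), (Num.min (R0 / 200) (Num.min (`|B| + 1)^-1 (8 * C4)^-1)); split; first by rewrite mulr_gt0 // ltr0n.
split; first by rewrite !lt_min !invr_gt0 h8 B1 divr_gt0 // ltr0n.
move=> h M h0; rewrite !le_min => /and3P[h1 h2 h3] HM.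
have e8 : 8 * L4 R0 gam h <= 1.
  by rewrite L4E mulrA -ler_pdivlMl // mulr1.
have eB : Cflat gam R0 * h * (Kgap gam + kap gam) <= 1.
  have -> : Cflat gam R0 * h * (Kgap gam + kap gam) = B * h by rewrite /B; ring.
  apply: (@le_trans _ _ ((`|B| + 1) * h)); last by rewrite -ler_pdivlMl // mulr1.
  by rewrite ler_pM2r // (le_trans (ler_norm B)) // lerDl.
have [w [wL wN wH [wS wI] wT]] := global_map T g0 h0 h1 eB HM e8.
have eps0 : 0 < 2 * L4 R0 gam h by rewrite L4E !mulr_gt0.
exists (fun x => x + w x); split => //.
have bB : bounded_set (bulk M) by have /compactE[_] := bulk_compact HM; move=> /bounded_enormP.
apply: (lip_parametrization eps0 wL bB) => //.
- by rewrite !mulr_ge0 ?ltW ?ltr0n ?exprn_gt0.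
- have e1 : 2 * L4 R0 gam h <= 1 by move: e8 eps0; move: (L4 _ _ _) => z; lra.
  apply: (@le_trans _ _ (18 * (2 * L4 R0 gam h * (1 + 1) ^+ 2))).
    rewrite ler_pM2l ?ltr0n // ler_pM2l // ler_pXn2r ?nnegrE ?lerD2l // addr_ge0 // ltW //.
  by rewrite L4E le_eqVlt; apply/orP; left; apply/eqP; ring.
- move=> x _; apply: (le_trans (wN x)); rewrite L4E expr2 mulrA ler_pM2r // ler_pM2r; [|exact: h0]; rewrite ler_peMl ?(ltW C40) ?ler1n ?ltr0n //.
- move=> x [[E ME Ex] nE]; apply: (wI E) => // eE; apply: nE; by exists E.
Qed.

Theorem lemma1 (R : realType) :
  (forall Omega : set (pt R),
     open Omega -> bounded_set Omega -> smooth_boundary Omega ->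
   forall gamma1 gamma2 : R, 0 < gamma1 -> 0 < gamma2 ->
   exists C h0 : R, 0 < C /\ 0 < h0 /\
   forall (h : R) (M : set (polyhedron R)), 0 < h -> h <= h0 ->
     bulk_surface_mesh Omega h gamma1 gamma2 M ->
   exists G : pt R -> pt R,
     bulk_parametrization Omega h C M G /\
     forall E, M E -> is_tetrahedron E -> diffeomorphism_on (ph_set E) G)
  /\
  (exists (Omega : set (pt R)) (gamma1 gamma2 h : R) (M : set (polyhedron R)),
     [/\ open Omega, bounded_set Omega & smooth_boundary Omega] /\
     [/\ 0 < gamma1, 0 < gamma2, 0 < h
       & bulk_surface_mesh Omega h gamma1 gamma2 M] /\
     exists E, [/\ M E, ~ is_tetrahedron E,
       exists (C : R) (G : pt R -> pt R), 0 < C /\ bulk_parametrization Omega h C M G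
     & forall (C : R) (G : pt R -> pt R), bulk_parametrization Omega h C M G ->
         ~ diffeomorphism_on (ph_set E) G]).

Proof.
split.
  by move=> Om oO bO sO gam gam2 g0 _; exact: parametrization_exists.
exists ball3, (1 / 4), (1 / 2), 4, [set (@CP R)]; split.
  by split; [exact: ball3_open | exact: ball3_bounded | exact: ball3_smooth].
split; first by split; [lra | lra | lra | exact: cube_mesh].
exists (@CP R); split => //.
- exact: CP_not_tetrahedron.
- exact: cube_parametrization.
- exact: cube_not_diffeomorphic.
Qed.
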